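(* Let $\tilde V_H$ be the prototypical multiscale space, $\mathcal R$ the operator $\mathcal R v=\sum_{c\in\{0,1\}}\sum_{T^c\in\mathcal T_H^c}q_{T^c}(v)\,\tilde\varphi_{T^c}$, and $u\in V_0$ the solution of the mixed-dimensional model problem $a(u,v)=F(v)$ for all $v\in V_0$ (all as defined in the context). The prototypical multiscale method, which seeks $\tilde u_H\in\tilde V_H$ such that $$a(\tilde u_H,\tilde v_H)=F(\tilde v_H)\qquad\text{for all }\tilde v_H\in\tilde V_H,$$ is well-posed (it has a unique solution), and its solution is $\tilde u_H=\mathcal R u$. Moreover, there is a constant $C>0$, independent of $H$, $f^0$ and $f^1$, such that for $s\in\{0,1\}$ and any right-hand side $F(w)=(f^0,w^0)_{\Omega^0}+(f^1,w^1)_{\Omega^1}$ with $f^0\in H^s(\Omega^0)$ and $f^1\in H^s(\Omega^1)$, $$\|u-\tilde u_H\|_V\le C\,H^{1+s}\,|f|_s,\qquad |f|_s^2:=|f^0|_{H^s(\Omega^0)}^2+|f^1|_{H^s(\Omega^1)}^2,$$ where $|\cdot|_{H^s}$ denotes the $H^s$-seminorm (the $L^2$-norm if $s=0$).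
   Context: Geometry. Let $d\in\{2,3\}$ and let $\Omega\subset\mathbb R^d$ be a bounded Lipschitz domain, partitioned as $\Omega=\Omega^0\cup\dots\cup\Omega^d$ where $\Omega^c$ has codimension $c$ and is a disjoint union of finitely many connected segments $\Omega^c_\ell$, $\ell\in L_c$, each contained in a planar (affine) set of codimension $c$. Set $X^0=\Omega$ and $X^c=X^{c-1}\setminus\Omega^{c-1}$ for $c>0$; topological notions are with respect to the subspace topology of $X^c$. Each $\Omega^c_\ell$ is open in $X^c$, and $\Omega^c$ is dense in $X^c$. For $(i,j)\in L_c\times L_{c+1}$ either $\Omega^{c+1}_j\subseteq\partial\Omega^c_i$ (then one writes $(i,j)\in E^c$) or $\Omega^{c+1}_j\cap\overline{\Omega^c_i}=\emptyset$. All segments have Lipschitz boundaries and are polyhedra, polygons, line segments or points, according to dimension. $\Omega^0$ is called the bulk and $\Omega^1$ the interface. Function spaces. On segments of codimension $c$, $H^1$ is understood after a rigid change of coordinates to $\mathbb R^{d-c}$, and $\nabla^c$ denotes the gradient there. $V^0=\prod_{i\in L_0}H^1(\Omega^0_i)$ (no continuity across interfaces); $V^1=\{v\in\prod_{j\in L_1}H^1(\Omega^1_j): v_j|_{\Omega^2_k}=v_{j'}|_{\Omega^2_k}\text{ for all }(j,k),(j',k)\in E^1\}$; $V=V^0\times V^1$; $V^c_0=\{v^c\in V^c: v^c|_{\partial\Omega}=0\}$; $V_0=V^0_0\times V^1_0$. Elements are written $v=(v^0,v^1)$ and $\|v\|_V^2=\|v^0\|^2_{H^1(\Omega^0)}+\|v^1\|^2_{H^1(\Omega^1)}$.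 $H^s(\Omega^c)$ is understood segment-wise. Model problem. Coefficients $A^0\in L^\infty(\Omega^0)$, $A^1,B^1\in L^\infty(\Omega^1)$ satisfy $\underline\alpha\le A^0\le\overline\alpha$ a.e. in $\Omega^0$ and $\underline\alpha\le A^1\le\overline\alpha$, $\underline\beta\le B^1\le\overline\beta$ a.e. in $\Omega^1$, with $0<\underline\alpha\le\overline\alpha<\infty$, $0<\underline\beta\le\overline\beta<\infty$. Define $$a(v,w)=(A^0\nabla^0v^0,\nabla^0w^0)_{\Omega^0}+(A^1\nabla^1v^1,\nabla^1w^1)_{\Omega^1}+\sum_{(i,j)\in E^0}(B^1(v^0_i-v^1_j),w^0_i-w^1_j)_{\Omega^1_j}.$$ It is known that $a$ is bounded and coercive on $V_0$ with respect to $\|\cdot\|_V$. For $f^0\in L^2(\Omega^0)$, $f^1\in L^2(\Omega^1)$ let $F(w)=(f^0,w^0)_{\Omega^0}+(f^1,w^1)_{\Omega^1}$; the model problem is to find $u\in V_0$ with $a(u,v)=F(v)$ for all $v\in V_0$. Coarse meshes. The bulk mesh $\mathcal T^0_H$ is a quasi-uniform partition of $\Omega$ (in the usual finite element sense) into finitely many closed, shape-regular simplicial or quadrilateral/hexahedral elements with mesh size (maximal diameter) $H>0$, such that each $\Omega^0_i$ is (up to boundaries) a union of elements. The interface mesh $\mathcal T^1_H$ is such that each $\Omega^1_j$ is a union of interface elements, and any face of a bulk element lying on some $\Omega^1_j$ coincides with an element of $\mathcal T^1_H$. The meshes need not resolve the coefficients. Prototypical space. For $T^c\in\mathcal T^c_H$,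 $c\in\{0,1\}$, let $q_{T^c}(v)=|T^c|_{d-c}^{-1}\int_{T^c}v^c\,dx$ (with $|\cdot|_n$ the $n$-dimensional volume). Let $W=\{v\in V_0: q_{T^c}(v)=0\ \forall T^c\in\mathcal T^c_H,\ c\in\{0,1\}\}$ and $\tilde V_H=\{v\in V_0: a(v,w)=0\ \forall w\in W\}$. For $T^c\in\mathcal T_H^c$, $\tilde\varphi_{T^c}\in\tilde V_H$ is the unique element with $q_{T^c}(\tilde\varphi_{T^c})=1$ and $q_{K}(\tilde\varphi_{T^c})=0$ for all other elements $K\in\mathcal T^0_H\cup\mathcal T^1_H$; these functions form a basis of $\tilde V_H$. Constants. $C$ may depend on $d$, the geometry of the segments, the bounds $\underline\alpha,\overline\alpha,\underline\beta,\overline\beta$, and the shape-regularity and quasi-uniformity constants of the meshes. *)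

(* Defs.v *)
From HB Require Import structures.
From mathcomp Require Import all_boot all_order all_algebra.
From mathcomp Require Import all_classical all_reals all_analysis.
Import Order.TTheory GRing.Theory Num.Theory numFieldNormedType.Exports.
Set Implicit Arguments. Unset Strict Implicit. Unset Printing Implicit Defensive.
Local Open Scope classical_set_scope.
Local Open Scope ring_scope.


Lemma pushforward_prod_sfm d1 d2 d3 (T1 : measurableType d1)
    (T2 : measurableType d2) (T3 : measurableType d3) (R : realType)
    (m1 : {sigma_finite_measure set T1 -> \bar R})
    (m2 : {sigma_finite_measure set T2 -> \bar R})
    (f : T1 * T2 -> T3) (g : T3 -> T1 * T2) :
  measurable_fun setT f -> measurable_fun setT g -> cancel f g ->
  exists nu : {sigma_finite_measure set T3 -> \bar R},
    forall A, nu A = (\int[m1]_x m2 [set y | A (f (x, y))])%E.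
Proof.
move=> mf mg fK.
have sf : sigma_finite setT (pushforward (m1 \x m2)%E f).
  have /sigma_finiteP[F [FT ndF Foo]] := sigma_finiteT m1.
  have /sigma_finiteP[G [GT ndG Goo]] := sigma_finiteT m2.
  exists (fun k => g @^-1` (F k `*` G k)).
    rewrite -preimage_bigcup -[LHS](preimage_setT g); congr (_ @^-1` _).
    rewrite -setXTT FT GT predeqE => -[x y]; split.
      move=> [/= [n _ Fnx] [k _ Gky]]; exists (maxn n k) => //; split.
      - by move: x Fnx; exact/subsetPset/ndF/leq_maxl.
      - by move: y Gky; exact/subsetPset/ndG/leq_maxr.
    by move=> [n _ []/= ? ?]; split; exists n.
  move=> k; have [mF Fk] := Foo k; have [mG Gk] := Goo k; split.
    by rewrite -[X in measurable X]setTI; apply: mg => //; exact: measurableX.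
  rewrite /pushforward -comp_preimage (_ : g \o f = id); last exact/funext.
  by rewrite preimage_id product_measure1E// lte_mul_pinfty// ge0_fin_numE.
pose nu : {sigma_finite_measure set T3 -> \bar R} :=
  HB.pack (pushforward (m1 \x m2)%E f) 
    (Measure_isSigmaFinite.Build _ _ _ _ sf).
exists (nu mf mf mf) => A.
rewrite /= /pushforward /product_measure1.
apply: eq_integral => t _ /=; congr (m2 _); apply/seteqP.
by split=> x; rewrite /xsection /= ?inE.
Qed.

Section lebesgue_rV.
Variable R : realType.

Definition rV_measurable n : set (set 'rV[R]_n) :=
  g_sigma_preimage (fun (i : 'I_n) (x : 'rV[R]_n) => x ord0 i).

Fact rV_display : measure_display. Proof. exact. Qed.

Let rV_measurable0 n : @rV_measurable n set0.
Proof. exact: sigma_algebra0. Qed.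

Let rV_measurableC n A : @rV_measurable n A -> @rV_measurable n (~` A).
Proof. exact: sigma_algebraC. Qed.

Let rV_measurable_bigcup n (F : (set 'rV[R]_n)^nat) :
  (forall i, @rV_measurable n (F i)) -> @rV_measurable n (\bigcup_i F i).
Proof. exact: sigma_algebra_bigcup. Qed.

HB.instance Definition _ n := @isMeasurable.Build rV_display 'rV[R]_n
  (@rV_measurable n) (@rV_measurable0 n) (@rV_measurableC n)
  (@rV_measurable_bigcup n).

(* (t, x_1, .., x_n) *)
Definition rV_cons n (t : R) (x : 'rV[R]_n) : 'rV[R]_n.+1 :=
  \row_i oapp (x ord0) t (unlift ord0 i).

(* n-dimensional Lebesgue measure, by iterated integration over the first
   coordinate; for n = 0 it is the unit point mass, so that the traces on
   zero-dimensional segments below are point values. *)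
Fixpoint leb n : set 'rV[R]_n -> \bar R :=
  match n with
  | 0%N => fun A => \d_(0 : 'rV[R]_0) A
  | m.+1 => fun A => (\int[lebesgue_measure]_t leb [set x | A (rV_cons t x)])%E
  end.

Lemma measurable_rV_coord n (i : 'I_n) :
  measurable_fun setT (fun x : 'rV[R]_n => x ord0 i : measurableTypeR R).
Proof.
move=> _ Y mY; rewrite setTI; apply: sub_sigma_algebra.
rewrite -bigcup_seq; exists i => /=; first by rewrite mem_index_enum.
by exists Y => //; rewrite setTI.
Qed.

Lemma measurable_rVP d (T : measurableType d) n (f : T -> 'rV[R]_n) :
  (forall i, measurable_fun setT (fun t => f t ord0 i : measurableTypeR R)) ->
  measurable_fun setT f.
Proof.
move=> co _ A mA; rewrite setTI.
pose G := [set B : set 'rV[R]_n | measurable (f @^-1` B)].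
suff: (@measurable _ 'rV[R]_n) `<=` G by apply.
apply: smallest_sub.
  split => /=; rewrite /G /=.
  - by rewrite preimage_set0.
  - by move=> B mB; rewrite setTD; exact: measurableC.
  - by move=> F mF; rewrite preimage_bigcup; exact: bigcupT_measurable.
rewrite -bigcup_seq; apply: bigcup_sub => i _ B [C mC <-]; rewrite /G /= setTI.
by have := co i measurableT C mC; rewrite setTI.
Qed.

Lemma leb_sigma_finite_measure n :
  exists mu : {sigma_finite_measure set 'rV[R]_n -> \bar R}, @leb n = mu.
Proof.
elim: n => [|n [mu lebE]]; first by exists (\d_(0 : 'rV[R]_0)).
pose g (x : 'rV[R]_n.+1) : measurableTypeR R * 'rV[R]_n :=
  (x ord0 ord0, \row_i x ord0 (lift ord0 i)).
have mg : measurable_fun setT g.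
  apply/measurable_fun_pairP; split => /=; first exact: measurable_rV_coord.
  apply: measurable_rVP => i /=; under eq_fun do rewrite mxE.
  exact: measurable_rV_coord.
have mf : measurable_fun setT
    (fun p : measurableTypeR R * 'rV[R]_n => rV_cons p.1 p.2).
  apply: measurable_rVP => i; have [j ->|->] := unliftP ord0 i.
    under eq_fun do rewrite mxE liftK /=.
    exact: (measurableT_comp (measurable_rV_coord j)).
  under eq_fun do rewrite mxE unlift_none /=.
  exact: measurable_fst.
have [] := @pushforward_prod_sfm _ _ _ _ _ _ R (@lebesgue_measure R) mu _ g mf mg.
  move=> [t x]; rewrite /g/= mxE unlift_none; congr pair; apply/rowP => i.
  by rewrite !mxE liftK.
by move=> nu nuE; exists nu; apply/funext => A; rewrite nuE /= lebE.
Qed.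

Let leb0 n : @leb n set0 = 0%E.
Proof. by have [mu ->] := leb_sigma_finite_measure n; rewrite measure0. Qed.

Let leb_ge0 n A : (0 <= @leb n A)%E.
Proof. by have [mu ->] := leb_sigma_finite_measure n; exact: measure_ge0. Qed.

Let leb_semi_sigma_additive n : semi_sigma_additive (@leb n).
Proof.
have [mu ->] := leb_sigma_finite_measure n.
exact: measure_semi_sigma_additive.
Qed.

HB.instance Definition _ n := isMeasure.Build _ _ _ (@leb n)
  (@leb0 n) (@leb_ge0 n) (@leb_semi_sigma_additive n).

Let leb_sigma_finite n : sigma_finite setT (@leb n).
Proof.
by have [mu ->] := leb_sigma_finite_measure n; exact: sigma_finiteT.
Qed.

HB.instance Definition _ n := Measure_isSigmaFinite.Build _ _ _ (@leb n)
  (@leb_sigma_finite n).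

End lebesgue_rV.

Arguments leb R n : clear implicits.

Section euclidean_space.
Variable R : realType.

(* 'rV[R]_n carries the sup norm, which is only used for its topology; lengths
   and angles are the Euclidean ones. *)
Definition dot n (x y : 'rV[R]_n) : R := \sum_i x ord0 i * y ord0 i.

Definition enorm n (x : 'rV[R]_n) : R := Num.sqrt (dot x x).

Definition diam n (A : set 'rV[R]_n) : R :=
  sup [set r | exists x y, [/\ A x, A y & r = enorm (x - y)]].

Definition boundary n (A : set 'rV[R]_n) : set 'rV[R]_n :=
  closure A `\` interior A.

(* Near each boundary point, D is the strict epigraph, in some unit direction
   e, of a Lipschitz function g of the component orthogonal to e. *)
Definition lipschitz_boundary n (D : set 'rV[R]_n) : Prop :=
  forall x, boundary D x ->
  exists (e : 'rV[R]_n) (g : 'rV[R]_n -> R) (k r : R),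
    [/\ enorm e = 1, 0 < r,
        forall y z, `|g y - g z| <= k * enorm (y - z)
      & forall y, enorm (y - x) < r ->
          (D y <-> g (y - dot y e *: e) < dot y e)].

Definition conv_hull n (I : finType) (p : I -> 'rV[R]_n) : set 'rV[R]_n :=
  [set x | exists w : I -> R,
     [/\ forall i, 0 <= w i, \sum_i w i = 1 & x = \sum_i w i *: p i]].

Definition polyhedral n (D : set 'rV[R]_n) : Prop :=
  exists (N m : nat) (p : 'I_N -> 'I_m -> 'rV[R]_n),
    closure D = \bigcup_k conv_hull (p k).

Record isometry (m n : nat) := Isometry {
  base : 'rV[R]_n ;
  frame : 'M[R]_(m, n) ;
  frame_orthonormal : frame *m frame^T = 1%:M }.

Definition emb m n (k : isometry m n) (y : 'rV[R]_m) : 'rV[R]_n :=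
  base k + y *m frame k.

(* left inverse of emb k *)
Definition coords m n (k : isometry m n) (x : 'rV[R]_n) : 'rV[R]_m :=
  (x - base k) *m (frame k)^T.

End euclidean_space.

Section sobolev_spaces.
Variable R : realType.

Definition partial n (i : 'I_n) (f : 'rV[R]_n -> R) : 'rV[R]_n -> R :=
  fun x => 'D_(delta_mx ord0 i) f x.

Definition smooth n (f : 'rV[R]_n -> R) : Prop :=
  forall s : seq 'I_n, let g := foldr (@partial n) f s in
    continuous g /\ forall x i, derivable g x (delta_mx ord0 i).

Definition test_function n (D : set 'rV[R]_n) (f : 'rV[R]_n -> R) : Prop :=
  smooth f /\
  exists K, [/\ compact K, K `<=` D & forall x, ~ K x -> f x = 0].

Definition L2 n (D : set 'rV[R]_n) (f : 'rV[R]_n -> R) : Prop :=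
  measurable_fun D f /\ (\int[leb R n]_(x in D) (f x ^+ 2)%:E < +oo)%E.

(* f \in H^1(D), with weak gradient df *)
Definition H1 n (D : set 'rV[R]_n) (f : 'rV[R]_n -> R)
    (df : 'rV[R]_n -> 'rV[R]_n) : Prop :=
  [/\ L2 D f, forall i, L2 D (fun x => df x ord0 i)
    & forall phi, test_function D phi -> forall i,
        \int[leb R n]_(x in D) (f x * partial i phi x) =
        - \int[leb R n]_(x in D) (df x ord0 i * phi x)].

Definition L2_norm2 n (D : set 'rV[R]_n) (f : 'rV[R]_n -> R) : R :=
  \int[leb R n]_(x in D) (f x ^+ 2).

Definition grad_norm2 n (D : set 'rV[R]_n) (df : 'rV[R]_n -> 'rV[R]_n) : R :=
  \int[leb R n]_(x in D) dot (df x) (df x).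

(* g is the trace of f \in H^1(D) on the flat piece k(S) of the boundary of D:
   the continuous extension of the restriction of smooth functions. *)
Definition has_trace n (D : set 'rV[R]_n) (f : 'rV[R]_n -> R)
    (df : 'rV[R]_n -> 'rV[R]_n) m (k : 'rV[R]_m -> 'rV[R]_n)
    (S : set 'rV[R]_m) (g : 'rV[R]_m -> R) : Prop :=
  L2 S g /\
  exists phi : nat -> 'rV[R]_n -> R,
  [/\ forall l, smooth (phi l),
      (\int[leb R n]_(x in D) ((phi l x - f x) ^+ 2 +
         \sum_i (partial i (phi l) x - df x ord0 i) ^+ 2)%:E)%E
        @[l --> \oo] --> 0%E
    & (\int[leb R m]_(y in S) ((phi l (k y) - g y) ^+ 2)%:E)%E
        @[l --> \oo] --> 0%E].

(* For s = 0 the argument df is irrelevant; only s = 0 and s = 1 are used. *)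
Definition Hs n (s : nat) (D : set 'rV[R]_n) (f : 'rV[R]_n -> R)
    (df : 'rV[R]_n -> 'rV[R]_n) : Prop :=
  if s is 0%N then L2 D f else H1 D f df.

Definition Hs_seminorm2 n (s : nat) (D : set 'rV[R]_n) (f : 'rV[R]_n -> R)
    (df : 'rV[R]_n -> 'rV[R]_n) : R :=
  if s is 0%N then L2_norm2 D f else grad_norm2 D df.

End sobolev_spaces.

Section mixed_dimensional_geometry.
Variables (R : realType) (d : nat).

(* A segment of codimension c is given in rigid coordinates, as a subset of
   R^(d-c); for c > d the data are not used. *)
Record geometry := Geometry {
  segment_index : nat -> finType ;
  chart : forall c, segment_index c -> isometry R (d - c) d ;
  dom : forall c, segment_index c -> set 'rV[R]_(d - c) }.

Variable G : geometry.

Definition seg c (l : segment_index G c) : set 'rV[R]_d :=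
  emb (chart l) @` dom l.

Definition stratum c : set 'rV[R]_d :=
  \bigcup_(l : segment_index G c) seg l.

Definition Omega : set 'rV[R]_d := \bigcup_(c in [set c | (c <= d)%N]) stratum c.

Fixpoint Xset c : set 'rV[R]_d := if c is c'.+1 then Xset c' `\` stratum c' else Omega.

(* (i, j) \in E^c. Closure and boundary are relative to Xset c, in which seg i is
   open. *)
Definition adjacent c (i : segment_index G c) (j : segment_index G c.+1) : Prop :=
  seg j `<=` (closure (seg i) `&` Xset c) `\` seg i.

Record mixed_geometry : Prop := MixedGeometry {
  Omega_nonempty : Omega !=set0 ;
  Omega_open : open Omega ;
  Omega_connected : connected Omega ;
  Omega_bounded : bounded_set Omega ;
  Omega_lipschitz : lipschitz_boundary Omega ;
  seg_disjoint : forall c c' (l : segment_index G c) (l' : segment_index G c'),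
    (c <= d)%N -> (c' <= d)%N -> seg l `&` seg l' !=set0 ->
    Tagged (segment_index G) l = Tagged (segment_index G) l' ;
  dom_nonempty : forall c (l : segment_index G c), (c <= d)%N -> dom l !=set0 ;
  dom_open : forall c (l : segment_index G c), (c <= d)%N -> open (dom l) ;
  dom_connected : forall c (l : segment_index G c), (c <= d)%N ->
    connected (dom l) ;
  dom_lipschitz : forall c (l : segment_index G c), (c <= d)%N ->
    lipschitz_boundary (dom l) ;
  dom_polyhedral : forall c (l : segment_index G c), (c <= d)%N ->
    polyhedral (dom l) ;
  seg_open : forall c (l : segment_index G c), (c <= d)%N ->
    exists2 U, open U & seg l = U `&` Xset c ;
  stratum_dense : forall c, (c <= d)%N -> Xset c `<=` closure (stratum c) ;
  seg_adjacent : forall c (i : segment_index G c) (j : segment_index G c.+1),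
    (c < d)%N -> adjacent i j \/ seg j `&` closure (seg i) = set0 }.

(* An element of V^0 x V^1 together with its weak gradients and the traces of
   its bulk components on the interface segments. These are determined almost
   everywhere by the functions bulk and intf, so that they add no degree of
   freedom; traces v i j is only meaningful for adjacent i j. Interface
   functions are expressed in the coordinates of their segment. *)
Record mdfun := MdFun {
  bulk : segment_index G 0 -> 'rV[R]_d -> R ;
  dbulk : segment_index G 0 -> 'rV[R]_d -> 'rV[R]_d ;
  traces : segment_index G 0 -> segment_index G 1 -> 'rV[R]_(d - 1) -> R ;
  intf : segment_index G 1 -> 'rV[R]_(d - 1) -> R ;
  dintf : segment_index G 1 -> 'rV[R]_(d - 1) -> 'rV[R]_(d - 1) }.

(* The boundary of Omega is polyhedral: vanishing on it means vanishing on
   each of its flat pieces, which have dimension d - 1 for the bulk segments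
   and d - 2 for the interface segments. *)
Record V_0 (v : mdfun) : Prop := {
  V_bulk : forall i, H1 (seg i) (bulk v i) (dbulk v i) ;
  V_traces : forall i j, adjacent i j ->
    has_trace (seg i) (bulk v i) (dbulk v i)
      (emb (chart j)) (dom j) (traces v i j) ;
  V_bulk_boundary : forall i (k : isometry R (d - 1) d) S,
    open S -> bounded_set S ->
    emb k @` S `<=` boundary Omega `&` closure (seg i) ->
    has_trace (seg i) (bulk v i) (dbulk v i) (emb k) S (cst 0) ;
  V_intf : forall j : segment_index G 1, H1 (dom j) (intf v j) (dintf v j) ;
  V_intf_continuity : forall k : segment_index G 2, exists g,
    forall j, adjacent j k ->
    has_trace (dom j) (intf v j) (dintf v j)
      (coords (chart j) \o emb (chart k)) (dom k) g ;
  V_intf_boundary : forall (j : segment_index G 1)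
      (k : isometry R (d - 2) d) S,
    open S -> bounded_set S ->
    emb k @` S `<=` boundary Omega `&` closure (seg j) ->
    has_trace (dom j) (intf v j) (dintf v j)
      (coords (chart j) \o emb k) S (cst 0) }.

Definition eqV (v w : mdfun) : Prop :=
  (forall i, {ae leb R d, forall x, seg i x -> bulk v i x = bulk w i x}) /\
  (forall j, {ae leb R (d - 1), forall y, dom j y -> intf v j y = intf w j y}).

Definition lincomb (K : finType) (c : K -> R) (v : K -> mdfun) : mdfun := {|
  bulk := fun i x => \sum_k c k * bulk (v k) i x ;
  dbulk := fun i x => \sum_k c k *: dbulk (v k) i x ;
  traces := fun i j y => \sum_k c k * traces (v k) i j y ;
  intf := fun j y => \sum_k c k * intf (v k) j y ;
  dintf := fun j y => \sum_k c k *: dintf (v k) j y |}.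

Definition subV (v w : mdfun) : mdfun := {|
  bulk := fun i x => bulk v i x - bulk w i x ;
  dbulk := fun i x => dbulk v i x - dbulk w i x ;
  traces := fun i j y => traces v i j y - traces w i j y ;
  intf := fun j y => intf v j y - intf w j y ;
  dintf := fun j y => dintf v j y - dintf w j y |}.

Definition normV (v : mdfun) : R := Num.sqrt (
  \sum_i (L2_norm2 (seg i) (bulk v i) + grad_norm2 (seg i) (dbulk v i)) +
  \sum_(j : segment_index G 1)
    (L2_norm2 (dom j) (intf v j) + grad_norm2 (dom j) (dintf v j))).

(* Functions on Omega^0, and on Omega^1 in segment coordinates *)
Definition bulk_fun T := segment_index G 0 -> 'rV[R]_d -> T.
Definition intf_fun T := segment_index G 1 -> 'rV[R]_(d - 1) -> T.

Definition bulk_coef (lo hi : R) (A : bulk_fun R) : Prop := forall i,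
  measurable_fun (seg i) (A i) /\
  {ae leb R d, forall x, seg i x -> lo <= A i x <= hi}.

Definition intf_coef (lo hi : R) (A : intf_fun R) : Prop := forall j,
  measurable_fun (dom j) (A j) /\
  {ae leb R (d - 1), forall y, dom j y -> lo <= A j y <= hi}.

Definition form (A0 : bulk_fun R) (A1 B1 : intf_fun R) (v w : mdfun) : R :=
  \sum_i \int[leb R d]_(x in seg i) (A0 i x * dot (dbulk v i x) (dbulk w i x)) +
  \sum_j \int[leb R (d - 1)]_(y in dom j)
    (A1 j y * dot (dintf v j y) (dintf w j y)) +
  \sum_i \sum_(j | `[< adjacent i j >]) \int[leb R (d - 1)]_(y in dom j)
    (B1 j y * (traces v i j y - intf v j y) * (traces w i j y - intf w j y)).

Definition load (f0 : bulk_fun R) (f1 : intf_fun R) (w : mdfun) : R :=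
  \sum_i \int[leb R d]_(x in seg i) (f0 i x * bulk w i x) +
  \sum_j \int[leb R (d - 1)]_(y in dom j) (f1 j y * intf w j y).

Definition Hs_data (s : nat) (f0 : bulk_fun R) (df0 : bulk_fun 'rV[R]_d)
    (f1 : intf_fun R) (df1 : intf_fun 'rV[R]_(d - 1)) : Prop :=
  (forall i, Hs s (seg i) (f0 i) (df0 i)) /\
  (forall j, Hs s (dom j) (f1 j) (df1 j)).

Definition data_seminorm (s : nat) (f0 : bulk_fun R) (df0 : bulk_fun 'rV[R]_d)
    (f1 : intf_fun R) (df1 : intf_fun 'rV[R]_(d - 1)) : R :=
  Num.sqrt (\sum_i Hs_seminorm2 s (seg i) (f0 i) (df0 i) +
            \sum_j Hs_seminorm2 s (dom j) (f1 j) (df1 j)).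

Definition model_solution (A0 : bulk_fun R) (A1 B1 : intf_fun R)
    (f0 : bulk_fun R) (f1 : intf_fun R) (u : mdfun) : Prop :=
  V_0 u /\ forall v, V_0 v -> form A0 A1 B1 u v = load f0 f1 v.

End mixed_dimensional_geometry.

Section finite_elements.
Variable R : realType.

Definition simplex n (T : set 'rV[R]_n) : Prop :=
  exists2 p : 'I_n.+1 -> 'rV[R]_n, T = conv_hull p &
    (\matrix_(i < n) (p (lift ord0 i) - p ord0)) \in unitmx.

(* Quadrilaterals (n = 2) and hexahedra (n = 3): convex polytopes whose
   vertices are indexed by those of the unit cube, the vertices of each facet
   of the cube being exactly those lying on a supporting hyperplane. *)
Definition hexahedron n (T : set 'rV[R]_n) : Prop :=
  exists2 p : {ffun 'I_n -> bool} -> 'rV[R]_n, T = conv_hull p &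
    forall (i : 'I_n) (b : bool), exists (a : 'rV[R]_n) (c : R),
      forall v : {ffun 'I_n -> bool},
      if v i == b then dot a (p v) = c else dot a (p v) < c.

Definition face n (T S : set 'rV[R]_n) : Prop :=
  S !=set0 /\
  exists a, S = [set x | T x /\ forall y, T y -> dot a y <= dot a x].

Definition facet n (T S : set 'rV[R]_n) : Prop :=
  [/\ face T S, S <> T
    & forall S', face T S' -> S `<=` S' -> S' = S \/ S' = T].

(* Conforming partition of D into the elements T k, k \in P *)
Definition fe_partition n (D : set 'rV[R]_n) (K : finType) (P : pred K)
    (T : K -> set 'rV[R]_n) : Prop :=
  [/\ closure D = \bigcup_(k in [set k | P k]) T k,
      forall k, P k -> simplex (T k) \/ hexahedron (T k)
    & forall k k', P k -> P k' -> k != k' ->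
        interior (T k) `&` interior (T k') = set0 /\
        (T k `&` T k' = set0 \/
         face (T k) (T k `&` T k') /\ face (T k') (T k `&` T k'))].

(* sigma: shape regularity, tau: quasi-uniformity *)
Definition regular_element n (sigma tau H : R) (T : set 'rV[R]_n) : Prop :=
  tau * H <= diam T <= H /\
  exists x, [set y | enorm (y - x) <= diam T / sigma] `<=` T.

Variables (d : nat) (G : geometry R d).

(* The interface elements are expressed in the coordinates of the interface
   segment intf_seg k they belong to. *)
Record meshes := Meshes {
  bulk_index : finType ;
  bulk_elt : bulk_index -> set 'rV[R]_d ;
  intf_index : finType ;
  intf_seg : intf_index -> segment_index G 1 ;
  intf_elt : intf_index -> set 'rV[R]_(d - 1) }.

Record coarse_meshes (sigma tau H : R) (M : meshes) : Prop := CoarseMeshes {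
  bulk_partition : fe_partition (Omega G) xpredT (@bulk_elt M) ;
  bulk_regular : forall k : bulk_index M,
    regular_element sigma tau H (bulk_elt k) ;
  bulk_mesh_size : exists k : bulk_index M, diam (bulk_elt k) = H ;
  bulk_resolves : forall i : segment_index G 0, exists P : {set bulk_index M},
    closure (seg i) = \bigcup_(k in [set k | k \in P]) bulk_elt k ;
  intf_partition : forall j : segment_index G 1,
    fe_partition (dom j) [pred k | intf_seg k == j] (@intf_elt M) ;
  intf_regular : forall k : intf_index M,
    regular_element sigma tau H (intf_elt k) ;
  intf_facets : forall (k : bulk_index M) (j : segment_index G 1) S,
    facet (bulk_elt k) S -> S `<=` closure (seg j) ->
    exists2 l : intf_index M, intf_seg l = j & S = emb (chart j) @` intf_elt l }.

Variable M : meshes.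

Definition element : finType := (bulk_index M + intf_index M)%type.

(* The elements are closed whereas the functions live on the open segments,
   hence the intersections, which only discard null sets. *)
Definition qoi (T : element) (v : mdfun G) : R :=
  match T with
  | inl k => (fine (leb R d (bulk_elt k)))^-1 *
      \sum_i \int[leb R d]_(x in bulk_elt k `&` seg i) bulk v i x
  | inr k => (fine (leb R (d - 1) (intf_elt k)))^-1 *
      \int[leb R (d - 1)]_(y in intf_elt k `&` dom (intf_seg k))
        intf v (intf_seg k) y
  end.

Definition kernel_W (w : mdfun G) : Prop := V_0 w /\ forall T, qoi T w = 0.

Variables (A0 : bulk_fun G R) (A1 B1 : intf_fun G R).

Definition V_tilde (v : mdfun G) : Prop :=
  V_0 v /\ forall w, kernel_W w -> form A0 A1 B1 v w = 0.

Definition prototypical_basis (phi : element -> mdfun G) : Prop :=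
  forall T, V_tilde (phi T) /\ forall K, qoi K (phi T) = (K == T)%:R.

Definition interpolant (phi : element -> mdfun G) (v : mdfun G) : mdfun G :=
  lincomb (fun T => qoi T v) phi.

Definition prototypical_solution (f0 : bulk_fun G R) (f1 : intf_fun G R)
    (uH : mdfun G) : Prop :=
  V_tilde uH /\ forall v, V_tilde v -> form A0 A1 B1 uH v = load f0 f1 v.

End finite_elements.

(* Main.v *)
From HB Require Import structures.
Require Import Defs.
From mathcomp Require Import all_boot all_order all_algebra.
From mathcomp Require Import all_classical all_reals all_analysis.
From mathcomp Require Import measurable_realfun ring lra.
Import Order.TTheory GRing.Theory Num.Theory numFieldNormedType.Exports.
Set Implicit Arguments. Unset Strict Implicit. Unset Printing Implicit Defensive.
Local Open Scope classical_set_scope.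
Local Open Scope ring_scope.

(* The error e = u - uH lies in W: since the functions phi T span V_tilde, uH is
   R u. By Galerkin orthogonality a(e, e) = F(e). As e has mean zero on every
   element, the Poincaré inequality on elements gives |e| <= C H |grad e|, so
   that the L^2 part of normV e is controlled by the gradient part, which is in
   turn controlled by a(e, e); and |F(e)| <= C H |f| |grad e|. For f in H^1, the
   means of f on the elements may be subtracted from f, and a second Poincaré
   inequality yields the additional power of H.

   Solvability and R u = uH only need a to be definite on V_0. If a(v, v) = 0,
   then v is constant on every segment. Suppose that some bulk constants are
   nonzero, and walk along a generic straight line from the union of their
   segments until it leaves the closure of this union. This happens at a point
   of a single flat boundary piece, which is either on the boundary of Omega,
   where the trace of v is zero, or on an interface segment with a zero constant
   on the other side, where the jump terms force both constants to agree.

   The Poincaré inequality on a convex U is proved directly for weak gradients: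
   x |-> (1 - e) x + e w is averaged over w against a mollifier supported in U,
   which gives admissible test functions, and e runs from 0 to 1. *)

(** * Lebesgue measure on R^n *)

(** Every inequality for [H1] functions comes from one bilinear statement: on a convex U of measure
    m, the quantity m ∫ f φ - ∫ f ∫ φ is bounded by the gradient of f and the L^2 norm of φ, for
    continuous φ. For the averaged functions g this quantity is the double integral of φ(x) (g(x) -
    g(y)), and the difference becomes an integral of the weak gradient along the segment from y to
    x. Since φ stands on the other side, removing the average needs only weak convergence, which is
    obtained by letting the kernel act on φ instead of f. Letting φ tend to f gives the Poincaré
    inequality; letting φ tend to another function with mean zero gives the bound that improves the
    load for smooth data. The factor 2^n of the constant is the square root of a mass bound 4^n for
    the kernel. Traces only have to be computed for functions that are constant on one side of a
    plane, so that a crude one-dimensional estimate along transversal lines suffices. The final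
    constant involves an upper bound of H, because [normV] contains the L^2 norm; such a bound
    exists since Omega is bounded. *)

Section rV_topology.
Variable R : realType.

Lemma rV_ballP n (x : 'rV[R]_n) (e : R) (y : 'rV[R]_n) : 0 < e ->
  ball x e y <-> forall i, `|x ord0 i - y ord0 i| < e.
Proof.
move=> e0; split => [[_ h] i|h]; first exact: h.
by split => // i j; rewrite (ord1 i); exact: h.
Qed.

(** Balls with rational centre and radius 1/(k+1) form a countable base. This makes open sets
    measurable for the sigma-algebra generated by the coordinates, and later replaces an uncountable
    cover by a countable one. *)
Lemma rV_rat_ball n (x : 'rV[R]_n) (e : R) : 0 < e ->
  exists (q : 'rV[rat]_n) (k : nat),
    ball (map_mx ratr q : 'rV[R]_n) k.+1%:R^-1 x /\
    ball (map_mx ratr q : 'rV[R]_n) k.+1%:R^-1 `<=` ball x e.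
Proof.
move=> e0.
have [k ke] : exists k, k.+1%:R^-1 < e / 2.
  by exists (Num.truncn (e / 2)^-1); rewrite invf_plt ?posrE ?divr_gt0// truncnS_gt.
have k0 : 0 < k.+1%:R^-1 :> R by rewrite invr_gt0.
have /(_ _)/cid h : forall i, exists q : rat,
    `|ratr q - x ord0 i| < k.+1%:R^-1.
  move=> i; have /rat_in_itvoo[q] : x ord0 i - k.+1%:R^-1 < x ord0 i + k.+1%:R^-1.
    by rewrite ltrBlDr -addrA ltrDl addr_gt0.
  rewrite in_itv/= => /andP[q1 q2]; exists q.
  by rewrite ltr_norml ltrBlDl q2 andbT ltrBrDl.
exists (\row_i sval (h i)), k; split.
  by apply/rV_ballP => // i; rewrite !mxE; exact: svalP (h i).
move=> y /(rV_ballP _ _ k0) hy; apply/rV_ballP => // i.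
have := hy i; have := svalP (h i); rewrite !mxE => h1 h2.
rewrite (_ : _ - _ = (x ord0 i - ratr (sval (h i))) + (ratr (sval (h i)) - y ord0 i)); last by rewrite subrKA.
apply: (le_lt_trans (ler_normD _ _)); rewrite (splitr e) ltrD//.
  by rewrite distrC (lt_trans h1).
exact: lt_trans h2 ke.
Qed.

Lemma measurable_rV_ball n (x : 'rV[R]_n) (e : R) :
  measurable (ball x e : set 'rV[R]_n).
Proof.
have [e0|e0] := ltP 0 e; last first.
  rewrite (_ : ball x e = set0)//; apply/seteqP; split=> // y [].
  by rewrite ltNge e0.
rewrite (_ : ball x e = \bigcap_(i in [set: 'I_n])
    ((fun y : 'rV[R]_n => y ord0 i) @^-1` ball (x ord0 i) e)).
  apply: fin_bigcap_measurable; first exact: finite_finset.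
  move=> i _; rewrite -[X in measurable X]setTI.
  by apply: measurable_rV_coord => //; exact: (open_measurable (ball_open _ _)).
apply/seteqP; split => y.
  by move=> /(rV_ballP _ _ e0) h i _; exact: h.
by move=> h; apply/rV_ballP => // i; exact: h.
Qed.

Lemma open_measurable_rV n (U : set 'rV[R]_n) : open U -> measurable U.
Proof.
move=> oU.
pose B (p : 'rV[rat]_n * nat) : set 'rV[R]_n :=
  ball (map_mx ratr p.1 : 'rV[R]_n) p.2.+1%:R^-1.
rewrite (_ : U = \bigcup_p (if `[< B p `<=` U >] then B p else set0)).
  apply: countable_bigcupT_measurable; first exact: countableP.
  by move=> p; case: ifP => // _; exact: measurable_rV_ball.
apply/seteqP; split => x.
  move=> Ux; have /nbhs_ballP[e /= e0 eU] := open_nbhs_nbhs (conj oU Ux).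
  have [q [k [h1 h2]]] := rV_rat_ball x e0.
  exists (q, k) => //; rewrite asboolT//.
  exact: (subset_trans h2).
by move=> [p _]; case: asboolP => // h /h.
Qed.

Lemma closed_measurable_rV n (U : set 'rV[R]_n) : closed U -> measurable U.
Proof.
by move=> /closed_openC/open_measurable_rV/measurableC; rewrite setCK.
Qed.

Lemma continuous_measurable_rV n (f : 'rV[R]_n -> R) : continuous f ->
  measurable_fun setT f.
Proof.
move=> cf; apply: (measurability _ (RGenOpens.measurableE R)).
move=> _ [_ [a [b ->] <-]].
rewrite setTI; apply: open_measurable_rV.
by apply: open_comp => // + _; exact: cf.
Qed.

Lemma rV_continuousP (T : topologicalType) n (f : T -> 'rV[R]_n) (x : T) :
  (forall i, {for x, continuous (fun t => f t ord0 i)}) -> {for x, continuous f}.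
Proof.
move=> h; apply/cvgrPdist_lt => e e0.
have : \forall t \near x, forall i, `|f x ord0 i - f t ord0 i| < e.
  apply: filter_forall => i; by have /cvgrPdist_lt := h i; apply.
apply: filterS => t ht.
have : ball (f x) e (f t) by apply/rV_ballP.
by rewrite -ball_normE.
Qed.

Lemma coord_cont n i : continuous (fun x : 'rV[R]_n => x ord0 i).
Proof. by move=> x; exact: coord_continuous. Qed.

Lemma measurable_rVD d (T : measurableType d) n (f g : T -> 'rV[R]_n) :
  measurable_fun setT f -> measurable_fun setT g ->
  measurable_fun setT (fun t => f t + g t).
Proof.
move=> mf mg; apply: measurable_rVP => i; under eq_fun do rewrite mxE.
by apply: measurable_funD; [exact: (measurableT_comp (measurable_rV_coord i) mf)|
  exact: (measurableT_comp (measurable_rV_coord i) mg)].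
Qed.

Lemma measurable_rVZ d (T : measurableType d) n (c : T -> R) (g : T -> 'rV[R]_n) :
  measurable_fun setT c -> measurable_fun setT g ->
  measurable_fun setT (fun t => c t *: g t).
Proof.
move=> mf mg; apply: measurable_rVP => i; under eq_fun do rewrite mxE.
apply: measurable_funM => //; exact: (measurableT_comp (measurable_rV_coord i) mg).
Qed.

End rV_topology.

Definition mfun_of d1 d2 (X : measurableType d1) (Y : measurableType d2)
    (f : X -> Y) (mf : measurable_fun setT f) : {mfun X >-> Y} :=
  HB.pack f (isMeasurableFun.Build _ _ _ _ _ mf).

Section leb_theory.
Variable R : realType.
Local Notation mu1 := (@lebesgue_measure R).

Lemma measurable_rV_cons n :
  measurable_fun setT
    (fun p : measurableTypeR R * 'rV[R]_n => rV_cons p.1 p.2).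
Proof.
apply: measurable_rVP => i; have [j ->|->] := unliftP ord0 i.
  under eq_fun do rewrite mxE liftK /=.
  exact: (measurableT_comp (measurable_rV_coord j)).
under eq_fun do rewrite mxE unlift_none /=.
exact: measurable_fst.
Qed.

Lemma eq_leb_cons n (A : set 'rV[R]_n.+1) : measurable A ->
  leb R n.+1 A = pushforward (lebesgue_measure \x leb R n)%E
    (fun p : measurableTypeR R * 'rV[R]_n => rV_cons p.1 p.2) A.
Proof.
move=> mA; rewrite /pushforward /= /product_measure1.
apply: eq_integral => t _ /=; congr (leb R n _); apply/seteqP.
by split=> x; rewrite /xsection /= ?inE.
Qed.

Lemma ge0_integral_leb_cons n (h : 'rV[R]_n.+1 -> \bar R) :
  measurable_fun setT h -> (forall x, (0 <= h x)%E) ->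
  (\int[leb R n.+1]_x h x = \int[mu1]_t \int[leb R n]_y h (rV_cons t y))%E.
Proof.
move=> mh h0; have mc := @measurable_rV_cons n.
pose phi := mfun_of mc.
transitivity (\int[pushforward (mu1 \x leb R n)%E phi]_x h x)%E.
  by apply: eq_measure_integral => A mA _; exact: eq_leb_cons.
rewrite ge0_integral_pushforward//= preimage_setT fubini_tonelli1//.
exact: measurableT_comp.
Qed.

Lemma lebesgue_measure_shift (a : R) (A : set (measurableTypeR R)) : measurable A ->
  mu1 [set t | A (t + a)] = mu1 A.
Proof.
move=> mA.
have mf : measurable_fun setT (fun t : measurableTypeR R => t + a : measurableTypeR R).
  exact: measurable_funD.
pose phi := mfun_of mf.
apply/esym; apply: (@lebesgue_measure_unique _ (pushforward mu1 phi)) => //.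
move=> _ [[b c] /= _ <-]; rewrite /pushforward /=.
rewrite (_ : _ @^-1` _ = `]b - a, c - a]%classic); last first.
  by apply/seteqP; split => t /=; rewrite !in_itv/= ltrBlDr lerBrDr.
rewrite !lebesgue_measure_itv/= !lte_fin ltrD2; case: ifP => // _.
by rewrite -!EFinB; congr EFin; ring.
Qed.

Lemma rV_consD n (t : R) (y : 'rV[R]_n) (a : 'rV[R]_n.+1) :
  rV_cons t y + a = rV_cons (t + a ord0 ord0) (y + \row_i a ord0 (lift ord0 i)).
Proof.
apply/rowP => i; rewrite !mxE.
by case: unliftP => [j ->|->] /=; rewrite ?mxE.
Qed.

Lemma measurable_shift_rV n (a : 'rV[R]_n) :
  measurable_fun setT (fun x : 'rV[R]_n => x + a).
Proof. exact: measurable_rVD. Qed.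

Lemma leb_shift n (a : 'rV[R]_n) (A : set 'rV[R]_n) : measurable A ->
  leb R n [set x | A (x + a)] = leb R n A.
Proof.
elim: n a A => [|n IH] a A mA.
  congr (leb R 0 _); apply/seteqP; split => x /=;
  by rewrite (_ : x + a = x)//; apply/rowP => -[].
have mB t : measurable [set y | A (rV_cons t y)].
  rewrite -[X in measurable X]setTI.
  apply: (measurableT_comp (@measurable_rV_cons n) (measurable_pair1 t)) => //.
have msec : measurable_fun setT (fun t : measurableTypeR R => leb R n [set y | A (rV_cons t y)]).
  have mX : measurable ((fun p : measurableTypeR R * 'rV[R]_n => rV_cons p.1 p.2) @^-1` A).
    by rewrite -[X in measurable X]setTI; apply: measurable_rV_cons.
  have := measurable_fun_xsection (leb R n) mX; apply: eq_measurable_fun => t _ /=.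
  by congr (leb R n _); apply/seteqP; split => y; rewrite /xsection /= inE.
transitivity (\int[mu1]_t leb R n [set y | A (rV_cons (t + a ord0 ord0) y)])%E.
  apply: eq_integral => t _.
  rewrite -(IH (\row_i a ord0 (lift ord0 i))); last exact: mB.
  by congr (leb R n _); apply/seteqP; split => y /=; rewrite rV_consD.
have mf : measurable_fun setT (fun t : measurableTypeR R => t + a ord0 ord0 : measurableTypeR R).
  exact: measurable_funD.
pose phi := mfun_of mf.
have := @ge0_integral_pushforward _ _ _ _ R _ mf mu1 setT
  (fun t => leb R n [set y | A (rV_cons t y)]) measurableT msec.
rewrite preimage_setT /= => <-; last by move=> *; exact: measure_ge0.
apply: (@eq_measure_integral _ _ _ _ mu1 (pushforward mu1 phi)) => B mB' _.
exact: lebesgue_measure_shift.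
Qed.

Lemma rV_ball0_cons n (e t : R) (y : 'rV[R]_n) : 0 < e ->
  ball (0 : 'rV[R]_n.+1) e (rV_cons t y) <-> `|t| < e /\ ball (0 : 'rV[R]_n) e y.
Proof.
move=> e0; split => [/(rV_ballP _ _ e0) h|[h /(rV_ballP _ _ e0) h']].
  split; first by have := h ord0; rewrite !mxE unlift_none sub0r normrN.
  by apply/rV_ballP => // i; have := h (lift ord0 i); rewrite !mxE liftK.
apply/rV_ballP => // i; rewrite !mxE.
case: unliftP => [j _|_] /=; last by rewrite sub0r normrN.
by have := h' j; rewrite !mxE.
Qed.

(** Balls are those of the sup norm, hence cubes of side 2e, and the volume follows by slicing off
    the first coordinate. *)
Lemma leb_ball0 n (e : R) : 0 < e ->
  leb R n (ball 0 e) = ((e *+ 2) ^+ n)%:E.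
Proof.
move=> e0; elim: n => [|n IH].
  by rewrite /= diracE mem_set//; exact: ballxx.
transitivity (\int[mu1]_t (((e *+ 2) ^+ n) * \1_`]-e, e[ t)%:E)%E.
  apply: eq_integral => t _; rewrite indicE.
  case: (boolP (t \in `]-e, e[%classic)) => [/set_mem|/negP ht].
    rewrite /= in_itv/= -ltr_norml => ht; rewrite mulr1 -IH.
    congr (leb R n _); apply/seteqP; split => y /=; first by move/(rV_ball0_cons _ _ e0) => -[].
    by move=> hy; apply/rV_ball0_cons.
  rewrite mulr0; transitivity (leb R n set0); last exact: measure0.
  congr (leb R n _).
  apply/seteqP; split => // y /= /(rV_ball0_cons _ _ e0) [h _]; apply: ht.
  by rewrite inE /= in_itv/= -ltr_norml.
under eq_integral do rewrite EFinM.
rewrite ge0_integralZl//.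
- rewrite integral_indic// setIT exprSr EFinM; congr (_ * _)%E.
  apply: (etrans (lebesgue_measure_itv `]-e, e[)) => /=.
  by rewrite lte_fin ifT ?gtrN// -EFinB opprK -mulr2n.
- by apply/measurable_EFinP; exact: measurable_indic.
- by rewrite lee_fin exprn_ge0// mulrn_wge0//; exact: ltW.
Qed.

Lemma leb_ball n (x : 'rV[R]_n) (e : R) : 0 < e ->
  leb R n (ball x e) = ((e *+ 2) ^+ n)%:E.
Proof.
move=> e0; rewrite -leb_ball0// -(leb_shift x); last exact: measurable_rV_ball.
congr (leb R n _); apply/seteqP; split => y /=.
  move=> /(rV_ballP _ _ e0) h; apply/rV_ballP => // i; have := h i.
  by rewrite !mxE sub0r; congr (`| _ | < _); ring.
move=> /(rV_ballP _ _ e0) h; apply/rV_ballP => // i; have := h i.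
by rewrite !mxE sub0r; congr (`| _ | < _); ring.
Qed.

Lemma leb_open_gt0 n (U : set 'rV[R]_n) : open U -> U !=set0 -> (0 < leb R n U)%E.
Proof.
move=> oU [x Ux]; have /nbhs_ballP[e /= e0 eU] := open_nbhs_nbhs (conj oU Ux).
apply: (@lt_le_trans _ _ (leb R n (ball x e))).
  by rewrite leb_ball// lte_fin exprn_gt0// pmulrn_lgt0.
by apply: le_measure => //; rewrite inE;
  [exact: measurable_rV_ball|exact: open_measurable_rV].
Qed.

Lemma bounded_sub_ball n (A : set 'rV[R]_n) : bounded_set A ->
  exists2 e, 0 < e & A `<=` ball 0 e.
Proof.
move=> [M [_ hM]]; exists (`|M| + 2) => //.
move=> x Ax; rewrite -ball_normE /= sub0r normrN.
apply: (@le_lt_trans _ _ (`|M| + 1)); last by rewrite ltrD2l ltr1n.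
by apply: hM => //; apply: (le_lt_trans (ler_norm _)); rewrite ltrDl.
Qed.

Lemma leb_bounded n (A : set 'rV[R]_n) : bounded_set A -> measurable A ->
  (leb R n A < +oo)%E.
Proof.
move=> /bounded_sub_ball[e e0 Ae] mA.
apply: (@le_lt_trans _ _ (leb R n (ball 0 e))).
  by apply: le_measure => //; rewrite inE//; exact: measurable_rV_ball.
by rewrite leb_ball// ltry.
Qed.

End leb_theory.

Lemma measure_integral_indic d (T : measurableType d) (R : realType)
    (mu : {measure set T -> \bar R}) (A : set T) : measurable A ->
  mu A = (\int[mu]_x (\1_A x)%:E)%E.
Proof. by move=> mA; rewrite integral_indic// setIT. Qed.

(** * Uniqueness of translation invariant measures and linear changes of variables *)

Section haar.
Variable R : realType.

Lemma ge0_integral_leb_shift n (a : 'rV[R]_n) (h : 'rV[R]_n -> \bar R) :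
  measurable_fun setT h -> (forall x, (0 <= h x)%E) ->
  (\int[leb R n]_x h (x + a)%R = \int[leb R n]_x h x)%E.
Proof.
move=> mh h0; have ms := measurable_shift_rV a.
transitivity (\int[pushforward (leb R n) (mfun_of ms)]_x h x)%E.
  by rewrite ge0_integral_pushforward//= preimage_setT.
by apply: eq_measure_integral => A mA _; exact: leb_shift.
Qed.

Lemma measurable_rV_comp d (T : measurableType d) n (f : T -> 'rV[R]_n) A :
  measurable_fun setT f -> measurable A -> measurable [set t | A (f t)].
Proof. by move=> mf mA; rewrite -[X in measurable X]setTI; exact: mf. Qed.

(* Both sides equal the integral of 1_A(x) 1_B(x + y) over leb x nu. *)
Lemma haar_unique n (nu : {sigma_finite_measure set 'rV[R]_n -> \bar R}) (A B : set 'rV[R]_n) :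
  (forall (a : 'rV[R]_n) (C : set 'rV[R]_n), measurable C ->
    nu [set x | C (x + a)] = nu C) ->
  measurable A -> measurable B ->
  (leb R n A * nu B = nu [set x | A (- x)%R] * leb R n B)%E.
Proof.
move=> nuD mA mB.
have mN : measurable_fun setT (fun x : 'rV[R]_n => - x).
  have := @measurable_rVZ R _ _ n (cst (-1)) id (measurable_cst _) (@measurable_id _ _ _).
  by under eq_fun do rewrite scaleN1r.
have m1 : measurable_fun setT (@fst 'rV[R]_n 'rV[R]_n) by exact: measurable_fst.
have m2 : measurable_fun setT (@snd 'rV[R]_n 'rV[R]_n) by exact: measurable_snd.
pose F (p : 'rV[R]_n * 'rV[R]_n) : \bar R := (\1_A p.1 * \1_B (p.1 + p.2))%:E.
pose G (p : 'rV[R]_n * 'rV[R]_n) : \bar R := (\1_A (p.1 - p.2) * \1_B p.1)%:E.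
have mF : measurable_fun setT F.
  apply/measurable_EFinP; apply: measurable_funM.
    exact: (measurableT_comp (measurable_indic mA) m1).
  exact: (measurableT_comp (measurable_indic mB) (measurable_rVD m1 m2)).
have mG : measurable_fun setT G.
  apply/measurable_EFinP; apply: measurable_funM.
    exact: (measurableT_comp (measurable_indic mA)
      (measurable_rVD m1 (measurableT_comp mN m2))).
  exact: (measurableT_comp (measurable_indic mB) m1).
have F0 p : (0 <= F p)%E by rewrite lee_fin.
have G0 p : (0 <= G p)%E by rewrite lee_fin.
transitivity (\int[leb R n]_x \int[nu]_y F (x, y))%E.
  transitivity (\int[leb R n]_x ((\1_A x)%:E * nu B))%E.
    rewrite ge0_integralZr//; first by rewrite integral_indic// setIT.
    by apply/measurable_EFinP; exact: measurable_indic.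
  apply: eq_integral => x _; rewrite /F /=.
  under [RHS]eq_integral do rewrite EFinM.
  rewrite ge0_integralZl//; last first.
    apply/measurable_EFinP.
    exact: (measurableT_comp (measurable_indic mB) (measurable_rVD (measurable_cst _) (@measurable_id _ _ _))).
  congr (_ * _)%E; rewrite -(nuD x B mB).
  rewrite measure_integral_indic; last exact: measurable_rV_comp (measurable_shift_rV x) mB.
  by apply: eq_integral => y _; rewrite !indicE/= addrC; congr (nat_of_bool _)%:R%:E; apply/idP/idP; rewrite !inE.
transitivity (\int[leb R n]_x \int[nu]_y G (x, y))%E; last first.
  transitivity (\int[leb R n]_x (nu [set x | A (- x)%R] * (\1_B x)%:E))%E; last first.
    rewrite ge0_integralZl//; first by rewrite integral_indic// setIT.
    by apply/measurable_EFinP; exact: measurable_indic.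
  apply: eq_integral => x _; rewrite /G /=.
  under eq_integral do rewrite EFinM.
  have mAx : measurable [set y | A (x - y)].
    exact: measurable_rV_comp (measurable_rVD (measurable_cst _) mN) mA.
  rewrite ge0_integralZr//; last first.
    apply/measurable_EFinP.
    exact: (measurableT_comp (measurable_indic mA) (measurable_rVD (measurable_cst _) mN)).
  congr (_ * _)%E; transitivity (nu [set y | A (x - y)]).
    by rewrite measure_integral_indic.
  rewrite -(nuD x)//; congr (nu _); apply/seteqP; split => y /=.
  - by rewrite opprD addrCA subrr addr0.
  - by rewrite opprD addrCA subrr addr0.
rewrite (sfinite_Fubini _ _ F F0 mF) (sfinite_Fubini _ _ G G0 mG); apply: eq_integral => y _.
(* For fixed y, translating x by y turns G into F. *)
rewrite -[RHS](@ge0_integral_leb_shift n y (fun x => G (x, y)))//; last exact: (measurableT_comp mG (measurable_pair2 y)).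
by apply: eq_integral => x _; rewrite /F /G /= addrK.
Qed.

Lemma measurable_mulmx n m (M : 'M[R]_(n, m)) :
  measurable_fun setT (fun x : 'rV[R]_n => x *m M).
Proof.
apply: measurable_rVP => i; under eq_fun do rewrite mxE.
apply: measurable_sum => j; apply: measurable_funM => //.
exact: measurable_rV_coord.
Qed.

Lemma mulmx_ball n m (M : 'M[R]_(n, m)) : exists2 c : R, 0 < c &
  forall (e : R) (x : 'rV[R]_n), 0 < e -> ball 0 e x -> ball 0 (c * e) (x *m M).
Proof.
exists (1 + \sum_i \sum_j `|M j i|).
  by rewrite ltr_wpDr// sumr_ge0// => i _; rewrite sumr_ge0.
move=> e x e0 /(rV_ballP _ _ e0) hx.
have c0 : 0 < 1 + \sum_i \sum_j `|M j i|.
  by rewrite ltr_wpDr// sumr_ge0// => i _; rewrite sumr_ge0.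
apply/rV_ballP => [|i]; first exact: mulr_gt0.
rewrite !mxE sub0r normrN (le_lt_trans (ler_norm_sum _ _ _))//.
apply: (@le_lt_trans _ _ ((\sum_j `|M j i|) * e)).
  rewrite mulr_suml ler_sum// => j _; rewrite normrM mulrC ler_wpM2l//.
  by have := hx j; rewrite mxE sub0r normrN => /ltW.
rewrite ltr_pM2r// (bigD1 i)//= addrCA ltrDl ltr_wpDr//.
by rewrite sumr_ge0// => k _; rewrite sumr_ge0.
Qed.

(** The image of [leb] under x -> x M is again translation invariant, and it is sigma-finite because
    an invertible M pulls cubes back into cubes; uniqueness then makes it a multiple of [leb]. The
    factor is not identified with a determinant: the trace estimate only needs it to exist, and for
    homotheties it is computed separately. *)
Lemma leb_linear n (M : 'M[R]_n) : M \in unitmx ->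
  exists2 c : R, 0 <= c & forall A, measurable A ->
    leb R n [set x | A (x *m M)] = (c%:E * leb R n A)%E.
Proof.
move=> uM; have mM := measurable_mulmx M.
pose nu0 := pushforward (leb R n) (mfun_of mM).
have nuball (e : R) : 0 < e -> (nu0 (ball (0%R : 'rV[R]_n) e) < +oo)%E.
  move=> e0; have [c c0 hc] := mulmx_ball (invmx M).
  apply: (@le_lt_trans _ _ (leb R n (ball 0 (c * e)))).
    apply: (@le_measure _ _ _ (leb R n)); rewrite ?inE.
    - by apply: (measurable_rV_comp mM); exact: measurable_rV_ball.
    - exact: measurable_rV_ball.
    - move=> x /= hx; rewrite -(mulmxK uM x); exact: hc.
  by rewrite leb_ball ?ltry// mulr_gt0.
have sf : sigma_finite setT nu0.
  exists (fun k => ball (0 : 'rV[R]_n) k.+1%:R).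
    apply/seteqP; split => // x _; have [e e0 h] : exists2 e : R, 0 < e & ball 0 e x.
      exists (`|x : 'rV[R]_n| + 1); first by rewrite ltr_wpDl.
      by rewrite -ball_normE /= sub0r normrN ltrDl.
    exists (Num.truncn e) => //=; apply: le_ball h.
    by rewrite ltW// truncnS_gt.
  by move=> k; split; [exact: measurable_rV_ball|exact: nuball].
have [nu nuE] : exists nu : {sigma_finite_measure set 'rV[R]_n -> \bar R},
    forall A, nu A = nu0 A.
  pose nu : {sigma_finite_measure set 'rV[R]_n -> \bar R} :=
    HB.pack nu0 (Measure_isSigmaFinite.Build _ _ _ _ sf).
  by exists (nu mM mM mM).
have nuD (a : 'rV[R]_n) (C : set 'rV[R]_n) : measurable C -> nu [set x | C (x + a)] = nu C.
  move=> mC; rewrite !nuE /nu0 /pushforward /=.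
  rewrite -[RHS](leb_shift (a *m invmx M)); last exact: measurable_rV_comp mM mC.
  by congr (leb R n _); apply/seteqP; split => x /=; rewrite mulmxDl mulmxKV.
(* The cube of half-side 1/2 has volume one, so that [haar_unique] with this cube as A reads off the
   factor c. *)
have h1 : leb R n (ball (0 : 'rV[R]_n) 2^-1) = 1%E.
  by rewrite leb_ball ?invr_gt0// -[_ *+ _]mulr_natr mulVf ?pnatr_eq0// expr1n.
have mb := @measurable_rV_ball R n 0 2^-1.
pose c := nu [set x : 'rV[R]_n | ball 0 2^-1 (- x)%R].
have cE : c \is a fin_num.
  rewrite ge0_fin_numE ?measure_ge0// /c nuE (_ : [set x | _] = ball 0 2^-1).
    by apply: nuball; rewrite invr_gt0.
  by apply/seteqP; split => x /=; rewrite -!ball_normE /= !sub0r !normrN.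
exists (fine c); first by rewrite fine_ge0//; exact: measure_ge0.
move=> A mA; rewrite fineK//.
by have := haar_unique nuD mb mA; rewrite h1 mul1e nuE.
Qed.

(** The factor given by [leb_linear] is found by testing it on [ball 0 |s|], whose preimage under
    the dilation is [ball 0 1]. *)
Lemma leb_homothety n (s : R) (a : 'rV[R]_n) (A : set 'rV[R]_n) : s != 0 -> measurable A ->
  leb R n [set x | A (s *: x + a)] = ((`|s| ^- n)%:E * leb R n A)%E.
Proof.
move=> s0 mA; have s0' : 0 < `|s| by rewrite normr_gt0.
have uM : (s%:M : 'M[R]_n) \in unitmx.
  by rewrite unitmxE det_scalar unitfE expf_neq0.
have [c c0 hc] := leb_linear uM.
have hc' (B : set 'rV[R]_n) : measurable B -> leb R n [set x | B (s *: x)] = (c%:E * leb R n B)%E.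
  by move=> mB; rewrite -hc//; congr (leb R n _); apply/seteqP; split => x /=; rewrite mul_mx_scalar.
have <- : c = `|s| ^- n.
  have := hc' (ball 0 `|s|) (measurable_rV_ball 0 `|s|).
  rewrite (_ : [set x | _] = ball 0 1); last first.
    by apply/seteqP; split => x /=; rewrite -!ball_normE /= !sub0r !normrN normrZ gtr_pMr.
  rewrite !leb_ball// -EFinM => -[].
  have h2 : (2 : R) ^+ n != 0 by rewrite expf_neq0// pnatr_eq0.
  have hs : `|s| ^+ n != 0 by rewrite expf_neq0// gt_eqF.
  rewrite -(mulr_natr `|s|) exprMn => h.
  by apply: (mulIf hs); rewrite mulVf//; apply: (mulIf h2); rewrite -mulrA -h mul1r.
rewrite (hc' [set x | A (x + a)]); last exact: measurable_rV_comp (measurable_shift_rV a) mA.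
by rewrite leb_shift.
Qed.

Lemma ge0_integral_homothety n (s : R) (a : 'rV[R]_n) (h : 'rV[R]_n -> \bar R) :
  s != 0 -> measurable_fun setT h -> (forall x, (0 <= h x)%E) ->
  (\int[leb R n]_x h (s *: x + a)%R = (`|s| ^- n)%:E * \int[leb R n]_x h x)%E.
Proof.
move=> s0 mh h0.
have ms : measurable_fun setT (fun x : 'rV[R]_n => s *: x + a).
  by apply: measurable_rVD => //; exact: measurable_rVZ.
transitivity (\int[pushforward (leb R n) (mfun_of ms)]_x h x)%E.
  by rewrite ge0_integral_pushforward//= preimage_setT.
have sn0 : 0 <= `|s| ^- n by rewrite invr_ge0 exprn_ge0.
rewrite -(ge0_integral_mscale _ _ (NngNum sn0))//.
by apply: eq_measure_integral => A mA _; exact: leb_homothety.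
Qed.

Lemma ge0_integral_linear n (M : 'M[R]_n) : M \in unitmx ->
  exists2 c : R, 0 <= c & forall h : 'rV[R]_n -> \bar R,
    measurable_fun setT h -> (forall x, (0 <= h x)%E) ->
    (\int[leb R n]_x h (x *m M)%R = c%:E * \int[leb R n]_x h x)%E.
Proof.
move=> uM; have [c c0 hc] := leb_linear uM; exists c => // h mh h0.
have ms := measurable_mulmx M.
transitivity (\int[pushforward (leb R n) (mfun_of ms)]_x h x)%E.
  by rewrite ge0_integral_pushforward//= preimage_setT.
rewrite -(ge0_integral_mscale _ _ (NngNum c0))//.
by apply: eq_measure_integral => A mA _; exact: hc.
Qed.

End haar.

(** * Mollifiers and square integrable functions *)

Section bump.
Variable R : realType.

(** For p = 1 this is the classical smooth function exp(-1/t) cut off at 0. The polynomial in 1/t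
    makes the family stable under differentiation, which replaces p by X^2 (p - p'). *)
Definition flat (p : {poly R}) (t : R) : R :=
  if 0 < t then p.[t^-1] * expR (- t^-1) else 0.

Lemma flat_le0 p t : t <= 0 -> flat p t = 0.
Proof. by rewrite /flat ltNge => ->. Qed.

Lemma horner_le (p : {poly R}) u : 1 <= u ->
  `|p.[u]| <= (\sum_(i < size p) `|p`_i|) * u ^+ size p.
Proof.
move=> u1; have u0 : 0 <= u by exact: le_trans u1.
rewrite horner_coef mulr_suml (le_trans (ler_norm_sum _ _ _))// ler_sum// => i _.
rewrite normrM ler_wpM2l// ger0_norm ?exprn_ge0// ler_weXn2l//.
exact: ltnW.
Qed.

(** Quadratic decay at 0, which makes the derivative vanish there. With u = 1/t, the term of degree
    [size p + 2] of the exponential series dominates both the growth u^(size p) of the polynomial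
    and the extra u^2. *)
Lemma flat_bound p : exists C : R, forall t, `|t| <= 1 -> `|flat p t| <= C * `|t| ^+ 2.
Proof.
pose k := (size p).+1.
exists ((\sum_(i < size p) `|p`_i|) * k.+1`!%:R) => t.
have c0 : 0 <= \sum_(i < size p) `|p`_i| by rewrite sumr_ge0.
have [t0|t0] := leP t 0; first by rewrite flat_le0// normr0 !mulr_ge0// exprn_ge0.
rewrite gtr0_norm// /flat t0 => t1; set u := t^-1.
have u1 : 1 <= u by rewrite /u invf_ge1.
have u0 : 0 < u by rewrite invr_gt0.
rewrite normrM [X in _ * X]ger0_norm ?expR_ge0// expRN.
have hk := @expR_ge1Dxn R u k (ltW u0).
apply: (@le_trans _ _ ((\sum_(i < size p) `|p`_i|) * u ^+ size p * (expR u)^-1)).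
  by rewrite ler_wpM2r ?invr_ge0 ?expR_ge0// horner_le.
rewrite -!mulrA ler_wpM2l// (_ : t = u^-1); last by rewrite invrK.
rewrite (exprVn u 2) ler_pdivlMr ?exprn_gt0//.
rewrite mulrAC ler_pdivrMr ?expR_gt0// -exprD addn2 -/k.
have : u ^+ k.+1 / k.+1`!%:R <= expR u by apply: le_trans hk; rewrite lerDr.
by rewrite ler_pdivrMr ?ltr0n ?fact_gt0// mulrC.
Qed.

Lemma is_derive_flat (p : {poly R}) (t : R) : is_derive t (1 : R) (flat p) (flat ('X^2 * (p - p^`())) t).
Proof.
have [t0|t0|->] := ltgtP t 0.
- rewrite flat_le0 ?ltW//.
  apply: (@near_eq_is_derive _ _ _ (cst 0)) => //.
    by near=> z; rewrite flat_le0// ltW//; near: z; exact: lt_nbhsl.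
- rewrite {2}/flat t0.
  apply: (@near_eq_is_derive _ R R (fun z : R => p.[z^-1] * expR (- z^-1) : R)).
    by near=> z; rewrite /flat ifT//; near: z; exact: lt_nbhsr.
  have tn : t != 0 by rewrite gt_eqF.
  have dV : is_derive t 1 (fun z : R => z^-1) (- t ^- 2).
    by apply: is_derive_eq; [exact: is_deriveV|rewrite scaler1].
  have d1 : is_derive t 1 (horner p \o (fun z : R => z^-1)) (p^`().[t^-1] * (- t ^- 2)).
    by apply: is_derive1_comp.
  have d2 : is_derive t 1 (expR \o (fun z : R => - z^-1)) (expR (- t^-1) * (t ^- 2)).
    apply: is_derive1_comp; rewrite -[t ^- 2]opprK; exact: is_deriveN.
  apply: (is_derive_eq (is_deriveM d1 d2)).
  rewrite /= !hornerE -!exprVn; set u := t^-1; rewrite /GRing.scale/=; ring.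
- rewrite flat_le0//.
  have h : h^-1 *: ((flat p \o shift 0) (h *: 1) - flat p 0) @[h --> 0^'] --> (0 : R).
    have [C hC] := flat_bound p.
    apply/cvgrPdist_lt => e e0; near=> h.
    have h0 : h != 0 by near: h; exact: nbhs_dnbhs_neq.
    rewrite /= addr0 (flat_le0 _ (lexx _)) subr0 sub0r normrN normrZ normfV /GRing.scale /= mulr1.
    rewrite mulrC ltr_pdivrMr ?normr_gt0//.
    have h1 : `|h| <= 1.
      near: h; exact: dnbhs0_le.
    apply: (le_lt_trans (hC _ h1)).
    rewrite expr2 mulrA ltr_pM2r ?normr_gt0//.
    apply: (@le_lt_trans _ _ (`|C| * `|h|)); first by rewrite ler_wpM2r// ler_norm.
    apply: (@le_lt_trans _ _ ((`|C| + 1) * `|h|)); first by rewrite ler_wpM2r// lerDl.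
    have C1 : 0 < `|C| + 1 by rewrite ltr_wpDl.
    rewrite mulrC -ltr_pdivlMr//.
    by near: h; apply: dnbhs0_lt; exact: divr_gt0.
  by split; [apply/cvg_ex; exists 0|exact: cvg_lim h].
Unshelve. all: by end_near.
Qed.

(** A class of expressions closed under partial derivatives, so that smoothness follows by one
    induction on the expression instead of a computation of iterated derivatives. *)
Inductive gen n : ('rV[R]_n -> R) -> Prop :=
| gen_cst c : gen (cst c)
| gen_flat p i a b : gen (fun x => flat p (a * x ord0 i + b))
| gen_add f g : gen f -> gen g -> gen (fun x => f x + g x)
| gen_mul f g : gen f -> gen g -> gen (fun x => f x * g x).

Lemma gen_affine n (f : 'rV[R]_n -> R) s v : gen f ->
  gen (fun x => f (s *: x + v)).
Proof.
elim => [c|p i a b|g h _ gg _ gh|g h _ gg _ gh].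
- exact: gen_cst.
- under eq_fun do rewrite !mxE mulrDr mulrA -addrA.
  exact: gen_flat.
- exact: gen_add.
- exact: gen_mul.
Qed.

Lemma gen_prod n (I : Type) (r : seq I) (F : I -> 'rV[R]_n -> R) :
  (forall i, gen (F i)) -> gen (fun x => \prod_(i <- r) F i x).
Proof.
move=> h; elim: r => [|i r IH].
  under eq_fun do rewrite big_nil; exact: gen_cst.
under eq_fun do rewrite big_cons; exact: gen_mul.
Qed.

Lemma gen_diff n (f : 'rV[R]_n -> R) : gen f ->
  (forall x, differentiable f x) /\ forall i, gen (partial i f).
Proof.
elim => [c|p i a b|g h _ [dg gg] _ [dh gh]|g h kg [dg gg] kh [dh gh]].
- split => [x|i]; first exact: differentiable_cst.
  have -> : partial i (cst c) = cst 0 by apply/funext => x; exact: derive_cst.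
  exact: gen_cst.
- have dc (x : 'rV[R]_n) : differentiable (fun y : 'rV[R]_n => a * y ord0 i + b) x.
    apply: differentiableD; last exact: differentiable_cst.
    by apply: differentiableM; [exact: differentiable_cst|exact: differentiable_coord].
  split => [x|j].
    apply: (@differentiable_comp _ _ _ _ (fun y : 'rV[R]_n => a * y ord0 i + b) (flat p)) => //.
    by apply/derivable1_diffP; case: (is_derive_flat p (a * x ord0 i + b)).
  have -> : partial j (fun x => flat p (a * x ord0 i + b)) =
      (fun x => (a * (j == i)%:R) * flat ('X^2 * (p - p^`())) (a * x ord0 i + b)).
    apply/funext => x; rewrite /partial.
    have hd : is_derive x (delta_mx ord0 j) (fun y : 'rV[R]_n => a * y ord0 i + b) (a * (j == i)%:R).
      suff h : (fun h => h^-1 *: (((fun y : 'rV[R]_n => a * y ord0 i + b) \o shift x) (h *: delta_mx ord0 j) -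
         (a * x ord0 i + b))) @ 0^' --> (a * (j == i)%:R).
        by split; [apply/cvg_ex; eexists; exact: h|exact: cvg_lim h].
      apply: (@cvg_trans _ (cst (a * (j == i)%:R) @ 0^')); last exact: cvg_cst.
      apply: near_eq_cvg; near=> h.
      have h0 : h != 0 by near: h; exact: nbhs_dnbhs_neq.
      rewrite /= !mxE /= eq_sym /GRing.scale /=; field.
      by rewrite h0.
    have fd := is_derive_flat p (a * x ord0 i + b).
    rewrite (_ : (fun y => _) = flat p \o (fun y : 'rV[R]_n => a * y ord0 i + b))//.
    have df : differentiable (flat p) (a * x ord0 i + b) by apply/derivable1_diffP; case: fd.
    rewrite deriveE; last exact: differentiable_comp.
    rewrite diff_comp//=; have [_ hde] := hd; rewrite deriveE// in hde.
    by rewrite hde diff1E//= derive1E; have [_ ->] := fd.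
  by apply: gen_mul; [exact: gen_cst|exact: gen_flat].
- split => [x|i]; first exact: differentiableD.
  have -> : partial i (fun x => g x + h x) = (fun x => partial i g x + partial i h x).
    by apply/funext => x; rewrite /partial; apply: deriveD; exact: diff_derivable.
  exact: gen_add.
- split => [x|i]; first exact: differentiableM.
  have -> : partial i (fun x => g x * h x) = (fun x => g x * partial i h x + h x * partial i g x).
    by apply/funext => x; rewrite /partial; apply: deriveM; exact: diff_derivable.
  by apply: gen_add; apply: gen_mul.
Unshelve. all: by end_near.
Qed.

Lemma gen_smooth n (f : 'rV[R]_n -> R) : gen f -> smooth f.
Proof.
move=> gf s; have : gen (foldr (@partial R n) f s).
  by elim: s => //= i s /gen_diff[_]; exact.
move=> /gen_diff[h _] /=; split => [x|x i]; first exact: differentiable_continuous.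
exact: diff_derivable.
Qed.

Lemma gen_continuous n (f : 'rV[R]_n -> R) : gen f -> continuous f.
Proof. by move=> /gen_diff[h _] x; exact: differentiable_continuous. Qed.

Lemma derive_partial n (f : 'rV[R]_n -> R) (x v : 'rV[R]_n) : differentiable f x ->
  'D_v f x = \sum_i v ord0 i * partial i f x.
Proof.
move=> df; rewrite deriveE// {1}(row_sum_delta v) linear_sum; apply: eq_bigr => i _.
by rewrite linearZ /= -deriveE.
Qed.

Lemma is_derive_line n (f : 'rV[R]_n -> R) (b v : 'rV[R]_n) (t : R) :
  differentiable f (b + t *: v) ->
  is_derive t (1 : R) (fun t => f (b + t *: v)) (\sum_i v ord0 i * partial i f (b + t *: v)).
Proof.
move=> df; rewrite -derive_partial//.
have dl : derivable f (b + t *: v) v by exact: diff_derivable.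
set g := (fun t => _).
have E : (fun h : R => h^-1 *: ((f \o shift (b + t *: v)) (h *: v) - f (b + t *: v))) =
   (fun h : R => h^-1 *: ((g \o shift t) (h *: 1) - g t)).
  apply/funext => h /=; rewrite /g /=; congr (_ *: (f _ - _)).
  have -> : h *: (1 : R) = h by exact: mulr1.
  by rewrite scalerDl addrCA.
by split; rewrite /derivable /derive -E.
Qed.

Lemma partial_affine n (f : 'rV[R]_n -> R) s v i (x : 'rV[R]_n) :
  differentiable f (s *: x + v) ->
  partial i (fun x => f (s *: x + v)) x = s * partial i f (s *: x + v).
Proof.
move=> df; transitivity ('D_(s *: delta_mx ord0 i) f (s *: x + v)); last first.
  by rewrite deriveE// linearZ /= -deriveE.
have E : (fun h : R => h^-1 *: (((fun x => f (s *: x + v)) \o shift x)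
      (h *: delta_mx ord0 i) - f (s *: x + v))) =
    (fun h : R => h^-1 *: ((f \o shift (s *: x + v)) (h *: (s *: delta_mx ord0 i)) -
      f (s *: x + v))).
  apply/funext => h /=; congr (_ *: (f _ - _)).
  by rewrite scalerDr addrA !scalerA mulrC.
by rewrite /partial /derive E.
Qed.

Definition cball n (c : 'rV[R]_n) r := [set x : 'rV[R]_n | `|c - x| <= r].

Lemma cballP n (c : 'rV[R]_n) r x : 0 <= r -> cball c r x <-> forall i, `|c ord0 i - x ord0 i| <= r.
Proof.
move=> r0; rewrite /cball /= [`|c - x|]mx_normrE; split.
  move=> /bigmax_leP[_ h] i; have := h (ord0, i) isT.
  by rewrite !mxE.
by move=> h; apply/bigmax_leP; split => // -[i j] _; rewrite /= (ord1 i) !mxE.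
Qed.

Lemma cball_closed n (c : 'rV[R]_n) r : closed (cball c r).
Proof. exact: closed_closed_ball_.
Qed.

Lemma cball_compact n (c : 'rV[R]_n) r : compact (cball c r).
Proof.
apply: bounded_closed_compact; last exact: cball_closed.
exists (`|c| + r); split; first exact: num_real.
move=> M hM x /= hx; apply/ltW/(le_lt_trans _ hM).
by rewrite -{1}(subKr c x) (le_trans (ler_normB _ _))// lerD2l.
Qed.

Lemma compact_continuous_bounded n (f : 'rV[R]_n -> R) (K : set 'rV[R]_n) :
  continuous f -> compact K -> exists2 M, 0 <= M & forall x, K x -> `|f x| <= M.
Proof.
move=> cf cK.
have /compact_bounded[M [_ hM]] : compact (f @` K).
  by apply: continuous_compact => //; apply: continuous_subspaceT.
exists (`|M| + 1); first by rewrite addr_ge0.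
move=> x Kx; apply: hM; last by exists x.
by rewrite (le_lt_trans (ler_norm _))// ltrDl.
Qed.

Lemma support_bounded n (f : 'rV[R]_n -> R) (K : set 'rV[R]_n) :
  continuous f -> compact K -> (forall x, ~ K x -> f x = 0) ->
  exists2 M, 0 <= M & forall x, `|f x| <= M.
Proof.
move=> cf cK f0; have [M M0 hM] := compact_continuous_bounded cf cK.
exists M => // x; have [/hM//|/f0 ->] := pselect (K x).
by rewrite normr0.
Qed.

Lemma partial_support n (f : 'rV[R]_n -> R) (K : set 'rV[R]_n) i :
  closed K -> (forall x, ~ K x -> f x = 0) -> forall x, ~ K x -> partial i f x = 0.
Proof.
move=> cK f0 x Kx; rewrite /partial.
rewrite (@near_eq_derive _ _ _ f (cst 0)); first exact: derive_cst.
have : nbhs x (~` K) by apply: open_nbhs_nbhs; split => //; exact: closed_openC.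
by apply: filterS => y /f0.
Qed.

(** In each coordinate two profiles exp(-1/t) face each other, one vanishing to the left of c_i - r
    and one to the right of c_i + r. Their product over the coordinates is positive on the open
    cube, and is normalised by its integral. *)
Lemma exists_mollifier n (c : 'rV[R]_n) (r : R) : 0 < r ->
  exists rho : 'rV[R]_n -> R, [/\ gen rho, forall x, 0 <= rho x,
    forall x, ~ cball c r x -> rho x = 0 & (\int[leb R n]_x (rho x)%:E = 1)%E].
Proof.
move=> r0.
pose b (x : 'rV[R]_n) := \prod_i (flat 1 (1 * x ord0 i + (r - c ord0 i)) *
                     flat 1 ((-1) * x ord0 i + (c ord0 i + r))) : R.
have gb : gen b.
  by apply: gen_prod => i; apply: gen_mul; exact: gen_flat.
have f0 t : 0 <= flat 1 t.
  by rewrite /flat; case: ifP => // t0; rewrite hornerC mul1r expR_ge0.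
have fp t : 0 < t -> 0 < flat 1 t.
  by move=> t0; rewrite /flat t0 hornerC mul1r expR_gt0.
have b0 x : 0 <= b x by apply: prodr_ge0 => i _; exact: mulr_ge0.
have bK x : ~ cball c r x -> b x = 0.
  move=> /(cballP _ _ (ltW r0)) /existsNP[i /negP]; rewrite -ltNge => hi.
  rewrite /b (bigD1 i)//= (_ : flat _ _ * flat _ _ = 0) ?mul0r//.
  move: hi; rewrite lter_normr => /orP[hi|hi].
    by rewrite flat_le0 ?mul0r//; lra.
  by rewrite [X in _ * X]flat_le0 ?mulr0//; lra.
have bp x : ball c r x -> 0 < b x.
  move=> /(rV_ballP _ _ r0) h; apply: prodr_gt0 => i _.
  by have := h i; rewrite ltr_norml => /andP[h1 h2]; apply: mulr_gt0; apply: fp; lra.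
have cb := gen_continuous gb.
have mb := continuous_measurable_rV cb.
have [M M0 hM] := support_bounded cb (@cball_compact n c r) bK.
have mK : measurable (cball c r) by apply: closed_measurable_rV; exact: cball_closed.
have Koo : (leb R n (cball c r) < +oo)%E.
  by apply: leb_bounded => //; apply: compact_bounded; exact: cball_compact.
pose J := (\int[leb R n]_x (b x)%:E)%E.
have Ioo : (J < +oo)%E.
  apply: (@le_lt_trans _ _ (\int[leb R n]_x (M%:E * (\1_(cball c r) x)%:E))%E).
    apply: ge0_le_integral => //.
    - by move=> x _; rewrite lee_fin.
    - exact/measurable_EFinP.
    - by apply: emeasurable_funM => //; apply/measurable_EFinP; exact: measurable_indic.
    - move=> x _; rewrite -EFinM lee_fin indicE; case: (boolP (x \in cball c r)) => hx.
        by rewrite mulr1 (le_trans (ler_norm _)).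
      by rewrite bK ?mulr0//; move/negP: hx; apply: contra_not; rewrite inE.
  rewrite ge0_integralZl//; last first.
    by apply/measurable_EFinP; exact: measurable_indic.
  by rewrite -measure_integral_indic// lte_mul_pinfty.
have I0 : (0 < J)%E.
  rewrite lt0e integral_ge0 ?andbT//; last by move=> x _; rewrite lee_fin.
  apply/eqP => I0.
  have mbE : measurable_fun setT (EFin \o b) by exact/measurable_EFinP.
  have := (ae_eq_integral_abs (leb R n) measurableT mbE).1.
  under eq_integral => x _ do rewrite gee0_abs ?lee_fin//.
  move=> /(_ I0)[N [mN N0 hN]].
  have : (leb R n (ball c r) <= leb R n N)%E.
    apply: le_measure; rewrite ?inE//; first exact: measurable_rV_ball.
    move=> x /bp bx; apply: hN => /= /(_ I) -[] bx0.
    by rewrite bx0 ltxx in bx.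
  rewrite N0 leNgt leb_open_gt0//; first exact: ball_open.
  by exists c; exact: ballxx.
have If : J \is a fin_num by rewrite ge0_fin_numE// ltW.
have fI : 0 < fine J by rewrite fine_gt0// I0.
exists (fun x => (fine J)^-1 * b x); split.
- by apply: gen_mul => //; exact: gen_cst.
- by move=> x; rewrite mulr_ge0// invr_ge0 ltW.
- by move=> x /bK ->; rewrite mulr0.
- under eq_integral do rewrite EFinM.
  rewrite ge0_integralZl//.
  + by rewrite -/J -(fineK If) -EFinM mulVf// gt_eqF.
  + exact/measurable_EFinP.
  + by move=> x _; rewrite lee_fin.
  + by rewrite lee_fin invr_ge0 ltW.
Qed.

End bump.

(** * Integrable and square integrable functions for an arbitrary measure *)

Section square_integrable.
Context d (T : measurableType d) (R : realType) (mu : {measure set T -> \bar R}).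
Variables (D : set T) (mD : measurable D).
Implicit Types f g h : T -> R.

Definition rint f := mu.-integrable D (EFin \o f).
(** [L2 D f] unfolds to [sqint (leb R n) D f], so the facts below apply to it directly. *)
Definition sqint f := measurable_fun D f /\ (\int[mu]_(x in D) (f x ^+ 2)%:E < +oo)%E.

Lemma rint_meas f : rint f -> measurable_fun D f.
Proof. by move=> /integrableP[/measurable_EFinP]. Qed.

Lemma rint_le f g : measurable_fun D f -> (forall x, D x -> `|f x| <= g x) ->
  rint g -> rint f.
Proof.
move=> mf fg; apply: le_integrable => //; first exact/measurable_EFinP.
by move=> x Dx; rewrite /= lee_fin (le_trans (fg x Dx))// ler_norm.
Qed.

Lemma rintD f g : rint f -> rint g -> rint (fun x => f x + g x).
Proof. by move=> hf hg; have := integrableD mD hf hg. Qed.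

Lemma rintZ k f : rint f -> rint (fun x => k * f x).
Proof. by move=> hf; have := integrableZl mD k hf. Qed.

Lemma rintB f g : rint f -> rint g -> rint (fun x => f x - g x).
Proof. by move=> hf hg; have := integrableB mD hf hg. Qed.

Lemma rint0 : rint (fun=> 0).
Proof. exact: integrable0. Qed.

Lemma rint_sum (I : Type) (s : seq I) (P : pred I) (F : I -> T -> R) :
  (forall i, rint (F i)) -> rint (fun x => \sum_(i <- s | P i) F i x).
Proof.
move=> h; elim: s => [|i s IH].
  by under eq_fun do rewrite big_nil; exact: rint0.
by under eq_fun do rewrite big_cons; case: (P i) => //; exact: rintD.
Qed.

Lemma Rint_sum (I : Type) (s : seq I) (P : pred I) (F : I -> T -> R) :
  (forall i, rint (F i)) ->
  \int[mu]_(x in D) (\sum_(i <- s | P i) F i x) =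
  \sum_(i <- s | P i) \int[mu]_(x in D) F i x.
Proof.
move=> h; elim: s => [|i s IH].
  by rewrite big_nil; under eq_Rintegral do rewrite big_nil; rewrite Rintegral_cst// mul0r.
rewrite big_cons; under eq_Rintegral do rewrite big_cons.
case: (P i); last exact: IH.
by rewrite RintegralD//; [rewrite IH|exact: h|exact: rint_sum].
Qed.

Lemma EFin_Rint f : rint f -> (\int[mu]_(x in D) (f x)%:E)%E = (\int[mu]_(x in D) f x)%:E.
Proof. by move=> hf; rewrite /Rintegral fineK//; exact: integrable_fin_num. Qed.

Lemma ge0_rint f : measurable_fun D f -> (forall x, D x -> 0 <= f x) ->
  (\int[mu]_(x in D) (f x)%:E < +oo)%E -> rint f.
Proof.
move=> mf f0 foo; apply/integrableP; split; first exact/measurable_EFinP.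
rewrite (_ : integral _ _ _ = (\int[mu]_(x in D) (f x)%:E)%E)//.
by apply: eq_integral => x /set_mem Dx; rewrite /= ger0_norm// f0.
Qed.

Lemma ge0_rint_lty f : rint f -> (\int[mu]_(x in D) (f x)%:E < +oo)%E.
Proof. by move=> hf; rewrite EFin_Rint// ltry. Qed.

Lemma ae_eq_Rint f g : measurable_fun D f -> measurable_fun D g ->
  {ae mu, forall x, D x -> f x = g x} ->
  \int[mu]_(x in D) f x = \int[mu]_(x in D) g x.
Proof.
move=> mf mg h; congr fine; apply: ae_eq_integral => //; try exact/measurable_EFinP.
by apply: filterS h => x h /h ->.
Qed.

Lemma ae_ge0_Rint f : rint f -> {ae mu, forall x, D x -> 0 <= f x} ->
  0 <= \int[mu]_(x in D) f x.
Proof.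
move=> hf h; have mf := rint_meas hf.
rewrite (@ae_eq_Rint _ (fun x => `|f x|))//.
- by apply: Rintegral_ge0.
- exact: measurableT_comp.
- by apply: filterS h => x h /h f0; rewrite ger0_norm.
Qed.

Lemma ae_le_Rint f g : rint f -> rint g -> {ae mu, forall x, D x -> f x <= g x} ->
  \int[mu]_(x in D) f x <= \int[mu]_(x in D) g x.
Proof.
move=> hf hg h; rewrite -subr_ge0 -RintegralB//; apply: ae_ge0_Rint.
  exact: rintB.
by apply: filterS h => x h /h; rewrite subr_ge0.
Qed.

Lemma ae_Rint_eq0 f : rint f -> {ae mu, forall x, D x -> 0 <= f x} ->
  \int[mu]_(x in D) f x = 0 -> {ae mu, forall x, D x -> f x = 0}.
Proof.
move=> hf h f0; have mf := rint_meas hf.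
have mE : measurable_fun D (EFin \o f) by exact/measurable_EFinP.
have [+ _] := ae_eq_integral_abs mu mD mE => /(_ _)[].
  rewrite (_ : integral _ _ _ = (\int[mu]_(x in D) (f x)%:E)%E).
    by rewrite EFin_Rint// f0.
  apply: ae_eq_integral => //; first exact: measurableT_comp.
  by apply: filterS h => x h /h f00; rewrite /= ger0_norm.
move=> N [mN N0 hN]; exists N; split => // x /= hx; apply: hN => /= h1; apply: hx => Dx.
by have [] := h1 Dx.
Qed.

Lemma sqint_sq f : sqint f -> rint (fun x => f x ^+ 2).
Proof.
move=> [mf foo]; apply: ge0_rint => //; first exact: measurable_funX.
by move=> x _; exact: sqr_ge0.
Qed.

Lemma rint_sqint f : measurable_fun D f -> rint (fun x => f x ^+ 2) -> sqint f.
Proof. by move=> mf hf; split => //; exact: ge0_rint_lty. Qed.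

Lemma sqint_le f g : measurable_fun D f -> sqint g ->
  {ae mu, forall x, D x -> `|f x| <= `|g x|} -> sqint f.
Proof.
move=> mf hg h; split => //; apply: le_lt_trans hg.2.
apply: ae_ge0_le_integral => //.
- by move=> x _; rewrite lee_fin sqr_ge0.
- by apply/measurable_EFinP; exact: measurable_funX.
- by move=> x _; rewrite lee_fin sqr_ge0.
- by apply/measurable_EFinP; apply: measurable_funX; exact: hg.1.
- by apply: filterS h => x h /h fg; rewrite lee_fin -(real_normK (num_real (f x)))
    -[leRHS](real_normK (num_real (g x))) lerXn2r// nnegrE.
Qed.

Lemma sqintM f g : sqint f -> sqint g -> rint (fun x => f x * g x).
Proof.
move=> hf hg; apply: (@rint_le _ (fun x => f x ^+ 2 + g x ^+ 2)).
- by apply: measurable_funM; [exact: hf.1|exact: hg.1].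
- move=> x _; rewrite ler_norml; apply/andP; split.
    by have := sqr_ge0 (f x + g x); nra.
  by have := sqr_ge0 (f x - g x); nra.
- by apply: rintD; exact: sqint_sq.
Qed.

Lemma sqintZ k f : sqint f -> sqint (fun x => k * f x).
Proof.
move=> hf; apply: rint_sqint.
  by apply: measurable_funM => //; exact: hf.1.
by under eq_fun do rewrite exprMn; apply: rintZ; exact: sqint_sq.
Qed.

Lemma sqintD f g : sqint f -> sqint g -> sqint (fun x => f x + g x).
Proof.
move=> hf hg; apply: rint_sqint.
  by apply: measurable_funD; [exact: hf.1|exact: hg.1].
under eq_fun do rewrite sqrrD -mulr_natl; apply: rintD; last exact: sqint_sq.
by apply: rintD; [exact: sqint_sq|apply: rintZ; exact: sqintM].
Qed.

Lemma sqintB f g : sqint f -> sqint g -> sqint (fun x => f x - g x).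
Proof.
move=> hf hg; have := sqintD hf (sqintZ (-1) hg).
by under eq_fun do rewrite mulN1r.
Qed.

Lemma sqint0 : sqint (fun=> 0).
Proof.
apply: rint_sqint => //; rewrite (_ : (fun _ => _) = (fun=> 0)); first exact: rint0.
by apply/funext => x; rewrite expr0n.
Qed.

Lemma sqint_sum (I : Type) (s : seq I) (P : pred I) (F : I -> T -> R) :
  (forall i, sqint (F i)) -> sqint (fun x => \sum_(i <- s | P i) F i x).
Proof.
move=> h; elim: s => [|i s IH].
  by under eq_fun do rewrite big_nil; exact: sqint0.
by under eq_fun do rewrite big_cons; case: (P i) => //; exact: sqintD.
Qed.

Lemma sqint_mul_bounded (h f : T -> R) M : measurable_fun D h ->
  {ae mu, forall x, D x -> `|h x| <= M} -> sqint f -> sqint (fun x => h x * f x).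
Proof.
move=> mh hM hf; apply: (@sqint_le _ (fun x => `|M| * f x)).
- by apply: measurable_funM => //; exact: hf.1.
- exact: sqintZ.
- apply: filterS hM => x hM /hM hx; rewrite !normrM normr_id ler_wpM2r//.
  exact: le_trans hx (ler_norm _).
Qed.

Lemma sqint_Cauchy_Schwarz f g : sqint f -> sqint g ->
  (\int[mu]_(x in D) (f x * g x)) ^+ 2 <=
  (\int[mu]_(x in D) (f x ^+ 2)) * (\int[mu]_(x in D) (g x ^+ 2)).
Proof.
move=> hf hg; set a := Rintegral _ _ (fun x => f x ^+ 2); set c := Rintegral _ _ (fun x => g x ^+ 2).
set b := Rintegral _ _ _.
have Q t : 0 <= a + t * (2 * b) + t ^+ 2 * c.
  have : 0 <= \int[mu]_(x in D) ((f x + t * g x) ^+ 2).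
    by apply: Rintegral_ge0 => x _; exact: sqr_ge0.
  rewrite (@eq_Rintegral _ _ _ _ _ (fun x => f x ^+ 2 + t * 2 * (f x * g x) + t ^+ 2 * g x ^+ 2)); last first.
    by move=> x _; ring.
  have hf2 := sqint_sq hf; have hg2 := sqint_sq hg; have hfg := sqintM hf hg.
  have hg2' := rintZ (t ^+ 2) hg2; have hfg' := rintZ (t * 2) hfg.
  rewrite (RintegralD mD (rintD hf2 hfg') hg2') (RintegralD mD hf2 hfg').
  by rewrite (RintegralZl _ mD hfg) (RintegralZl _ mD hg2) -/a -/b -/c -mulrA.
have c0 : 0 <= c by apply: Rintegral_ge0 => x _; exact: sqr_ge0.
have [c1|c1] := eqVneq c 0.
  have [->|b0] := eqVneq b 0; first by rewrite expr0n c1 mulr0.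
  (* For c = 0 the nonnegative quadratic is affine in t, and this t would give it the value -1. *)
  have := Q (- (a + 1) / (2 * b)); rewrite c1 mulr0 addr0.
  have -> : a + - (a + 1) / (2 * b) * (2 * b) = -1 by field.
  by rewrite oppr_ge0 ler10.
have cp : 0 < c by rewrite lt_neqAle eq_sym c1.
have := Q (- b / c).
have -> : a + - b / c * (2 * b) + (- b / c) ^+ 2 * c = a - b ^+ 2 / c by field.
by rewrite subr_ge0 ler_pdivrMr.
Qed.

End square_integrable.

Definition convex_rV (R : realType) n (U : set 'rV[R]_n) := forall x y t,
  U x -> U y -> 0 <= t -> t <= 1 -> U (y + t *: (x - y)).

Lemma continuous_at_sum (R : realType) (T : topologicalType) (I : Type) (s : seq I)
    (F : I -> T -> R) (x : T) : (forall i, {for x, continuous (F i)}) ->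
  continuous_at x (fun t => \sum_(i <- s) F i t).
Proof.
move=> h; elim: s => [|i s IH].
  by under eq_fun do rewrite big_nil; exact: cvg_cst.
under eq_fun do rewrite big_cons.
by apply: cvgD; [exact: h|exact: IH].
Qed.

(** * The Poincaré inequality for weak gradients *)

Section mollifying_kernel.
Context (R : realType) (n : nat) (rho : 'rV[R]_n -> R) (c : 'rV[R]_n) (r : R).
Hypothesis grho : gen rho.
Hypothesis rho0 : forall x, 0 <= rho x.
Hypothesis rhoK : forall x, ~ cball c r x -> rho x = 0.
Hypothesis rho1 : (\int[leb R n]_x (rho x)%:E = 1)%E.
Variables (U : set 'rV[R]_n) (r0 : 0 < r).
Hypothesis cU : convex_rV U.
Hypothesis KU : cball c r `<=` U.

(* For s = 1/e this is the density at z of (1 - e) x + e w, where w has density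
   rho; if x and the support of rho lie in the convex set U, so does its support. *)
Definition ker (s : R) (x z : 'rV[R]_n) : R := s ^+ n * rho (s *: z + (1 - s) *: x).

(** The derivative of [ker s x z] in x along v, written through derivatives in z: since x and z
    enter only through s z + (1 - s) x, the two differ by the factor (1 - s)/s. In this form the
    weak identity, which acts on z, can be applied. *)
Definition dker (s : R) (x v z : 'rV[R]_n) : R :=
  (1 - s) / s * \sum_i v ord0 i * partial i (ker s x) z.

Lemma ker_ge0 s x z : 0 <= s -> 0 <= ker s x z.
Proof. by move=> s0; rewrite mulr_ge0// exprn_ge0. Qed.

Lemma ker_gen s x : gen (ker s x).
Proof.
apply: gen_mul; first exact: gen_cst.
exact: (gen_affine s ((1 - s) *: x) grho).
Qed.

Lemma rho_bounded : exists2 M, 0 <= M & forall x, `|rho x| <= M.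
Proof. exact: support_bounded (gen_continuous grho) (@cball_compact R n c r) rhoK. Qed.

Lemma ker_bounded s : exists2 M, 0 <= M & forall x z, `|ker s x z| <= M.
Proof.
have [M M0 hM] := rho_bounded; exists (`|s ^+ n| * M); first exact: mulr_ge0.
by move=> x z; rewrite normrM ler_wpM2l.
Qed.

Lemma ker_meas d (T : measurableType d) s (X Z : T -> 'rV[R]_n) :
  measurable_fun setT X -> measurable_fun setT Z ->
  measurable_fun setT (fun a => ker s (X a) (Z a)).
Proof.
move=> mX mZ; apply: measurable_funM => //.
have mr := continuous_measurable_rV (gen_continuous grho).
by apply: (measurableT_comp mr); apply: measurable_rVD; apply: measurable_rVZ.
Qed.

Lemma ker_support s x : 1 < s -> forall z, ker s x z != 0 ->
  cball c r (s *: z + (1 - s) *: x).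
Proof.
move=> s1 z; apply: contra_neqP => /rhoK h; by rewrite /ker h mulr0.
Qed.

(** If w = s z + (1 - s) x lies in the support of [rho], then z = x + (w - x)/s is a point between x
    and w, and convexity of U keeps it in U. The support in z is the cube of radius r/s about the
    image of c. *)
Lemma ker_test s x : 1 < s -> U x -> test_function U (ker s x).
Proof.
move=> s1 Ux; have s0 : 0 < s by exact: lt_trans s1.
have sn0 : s != 0 by rewrite gt_eqF.
split; first exact: gen_smooth (ker_gen s x).
pose c' := s^-1 *: (c + (s - 1) *: x).
have E z : s *: (c' - z) = c - (s *: z + (1 - s) *: x).
  by apply/rowP => i; rewrite !mxE; field.
have cE z : cball c' (r / s) z = cball c r (s *: z + (1 - s) *: x).
  by rewrite /cball /= -E normrZ gtr0_norm// ler_pdivlMr// mulrC.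
exists (cball c' (r / s)); split; first exact: cball_compact.
  move=> z; rewrite cE => /KU Uw.
  have := @cU _ _ s^-1 Uw Ux; rewrite invr_ge0 (ltW s0) invf_le1// (ltW s1) => /(_ isT isT).
  by congr (U _); apply/rowP => i; rewrite !mxE; field.
by move=> z; rewrite cE => hz; apply/eqP; apply: contra_notT hz => /(ker_support s1).
Qed.

Lemma rho_mass (a : R) (v : 'rV[R]_n) : a != 0 ->
  (\int[leb R n]_z (rho (a *: z + v))%:E = (`|a| ^- n)%:E)%E.
Proof.
move=> a0; rewrite -[RHS]mule1 -rho1.
apply: (@ge0_integral_homothety R n a v (EFin \o rho)) => //.
  by apply/measurable_EFinP; exact: continuous_measurable_rV (gen_continuous grho).
Qed.

Lemma ker_mass s x : 0 < s -> (\int[leb R n]_z (ker s x z)%:E = 1)%E.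
Proof.
move=> s0; under eq_integral do rewrite EFinM.
rewrite ge0_integralZl//.
- by rewrite rho_mass ?gt_eqF// gtr0_norm// -EFinM divff// expf_neq0// gt_eqF.
- apply/measurable_EFinP.
  apply: (measurableT_comp (continuous_measurable_rV (gen_continuous grho))).
  by apply: measurable_rVD => //; exact: measurable_rVZ.
- by move=> z _; rewrite lee_fin.
- by rewrite lee_fin exprn_ge0// ltW.
Qed.

Lemma ker_massl s a v z : 1 < s -> a != 0 ->
  (\int[leb R n]_x (ker s (a *: x + v) z)%:E = ((s / ((s - 1) * `|a|)) ^+ n)%:E)%E.
Proof.
move=> s1 a0; have s0 : 0 < s by exact: lt_trans s1.
have E x : s *: z + (1 - s) *: (a *: x + v) = ((1 - s) * a) *: x + (s *: z + (1 - s) *: v).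
  by rewrite scalerDr scalerA addrCA.
under eq_integral => x _ do rewrite /ker EFinM E.
rewrite ge0_integralZl//.
- have sa : (1 - s) * a != 0 by rewrite mulf_neq0// subr_eq0 lt_eqF.
  rewrite rho_mass// -EFinM normrM -(opprB s 1) normrN (@gtr0_norm _ (s - 1)) ?subr_gt0//.
  by rewrite expr_div_n.
- apply/measurable_EFinP.
  apply: (measurableT_comp (continuous_measurable_rV (gen_continuous grho))).
  by apply: measurable_rVD => //; exact: measurable_rVZ.
- by move=> x _; rewrite lee_fin.
- by rewrite lee_fin exprn_ge0// ltW.
Qed.

(** Integrating in x instead of z gives the mass (s/((s - 1) a))^n, where s/(s - 1) <= 2 and 1/a <=
    2. This is the origin of 4^n, and of 2^n in the Poincaré constant. *)
Lemma ker_massl_le s a v z : 2 <= s -> 2^-1 <= a ->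
  (\int[leb R n]_x (ker s (a *: x + v) z)%:E <= (4 ^+ n)%:E)%E.
Proof.
move=> s2 a2; have s1 : 1 < s by lra.
have a0 : 0 < a by lra.
rewrite ker_massl ?gt_eqF// lee_fin lerXn2r ?nnegrE//.
  by rewrite divr_ge0 ?mulr_ge0//; lra.
rewrite gtr0_norm// ler_pdivrMr ?mulr_gt0 ?subr_gt0//; nra.
Qed.

Lemma partial_ker s x i z :
  partial i (ker s x) z = s ^+ n * (s * partial i rho (s *: z + (1 - s) *: x)).
Proof.
have [dr _] := gen_diff grho.
rewrite -partial_affine; last exact: dr.
have [df _] := gen_diff (gen_affine s ((1 - s) *: x) grho).
rewrite {1}/partial (_ : ker s x = (s ^+ n) *: (fun z => rho (s *: z + (1 - s) *: x)))//.
by rewrite deriveZ//; exact: diff_derivable.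
Qed.

Lemma dkerE (s : R) x v z : s != 0 ->
  dker s x v z = s ^+ n * ((1 - s) * \sum_i v ord0 i * partial i rho (s *: z + (1 - s) *: x)).
Proof.
move=> s0; rewrite /dker; under eq_bigr => i _ do rewrite partial_ker.
rewrite !mulr_sumr; apply: eq_bigr => i _; field; exact: s0.
Qed.

Lemma is_derive_ker (s : R) (y v z : 'rV[R]_n) (t : R) : s != 0 ->
  is_derive t (1 : R) (fun t => ker s (y + t *: v) z) (dker s (y + t *: v) v z).
Proof.
move=> s0; have [dr _] := gen_diff grho.
have E u : s *: z + (1 - s) *: (y + u *: v) = (s *: z + (1 - s) *: y) + u *: ((1 - s) *: v).
  by rewrite scalerDr addrA !scalerA (mulrC u).
have := @is_derive_line R n rho (s *: z + (1 - s) *: y) ((1 - s) *: v) t (dr _).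
rewrite -E => h; rewrite dkerE//.
have -> : (fun t => ker s (y + t *: v) z) =
    (s ^+ n) *: (fun t : R => rho (s *: z + (1 - s) *: y + t *: ((1 - s) *: v))).
  by apply/funext => u; rewrite /ker E.
rewrite mulr_sumr; have := @is_deriveZ _ _ _ _ (s ^+ n) _ _ _ h.
by under eq_bigr do rewrite mxE -mulrA.
Qed.

Lemma dker_cont (s : R) (y v z : 'rV[R]_n) : s != 0 ->
  continuous (fun t : R => dker s (y + t *: v) v z).
Proof.
move=> s0 t.
have E (u : R) : s *: z + (1 - s) *: (y + u *: v) = (s *: z + (1 - s) *: y) + u *: ((1 - s) *: v).
  by rewrite scalerDr addrA !scalerA (mulrC u).
have -> : (fun t : R => dker s (y + t *: v) v z) = (fun t : R => s ^+ n * ((1 - s) *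
    \sum_i v ord0 i * partial i rho ((s *: z + (1 - s) *: y) + t *: ((1 - s) *: v)))).
  by apply/funext => u; rewrite (dkerE _ _ _ s0) E.
apply: cvgMr; apply: cvgMr; apply: continuous_at_sum => i; apply: cvgMr.
have [_ gp] := gen_diff grho; have [dp _] := gen_diff (gp i).
have [dl _] := is_derive_line (dp ((s *: z + (1 - s) *: y) + t *: ((1 - s) *: v))).
by apply: (@differentiable_continuous _ _ _ t (fun t : R =>
  partial i rho ((s *: z + (1 - s) *: y) + t *: ((1 - s) *: v)))); apply/derivable1_diffP.
Qed.

Lemma ker_line (s : R) (x y z : 'rV[R]_n) : s != 0 ->
  (\int[lebesgue_measure]_(t in `[0%R, 1%R])
     (dker s (y + t *: (x - y)) (x - y) z)%R%:E = (ker s x z - ker s y z)%R%:E)%E.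
Proof.
move=> s0; pose f t := ker s (y + t *: (x - y)) z.
have df t : is_derive t (1 : R) f (dker s (y + t *: (x - y)) (x - y) z) by exact: is_derive_ker.
have cf t : {for t, continuous f}.
  by apply: differentiable_continuous; apply/derivable1_diffP; case: (df t).
rewrite (@continuous_FTC2 R _ f 0 1)//.
- by rewrite /f scale1r (addrC y) subrK scale0r addr0 EFinB.
- by apply: continuous_subspaceT; exact: dker_cont.
- split.
  + by move=> t _; case: (df t).
  + by apply: cvg_at_right_filter; exact: cf.
  + by apply: cvg_at_left_filter; exact: cf.
- by move=> t _; rewrite derive1E; case: (df t).
Qed.

Lemma dker_bounded (s : R) v : s != 0 -> exists2 M, 0 <= M & forall x z, `|dker s x v z| <= M.
Proof.
move=> s0; have [_ gp] := gen_diff grho.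
have /(_ _)/cid2 hM i := support_bounded (gen_continuous (gp i)) (@cball_compact R n c r)
  (partial_support i (@cball_closed R n c r) rhoK).
exists (`|s ^+ n| * (`|1 - s| * \sum_i `|v ord0 i| * sval (hM i))).
  by do 2 rewrite mulr_ge0//; apply: sumr_ge0 => i _; rewrite mulr_ge0//; case: (hM i).
move=> x z; rewrite dkerE// !normrM; do 2 rewrite ler_wpM2l//.
rewrite (le_trans (ler_norm_sum _ _ _))// ler_sum// => i _.
by rewrite normrM ler_wpM2l//; case: (hM i).
Qed.

Lemma dker_meas d (T : measurableType d) (s : R) (X Z : T -> 'rV[R]_n) v : s != 0 ->
  measurable_fun setT X -> measurable_fun setT Z ->
  measurable_fun setT (fun a => dker s (X a) v (Z a)).
Proof.
move=> s0 mX mZ; under eq_fun do rewrite dkerE//.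
do 2 apply: measurable_funM => //; apply: measurable_sum => i; apply: measurable_funM => //.
have [_ gp] := gen_diff grho.
apply: (measurableT_comp (continuous_measurable_rV (gen_continuous (gp i)))).
by apply: measurable_rVD; apply: measurable_rVZ.
Qed.

End mollifying_kernel.

(** * Iterated integrals on product spaces *)

Section products.
Local Open Scope ereal_scope.
Context d1 d2 d3 (T1 : measurableType d1) (T2 : measurableType d2)
  (T3 : measurableType d3) (R : realType).
Variable m1 : {sigma_finite_measure set T1 -> \bar R}.
Variable m2 : {sigma_finite_measure set T2 -> \bar R}.
Variable m3 : {sigma_finite_measure set T3 -> \bar R}.

Lemma prod_dominated_integrable (a : T1 -> R) (b : T2 -> R) (f : T1 * T2 -> R) :
  measurable_fun setT f -> (forall x, 0 <= a x)%R -> (forall y, 0 <= b y)%R ->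
  rint m1 setT a -> rint m2 setT b -> (forall x y, `|f (x, y)| <= a x * b y)%R ->
  (m1 \x m2).-integrable setT (EFin \o f).
Proof.
move=> mf a0 b0 ha hb hf.
have ma := rint_meas ha; have mb := rint_meas hb.
apply/integrableP; split; first exact/measurable_EFinP.
have mg : measurable_fun setT (fun p : T1 * T2 => (a p.1 * b p.2)%:E).
  apply/measurable_EFinP; apply: measurable_funM.
    exact: (measurableT_comp ma measurable_fst).
  exact: (measurableT_comp mb measurable_snd).
apply: (@le_lt_trans _ _ (\int[m1 \x m2]_p (a p.1 * b p.2)%:E)).
  apply: ge0_le_integral => //.
  - by apply: measurableT_comp => //; exact/measurable_EFinP.
  - by move=> [x y] _; rewrite /= lee_fin hf.
rewrite fubini_tonelli1//; last by move=> p; rewrite lee_fin mulr_ge0.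
rewrite /fubini_F /=.
under eq_integral => x _.
  under eq_integral do rewrite EFinM.
  rewrite ge0_integralZl//; last 3 first.
  - exact/measurable_EFinP.
  - by move=> y _; rewrite lee_fin.
  - by rewrite lee_fin.
  rewrite EFin_Rint// -EFinM mulrC.
  over.
by rewrite EFin_Rint ?ltry//; exact: rintZ.
Qed.

Lemma tonelli_swap3 (G : (T1 * T2) * T3 -> \bar R) : measurable_fun setT G ->
  (forall p, 0 <= G p) ->
  \int[m1]_x \int[m2]_y \int[m3]_z G ((x, y), z) =
  \int[m3]_z \int[m1]_x \int[m2]_y G ((x, y), z).
Proof.
move=> mG G0.
pose H (p : (T1 * T3) * T2) := G ((p.1.1, p.2), p.1.2).
have mH : measurable_fun setT H.
  apply: (measurableT_comp mG); apply/measurable_fun_pairP; split => /=; last first.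
    exact: (measurableT_comp measurable_snd measurable_fst).
  apply/measurable_fun_pairP; split => /=; last exact: measurable_snd.
  exact: (measurableT_comp measurable_fst measurable_fst).
have mH2 := measurable_fun_fubini_tonelli_F (m2 := m2) H mH (fun=> G0 _).
rewrite (eq_integral (fun x => \int[m3]_z \int[m2]_y H ((x, z), y))).
  rewrite (sfinite_Fubini _ _ (fubini_F m2 H))// => p.
  by apply: integral_ge0 => y _; exact: G0.
move=> x _; rewrite (sfinite_Fubini _ _ (fun p => G ((x, p.1), p.2)))//.
apply: (measurableT_comp mG); apply: measurable_fun_pair; last exact: measurable_snd.
by apply: measurable_fun_pair => //; exact: measurable_fst.
Qed.

Lemma ge0_integral_indicl (D : set T1) (f : T1 -> \bar R) : measurable D ->
  \int[m1]_x ((\1_D x)%:E * f x) = \int[m1]_(x in D) f x.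
Proof.
move=> mD; rewrite [RHS]integral_mkcond; apply: eq_integral => x _.
by rewrite patchE indicE; case: ifP => _; rewrite ?mul1e ?mul0e.
Qed.

End products.

Lemma integral_cst_indic d (T : measurableType d) (R : realType)
    (mu : {measure set T -> \bar R}) (D : set T) (b M : R) :
  measurable D -> 0 <= b -> mu D = M%:E ->
  (\int[mu]_x (b%:E * (\1_D x)%:E) = (b * M)%:E)%E.
Proof.
move=> mD b0 DM; rewrite ge0_integralZl//; first by rewrite -measure_integral_indic// DM EFinM.
by apply/measurable_EFinP; exact: measurable_indic.
Qed.

Lemma ge0_integralMl d (T : measurableType d) (R : realType)
    (mu : {measure set T -> \bar R}) (k : T -> R) (b : R) :
  0 <= b -> (forall y, 0 <= k y) -> measurable_fun setT k ->
  (\int[mu]_y (b * k y)%:E = b%:E * \int[mu]_y (k y)%:E)%E.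
Proof.
move=> b0 k0 mk; under eq_integral do rewrite EFinM.
rewrite ge0_integralZl//; first exact/measurable_EFinP.
by move=> y _; rewrite lee_fin.
Qed.

Lemma ge0_integralMl2 d1 d2 (T1 : measurableType d1) (T2 : measurableType d2) (R : realType)
    (m1 : {sigma_finite_measure set T1 -> \bar R}) (m2 : {sigma_finite_measure set T2 -> \bar R})
    (k : T1 * T2 -> R) (b : R) :
  0 <= b -> (forall p, 0 <= k p) -> measurable_fun setT k ->
  (\int[m1]_x \int[m2]_y (b * k (x, y))%:E = b%:E * \int[m1]_x \int[m2]_y (k (x, y))%:E)%E.
Proof.
move=> b0 k0 mk; rewrite -ge0_integralZl//.
- apply: eq_integral => x _; rewrite ge0_integralMl//.
  exact: (measurableT_comp mk (measurable_pair1 x)).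
- apply: (measurable_fun_fubini_tonelli_F (m2 := m2) (EFin \o k)); first exact/measurable_EFinP.
  by move=> p; rewrite lee_fin.
- by move=> x _; apply: integral_ge0 => y _; rewrite lee_fin.
Qed.

Lemma ge0_integral2_comb d1 d2 (T1 : measurableType d1) (T2 : measurableType d2) (R : realType)
    (m1 : {sigma_finite_measure set T1 -> \bar R}) (m2 : {sigma_finite_measure set T2 -> \bar R})
    (Q : T1 * T2 -> \bar R) (k : T1 * T2 -> R) (a b : R) :
  0 <= a -> 0 <= b -> measurable_fun setT Q -> (forall p, (0 <= Q p)%E) ->
  measurable_fun setT k -> (forall p, 0 <= k p) ->
  (\int[m1]_x \int[m2]_y (a%:E * Q (x, y) + (b * k (x, y))%:E) =
   a%:E * \int[m1]_x \int[m2]_y Q (x, y) + b%:E * \int[m1]_x \int[m2]_y (k (x, y))%:E)%E.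
Proof.
move=> a0 b0 mQ Q0 mk k0.
have mbk : measurable_fun setT (fun p => (b * k p)%:E).
  by apply/measurable_EFinP; exact: measurable_funM.
have maQ : measurable_fun setT (fun p => (a%:E * Q p)%E) by exact: emeasurable_funM.
have aQ0 p : (0 <= a%:E * Q p)%E by exact: mule_ge0.
have bk0 p : (0 <= (b * k p)%:E)%E by rewrite lee_fin mulr_ge0.
rewrite -ge0_integralMl2// -ge0_integralZl//; last 2 first.
- exact: (measurable_fun_fubini_tonelli_F (m2 := m2) Q mQ Q0).
- by move=> x _; exact: integral_ge0.
rewrite -ge0_integralD//; last 4 first.
- by move=> x _; apply: mule_ge0 => //; exact: integral_ge0.
- apply: emeasurable_funM => //.
  exact: (measurable_fun_fubini_tonelli_F (m2 := m2) Q mQ Q0).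
- by move=> x _; exact: integral_ge0.
- exact: (measurable_fun_fubini_tonelli_F (m2 := m2) _ mbk bk0).
apply: eq_integral => x _; rewrite -ge0_integralZl//; last first.
  exact: (measurableT_comp mQ (measurable_pair1 x)).
rewrite -ge0_integralD//.
- exact: (measurableT_comp maQ (measurable_pair1 x)).
- exact: (measurableT_comp mbk (measurable_pair1 x)).
Qed.

(** * The pairing inequality for averaged functions *)

Section mollified_poincare.
Context (R : realType) (n : nat) (rho : 'rV[R]_n -> R) (c : 'rV[R]_n) (r : R).
Hypothesis grho : gen rho.
Hypothesis rho0 : forall x, 0 <= rho x.
Hypothesis rhoK : forall x, ~ cball c r x -> rho x = 0.
Hypothesis rho1 : (\int[leb R n]_x (rho x)%:E = 1)%E.
Variable U : set 'rV[R]_n.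
Hypothesis cU : convex_rV U.
Hypothesis KU : cball c r `<=` U.
Hypothesis mU : measurable U.
Hypothesis bU : bounded_set U.
Variables (F : 'rV[R]_n -> R) (Fg : 'I_n -> 'rV[R]_n -> R).
Hypothesis F2 : sqint (leb R n) setT F.
Hypothesis Fg2 : forall i, sqint (leb R n) setT (Fg i).
Hypothesis FU : forall x, ~ U x -> F x = 0.
Hypothesis weak : forall psi, test_function U psi -> forall i,
  \int[leb R n]_x (F x * partial i psi x) = - \int[leb R n]_x (Fg i x * psi x).
Variable delta : R.
Hypothesis delta0 : 0 <= delta.
Hypothesis diamU : forall x y, U x -> U y -> dot (x - y) (x - y) <= delta ^+ 2.
Variable phi : 'rV[R]_n -> R.
Hypothesis cphi : continuous phi.
Variable s : R.
Hypothesis s2 : 2 <= s.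

Local Notation mu := (leb R n).
Local Notation mu1 := (@lebesgue_measure R).
Let s0 : s != 0. Proof. by rewrite gt_eqF//; have := s2; lra. Qed.
Let s1 : 1 < s. Proof. by have := s2; lra. Qed.
Let sp : 0 < s. Proof. by have := s2; lra. Qed.

Definition moll x := \int[mu]_z (F z * ker rho s x z).
Definition energy z := \sum_i Fg i z ^+ 2.

Let mF : measurable_fun setT F. Proof. exact: F2.1. Qed.
Let mFg i : measurable_fun setT (Fg i). Proof. exact: (Fg2 i).1. Qed.

Lemma indic_sqint : sqint mu setT (\1_U : _ -> R).
Proof.
split; first exact: measurable_indic.
rewrite (_ : (\int[mu]_x _)%E = mu U); first exact: leb_bounded.
rewrite measure_integral_indic//; apply: eq_integral => x _.
by rewrite indicE; case: (_ \in _); rewrite ?expr1n ?expr0n.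
Qed.

Lemma indic_rint : rint mu setT (\1_U : _ -> R).
Proof.
have := sqint_sq indic_sqint; congr (rint _ _); apply/funext => x.
by rewrite indicE; case: (_ \in _); rewrite ?expr1n ?expr0n.
Qed.

Lemma Fint : rint mu setT F.
Proof.
have := sqintM measurableT F2 indic_sqint; congr (rint _ _); apply/funext => x.
rewrite indicE; case: (boolP (x \in U)) => [_|/negP hx]; rewrite ?mulr1//.
by rewrite FU ?mul0r// => /mem_set.
Qed.

Lemma energy_rint : rint mu setT energy.
Proof. by apply: rint_sum => // i; exact: sqint_sq (Fg2 i). Qed.

Lemma bounded_mul_rint (k f : 'rV[R]_n -> R) : measurable_fun setT k ->
  (exists2 M, 0 <= M & forall x, `|k x| <= M) -> rint mu setT f ->
  rint mu setT (fun x => f x * k x).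
Proof.
move=> mk [M M0 hM] hf.
apply: (@rint_le _ _ _ _ _ _ _ (fun x => M * `|f x|)) => //.
- by apply: measurable_funM => //; exact: rint_meas hf.
- by move=> x _; rewrite normrM mulrC ler_wpM2r.
- by apply: rintZ => //; have := integrable_norm hf.
Qed.

Lemma moll_rint x : rint mu setT (fun z => F z * ker rho s x z).
Proof.
apply: bounded_mul_rint Fint; first exact: (ker_meas grho s (measurable_cst x) (@measurable_id _ _ _)).
by have [M M0 hM] := ker_bounded grho rhoK s; exists M.
Qed.

Lemma ker_rint x : rint mu setT (ker rho s x).
Proof.
apply: ge0_rint => //.
- exact: (ker_meas grho s (measurable_cst x) (@measurable_id _ _ _)).
- by move=> z _; apply: ker_ge0 => //; exact: ltW.
- by rewrite ker_mass// ltry.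
Qed.

Lemma ker_sqint x : sqint mu setT (ker rho s x).
Proof.
have [M M0 hM] := ker_bounded grho rhoK s.
apply: rint_sqint => //; first exact: rint_meas (ker_rint x).
by apply: bounded_mul_rint (ker_rint x); [exact: rint_meas (ker_rint x)|exists M].
Qed.

(** [dker] is a combination of derivatives of the test function [ker rho s x], so the weak identity
    puts the gradient in its place. The factor (s - 1)/s left over is at most one. *)
Lemma weak_dker x v : U x ->
  \int[mu]_z (F z * dker rho s x v z) =
  (s - 1) / s * \int[mu]_z ((\sum_i v ord0 i * Fg i z) * ker rho s x z).
Proof.
move=> Ux.
have t := ker_test grho rhoK cU KU s1 Ux.
have [_ gp] := gen_diff (ker_gen grho s x).
have [_ [K [cK KsubU K0]]] := t.
have clK : closed K by apply: compact_closed => //; exact: norm_hausdorff.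
have bd i : exists2 M, 0 <= M & forall z, `|partial i (ker rho s x) z| <= M.
  exact: support_bounded (gen_continuous (gp i)) cK (partial_support i clK K0).
have hi i : rint mu setT (fun z => F z * partial i (ker rho s x) z).
  apply: bounded_mul_rint (bd i) Fint.
  exact: continuous_measurable_rV (gen_continuous (gp i)).
have kb : exists2 M, 0 <= M & forall z, `|ker rho s x z| <= M.
  by have [M M0 hM] := ker_bounded grho rhoK s; exists M.
have mk : measurable_fun setT (ker rho s x).
  exact: (ker_meas grho s (measurable_cst x) (@measurable_id _ _ _)).
have k2 := ker_sqint x.
have hgi i : rint mu setT (fun z => Fg i z * ker rho s x z) by exact: sqintM.
transitivity ((1 - s) / s * \sum_i v ord0 i * \int[mu]_z (F z * partial i (ker rho s x) z)).
  have -> : \sum_i v ord0 i * \int[mu]_z (F z * partial i (ker rho s x) z) =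
      \sum_i \int[mu]_z (v ord0 i * (F z * partial i (ker rho s x) z)).
    by apply: eq_bigr => i _; exact: (esym (RintegralZl _ measurableT (hi i))).
  rewrite -Rint_sum//; last by move=> i; exact: rintZ.
  rewrite -RintegralZl//; last by apply: rint_sum => // i; exact: rintZ.
  apply: eq_Rintegral => z _; rewrite /dker mulrCA; congr (_ * _).
  by rewrite mulr_sumr; apply: eq_bigr => i _; rewrite mulrCA.
have -> : \sum_i v ord0 i * \int[mu]_z (F z * partial i (ker rho s x) z) =
    - \sum_i \int[mu]_z (v ord0 i * (Fg i z * ker rho s x z)).
  rewrite -sumrN; apply: eq_bigr => i _; rewrite weak// mulrN; congr (- _).
  exact: (esym (RintegralZl _ measurableT (hgi i))).
rewrite mulrN -mulNr -Rint_sum//; last by move=> i; exact: rintZ.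
congr (_ * _); first by rewrite -mulNr opprB.
by apply: eq_Rintegral => z _; rewrite mulr_suml; apply: eq_bigr => i _; rewrite mulrA.
Qed.

Lemma prod_rint (k : 'rV[R]_n * 'rV[R]_n -> R) : measurable_fun setT k ->
  (exists2 M, 0 <= M & forall p, `|k p| <= M) ->
  (mu \x mu)%E.-integrable setT (fun p => (\1_U p.1 * F p.2 * k p)%:E).
Proof.
move=> mk [M M0 hM].
have mI : measurable_fun setT (\1_U : 'rV[R]_n -> R) by exact: measurable_indic.
apply: (@prod_dominated_integrable _ _ _ _ R mu mu (fun x => M * \1_U x) (fun z => `|F z|)).
- apply: measurable_funM => //; apply: measurable_funM.
    exact: (measurableT_comp mI measurable_fst).
  exact: (measurableT_comp mF measurable_snd).
- by move=> x; rewrite mulr_ge0.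
- by [].
- by apply: rintZ => //; exact: indic_rint.
- exact: integrable_norm Fint.
- move=> x z; rewrite !normrM (@ger0_norm _ (\1_U x))// mulrC mulrA ler_wpM2r//.
  by rewrite ler_wpM2r.
Qed.

Let m := fine (mu U).

Lemma umoll_rint : rint mu setT (fun x => \1_U x * moll x).
Proof.
have [M M0 hM] := ker_bounded grho rhoK s.
have h := integrable_fubini_F (prod_rint (k := fun p => ker rho s p.1 p.2)
  (ker_meas grho s measurable_fst measurable_snd) (ex_intro2 _ _ M M0 (fun p => hM p.1 p.2))).
apply: eq_integrable h => // x _; rewrite /fubini_F /moll /=.
under eq_integral do rewrite -mulrA EFinM.
by rewrite integralZl//; [rewrite EFin_Rint//; exact: moll_rint|exact: moll_rint].
Qed.

(** [ker_line] integrated against F, followed by an exchange of the integrals in t and z.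
    Measurability in t is recorded as well, because the right side is estimated further under the
    t-integral. *)
Lemma moll_diff x y : U x -> U y ->
  measurable_fun (`[0%R, 1%R] : set (measurableTypeR R))
    (fun t => \int[mu]_z (F z * dker rho s (y + t *: (x - y)) (x - y) z)) /\
  (`|moll x - moll y|%:E <= \int[mu1]_(t in `[0%R, 1%R])
    (`|\int[mu]_z (F z * dker rho s (y + t *: (x - y)) (x - y) z)|)%:E)%E.
Proof.
move=> Ux Uy; set v := x - y.
have [M M0 hM] := dker_bounded grho rhoK v s0.
pose D := `[0%R, 1%R]%classic : set (measurableTypeR R).
have mD : measurable D by exact: measurable_itv.
have m01 : mu1 D = 1%E.
  by apply: (etrans (lebesgue_measure_itv `[0%R, 1%R])) => /=; rewrite lte_fin ltr01 sube0.
pose f (p : measurableTypeR R * 'rV[R]_n) :=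
  \1_D p.1 * F p.2 * dker rho s (y + p.1 *: v) v p.2.
have mI : measurable_fun setT (\1_D : measurableTypeR R -> R) by exact: measurable_indic.
have mline : measurable_fun setT (fun p : measurableTypeR R * 'rV[R]_n => y + p.1 *: v).
  by apply: measurable_rVD => //; apply: measurable_rVZ => //; exact: measurable_fst.
have mf : measurable_fun setT f.
  apply: measurable_funM.
    apply: measurable_funM; first exact: (measurableT_comp mI measurable_fst).
    exact: (measurableT_comp mF measurable_snd).
  exact: (dker_meas grho v s0 mline measurable_snd).
have fint : (mu1 \x mu)%E.-integrable setT (EFin \o f).
  apply: (@prod_dominated_integrable _ _ _ _ R mu1 mu (fun x => M * \1_D x) (fun z => `|F z|)) => //.
  - by move=> t; rewrite mulr_ge0.
  - apply: rintZ => //; apply: ge0_rint => //.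
    rewrite (_ : (\int[mu1]_x _)%E = 1%E) ?ltry// -m01.
    exact/esym/measure_integral_indic.
  - exact: integrable_norm Fint.
  - move=> t z; rewrite /f normrM (normrM (\1_D t)) (@ger0_norm _ (\1_D t))// mulrC mulrA.
    by rewrite ler_wpM2r// ler_wpM2r.
have hd t : rint mu setT (fun z => F z * dker rho s (y + t *: v) v z).
  apply: bounded_mul_rint Fint; last by exists M.
  exact: (dker_meas grho v s0 (measurable_cst _) (@measurable_id _ _ _)).
have E : (\int[mu1]_t \int[mu]_z (f (t, z))%:E = (moll x - moll y)%:E)%E.
  have := Fubini fint; rewrite /comp /= => ->.
  rewrite -(RintegralB measurableT (moll_rint x) (moll_rint y)).
  rewrite -EFin_Rint//; last by apply: rintB => //; exact: moll_rint.
  apply: eq_integral => z _; rewrite /f /=.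
  under eq_integral => t _ do rewrite -mulrA EFinM.
  rewrite ge0_integral_indicl//.
  under eq_integral => t _ do rewrite EFinM.
  have hdk : mu1.-integrable D (fun t => (dker rho s (y + t *: v) v z)%:E).
    apply: continuous_compact_integrable; first exact: segment_compact.
    by apply: continuous_subspaceT; exact: dker_cont.
  by rewrite integralZl// (ker_line grho x y z s0) -EFinM mulrBr.
have mi : measurable_fun setT (fun t : measurableTypeR R => (\int[mu]_z (f (t, z))%:E)%E).
  exact: measurable_fubini_F fint.
split.
  apply: (@eq_measurable_fun _ _ _ _ _ (fun t => fine (\int[mu]_z (f (t, z))%:E)%E)).
    move=> t tD; congr fine; apply: eq_integral => z _.
    by rewrite /f /= indicE tD mul1r.
  apply: measurable_funTS; apply: (measurableT_comp _ mi).
  exact: fine_measurable.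
rewrite -[leLHS]/(`|(moll x - moll y)%:E|)%E -E.
apply: (le_trans (le_abse_integral mu1 measurableT mi)).
rewrite -[leRHS](@ge0_integral_indicl _ _ R mu1 D _ mD) le_eqVlt; apply/orP; left; apply/eqP.
apply: eq_integral => t _.
have -> : (\int[mu]_z (f (t, z))%:E)%E =
    (\1_D t * \int[mu]_z (F z * dker rho s (y + t *: v) v z))%:E.
  rewrite -(RintegralZl _ measurableT (hd t)) -(EFin_Rint measurableT (rintZ measurableT _ (hd t))).
  by apply: eq_integral => z _; rewrite /f /= mulrA.
by rewrite /= normrM (@ger0_norm _ (\1_D t))// EFinM.
Qed.

Lemma sum_Cauchy_Schwarz (I : finType) (a b : I -> R) :
  (\sum_i a i * b i) ^+ 2 <= (\sum_i a i ^+ 2) * (\sum_i b i ^+ 2).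
Proof.
set A := \sum_i _ ^+ 2; set C := \sum_i b i ^+ 2; set B := \sum_i _.
have Q t : 0 <= A + t * (2 * B) + t ^+ 2 * C.
  have : 0 <= \sum_i (a i + t * b i) ^+ 2 by apply: sumr_ge0 => i _; exact: sqr_ge0.
  congr (_ <= _); rewrite !mulr_sumr -!big_split; apply: eq_bigr => i _ /=; ring.
have C0 : 0 <= C by apply: sumr_ge0 => i _; exact: sqr_ge0.
have [c1|c1] := eqVneq C 0.
  have [->|b0] := eqVneq B 0; first by rewrite expr0n c1 mulr0.
  have := Q (- (A + 1) / (2 * B)); rewrite c1 mulr0 addr0.
  have -> : A + - (A + 1) / (2 * B) * (2 * B) = -1 by field.
  by rewrite oppr_ge0 ler10.
have cp : 0 < C by rewrite lt_neqAle eq_sym c1.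
have := Q (- B / C).
have -> : A + - B / C * (2 * B) + (- B / C) ^+ 2 * C = A - B ^+ 2 / C by field.
by rewrite subr_ge0 ler_pdivrMr.
Qed.

(** Cauchy-Schwarz followed by Young's inequality with weight l. The result is linear in the squared
    gradient and in p^2, so that it can be integrated term by term; l is optimised only after all
    integrations. *)
Lemma dot_young (v : 'rV[R]_n) (w : 'I_n -> R) (p l : R) : dot v v <= delta ^+ 2 -> 0 < l ->
  `|\sum_i v ord0 i * w i| * `|p| <=
  delta / 2 * (l * \sum_i w i ^+ 2 + p ^+ 2 / l).
Proof.
move=> hv l0; set S := \sum_i _; set W := \sum_i _.
have W0 : 0 <= W by apply: sumr_ge0 => i _; exact: sqr_ge0.
have SW : S ^+ 2 <= delta ^+ 2 * W.
  by apply: (le_trans (sum_Cauchy_Schwarz _ _)); rewrite ler_wpM2r.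
have SW' : `|S| <= delta * Num.sqrt W.
  by rewrite -ler_sqr ?nnegrE ?mulr_ge0 ?sqrtr_ge0// exprMn sqr_sqrtr// real_normK// num_real.
apply: (@le_trans _ _ (delta * Num.sqrt W * `|p|)); first by rewrite ler_wpM2r.
have -> : W = Num.sqrt W ^+ 2 by rewrite sqr_sqrtr.
have -> : p ^+ 2 = `|p| ^+ 2 by rewrite real_normK// num_real.
rewrite sqrtr_sqr; set q := `|Num.sqrt W|; set k := `|p|.
have -> : (Num.sqrt W) ^+ 2 = q ^+ 2 by rewrite real_normK// num_real.
rewrite -subr_ge0.
have -> : delta / 2 * (l * q ^+ 2 + k ^+ 2 / l) - delta * q * k =
    delta / 2 * ((l * q - k) ^+ 2 / l) by field; rewrite gt_eqF.
by rewrite mulr_ge0 ?divr_ge0 ?sqr_ge0// ltW.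
Qed.

(** [dot_young] is applied under the z-integral against [ker]. Since [ker] has mass one in z, the
    term p^2/l comes out unchanged. *)
Lemma moll_diff_bound x y p l : U x -> U y -> 0 < l ->
  ((`|p| * `|moll x - moll y|)%:E <=
   (delta / 2 * l)%:E * (\int[mu1]_(t in `[0%R, 1%R])
      \int[mu]_z (energy z * ker rho s (y + t *: (x - y)) z)%:E) +
   (delta / 2 * (p ^+ 2 / l))%:E)%E.
Proof.
move=> Ux Uy l0; set v := x - y.
pose D := `[0%R, 1%R]%classic : set (measurableTypeR R).
have mD : measurable D by exact: measurable_itv.
have m01 : mu1 D = 1%E.
  by apply: (etrans (lebesgue_measure_itv `[0%R, 1%R])) => /=; rewrite lte_fin ltr01 sube0.
have mline : measurable_fun setT (fun p : measurableTypeR R * 'rV[R]_n => y + p.1 *: v).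
  by apply: measurable_rVD => //; apply: measurable_rVZ => //; exact: measurable_fst.
have e0 z : 0 <= energy z by apply: sumr_ge0 => i _; exact: sqr_ge0.
have k0 x' z : 0 <= ker rho s x' z by apply: ker_ge0 => //; exact: ltW.
pose w (t : R) := (\int[mu]_z (energy z * ker rho s (y + t *: v) z)%:E)%E.
have mw : measurable_fun setT (w : measurableTypeR R -> \bar R).
  apply: (measurable_fun_fubini_tonelli_F (m2 := mu)
    (fun p : measurableTypeR R * 'rV[R]_n => (energy p.2 * ker rho s (y + p.1 *: v) p.2)%:E)).
    apply/measurable_EFinP; apply: measurable_funM.
      exact: (measurableT_comp (rint_meas energy_rint) measurable_snd).
    exact: (ker_meas grho s mline measurable_snd).
  by move=> q; rewrite lee_fin mulr_ge0.
have kerm x' : measurable_fun setT (ker rho s x').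
  exact: (ker_meas grho s (measurable_cst x') (@measurable_id _ _ _)).
have kb x' : exists2 M, 0 <= M & forall z, `|ker rho s x' z| <= M.
  by have [M M0 hM] := ker_bounded grho rhoK s; exists M.
have kint x' : rint mu setT (ker rho s x') by exact: ker_rint.
have eint x' : rint mu setT (fun z => energy z * ker rho s x' z).
  by apply: bounded_mul_rint => //; exact: energy_rint.
have w0 t : (0 <= w t)%E by apply: integral_ge0 => z _; rewrite lee_fin mulr_ge0.
have dl0 : 0 <= delta / 2 by rewrite divr_ge0.
have step t : D t ->
  ((`|p| * `|\int[mu]_z (F z * dker rho s (y + t *: v) v z)|)%:E <=
    (delta / 2 * l)%:E * w t + (delta / 2 * (p ^+ 2 / l))%:E)%E.
  rewrite /D /= in_itv/= => /andP[t0 t1].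
  have Ut : U (y + t *: v) by exact: cU.
  rewrite weak_dker// normrM mulrCA.
  set x' := y + t *: v.
  have hw : w t = (\int[mu]_z (energy z * ker rho s x' z))%:E by rewrite /w EFin_Rint.
  rewrite hw -EFinM -EFinD lee_fin.
  have vint : rint mu setT (fun z => (\sum_i v ord0 i * Fg i z) * ker rho s x' z).
    under eq_fun do rewrite mulr_suml; apply: rint_sum => // i.
    under eq_fun do rewrite -mulrA; apply: rintZ => //.
    exact: sqintM (Fg2 i) (ker_sqint x').
  apply: (@le_trans _ _ (`|p| * `|\int[mu]_z ((\sum_i v ord0 i * Fg i z) * ker rho s x' z)|)).
    have hs : 0 <= (s - 1) / s <= 1.
      by rewrite divr_ge0 ?subr_ge0 ?(ltW s1) ?(ltW sp)//= ler_pdivrMr// mul1r gerBl.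
    by rewrite ler_piMl ?mulr_ge0// ger0_norm//; case/andP: hs.
  apply: (@le_trans _ _ (\int[mu]_z (`|p| * `|(\sum_i v ord0 i * Fg i z) * ker rho s x' z|))).
    rewrite RintegralZl//; last exact: integrable_norm.
    by rewrite ler_wpM2l//; exact: le_normr_Rintegral.
  have -> : delta / 2 * l * \int[mu]_z (energy z * ker rho s x' z) + delta / 2 * (p ^+ 2 / l) =
      \int[mu]_z (delta / 2 * l * (energy z * ker rho s x' z) + delta / 2 * (p ^+ 2 / l) * ker rho s x' z).
    rewrite (RintegralD measurableT (rintZ measurableT _ (eint x')) (rintZ measurableT _ (kint x'))).
    rewrite (RintegralZl _ measurableT (eint x')) (RintegralZl _ measurableT (kint x')).
    by congr (_ + _); rewrite /Rintegral ker_mass//= mulr1.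
  apply: le_Rintegral => //.
  - by apply: rintZ => //; exact: integrable_norm.
  - by apply: rintD => //; exact: rintZ.
  - move=> z _; rewrite normrM (ger0_norm (k0 _ _)).
    have := ler_wpM2r (k0 x' z) (@dot_young v (Fg^~ z) p l (diamU Ux Uy) l0).
    by rewrite -/(energy z); lra.
rewrite EFinM; apply: (le_trans (lee_wpmul2l _ (moll_diff Ux Uy).2)); first by rewrite lee_fin.
have mG := (moll_diff Ux Uy).1.
rewrite -ge0_integralZl//; last by apply/measurable_EFinP; exact: measurableT_comp.
apply: (@le_trans _ _ (\int[mu1]_(t in D) ((delta / 2 * l)%:E * w t + (delta / 2 * (p ^+ 2 / l))%:E))%E).
  apply: ge0_le_integral => //.
  - by apply: emeasurable_funM => //; apply/measurable_EFinP; exact: measurableT_comp.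
  - apply: measurable_funTS; apply: emeasurable_funD => //; exact: emeasurable_funM.
have pl0 : 0 <= delta / 2 * (p ^+ 2 / l) by rewrite mulr_ge0// divr_ge0 ?sqr_ge0// ltW.
have dl1 : 0 <= delta / 2 * l by rewrite mulr_ge0// ltW.
rewrite ge0_integralD//; last 2 first.
- by move=> t _; rewrite mule_ge0// lee_fin.
- by apply: measurable_funTS; exact: emeasurable_funM.
rewrite ge0_integralZl//; last exact: measurable_funTS.
apply: leeD => //; rewrite le_eqVlt; apply/orP; left; apply/eqP.
exact: etrans (integral_cst mu1 mD _) (etrans (congr1 (mule _) m01) (mule1 _)).
Qed.

Let D01 := `[0%R, 1%R]%classic : set (measurableTypeR R).
Let mD01 : measurable D01. Proof. exact: measurable_itv. Qed.
Let muU : (mu U)%E = m%:E.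
Proof. by rewrite /m fineK// ge0_fin_numE ?leb_bounded. Qed.
Let m0 : 0 <= m. Proof. by rewrite /m fine_ge0. Qed.
Let mIU : measurable_fun setT (\1_U : 'rV[R]_n -> R). Proof. exact: measurable_indic. Qed.
Let e0 z : 0 <= energy z. Proof. by apply: sumr_ge0 => i _; exact: sqr_ge0. Qed.
Let k0 x z : 0 <= ker rho s x z. Proof. by apply: ker_ge0 => //; exact: ltW. Qed.

(** Integrand in x, y, the parameter t of the segment from y to x, and z. All domains of integration
    are encoded by indicators, so that Tonelli's theorem is used on full spaces only. *)
Definition quad (p : (('rV[R]_n * 'rV[R]_n) * measurableTypeR R) * 'rV[R]_n) : R :=
  \1_U p.1.1.1 * \1_U p.1.1.2 * \1_D01 p.1.2 * energy p.2 *
  ker rho s (p.1.1.2 + p.1.2 *: (p.1.1.1 - p.1.1.2)) p.2.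

Lemma quad_ge0 p : 0 <= quad p.
Proof. by do 4 (apply: mulr_ge0 => //). Qed.

Lemma measurable_quad : measurable_fun setT quad.
Proof.
have mx : measurable_fun setT (fun p : (('rV[R]_n * 'rV[R]_n) * measurableTypeR R) * 'rV[R]_n => p.1.1.1).
  exact: (measurableT_comp measurable_fst (measurableT_comp measurable_fst measurable_fst)).
have my : measurable_fun setT (fun p : (('rV[R]_n * 'rV[R]_n) * measurableTypeR R) * 'rV[R]_n => p.1.1.2).
  exact: (measurableT_comp measurable_snd (measurableT_comp measurable_fst measurable_fst)).
have mt : measurable_fun setT (fun p : (('rV[R]_n * 'rV[R]_n) * measurableTypeR R) * 'rV[R]_n => p.1.2).
  exact: (measurableT_comp measurable_snd measurable_fst).
have mz : measurable_fun setT (fun p : (('rV[R]_n * 'rV[R]_n) * measurableTypeR R) * 'rV[R]_n => p.2).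
  exact: measurable_snd.
have mI : measurable_fun setT (\1_D01 : measurableTypeR R -> R) by exact: measurable_indic.
apply: measurable_funM; last first.
  apply: (ker_meas grho s _ mz); apply: measurable_rVD => //; apply: measurable_rVZ => //.
  apply: measurable_rVD => //; under eq_fun do rewrite -scaleN1r; exact: measurable_rVZ.
apply: measurable_funM; last exact: (measurableT_comp (rint_meas energy_rint) mz).
apply: measurable_funM; last exact: (measurableT_comp mI mt).
by apply: measurable_funM; [exact: (measurableT_comp mIU mx)|exact: (measurableT_comp mIU my)].
Qed.

Let mquad : measurable_fun setT (EFin \o quad).
Proof. by apply/measurable_EFinP; exact: measurable_quad. Qed.
Let quad0 p : (0 <= (EFin \o quad) p)%E. Proof. by rewrite lee_fin quad_ge0. Qed.

Lemma indic_mass (a : R) (v z : 'rV[R]_n) : 2^-1 <= a ->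
  (\int[mu]_x (\1_U x * ker rho s (a *: x + v) z)%:E <= (4 ^+ n)%:E)%E.
Proof.
move=> a2; apply: le_trans (ker_massl_le grho rho0 rho1 v z s2 a2).
have mk : measurable_fun setT (fun x : 'rV[R]_n => ker rho s (a *: x + v) z).
  by apply: (ker_meas grho s) => //; apply: measurable_rVD => //; exact: measurable_rVZ.
apply: ge0_le_integral => //.
- by move=> x _; rewrite lee_fin mulr_ge0.
- by apply/measurable_EFinP; exact: measurable_funM.
- exact/measurable_EFinP.
- by move=> x _; rewrite lee_fin ler_piMl// indicE; case: (_ \in _).
Qed.

(** The point y + t (x - y) depends on x with slope t and on y with slope 1 - t, and one of the two
    is at least 1/2. Integrating first in that variable costs at most 4^n by [indic_mass]; the other
    variable contributes the measure m of U. *)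
Lemma indic_mass2 t z : D01 t ->
  (\int[mu]_x \int[mu]_y (\1_U x * \1_U y * ker rho s (y + t *: (x - y)) z)%:E <=
   (4 ^+ n * m)%:E)%E.
Proof.
rewrite /D01 /= in_itv/= => /andP[t0 t1].
have mk d (T : measurableType d) (X Y : T -> 'rV[R]_n) : measurable_fun setT X ->
    measurable_fun setT Y -> measurable_fun setT (fun a => ker rho s (Y a + t *: (X a - Y a)) z).
  move=> mX mY; apply: (ker_meas grho s) => //; apply: measurable_rVD => //; apply: measurable_rVZ => //.
  apply: measurable_rVD => //; under eq_fun do rewrite -scaleN1r; exact: measurable_rVZ.
have mI2 : measurable_fun setT (fun p : 'rV[R]_n * 'rV[R]_n =>
    (\1_U p.1 * \1_U p.2 * ker rho s (p.2 + t *: (p.1 - p.2)) z)%:E).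
  apply/measurable_EFinP; apply: measurable_funM; last exact: mk measurable_fst measurable_snd.
  by apply: measurable_funM; [exact: (measurableT_comp mIU measurable_fst)|exact: (measurableT_comp mIU measurable_snd)].
have I0 p : (0 <= (\1_U p.1 * \1_U p.2 * ker rho s (p.2 + t *: (p.1 - p.2)) z)%:E)%E.
  by rewrite lee_fin; do 2 (apply: mulr_ge0 => //).
have fin (J : 'rV[R]_n -> \bar R) : (forall x, J x <= (4 ^+ n)%:E)%E -> (forall x, 0 <= J x)%E ->
    measurable_fun setT J -> (\int[mu]_x ((\1_U x)%:E * J x) <= (4 ^+ n * m)%:E)%E.
  move=> hJ J0 mJ.
  have mE : measurable_fun setT (fun x : 'rV[R]_n => (\1_U x)%:E : \bar R) by exact/measurable_EFinP.
  apply: (@le_trans _ _ (\int[mu]_x ((4 ^+ n)%:E * (\1_U x)%:E))%E).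
    apply: ge0_le_integral => //.
    - by move=> x _; rewrite mule_ge0// lee_fin.
    - exact: emeasurable_funM.
    - exact: emeasurable_funM.
    - by move=> x _; rewrite muleC lee_wpmul2r// lee_fin.
  by rewrite (integral_cst_indic mU _ muU)// exprn_ge0.
have [th|th] := leP 2^-1 t; last first.
  under eq_integral => x _.
    under eq_integral do rewrite -mulrA.
    rewrite ge0_integralMl//; last 2 first.
    - by move=> y; rewrite mulr_ge0.
    - by apply: measurable_funM => //; exact: mk.
    over.
  apply: fin => [x|x|].
  - have E (y : 'rV[R]_n) : (1 - t) *: y + t *: x = y + t *: (x - y).
      by apply/rowP => i; rewrite !mxE; ring.
    apply: le_trans (@indic_mass (1 - t) (t *: x) z _); last lra.
    by rewrite le_eqVlt; apply/orP; left; apply/eqP; apply: eq_integral => y _; rewrite E.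
  - by apply: integral_ge0 => y _; rewrite lee_fin mulr_ge0.
  - apply: (measurable_fun_fubini_tonelli_F (m2 := mu)
      (fun p : 'rV[R]_n * 'rV[R]_n => (\1_U p.2 * ker rho s (p.2 + t *: (p.1 - p.2)) z)%:E)).
      apply/measurable_EFinP; apply: measurable_funM; last exact: mk measurable_fst measurable_snd.
      exact: (measurableT_comp mIU measurable_snd).
    by move=> p; rewrite lee_fin mulr_ge0.
rewrite (sfinite_Fubini mu mu _ I0 mI2) /=.
under eq_integral => y _.
  under eq_integral do rewrite mulrAC mulrC.
  rewrite ge0_integralMl//; last 2 first.
  - by move=> x; rewrite mulr_ge0.
  - by apply: measurable_funM => //; exact: mk.
  over.
apply: fin => [y|y|].
- have E (x : 'rV[R]_n) : t *: x + (1 - t) *: y = y + t *: (x - y).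
    by apply/rowP => i; rewrite !mxE; ring.
  apply: le_trans (@indic_mass t ((1 - t) *: y) z th).
  by rewrite le_eqVlt; apply/orP; left; apply/eqP; apply: eq_integral => x _; rewrite E.
- by apply: integral_ge0 => x _; rewrite lee_fin mulr_ge0.
- apply: (measurable_fun_fubini_tonelli_F (m2 := mu)
    (fun p : 'rV[R]_n * 'rV[R]_n => (\1_U p.2 * ker rho s (p.1 + t *: (p.2 - p.1)) z)%:E)).
    apply/measurable_EFinP; apply: measurable_funM; last exact: mk measurable_snd measurable_fst.
    exact: (measurableT_comp mIU measurable_snd).
  by move=> p; rewrite lee_fin mulr_ge0.
Qed.

Lemma quad_section_measurable t z : measurable_fun setT
  (fun p : 'rV[R]_n * 'rV[R]_n => \1_U p.1 * \1_U p.2 * ker rho s (p.2 + t *: (p.1 - p.2)) z).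
Proof.
apply: measurable_funM; last first.
  apply: (ker_meas grho s) => //; apply: measurable_rVD; first exact: measurable_snd.
  apply: measurable_rVZ => //; apply: measurable_rVD; first exact: measurable_fst.
  by under eq_fun do rewrite -scaleN1r; apply: measurable_rVZ => //; exact: measurable_snd.
by apply: measurable_funM; [exact: (measurableT_comp mIU measurable_fst)|exact: (measurableT_comp mIU measurable_snd)].
Qed.

(** The z-integral is moved outermost, where [energy z] factors out and [indic_mass2] bounds what
    remains, uniformly in t and z. *)
Lemma quad_bound :
  (\int[mu]_x \int[mu]_y \int[mu1]_t \int[mu]_z (quad (((x, y), t), z))%:E <=
   (4 ^+ n * m * \int[mu]_z energy z)%:E)%E.
Proof.
have mq2 := measurable_fun_fubini_tonelli_F (m2 := mu) (EFin \o quad) mquad quad0.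
have q2 p : (0 <= fubini_F mu (EFin \o quad) p)%E by apply: integral_ge0 => z _; exact: quad0.
have := @tonelli_swap3 _ _ _ _ _ _ R mu mu mu1 _ mq2 q2.
rewrite /fubini_F /= => ->.
have m01 : mu1 D01 = 1%E.
  by apply: (etrans (lebesgue_measure_itv `[0%R, 1%R])) => /=; rewrite lte_fin ltr01 sube0.
set C := (4 ^+ n * m * \int[mu]_z energy z).
have C0 : 0 <= C by rewrite !mulr_ge0 ?exprn_ge0//; apply: Rintegral_ge0.
apply: (@le_trans _ _ (\int[mu1]_t (C%:E * (\1_D01 t)%:E))%E); last first.
  have mE : measurable_fun setT (fun t : measurableTypeR R => (\1_D01 t)%:E : \bar R).
    by apply/measurable_EFinP; exact: measurable_indic.
  by rewrite (integral_cst_indic mD01 _ m01)// mulr1.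
have step t : (\int[mu]_x \int[mu]_y \int[mu]_z (quad (((x, y), t), z))%:E <= C%:E * (\1_D01 t)%:E)%E.
  have mqt : measurable_fun setT (fun p : ('rV[R]_n * 'rV[R]_n) * 'rV[R]_n => (quad ((p.1, t), p.2))%:E).
    apply: (measurableT_comp mquad); apply: measurable_fun_pair; last exact: measurable_snd.
    by apply: measurable_fun_pair => //; exact: measurable_fst.
  have := @tonelli_swap3 _ _ _ _ _ _ R mu mu mu _ mqt (fun=> quad0 _).
  rewrite /= => ->.
  case: (boolP (t \in D01)) => [tD|tD]; last first.
    have D0 : \1_D01 t = 0 :> R by rewrite indicE (negbTE tD).
    rewrite D0 mule0 le_eqVlt; apply/orP; left; apply/eqP.
    rewrite -[RHS](integral0 mu setT); apply: eq_integral => z _.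
    rewrite -[RHS](integral0 mu setT); apply: eq_integral => x _.
    rewrite -[RHS](integral0 mu setT); apply: eq_integral => y _.
    by rewrite /quad /= D0 mulr0 !mul0r.
  have D1 : \1_D01 t = 1 :> R by rewrite indicE tD.
  rewrite D1 mule1 /C EFinM -EFin_Rint//; last exact: energy_rint.
  rewrite -ge0_integralZl//; last 3 first.
  - by apply/measurable_EFinP; exact: rint_meas energy_rint.
  - by move=> z _; rewrite lee_fin.
  - by rewrite lee_fin mulr_ge0 ?exprn_ge0.
  have mperm : measurable_fun setT (fun p : ('rV[R]_n * 'rV[R]_n) * 'rV[R]_n =>
      (quad (((p.1.2, p.2), t), p.1.1))%:E).
    apply: (measurableT_comp mquad); apply: measurable_fun_pair => /=; last first.
      exact: (measurableT_comp measurable_fst measurable_fst).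
    apply: measurable_fun_pair => //; apply: measurable_fun_pair; last exact: measurable_snd.
    exact: (measurableT_comp measurable_snd measurable_fst).
  have m1 := measurable_fun_fubini_tonelli_F (m2 := mu) _ mperm (fun=> quad0 _).
  have p1 p : (0 <= fubini_F mu (fun p : ('rV[R]_n * 'rV[R]_n) * 'rV[R]_n =>
      (quad (((p.1.2, p.2), t), p.1.1))%:E) p)%E by apply: integral_ge0 => ? _; exact: quad0.
  have m2 := measurable_fun_fubini_tonelli_F (m2 := mu) _ m1 p1.
  apply: ge0_le_integral => //.
  - by move=> z _; apply: integral_ge0 => x _; apply: integral_ge0 => y _; exact: quad0.
  - by apply: emeasurable_funM => //; apply/measurable_EFinP; exact: rint_meas energy_rint.
  move=> z _.
  have pull2 : (\int[mu]_x \int[mu]_y (quad (((x, y), t), z))%:E =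
     (energy z)%:E * \int[mu]_x \int[mu]_y (\1_U x * \1_U y * ker rho s (y + t *: (x - y)) z)%:E)%E.
    rewrite -(ge0_integralMl2 mu mu (e0 z) _ (quad_section_measurable t z)); last first.
      by move=> p; do 2 (apply: mulr_ge0 => //).
    apply: eq_integral => x _; apply: eq_integral => y _.
    by rewrite /quad /= D1 mulr1; congr EFin; ring.
  rewrite pull2 muleC lee_wpmul2r ?lee_fin//; exact/indic_mass2/set_mem.
apply: ge0_le_integral => //.
- move=> t _; apply: integral_ge0 => x _; apply: integral_ge0 => y _; apply: integral_ge0 => z _; exact: quad0.
- have mp : measurable_fun setT (fun p : ((measurableTypeR R * 'rV[R]_n) * 'rV[R]_n) * 'rV[R]_n =>
      (quad (((p.1.1.2, p.1.2), p.1.1.1), p.2))%:E).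
    apply: (measurableT_comp mquad); apply: measurable_fun_pair => /=; last exact: measurable_snd.
    apply: measurable_fun_pair; last first.
      exact: (measurableT_comp measurable_fst (measurableT_comp measurable_fst measurable_fst)).
    apply: measurable_fun_pair; last exact: (measurableT_comp measurable_snd measurable_fst).
    exact: (measurableT_comp measurable_snd (measurableT_comp measurable_fst measurable_fst)).
  have p1 := measurable_fun_fubini_tonelli_F (m2 := mu) _ mp (fun=> quad0 _).
  have p2 := measurable_fun_fubini_tonelli_F (m2 := mu) _ p1 _.
  apply: (measurable_fun_fubini_tonelli_F (m2 := mu) _ (p2 _)) => p.
  + by apply: integral_ge0 => ? _; exact: quad0.
  + by apply: integral_ge0 => ? _; apply: integral_ge0 => ? _; exact: quad0.
- by apply: emeasurable_funM => //; apply/measurable_EFinP; exact: measurable_indic.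
Qed.

Lemma phi_bounded : exists2 M, 0 <= M & forall x, U x -> `|phi x| <= M.
Proof.
have [e e0' Ue] := bounded_sub_ball bU.
have [M M0 hM] := compact_continuous_bounded cphi (@cball_compact R n 0 e).
by exists M => // x /Ue; rewrite -ball_normE => h; apply: hM; exact: ltW.
Qed.

Let mphi : measurable_fun setT phi. Proof. exact: continuous_measurable_rV. Qed.

Lemma uphi_sqint : sqint mu setT (fun x => \1_U x * phi x).
Proof.
have [M M0 hM] := phi_bounded.
apply: (@sqint_le _ _ _ _ _ _ _ (fun z => M * \1_U z)) => //.
- exact: measurable_funM.
- exact/sqintZ/indic_sqint.
- apply: aeW => z _; rewrite indicE; case: (boolP (z \in U)) => [/set_mem hz|hz].
    by rewrite mul1r mulr1 (le_trans (hM z hz))// ler_norm.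
  by rewrite mul0r normr0.
Qed.

Lemma sqint_indic_rint (f : 'rV[R]_n -> R) : sqint mu setT (fun x => \1_U x * f x) ->
  rint mu setT (fun x => \1_U x * f x).
Proof.
move=> h; have := sqintM measurableT h indic_sqint; congr (rint _ _); apply/funext => x.
by rewrite mulrAC -expr2 indicE; case: (_ \in _); rewrite ?expr1n ?expr0n ?mul1r ?mul0r.
Qed.

Lemma uphi_rint : rint mu setT (fun x => \1_U x * phi x).
Proof. exact: sqint_indic_rint uphi_sqint. Qed.

Lemma umoll_phi_rint : rint mu setT (fun x => \1_U x * moll x * phi x).
Proof.
have [M M0 hM] := phi_bounded.
apply: (@rint_le _ _ _ _ _ _ _ (fun x => M * `|\1_U x * moll x|)) => //.
- by apply: measurable_funM => //; exact: rint_meas umoll_rint.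
- move=> x _; rewrite normrM mulrC indicE; case: (boolP (x \in U)) => [/set_mem hz|hz].
    by rewrite ler_wpM2r// hM.
  by rewrite mul0r normr0 !mulr0.
- by apply: rintZ => //; exact: integrable_norm umoll_rint.
Qed.

(** The left side is the modulus of the double integral over U x U of phi(x) (moll x - moll y).
    After [moll_diff_bound] with p = phi(x), the gradient term is controlled by [quad_bound], and
    integrating the term phi(x)^2/l over y in U produces the second factor m. *)
Lemma moll_pairing_bound l : 0 < l ->
  `|m * \int[mu]_x (\1_U x * moll x * phi x) -
     (\int[mu]_x (\1_U x * moll x)) * (\int[mu]_x (\1_U x * phi x))| <=
  delta / 2 * m * (l * 4 ^+ n * \int[mu]_z energy z + (\int[mu]_x (\1_U x * phi x ^+ 2)) / l).
Proof.
move=> l0; set G := Rintegral _ _ (fun x => \1_U x * moll x).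
set E := Rintegral _ _ energy; set P2 := Rintegral _ _ (fun x => \1_U x * phi x ^+ 2).
have mum := rint_meas umoll_rint.
have hd x : rint mu setT (fun y => \1_U x * \1_U y * (moll x - moll y)).
  rewrite (_ : (fun y => _) = (fun y => (\1_U x * moll x) * \1_U y - \1_U x * (\1_U y * moll y))).
    by apply: rintB => //; apply: rintZ => //; [exact: indic_rint|exact: umoll_rint].
  by apply/funext => y; ring.
have Hd x : \int[mu]_y (\1_U x * \1_U y * (moll x - moll y)) = \1_U x * (m * moll x - G).
  under eq_Rintegral => y _.
    rewrite (_ : _ * _ = (\1_U x * moll x) * \1_U y - \1_U x * (\1_U y * moll y)); last by ring.
    over.
  rewrite (RintegralB measurableT (rintZ measurableT _ indic_rint) (rintZ measurableT _ umoll_rint)).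
  rewrite (RintegralZl _ measurableT indic_rint) (RintegralZl _ measurableT umoll_rint) -/G.
  have -> : \int[mu]_y \1_U y = m by rewrite /Rintegral -measure_integral_indic.
  by ring.
have HD : rint mu setT (fun x => phi x * (\1_U x * (m * moll x - G))).
  rewrite (_ : (fun x => _) = (fun x => m * (\1_U x * moll x * phi x) - G * (\1_U x * phi x))).
    by apply: rintB => //; apply: rintZ => //; [exact: umoll_phi_rint|exact: uphi_rint].
  by apply/funext => x; ring.
have -> : m * \int[mu]_x (\1_U x * moll x * phi x) - G * \int[mu]_x (\1_U x * phi x) =
    \int[mu]_x (phi x * (\1_U x * (m * moll x - G))).
  under [RHS]eq_Rintegral => x _.
    rewrite (_ : _ * _ = m * (\1_U x * moll x * phi x) - G * (\1_U x * phi x)); last by ring.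
    over.
  rewrite (RintegralB measurableT (rintZ measurableT _ umoll_phi_rint) (rintZ measurableT _ uphi_rint)).
  by rewrite (RintegralZl _ measurableT umoll_phi_rint) (RintegralZl _ measurableT uphi_rint).
rewrite -lee_fin; apply: (le_trans (y := (\int[mu]_x (`|phi x * (\1_U x * (m * moll x - G))|)%:E)%E)).
  rewrite (EFin_Rint measurableT (integrable_norm HD)) lee_fin.
  exact: (le_normr_Rintegral measurableT HD).
pose Q (p : 'rV[R]_n * 'rV[R]_n) : \bar R := (\int[mu1]_t \int[mu]_z (quad ((p, t), z))%:E)%E.
pose K (p : 'rV[R]_n * 'rV[R]_n) : R := \1_U p.2 * (\1_U p.1 * phi p.1 ^+ 2).
pose B (p : 'rV[R]_n * 'rV[R]_n) : \bar R := ((delta / 2 * l)%:E * Q p + (delta / 2 / l * K p)%:E)%E.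
have dl0 : 0 <= delta / 2 * l by rewrite mulr_ge0 ?divr_ge0// ltW.
have dl1 : 0 <= delta / 2 / l by rewrite !divr_ge0// ltW.
have mq1 := measurable_fun_fubini_tonelli_F (m2 := mu) (EFin \o quad) mquad quad0.
have q1 p : (0 <= fubini_F mu (EFin \o quad) p)%E by apply: integral_ge0 => z _; exact: quad0.
have mQ : measurable_fun setT Q := measurable_fun_fubini_tonelli_F (m2 := mu1) _ mq1 q1.
have Q0 p : (0 <= Q p)%E by apply: integral_ge0 => t _; exact: q1.
have mK : measurable_fun setT K.
  apply: measurable_funM; first exact: (measurableT_comp mIU measurable_snd).
  apply: measurable_funM; first exact: (measurableT_comp mIU measurable_fst).
  by apply: measurable_funX; exact: (measurableT_comp mphi measurable_fst).
have K0 p : 0 <= K p.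
  by apply: mulr_ge0 => //; apply: mulr_ge0 => //; exact: sqr_ge0.
have mB : measurable_fun setT B.
  apply: emeasurable_funD; first exact: emeasurable_funM.
  by apply/measurable_EFinP; exact: measurable_funM.
have B0 p : (0 <= B p)%E.
  by apply: adde_ge0; [exact: mule_ge0|rewrite lee_fin; exact: mulr_ge0].
have key x y : ((`|phi x| * `|\1_U x * \1_U y * (moll x - moll y)|)%:E <= B (x, y))%E.
  have [xU|xU] := boolP (x \in U); last first.
    have I0 : \1_U x = 0 :> R by rewrite indicE (negbTE xU).
    by rewrite I0 !mul0r normr0 mulr0; exact: B0.
  have [yU|yU] := boolP (y \in U); last first.
    have I0 : \1_U y = 0 :> R by rewrite indicE (negbTE yU).
    by rewrite I0 mulr0 !mul0r normr0 mulr0; exact: B0.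
  have I1 : \1_U x = 1 :> R by rewrite indicE xU.
  have I2 : \1_U y = 1 :> R by rewrite indicE yU.
  rewrite I1 I2 !mul1r; apply: (le_trans (moll_diff_bound (phi x) (set_mem xU) (set_mem yU) l0)).
  rewrite /B /K /Q /= I1 I2 !mul1r; apply: leeD; last by rewrite [_ / l * _]mulrAC mulrA.
  apply: lee_wpmul2l; first by rewrite lee_fin.
  rewrite -(@ge0_integral_indicl _ _ R mu1 _ _ mD01) le_eqVlt; apply/orP; left; apply/eqP.
  apply: eq_integral => t _; rewrite -(@ge0_integralMl _ _ R mu)//.
  - by apply: eq_integral => z _; rewrite /quad /= I1 I2 !mul1r mulrA.
  - by move=> z; exact: mulr_ge0.
  - by apply: measurable_funM; [exact: rint_meas energy_rint|exact: rint_meas (ker_rint _)].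
apply: (@le_trans _ _ (\int[mu]_x \int[mu]_y B (x, y))%E).
  apply: ge0_le_integral => //.
  - by apply/measurable_EFinP; apply: measurableT_comp => //; exact: rint_meas HD.
  - exact: (measurable_fun_fubini_tonelli_F (m2 := mu) B mB B0).
  move=> x _; rewrite -Hd.
  apply: (@le_trans _ _ (\int[mu]_y (`|phi x| * `|\1_U x * \1_U y * (moll x - moll y)|)%:E)%E).
    have hn := integrable_norm (hd x).
    rewrite (EFin_Rint measurableT (rintZ measurableT `|phi x| hn)) lee_fin.
    rewrite (RintegralZl _ measurableT hn) normrM ler_wpM2l//.
    exact: (le_normr_Rintegral measurableT (hd x)).
  apply: ge0_le_integral => //.
  - apply/measurable_EFinP; apply: measurable_funM => //; apply: measurableT_comp => //.
    exact: rint_meas (hd x).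
  - exact: (measurableT_comp mB (measurable_pair1 x)).
have sp2 : rint mu setT (fun x => \1_U x * phi x ^+ 2).
  have := sqint_sq uphi_sqint; congr (rint _ _); apply/funext => x.
  by rewrite exprMn indicE; case: (_ \in _); rewrite ?expr1n ?expr0n.
rewrite (ge0_integral2_comb mu mu dl0 dl1 mQ Q0 mK K0).
have -> : delta / 2 * m * (l * 4 ^+ n * E + P2 / l) =
   (delta / 2 * l) * (4 ^+ n * m * E) + (delta / 2 / l) * (m * P2) by field; rewrite gt_eqF.
rewrite EFinD; apply: leeD.
  by rewrite [leRHS]EFinM; apply: lee_wpmul2l; [rewrite lee_fin|exact: quad_bound].
rewrite [leRHS]EFinM; apply: lee_wpmul2l; first by rewrite lee_fin.
rewrite -/P2 (_ : (m * P2)%:E = (\int[mu]_x (m * (\1_U x * phi x ^+ 2))%:E)%E); last first.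
  by rewrite (EFin_Rint measurableT (rintZ measurableT m sp2)) (RintegralZl _ measurableT sp2).
rewrite le_eqVlt; apply/orP; left; apply/eqP; apply: eq_integral => x _ /=.
rewrite /K /=; under eq_integral => y _ do rewrite mulrC EFinM.
rewrite [in RHS]mulrC; apply: (integral_cst_indic mU _ muU).
by apply: mulr_ge0 => //; exact: sqr_ge0.
Qed.

End mollified_poincare.

Lemma Fubini_Rint d1 d2 (T1 : measurableType d1) (T2 : measurableType d2) (R : realType)
    (m1 : {sigma_finite_measure set T1 -> \bar R}) (m2 : {sigma_finite_measure set T2 -> \bar R})
    (f : T1 * T2 -> R) :
  (m1 \x m2)%E.-integrable setT (EFin \o f) ->
  (forall x, rint m2 setT (fun y => f (x, y))) -> (forall y, rint m1 setT (fun x => f (x, y))) ->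
  \int[m1]_x \int[m2]_y f (x, y) = \int[m2]_y \int[m1]_x f (x, y).
Proof.
move=> hf h1 h2; rewrite /Rintegral; congr fine.
under eq_integral => x _ do rewrite -[fine _]/(Rintegral _ _ _) -(EFin_Rint measurableT (h1 x)).
under [RHS]eq_integral => x _ do rewrite -[fine _]/(Rintegral _ _ _) -(EFin_Rint measurableT (h2 x)).
exact: Fubini hf.
Qed.

(** * Removing the average *)

Section mollified_limit.
Context (R : realType) (n : nat) (rho : 'rV[R]_n -> R) (c : 'rV[R]_n) (r : R).
Hypothesis r0 : 0 < r.
Hypothesis grho : gen rho.
Hypothesis rho0 : forall x, 0 <= rho x.
Hypothesis rhoK : forall x, ~ cball c r x -> rho x = 0.
Hypothesis rho1 : (\int[leb R n]_x (rho x)%:E = 1)%E.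
Variable U : set 'rV[R]_n.
Hypothesis oU : open U.
Hypothesis bU : bounded_set U.
Variable F : 'rV[R]_n -> R.
Hypothesis F2 : sqint (leb R n) setT F.
Hypothesis FU : forall x, ~ U x -> F x = 0.
Variable phi : 'rV[R]_n -> R.
Hypothesis cphi : continuous phi.

Local Notation mu := (leb R n).
Let mU : measurable U. Proof. exact: open_measurable_rV. Qed.

(** The adjoint of [moll], applied to phi on U. As phi is continuous, this converges pointwise on U
    and boundedly, whereas F is only square integrable. *)
Definition dual_moll (s : R) (z : 'rV[R]_n) : R := \int[mu]_x (\1_U x * phi x * ker rho s x z).

Let sz (k : nat) : R := k.+2%:R.

Lemma ker_massr s z : 1 < s -> (\int[mu]_x (ker rho s x z)%:E = ((s / (s - 1)) ^+ n)%:E)%E.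
Proof.
move=> s1; have := ker_massl grho rho0 rho1 0 z s1 (oner_neq0 R); rewrite normr1 mulr1 => <-.
by apply: eq_integral => x _; rewrite scale1r addr0.
Qed.

Lemma ker_rintl s z : 1 < s -> rint mu setT (fun x => ker rho s x z).
Proof.
move=> s1; apply: ge0_rint => //.
- exact: (ker_meas grho s (@measurable_id _ _ _) (measurable_cst z)).
- by move=> x _; apply: ker_ge0 => //; lra.
- by rewrite ker_massr// ltry.
Qed.

Lemma ker_massR s z : 1 < s -> \int[mu]_x ker rho s x z = (s / (s - 1)) ^+ n.
Proof. by move=> s1; rewrite /Rintegral ker_massr. Qed.

Lemma uphi_measurable : measurable_fun setT (fun x => \1_U x * phi x).
Proof. by apply: measurable_funM; [exact: measurable_indic|exact: continuous_measurable_rV]. Qed.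

Lemma uphi_bounded : exists2 M, 0 <= M & forall x, `|\1_U x * phi x| <= M.
Proof.
have [M M0 hM] := phi_bounded bU cphi; exists M => // x.
rewrite indicE; case: (boolP (x \in U)) => [/set_mem hx|hx]; first by rewrite mul1r hM.
by rewrite mul0r normr0.
Qed.

Lemma dual_rint s z : 1 < s -> rint mu setT (fun x => \1_U x * phi x * ker rho s x z).
Proof.
move=> s1; have := bounded_mul_rint uphi_measurable uphi_bounded (ker_rintl z s1).
by congr (rint _ _); apply/funext => x; rewrite mulrC.
Qed.

Lemma dual_moll_le : exists2 M, 0 <= M & forall s z, 2 <= s -> `|dual_moll s z| <= M.
Proof.
have [M M0 hM] := uphi_bounded; exists (M * 2 ^+ n); first by rewrite mulr_ge0 ?exprn_ge0.
move=> s z s2; have s1 : 1 < s by lra.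
apply: (@le_trans _ _ (\int[mu]_x (M * ker rho s x z))).
  apply: (le_trans (le_normr_Rintegral measurableT (dual_rint z s1))).
  apply: le_Rintegral => //.
  - exact: integrable_norm (dual_rint z s1).
  - exact: rintZ (ker_rintl z s1).
  - move=> x _; rewrite normrM; have k0 : 0 <= ker rho s x z by apply: ker_ge0 => //; lra.
    by rewrite (ger0_norm k0); apply: ler_wpM2r.
rewrite (RintegralZl _ measurableT (ker_rintl z s1)) ker_massR// ler_wpM2l//.
apply: lerXn2r; rewrite ?nnegrE//; first by rewrite divr_ge0//; lra.
by rewrite ler_pdivrMr; lra.
Qed.

(** As a function of x the kernel concentrates at z, and its mass (s/(s - 1))^n, which for s = k + 2
    equals (1 + 1/(k+1))^n, tends to one. *)
Lemma dual_moll_cvg z : U z -> dual_moll (sz k) z @[k --> \oo] --> phi z.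
Proof.
move=> Uz; pose ms k := (1 + harmonic k) ^+ n : R.
have szE k : sz k = k%:R + 2 by rewrite /sz -natr1 -natr1; ring.
have kp (k : nat) : 0 <= k%:R :> R by [].
have sz1 k : 1 < sz k by rewrite szE; have := kp k; lra.
have msE k : \int[mu]_x ker rho (sz k) x z = ms k.
  rewrite ker_massR// /ms; congr (_ ^+ _); rewrite /harmonic szE /=.
  rewrite (_ : (k.+1%:R : R) = k%:R + 1) ?natr1//; have := kp k => hk; field.
  by apply/negP => /eqP; lra.
have hms : ms k @[k --> \oo] --> (1 : R).
  have -> : (1 : R) = (1 + 0) ^+ n by rewrite addr0 expr1n.
  have hk : (1 + harmonic k) @[k --> \oo] --> (1 + 0 : R) by apply: cvgD; [exact: cvg_cst|exact: cvg_harmonic].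
  exact: cvg_trans (cvg_app _ hk) (@exprn_continuous R n _).
have h1 : phi z * ms k @[k --> \oo] --> phi z.
  by rewrite -[X in _ --> X]mulr1; apply: cvgM; [exact: cvg_cst|exact: hms].
suff h2 : (dual_moll (sz k) z - phi z * ms k) @[k --> \oo] --> (0 : R).
  have E : (fun k => dual_moll (sz k) z) = (fun k => (dual_moll (sz k) z - phi z * ms k) + phi z * ms k).
    by apply/funext => k; rewrite subrK.
  by rewrite E -[X in _ --> X]add0r; exact: cvgD h2 h1.
apply/cvgrPdist_le => e e0.
(* The mass of the kernel in x is at most 2^n. *)
pose e' := e / 2 ^+ n; have e'0 : 0 < e' by rewrite divr_gt0 ?exprn_gt0.
have [eta eta0 heta] : exists2 eta, 0 < eta & ball z eta `<=` [set x | U x /\ `|phi z - phi x| <= e'].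
  have : nbhs z [set x | U x /\ `|phi z - phi x| <= e'].
    apply: filterI; first exact: open_nbhs_nbhs.
    by have /cvgrPdist_le := @cphi z; apply.
  by case/nbhs_ballP => eta /= eta0 h; exists eta.
near=> k; rewrite sub0r normrN -msE.
have kr := ker_rintl z (sz1 k).
rewrite -(RintegralZl _ measurableT kr) -(RintegralB measurableT (dual_rint z (sz1 k)) (rintZ measurableT _ kr)).
have hr := rintB measurableT (dual_rint z (sz1 k)) (rintZ measurableT (phi z) kr).
apply: (@le_trans _ _ (\int[mu]_x (e' * ker rho (sz k) x z))); last first.
  rewrite (RintegralZl _ measurableT kr) msE /e' mulrAC ler_pdivrMr ?exprn_gt0//.
  rewrite ler_pM2l// lerXn2r ?nnegrE//; first by rewrite addr_ge0// invr_ge0.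
  by rewrite (_ : 2 = 1 + 1 :> R)// lerD2l /harmonic invf_le1 ?ltr0n// ler1n.
apply: (le_trans (le_normr_Rintegral measurableT hr)).
apply: le_Rintegral => //; [exact: integrable_norm hr|exact: rintZ|] => x _.
have k0 : 0 <= ker rho (sz k) x z by apply: ker_ge0 => //; have := sz1 k; lra.
rewrite -mulrBl normrM (ger0_norm k0).
have [->|kne] := eqVneq (ker rho (sz k) x z) 0; first by rewrite !mulr0.
apply: ler_wpM2r => //.
(* On the support of the kernel w = s z + (1 - s) x is within r of c, while (s - 1) (x - z) = z - w.
   Hence |x - z| <= (r + |c - z|)/(s - 1), which is small for large k. *)
have hx : ball z eta x.
  have := ker_support rhoK (sz1 k) kne; rewrite /cball /= => h.
  have h' : `|(sz k - 1) *: (x - z)| <= r + `|c - z|.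
    have -> : (sz k - 1) *: (x - z) = (c - (sz k *: z + (1 - sz k) *: x)) - (c - z).
      by apply/rowP => i; rewrite !mxE; ring.
    by apply: (le_trans (ler_normB _ _)); rewrite lerD2r.
  rewrite -ball_normE /= distrC.
  rewrite normrZ ger0_norm in h'; last by have := sz1 k; lra.
  rewrite -(@ltr_pM2l _ (sz k - 1)); last by have := sz1 k; lra.
  apply: (le_lt_trans h'); rewrite -ltr_pdivrMr//.
  rewrite szE (_ : k%:R + 2 - 1 = k.+1%:R); last by rewrite -natr1; ring.
  apply: (@lt_le_trans _ _ k%:R); last by rewrite ler_nat.
  by near: k; exact: nbhs_infty_gtr.
have [Ux px] := heta _ hx.
by rewrite indicE (mem_set Ux) mul1r distrC.
Unshelve. all: by end_near.
Qed.

Let kk s (p : 'rV[R]_n * 'rV[R]_n) := \1_U p.1 * phi p.1 * ker rho s p.1 p.2.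

Let kk_rint s : (mu \x mu)%E.-integrable setT (fun p => (\1_U p.1 * F p.2 * kk s p)%:E).
Proof.
have [M M0 hM] := uphi_bounded; have [K K0 hK] := ker_bounded grho rhoK s.
apply: (prod_rint mU bU F2 FU).
  apply: measurable_funM; first exact: (measurableT_comp uphi_measurable measurable_fst).
  exact: (ker_meas grho s measurable_fst measurable_snd).
by exists (M * K); [exact: mulr_ge0|move=> p; rewrite normrM; apply: ler_pM].
Qed.

Let kkE s x z : \1_U x * F z * kk s (x, z) = (\1_U x * phi x) * (F z * ker rho s x z).
Proof.
have I2 : \1_U x * \1_U x = \1_U x :> R by rewrite indicE; case: (_ \in _); rewrite ?mulr1 ?mulr0.
by rewrite /kk /= -[in RHS]I2; ring.
Qed.

Let kkE' s x z : \1_U x * F z * kk s (x, z) = F z * (\1_U x * phi x * ker rho s x z).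
Proof. by rewrite kkE; ring. Qed.

Lemma moll_pairing_swap s : 1 < s ->
  \int[mu]_x (\1_U x * moll rho F s x * phi x) = \int[mu]_z (F z * dual_moll s z).
Proof.
move=> s1; have e1 x z := kkE s x z; have e2 x z := kkE' s x z.
transitivity (\int[mu]_x \int[mu]_z (\1_U x * F z * kk s (x, z))).
  apply: eq_Rintegral => x _; under [RHS]eq_Rintegral => z _ do rewrite e1.
  by rewrite (RintegralZl _ measurableT (moll_rint grho rhoK mU bU F2 FU s x)) /moll mulrAC.
rewrite (@Fubini_Rint _ _ _ _ R mu mu (fun p => \1_U p.1 * F p.2 * kk s p) (kk_rint s)); last 2 first.
- move=> x; rewrite (_ : (fun y => _) = (fun z => (\1_U x * phi x) * (F z * ker rho s x z))).
    exact: (rintZ measurableT) (moll_rint grho rhoK mU bU F2 FU s x).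
  by apply/funext => z; exact: e1.
- move=> z; rewrite (_ : (fun y => _) = (fun x => F z * (\1_U x * phi x * ker rho s x z))).
    exact: (rintZ measurableT) (dual_rint z s1).
  by apply/funext => x; exact: e2.
apply: eq_Rintegral => z _; rewrite /dual_moll -(RintegralZl _ measurableT (dual_rint z s1)).
by apply: eq_Rintegral => x _; exact: e2.
Qed.

Lemma dual_moll_rint s : 2 <= s -> rint mu setT (fun z => F z * dual_moll s z).
Proof.
move=> s2; have s1 : 1 < s by lra.
have [M M0 hM] := dual_moll_le.
apply: (@rint_le _ _ _ _ _ _ _ (fun z => M * `|F z|)) => //; last 2 first.
- by move=> z _; rewrite normrM mulrC ler_wpM2r// hM.
- exact: (rintZ measurableT) (integrable_norm (Fint mU bU F2 FU)).
apply/measurable_EFinP.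
rewrite (_ : EFin \o _ = fubini_G mu (fun p => (\1_U p.1 * F p.2 * kk s p)%:E)).
  exact: (measurable_fubini_G (kk_rint s)).
apply/funext => z; rewrite /fubini_G.
rewrite /dual_moll /= -(RintegralZl _ measurableT (dual_rint z s1)) -EFin_Rint//; last first.
  exact: (rintZ measurableT) (dual_rint z s1).
by apply: eq_integral => x _; congr EFin; rewrite kkE'.
Qed.

(** Dominated convergence for the integrals of F against [dual_moll], with a multiple of |F| as the
    dominating function. *)
Lemma moll_pairing_cvg :
  \int[mu]_x (\1_U x * moll rho F k.+2%:R x * phi x) @[k --> \oo] --> \int[mu]_z (F z * phi z).
Proof.
have [M M0 hM] := dual_moll_le; have FI := Fint mU bU F2 FU.
have k2 k : 2 <= k.+2%:R :> R by rewrite (ler_nat R 2).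
have k1 k : 1 < k.+2%:R :> R by have := k2 k; lra.
have h1 k : rint mu setT (fun z => F z * dual_moll k.+2%:R z).
  exact: (dual_moll_rint (k2 k)).
have [K K0 hK] := phi_bounded bU cphi.
have h2 : rint mu setT (fun z => F z * phi z).
  apply: (@rint_le _ _ _ _ _ _ _ (fun z => K * `|F z|)) => //.
  - by apply: measurable_funM; [exact: F2.1|exact: continuous_measurable_rV].
  - move=> z _; rewrite normrM mulrC; have [Uz|Uz] := pselect (U z); last by rewrite FU// normr0 !mulr0.
    by rewrite ler_wpM2r// hK.
  - exact: (rintZ measurableT) (integrable_norm FI).
under eq_fun do rewrite moll_pairing_swap//.
apply: fine_cvg; rewrite -/(Rintegral _ _ _) -(EFin_Rint measurableT h2).
apply: (@dominated_cvg _ _ _ _ _ measurableT _ _ (fun z => (M * `|F z|)%:E)) => //.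
- by move=> k; apply/measurable_EFinP; exact: rint_meas (h1 k).
- move=> z _; apply: cvg_EFin; first by near=> k.
  have [Uz|Uz] := pselect (U z); first by apply: cvgM; [exact: cvg_cst|exact: dual_moll_cvg].
  rewrite (_ : fine \o _ = cst 0) ?(FU Uz) ?mul0r; first exact: cvg_cst.
  by apply/funext => k; rewrite /= mul0r.
- exact: (rintZ measurableT) (integrable_norm FI).
- by move=> k z _; rewrite lee_fin normrM mulrC ler_wpM2r// hM.
Unshelve. all: by end_near.
Qed.

End mollified_limit.

Section weak_poincare.
Context (R : realType) (n : nat) (U : set 'rV[R]_n).
Hypotheses (oU : open U) (bU : bounded_set U) (cU : convex_rV U) (U0 : U !=set0).
Variables (F : 'rV[R]_n -> R) (Fg : 'I_n -> 'rV[R]_n -> R).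
Hypothesis F2 : sqint (leb R n) setT F.
Hypothesis Fg2 : forall i, sqint (leb R n) setT (Fg i).
Hypothesis FU : forall x, ~ U x -> F x = 0.
Hypothesis weak : forall psi, test_function U psi -> forall i,
  \int[leb R n]_x (F x * partial i psi x) = - \int[leb R n]_x (Fg i x * psi x).
Variable delta : R.
Hypothesis delta0 : 0 <= delta.
Hypothesis diamU : forall x y, U x -> U y -> dot (x - y) (x - y) <= delta ^+ 2.

Local Notation mu := (leb R n).
Let m := fine (mu U).

Lemma open_has_cball : exists c r, 0 < r /\ cball c r `<=` U.
Proof.
have [c Uc] := U0; have : nbhs c U by exact: open_nbhs_nbhs.
case/nbhs_ballP => e /= e0 h; exists c, (e / 2); split; first by rewrite divr_gt0.
by move=> x hx; apply: h; rewrite -ball_normE /=; apply: (le_lt_trans hx); lra.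
Qed.

(** [moll_pairing_bound] passes to the limit. The convergence is used twice, for phi and for the
    constant one, since the mean of the averaged function must converge as well. *)
Lemma weak_poincare_young (phi : 'rV[R]_n -> R) l : continuous phi -> 0 < l ->
  `|m * \int[mu]_x (F x * phi x) - (\int[mu]_x F x) * (\int[mu]_x (\1_U x * phi x))| <=
  delta / 2 * m * (l * 4 ^+ n * \int[mu]_z energy Fg z + (\int[mu]_x (\1_U x * phi x ^+ 2)) / l).
Proof.
move=> cphi l0; have [c [r [r0 KU]]] := open_has_cball.
have [rho [grho rho0 rhoK rho1]] := exists_mollifier c r0.
have mU : measurable U by exact: open_measurable_rV.
have c1 : continuous (fun _ : 'rV[R]_n => 1 : R).
  by move=> x; apply: (@cst_continuous _ _ (1 : R)).
have h1 := moll_pairing_cvg grho rho0 rhoK rho1 oU bU F2 FU cphi.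
have h2 := moll_pairing_cvg grho rho0 rhoK rho1 oU bU F2 FU c1.
have h k := moll_pairing_bound grho rho0 rhoK rho1 cU KU mU bU F2 Fg2 FU weak delta0 diamU cphi
  (_ : 2 <= k.+2%:R) l0.
have k2 (k : nat) : 2 <= k.+2%:R :> R by rewrite (ler_nat R 2).
set B := _ * (_ + _).
pose G (k : nat) := \int[mu]_x (\1_U x * moll rho F k.+2%:R x * 1).
pose A (k : nat) := \int[mu]_x (\1_U x * moll rho F k.+2%:R x * phi x).
have hB k : `|m * A k - G k * \int[mu]_x (\1_U x * phi x)| <= B.
  have eG : G k = \int[mu]_x (\1_U x * moll rho F k.+2%:R x).
    by apply: eq_Rintegral => x _; rewrite mulr1.
  rewrite eG; exact: (h k2 k).
have e1 : \int[mu]_x F x = \int[mu]_x (F x * 1) by under [RHS]eq_Rintegral do rewrite mulr1.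
rewrite e1.
have hc : `|m * A k - G k * \int[mu]_x (\1_U x * phi x)| @[k --> \oo] -->
    `|m * \int[mu]_x (F x * phi x) - \int[mu]_x (F x * 1) * \int[mu]_x (\1_U x * phi x)|.
  apply: (@cvg_norm _ R^o); apply: (@cvgB _ R^o); last exact: cvgMl.
  exact: cvgMr.
apply: (closed_cvg (fun y : R => y <= B) (@closed_le R B) _ _ hc).
by apply: nearW => k; exact: hB.
Qed.

(** Optimisation of the Young weight l. Multiplied by l, the bound reads 2 |X| l <= l^2 w + D P with
    w = K^2 E D, where K = 2^n, D = delta m, E is the energy and P the squared norm of phi. *)
Lemma weak_poincare (phi : 'rV[R]_n -> R) : continuous phi ->
  (m * \int[mu]_x (F x * phi x) - (\int[mu]_x F x) * (\int[mu]_x (\1_U x * phi x))) ^+ 2 <=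
  (2 ^+ n * delta * m) ^+ 2 * ((\int[mu]_z energy Fg z) * (\int[mu]_x (\1_U x * phi x ^+ 2))).
Proof.
move=> cphi; set X := _ - _; set E := Rintegral _ _ (energy _); set P := Rintegral _ _ (fun x => _ * _ ^+ 2).
have E0 : 0 <= E by apply: Rintegral_ge0 => x _; apply: sumr_ge0 => i _; exact: sqr_ge0.
have P0 : 0 <= P by apply: Rintegral_ge0 => x _; rewrite mulr_ge0// sqr_ge0.
have m0 : 0 <= m by rewrite fine_ge0.
have hl l : 0 < l -> `|X| <= delta / 2 * m * (l * 4 ^+ n * E + P / l).
  by move=> l0; exact: weak_poincare_young.
set K := 2 ^+ n; have K1 : 4 ^+ n = K ^+ 2 by rewrite /K -exprM mulnC exprM; congr (_ ^+ _); ring.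
have K0 : 0 < K by rewrite exprn_gt0.
apply: (@le_trans _ _ (`|X| ^+ 2)); first by rewrite real_normK// num_real.
have KEP : 0 <= (K * delta * m) ^+ 2 * (E * P) by apply: mulr_ge0; [exact: sqr_ge0|exact: mulr_ge0].
set D := delta * m; have D0 : 0 <= D by exact: mulr_ge0.
have h1 l : 0 < l -> 2 * `|X| * l <= D * (l ^+ 2 * K ^+ 2 * E + P).
  move=> l0; have := hl l l0; rewrite K1 => h.
  have := ler_wpM2r (ltW l0) h.
  rewrite (_ : delta / 2 * m * (l * K ^+ 2 * E + P / l) * l = (D * (l ^+ 2 * K ^+ 2 * E + P)) / 2); first by lra.
  by rewrite /D; field; rewrite gt_eqF.
have x0 : 0 <= `|X| by [].
have [Ez|Ep] := leP (K ^+ 2 * E * D) 0.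
  have EE : K ^+ 2 * E * D = 0 by apply/eqP; rewrite eq_le Ez !mulr_ge0// ?sqr_ge0 ?exprn_ge0.
  suff -> : `|X| = 0 by rewrite expr0n.
  apply/eqP; rewrite eq_le x0 andbT leNgt; apply/negP => Xp.
  (* For w = 0 the bound would say 2 |X| l <= D P for every l; this l violates it. *)
  have := h1 ((D * P + 1) / `|X|) (divr_gt0 (ltr_wpDl (mulr_ge0 D0 P0) ltr01) Xp).
  set l := _ / _; rewrite (_ : D * _ = l ^+ 2 * (K ^+ 2 * E * D) + D * P); last by ring.
  have -> : 2 * `|X| * l = 2 * (D * P + 1) by rewrite /l; field; rewrite gt_eqF.
  rewrite EE mulr0 add0r.
  by have := mulr_ge0 D0 P0; lra.
(* The maximiser of 2 |X| l - l^2 w. *)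
have := h1 (`|X| / (K ^+ 2 * E * D)).
have [->|Xn] := eqVneq `|X| 0; first by by rewrite expr0n.
have Xp : 0 < `|X| by rewrite lt_neqAle eq_sym Xn.
move=> /(_ (divr_gt0 Xp Ep)); set w := K ^+ 2 * E * D.
have e1 t : D * (t ^+ 2 * K ^+ 2 * E + P) = t ^+ 2 * w + D * P by rewrite /w; ring.
have wn : w != 0 by rewrite gt_eqF.
have e2 : (`|X| / w) ^+ 2 * w = `|X| ^+ 2 / w by rewrite expr2 -mulrA divfK// mulrAC -expr2.
rewrite e1 e2.
rewrite (_ : 2 * `|X| * (`|X| / w) = 2 * (`|X| ^+ 2 / w)); last by rewrite expr2; ring.
move=> h; have : `|X| ^+ 2 / w <= D * P by lra.
rewrite ler_pdivrMr// => h2; apply: (le_trans h2); rewrite /w /D le_eqVlt; apply/orP; left; apply/eqP.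
by ring.
Qed.

End weak_poincare.

(** * Pairings and norms under L^2 convergence *)

Section L2_limits.
Context d (T : measurableType d) (R : realType) (mu : {measure set T -> \bar R}).
Variables (D : set T) (mD : measurable D).

Lemma sqint_subset (A : set T) f : measurable A -> A `<=` D -> sqint mu D f -> sqint mu A f.
Proof.
move=> mA AD [mf lf]; split; first exact: measurable_funS mf.
apply: le_lt_trans lf; apply: ge0_subset_integral => //.
- apply/measurable_EFinP; exact: measurable_funX.
- by move=> x _; rewrite lee_fin sqr_ge0.
Qed.

Lemma sqint_restrict f : sqint mu D f -> sqint mu setT (f \_ D).
Proof.
move=> [mf lf]; split; first exact/(measurable_restrictT _ mD).
apply: le_lt_trans lf; rewrite [leRHS]integral_mkcond le_eqVlt; apply/orP; left; apply/eqP.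
by apply: eq_integral => x _; rewrite !patchE; case: ifP => //; rewrite expr0n.
Qed.

Lemma Rint_restrictM (f g : T -> R) : \int[mu]_x ((f \_ D) x * g x) = \int[mu]_(x in D) (f x * g x).
Proof.
rewrite [RHS]Rintegral_mkcond; apply: eq_Rintegral => x _.
by rewrite !patchE; case: ifP => //; rewrite mul0r.
Qed.

Lemma Rint_indicM (g : T -> R) : \int[mu]_x (\1_D x * g x) = \int[mu]_(x in D) g x.
Proof.
rewrite [RHS]Rintegral_mkcond; apply: eq_Rintegral => x _.
by rewrite patchE indicE; case: ifP; rewrite ?mul1r ?mul0r.
Qed.

Lemma L2_pairing_cvg (f e : T -> R) (h : nat -> T -> R) : sqint mu D f -> sqint mu D e ->
  (forall l, sqint mu D (h l)) -> \int[mu]_(x in D) (h l x - e x) ^+ 2 @[l --> \oo] --> (0 : R) ->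
  \int[mu]_(x in D) (f x * h l x) @[l --> \oo] --> \int[mu]_(x in D) (f x * e x).
Proof.
move=> f2 e2 h2 he.
have hs : Num.sqrt (\int[mu]_(x in D) f x ^+ 2) * Num.sqrt (\int[mu]_(x in D) (h l x - e x) ^+ 2) @[l --> \oo] --> (0 : R).
  have hq : Num.sqrt (\int[mu]_(x in D) (h l x - e x) ^+ 2) @[l --> \oo] --> Num.sqrt (0 : R).
    exact: cvg_trans (cvg_app _ he) (@sqrt_continuous R _).
  rewrite sqrtr0 in hq.
  by rewrite -[X in _ --> X](mulr0 (Num.sqrt (\int[mu]_(x in D) f x ^+ 2))); exact: cvgMl_tmp.
apply/cvgrPdist_le => e' e'0.
have /cvgrPdist_le/(_ _ e'0) := hs; apply: filterS => l.
rewrite sub0r normrN ger0_norm ?mulr_ge0 ?sqrtr_ge0// => hl.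
have -> : \int[mu]_(x in D) (f x * e x) - \int[mu]_(x in D) (f x * h l x) =
    - \int[mu]_(x in D) (f x * (h l x - e x)).
  under [in RHS]eq_Rintegral => x _ do rewrite mulrBr.
  by rewrite (RintegralB mD (sqintM mD f2 (h2 l)) (sqintM mD f2 e2)) opprB.
rewrite normrN; apply: (le_trans _ hl).
have d2 := sqintB mD (h2 l) e2.
have := sqint_Cauchy_Schwarz mD f2 d2 => cs.
rewrite -sqrtrM ?Rintegral_ge0//; last by move=> x _; exact: sqr_ge0.
by rewrite -sqrtr_sqr ler_sqrt// mulr_ge0// Rintegral_ge0// => x _; exact: sqr_ge0.
Qed.

Lemma L2_norm_cvg (e : T -> R) (h : nat -> T -> R) : sqint mu D e ->
  (forall l, sqint mu D (h l)) -> \int[mu]_(x in D) (h l x - e x) ^+ 2 @[l --> \oo] --> (0 : R) ->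
  \int[mu]_(x in D) h l x ^+ 2 @[l --> \oo] --> \int[mu]_(x in D) e x ^+ 2.
Proof.
move=> e2 h2 he.
have E l : \int[mu]_(x in D) h l x ^+ 2 = \int[mu]_(x in D) (h l x - e x) ^+ 2 +
    2 * \int[mu]_(x in D) (e x * h l x) - \int[mu]_(x in D) (e x ^+ 2).
  have d2 := sqintB mD (h2 l) e2; have m2 := sqintM mD e2 (h2 l).
  have r1 := rintD mD (sqint_sq d2) (rintZ mD 2 m2).
  rewrite -(RintegralZl _ mD m2) -(RintegralD mD (sqint_sq d2) (rintZ mD 2 m2)).
  rewrite -(RintegralB mD r1 (sqint_sq e2)).
  by apply: eq_Rintegral => x _; ring.
have Y : \int[mu]_(x in D) e x ^+ 2 = 0 + 2 * \int[mu]_(x in D) (e x * e x) - \int[mu]_(x in D) (e x ^+ 2).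
  by under [in RHS]eq_Rintegral => x _ do rewrite -expr2; ring.
rewrite [X in _ --> X]Y (funext E); apply: (@cvgB _ R^o); last exact: cvg_cst.
by apply: (@cvgD _ R^o) => //; apply: cvgMl_tmp; exact: L2_pairing_cvg.
Qed.

End L2_limits.

(** * The Poincaré inequality on a convex subset of a domain *)

Section poincare.
Context (R : realType) (n : nat).
Local Notation mu := (leb R n).

(** Approximability by continuous functions, which extends the pairing inequality from continuous
    phi to e. For elements of [V_0] it is read off from the smooth sequences contained in the trace
    conditions. *)
Definition L2_approx (U : set 'rV[R]_n) (e : 'rV[R]_n -> R) := exists phi : nat -> 'rV[R]_n -> R,
  (forall l, continuous (phi l)) /\ \int[mu]_(x in U) (phi l x - e x) ^+ 2 @[l --> \oo] --> (0 : R).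

Lemma continuous_sqint (U : set 'rV[R]_n) (phi : 'rV[R]_n -> R) : bounded_set U -> measurable U ->
  continuous phi -> sqint mu U phi.
Proof.
move=> bU mU cphi; have [h1 h2] := uphi_sqint mU bU cphi.
split; first by apply: measurable_funTS; exact: continuous_measurable_rV.
apply: le_lt_trans h2; rewrite [leLHS]integral_mkcond le_eqVlt; apply/orP; left; apply/eqP.
apply: eq_integral => x _; rewrite patchE indicE; case: ifP => _; rewrite ?mul1r// mul0r expr0n.
by [].
Qed.

Variables (D U : set 'rV[R]_n).
Hypotheses (oU : open U) (bU : bounded_set U) (cU : convex_rV U) (U0 : U !=set0).
Hypotheses (oD : open D) (UD : U `<=` D).
Variable delta : R.
Hypothesis delta0 : 0 <= delta.
Hypothesis diamU : forall x y, U x -> U y -> dot (x - y) (x - y) <= delta ^+ 2.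
Let mU : measurable U. Proof. exact: open_measurable_rV. Qed.
Let mD : measurable D. Proof. exact: open_measurable_rV. Qed.

Lemma vol_gt0 : 0 < fine (mu U).
Proof. by rewrite fine_gt0// leb_open_gt0//= leb_bounded. Qed.

Lemma grad_norm2E f df : H1 D f df ->
  grad_norm2 U df = \int[mu]_x energy (fun i => (fun z => df z ord0 i) \_ U) x.
Proof.
move=> _; rewrite /grad_norm2 Rintegral_mkcond; apply: eq_Rintegral => x _.
rewrite patchE /energy /dot; under [RHS]eq_bigr do rewrite patchE.
by case: ifP => _; [|rewrite big1// => i _; rewrite expr0n].
Qed.

(** A test function on U is one on D, so f and its gradient, restricted to U and extended by zero,
    satisfy the weak identity for test functions of U. *)
Lemma poincare_continuous f df (phi : 'rV[R]_n -> R) : H1 D f df -> continuous phi ->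
  (fine (mu U) * \int[mu]_(x in U) (f x * phi x) -
     (\int[mu]_(x in U) f x) * (\int[mu]_(x in U) phi x)) ^+ 2 <=
  (2 ^+ n * delta * fine (mu U)) ^+ 2 * (grad_norm2 U df * \int[mu]_(x in U) phi x ^+ 2).
Proof.
move=> H cphi; have [f2 df2 weak] := H.
have F2 := sqint_restrict mU (sqint_subset mD mU UD f2).
have G2 i := sqint_restrict mU (sqint_subset mD mU UD (df2 i)).
have FU x : ~ U x -> (f \_ U) x = 0 by move=> Ux; rewrite patchE memNset.
have wk psi : test_function U psi -> forall i,
  \int[mu]_x ((f \_ U) x * partial i psi x) = - \int[mu]_x (((fun z => df z ord0 i) \_ U) x * psi x).
  move=> [spsi [K [cK KU K0]]] i.
  have := weak psi (conj spsi (ex_intro _ K (And3 cK (subset_trans KU UD) K0))) i.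
  have z1 x : ~ U x -> psi x = 0 by move=> Ux; apply: K0 => /KU.
  have clK : closed K by apply: compact_closed => //; exact: norm_hausdorff.
  have z2 x : ~ U x -> partial i psi x = 0.
    by move=> Ux; apply: (partial_support i clK K0) => /KU.
  move=> h; have e (g q : 'rV[R]_n -> R) : (forall x, ~ U x -> q x = 0) ->
      \int[mu]_x ((g \_ U) x * q x) = \int[mu]_(x in D) (g x * q x).
    move=> zq; rewrite Rint_restrictM// Rintegral_mkcond [RHS]Rintegral_mkcond.
    apply: eq_Rintegral => x _; rewrite !patchE; case: ifPn => [/set_mem xU|xU].
      by rewrite mem_set//; exact: UD.
    by case: ifP => // _; rewrite zq ?mulr0// => /mem_set xU'; rewrite xU' in xU.
  by rewrite !e.
have := weak_poincare oU bU cU U0 F2 G2 FU wk delta0 diamU cphi.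
rewrite -(grad_norm2E H) !Rint_indicM Rint_restrictM//.
by rewrite -[\int[mu]_x (f \_ U) x]Rintegral_mkcond.
Qed.

(** Both sides are continuous in phi for the L^2 norm. The choice e = f yields the Poincaré
    inequality and the constancy of functions without gradient; a right-hand side as f and the
    discretisation error as e yield the second power of H. *)
Lemma poincare_approx f df e : H1 D f df -> sqint mu U e -> L2_approx U e ->
  (fine (mu U) * \int[mu]_(x in U) (f x * e x) -
     (\int[mu]_(x in U) f x) * (\int[mu]_(x in U) e x)) ^+ 2 <=
  (2 ^+ n * delta * fine (mu U)) ^+ 2 * (grad_norm2 U df * \int[mu]_(x in U) e x ^+ 2).
Proof.
move=> H e2 [h [ch he]]; have [f2 _ _] := H; have f2U := sqint_subset mD mU UD f2.
have h2 l : sqint mu U (h l) by exact: continuous_sqint.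
have c1 : continuous (fun _ : 'rV[R]_n => 1 : R) by move=> x; apply: (@cst_continuous _ _ (1 : R)).
have P l := poincare_continuous H (ch l).
have C1 := L2_pairing_cvg mU f2U e2 h2 he.
have C2 := L2_pairing_cvg mU (continuous_sqint bU mU c1) e2 h2 he.
have C3 := L2_norm_cvg mU e2 h2 he.
have one g : \int[mu]_(x in U) (1 * g x) = \int[mu]_(x in U) g x.
  by apply: eq_Rintegral => x _; rewrite mul1r.
rewrite one in C2.
have {}C2 : \int[mu]_(x in U) h l x @[l --> \oo] --> \int[mu]_(x in U) e x.
  by rewrite (_ : (fun l => _) = fun l => \int[mu]_(x in U) (1 * h l x))//; apply/funext => l; rewrite one.
set a := fine _ in P *; set b := \int[mu]_(x in U) f x in P *; set K := _ ^+ 2 in P *; set g := grad_norm2 _ _ in P *.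
rewrite -subr_ge0.
pose r (x y z : R) := K * (g * z) - (a * x - b * y) ^+ 2.
pose S l := r (\int[mu]_(x in U) (f x * h l x)) (\int[mu]_(x in U) h l x) (\int[mu]_(x in U) h l x ^+ 2).
have hS : S l @[l --> \oo] --> r (\int[mu]_(x in U) (f x * e x)) (\int[mu]_(x in U) e x) (\int[mu]_(x in U) e x ^+ 2).
  rewrite /S /r; apply: (@cvgB _ R^o); first by do 2 apply: cvgMl_tmp.
  have hh : (a * \int[mu]_(x in U) (f x * h l x) - b * \int[mu]_(x in U) h l x) @[l --> \oo] -->
     a * \int[mu]_(x in U) (f x * e x) - b * \int[mu]_(x in U) e x.
    by apply: (@cvgB _ R^o); exact: cvgMl_tmp.
  exact: cvg_trans (cvg_app _ hh) (@exprn_continuous R 2 _).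
apply: (closed_cvg (fun y : R => 0 <= y) (@closed_ge R 0) _ _ hS).
by apply: nearW => l; rewrite /S /r subr_ge0; exact: P.
Qed.

(** The mean of f on U needs no separate treatment: it is multiplied by the integral of e, which is
    zero. *)
Lemma poincare_mean0 f df e : H1 D f df -> sqint mu U e -> L2_approx U e ->
  \int[mu]_(x in U) e x = 0 ->
  (\int[mu]_(x in U) (f x * e x)) ^+ 2 <=
  (2 ^+ n * delta) ^+ 2 * (grad_norm2 U df * \int[mu]_(x in U) e x ^+ 2).
Proof.
move=> H e2 he e0; have := poincare_approx H e2 he; rewrite e0 mulr0 subr0 !exprMn.
have m0 := vol_gt0; set X := (\int[mu]_(x in U) (f x * e x)) ^+ 2; set m := fine _ in m0 *.
rewrite mulrC [leRHS]mulrAC ler_pM2r// exprn_gt0//.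
Qed.

Lemma poincare e de : H1 D e de -> L2_approx U e -> \int[mu]_(x in U) e x = 0 ->
  \int[mu]_(x in U) e x ^+ 2 <= (2 ^+ n * delta) ^+ 2 * grad_norm2 U de.
Proof.
move=> H he e0; have [e2 _ _] := H; have e2U := sqint_subset mD mU UD e2.
have := poincare_mean0 H e2U he e0.
under [in X in X ^+ 2 <= _ -> _]eq_Rintegral => x _ do rewrite -expr2.
set X := Rintegral _ _ _; have X0 : 0 <= X by apply: Rintegral_ge0 => x _; exact: sqr_ge0.
have [->|Xn] := eqVneq X 0.
  move=> _; apply: mulr_ge0; first exact: sqr_ge0.
  by apply: Rintegral_ge0 => x _; apply: sumr_ge0 => i _; rewrite -expr2 sqr_ge0.
by rewrite expr2 mulrA ler_pM2r// lt_neqAle eq_sym Xn.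
Qed.

(** Without gradient the pairing inequality with f = e becomes m ∫ e^2 = (∫ e)^2, which says that e
    minus its mean b/m has zero L^2 norm. *)
Lemma grad0_const e de : H1 D e de -> L2_approx U e -> grad_norm2 U de = 0 ->
  exists c : R, {ae mu, forall x, U x -> e x = c}.
Proof.
move=> H he g0; have [e2 _ _] := H; have e2U := sqint_subset mD mU UD e2.
have := poincare_approx H e2U he; rewrite g0 mul0r mulr0 => h.
set m := fine (mu U) in h; set b := \int[mu]_(x in U) e x in h.
have m0 : 0 < m := vol_gt0.
have {h} hX : m * \int[mu]_(x in U) (e x * e x) - b * b = 0.
  by apply/eqP; rewrite -sqrf_eq0 eq_le h sqr_ge0.
have c1 : continuous (fun _ : 'rV[R]_n => 1 : R) by move=> x; apply: (@cst_continuous _ _ (1 : R)).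
have s1 := continuous_sqint bU mU c1.
have eI : rint mu U e.
  by have := sqintM mU e2U s1; congr (rint _ _); apply/funext => x; rewrite mulr1.
have I1 : rint mu U (fun=> (b / m) ^+ 2).
  have := rintZ mU ((b / m) ^+ 2) (sqintM mU s1 s1).
  by congr (rint _ _); apply/funext => x; rewrite !mulr1.
exists (b / m).
have d2 : sqint mu U (fun x => e x - b / m).
  have := sqintB mU e2U (sqintZ mU (b / m) s1).
  by congr (sqint _ _); apply/funext => x; rewrite mulr1.
have : \int[mu]_(x in U) (e x - b / m) ^+ 2 = 0.
  have E : (fun x => (e x - b / m) ^+ 2) = (fun x => (e x * e x - 2 * (b / m) * e x) + (b / m) ^+ 2).
    by apply/funext => x; ring.
  rewrite E; have r1 := sqintM mU e2U e2U.
  rewrite (RintegralD mU (rintB mU r1 (rintZ mU (2 * (b / m)) eI)) I1).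
  rewrite (RintegralB mU r1 (rintZ mU (2 * (b / m)) eI)) (RintegralZl _ mU eI) -/b.
  have -> : \int[mu]_(x in U) (b / m) ^+ 2 = (b / m) ^+ 2 * m by rewrite Rintegral_cst.
  have mn : m != 0 by rewrite gt_eqF.
  have -> : \int[mu]_(x in U) (e x * e x) = b * b / m.
    by apply: (mulfI mn); rewrite mulrCA divff// mulr1; apply/eqP; rewrite -subr_eq0; exact/eqP.
  by field.
move/(ae_Rint_eq0 mU (sqint_sq d2)) => /(_ (aeW _ (fun x _ => sqr_ge0 _))).
by apply: filterS => x h Ux; apply/eqP; rewrite -subr_eq0 -sqrf_eq0; apply/eqP; exact: h.
Qed.

End poincare.

(** * Traces on flat pieces *)

Section continuous_real.
Context (R : realType) (T : topologicalType).
Implicit Types f g : T -> R.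

Lemma contD f g : continuous f -> continuous g -> continuous (fun x => f x + g x).
Proof. by move=> cf cg x; apply: (@cvgD _ R^o); [exact: cf|exact: cg]. Qed.

Lemma contB f g : continuous f -> continuous g -> continuous (fun x => f x - g x).
Proof. by move=> cf cg x; apply: (@cvgB _ R^o); [exact: cf|exact: cg]. Qed.

Lemma contM f g : continuous f -> continuous g -> continuous (fun x => f x * g x).
Proof. by move=> cf cg x; apply: cvgM; [exact: cf|exact: cg]. Qed.

Lemma contC (c : R) : continuous (fun _ : T => c).
Proof. by move=> x; apply: cst_continuous. Qed.

Lemma contX2 f : continuous f -> continuous (fun x => f x ^+ 2).
Proof. by move=> cf; under eq_fun do rewrite expr2; exact: contM. Qed.

Lemma cont_sum (I : finType) (F : I -> T -> R) : (forall i, continuous (F i)) ->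
  continuous (fun x => \sum_i F i x).
Proof. by move=> cF x; apply: continuous_at_sum => i; exact: cF. Qed.

End continuous_real.

(** * Smooth functions along lines *)

Section smooth_lines.
Context (R : realType) (n : nat).

Lemma is_derive_direction (f : 'rV[R]_n -> R) (b v : 'rV[R]_n) (t : R) : derivable f (b + t *: v) v ->
  is_derive t (1 : R) (fun t => f (b + t *: v)) ('D_v f (b + t *: v)).
Proof.
move=> dl; set g := (fun t => _).
have E : (fun h : R => h^-1 *: ((f \o shift (b + t *: v)) (h *: v) - f (b + t *: v))) =
   (fun h : R => h^-1 *: ((g \o shift t) (h *: 1) - g t)).
  apply/funext => h /=; rewrite /g /=; congr (_ *: (f _ - _)).
  have -> : h *: (1 : R) = h by exact: mulr1.
  by rewrite scalerDl addrCA.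
by split; rewrite /derivable /derive -E.
Qed.

Lemma increment_le (u du : R -> R) (p e s : R) : (forall t, is_derive t (1 : R) u (du t)) ->
  (forall t, `|t| <= `|s| -> `|du t - p| <= e) -> `|u s - u 0 - s * p| <= e * `|s|.
Proof.
move=> hu hd.
have cu A : {within A, continuous u}.
  apply: continuous_subspaceT => t; apply: differentiable_continuous; apply/derivable1_diffP.
  by case: (hu t).
have [s0|s0] := leP 0 s.
  have [c] := MVT_segment s0 (fun x _ => hu x) (cu _).
  rewrite in_itv /= => /andP[c0 c1] ->; rewrite subr0 mulrC -mulrBr normrM mulrC ler_wpM2r//.
  by apply: hd; rewrite !ger0_norm.
have [c] := MVT_segment (ltW s0) (fun x _ => hu x) (cu _).
rewrite in_itv /= => /andP[c0 c1] E.
have -> : u s - u 0 - s * p = s * (du c - p) by rewrite -(opprB (u 0)) E; ring.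
by rewrite normrM mulrC ler_wpM2r//; apply: hd; rewrite !ler0_norm ?lerN2// ltW.
Qed.

Lemma smooth_continuous (f : 'rV[R]_n -> R) : smooth f -> continuous f.
Proof. by move=> /(_ [::]) []. Qed.

Lemma smooth_partial_continuous (f : 'rV[R]_n -> R) i : smooth f -> continuous (partial i f).
Proof. by move=> /(_ [:: i]) []. Qed.

(** [smooth] only provides continuous derivatives along the coordinate axes. An arbitrary direction
    is reached by changing one coordinate at a time, each change being controlled by the mean value
    theorem and the continuity of the partial derivatives at x. *)
Lemma smooth_is_derive0 (f : 'rV[R]_n -> R) (x v : 'rV[R]_n) : smooth f ->
  derivable f x v /\ 'D_v f x = \sum_i v ord0 i * partial i f x.
Proof.
move=> sf; set L := \sum_i _.
pose V := 1 + \sum_i `|v ord0 i|.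
have V1 : 1 <= V by rewrite lerDl sumr_ge0.
have vV i : `|v ord0 i| <= V.
  by rewrite /V (bigD1 i)//= addrCA lerDl addr_ge0// sumr_ge0.
have V0 : 0 < V by apply: lt_le_trans V1.
suff h : h^-1 *: ((f \o shift x) (h *: v) - f x) @[h --> 0^'] --> L.
  by split; [apply/cvg_ex; exists L|exact: cvg_lim h].
apply/cvgrPdist_le => e e0; pose e' := e / V; have e'0 : 0 < e' by rewrite divr_gt0.
have : \forall y \near x, forall i : 'I_n, `|partial i f x - partial i f y| <= e'.
  apply: (@filter_forall _ _ (fun i y => `|partial i f x - partial i f y| <= e') (nbhs x) _) => i.
  by have /cvgrPdist_le := @smooth_partial_continuous f i sf x; apply.
case/nbhs_ballP => eta /= eta0 heta.
near=> h.
have h0 : h != 0 by near: h; exact: nbhs_dnbhs_neq.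
have hV : `|h| * V < eta.
  rewrite -ltr_pdivlMr//; near: h; apply: dnbhs0_lt; exact: divr_gt0.
(* The vector v truncated to its first k coordinates: the points x + h p(k) lead from x to x + h v
   along the axes, and the increments telescope. *)
pose p (k : nat) : 'rV[R]_n := \row_j (if (j < k)%N then v ord0 j else 0).
have pS (i : 'I_n) : x + h *: p i.+1 = (x + h *: p i) + (h * v ord0 i) *: delta_mx ord0 i.
  apply/rowP => j; rewrite !mxE ltnS leq_eqVlt eqxx /=.
  have [->|/negPf ji] := eqVneq j i; first by rewrite ltnn eqxx /=; ring.
  by rewrite (_ : (val j == val i) = false) //= mulr0 addr0.
have step (i : 'I_n) : `|f (x + h *: p i.+1) - f (x + h *: p i) - (h * v ord0 i) * partial i f x| <=
    e' * `|h * v ord0 i|.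
  rewrite pS; set w := x + h *: p i.
  pose u t := f (w + t *: delta_mx ord0 i).
  have hu t : is_derive t (1 : R) u (partial i f (w + t *: delta_mx ord0 i)).
    by apply: is_derive_direction; have [_] := sf [::]; apply.
  have := @increment_le u _ (partial i f x) e' (h * v ord0 i) hu; rewrite /u scale0r addr0; apply.
  move=> t ht; rewrite distrC; apply: heta; apply/rV_ballP => // j.
  rewrite /w !mxE opprD addrA; rewrite (_ : x ord0 j - _ - _ = - (h * (if (j < i)%N then v ord0 j else 0) + t * (j == i)%:R)); last first.
    by rewrite eqxx /=; ring.
  rewrite normrN; apply: le_lt_trans hV.
  have [->|ji] := eqVneq j i.
    by rewrite ltnn mulr0 add0r mulr1; apply: (le_trans ht); rewrite normrM ler_wpM2l.
  rewrite mulr0 addr0; case: ifP => _; first by rewrite normrM ler_wpM2l.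
  by rewrite mulr0 normr0 mulr_ge0// ltW.
have tel : f (x + h *: v) - f x - h * L =
  \sum_(i < n) (f (x + h *: p i.+1) - f (x + h *: p i) - (h * v ord0 i) * partial i f x).
  rewrite sumrB -(big_mkord xpredT (fun i => f (x + h *: p i.+1) - f (x + h *: p i))) telescope_sumr//.
  rewrite /L mulr_sumr; congr (_ - _ - _); last by apply: eq_bigr => i _; rewrite mulrA.
    by congr (f (_ + _ *: _)); apply/rowP => j; rewrite mxE ltn_ord.
  by congr f; apply/rowP => j; rewrite !mxE ltn0 mulr0 addr0.
have hle : `|f (x + h *: v) - f x - h * L| <= e * `|h|.
  rewrite tel; apply: (le_trans (ler_norm_sum _ _ _)).
  apply: (le_trans (ler_sum _ (fun i _ => step i))).
  rewrite -mulr_sumr; under eq_bigr do rewrite normrM.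
  rewrite -mulr_sumr /e' -mulrA ler_pM2l// mulrCA ler_piMr// mulrC ler_pdivrMr// mul1r /V lerDr.
  exact: ler01.
have -> : L - h^-1 *: ((f \o shift x) (h *: v) - f x) = - (h^-1 * (f (x + h *: v) - f x - h * L)).
  by rewrite /= (addrC (h *: v)) mulrBr mulKf// /GRing.scale /=; ring.
rewrite normrN normrM normfV mulrC ler_pdivrMr ?normr_gt0//.
Unshelve. all: by end_near.
Qed.

Lemma smooth_is_derive_line (f : 'rV[R]_n -> R) (b v : 'rV[R]_n) (t : R) : smooth f ->
  is_derive t (1 : R) (fun t => f (b + t *: v)) (\sum_i v ord0 i * partial i f (b + t *: v)).
Proof.
move=> sf; have [h <-] := @smooth_is_derive0 f (b + t *: v) v sf.
exact: is_derive_direction.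
Qed.

End smooth_lines.

(** * Boundary values of smooth functions *)

Section trace_bound.
Context (R : realType) (n : nat).

Lemma line_continuous (f : 'rV[R]_n -> R) (b v : 'rV[R]_n) : continuous f ->
  continuous (fun t : R => f (b + t *: v)).
Proof.
move=> cf t; apply: (@continuous_comp _ _ _ (fun t : R => b + t *: v) f); last exact: cf.
by apply: cvgD; [exact: cvg_cst|apply: cvgZr_tmp; exact: cvg_id].
Qed.

Definition jet (c : R) (phi : 'rV[R]_n -> R) x := (phi x - c) ^+ 2 + \sum_i partial i phi x ^+ 2.

Lemma jet_continuous c phi : smooth phi -> continuous (jet c phi).
Proof.
move=> sphi; apply: contD; last by apply: cont_sum => i; apply: contX2; exact: smooth_partial_continuous.
by apply: contX2; apply: contB; [exact: smooth_continuous|exact: contC].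
Qed.

Lemma jet_ge0 c phi x : 0 <= jet c phi x.
Proof. by rewrite addr_ge0 ?sqr_ge0// sumr_ge0// => i _; exact: sqr_ge0. Qed.

(* integrate the derivative of (t - tau) (phi - c)^2 along the segment *)
Lemma trace_line_bound c phi (b e : 'rV[R]_n) (tau : R) : smooth phi -> 0 < tau ->
  ((tau * (phi b - c) ^+ 2)%:E <= (1 + tau + tau * dot e e)%:E *
    \int[lebesgue_measure]_(t in `[0%R, tau]) (jet c phi (b + t *: e)%R)%:E)%E.
Proof.
move=> sphi t0; pose psi t := phi (b + t *: e) - c.
pose dpsi t := \sum_i e ord0 i * partial i phi (b + t *: e).
(* The weight vanishes at tau, so only the value at t = 0 survives the integration. *)
pose F t := (t - tau) * psi t ^+ 2.
pose f t := psi t ^+ 2 + (t - tau) * (2 * psi t * dpsi t).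
have cpsi : continuous psi.
  by apply: contB; [exact: line_continuous (smooth_continuous sphi)|exact: contC].
have cdpsi : continuous dpsi.
  apply: cont_sum => i; apply: contM; first exact: contC.
  exact: line_continuous (smooth_partial_continuous sphi).
have cf : continuous f.
  apply: contD; first exact: contX2.
  apply: contM; first by apply: contB; [move=> t; exact: cvg_id|exact: contC].
  by apply: contM => //; apply: contM => //; exact: contC.
have dF t : is_derive t (1 : R) F (f t).
  have d1 : is_derive t (1 : R) psi (dpsi t).
    have := @is_deriveB _ _ _ _ _ _ _ _ _ (@smooth_is_derive_line R n phi b e t sphi) (is_derive_cst c t 1).
    by rewrite subr0.
  apply: is_derive_eq.
  by rewrite /f /GRing.scale /=; ring.
have cF t : {for t, continuous F}.
  by apply: differentiable_continuous; apply/derivable1_diffP; case: (dF t).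
have FTC : (\int[lebesgue_measure]_(t in `[0%R, tau]) (f t)%:E = (tau * psi 0 ^+ 2)%:E)%E.
  rewrite (@continuous_FTC2 R _ F 0 tau)//.
  - by rewrite /F subrr mul0r sub0r -EFinB sub0r mulNr opprK.
  - exact: continuous_subspaceT.
  - split.
    + by move=> t _; case: (dF t).
    + by apply: cvg_at_right_filter; exact: cF.
    + by apply: cvg_at_left_filter; exact: cF.
  - by move=> t _; rewrite derive1E; case: (dF t).
have ee : 0 <= dot e e by apply: sumr_ge0 => i _; rewrite -expr2 sqr_ge0.
have cj := @line_continuous (jet c phi) b e (@jet_continuous c phi sphi).
have -> : phi b - c = psi 0 by rewrite /psi scale0r addr0.
rewrite -FTC -ge0_integralZl//; last 3 first.
- apply/measurable_EFinP; apply: measurable_funTS; exact: (continuous_measurable_fun cj).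
- by move=> t _; rewrite lee_fin jet_ge0.
- by rewrite lee_fin; apply: addr_ge0; [lra|apply: mulr_ge0 => //; exact: ltW].
have If : lebesgue_measure.-integrable `[0%R, tau] (EFin \o f).
  by apply: continuous_compact_integrable; [exact: segment_compact|exact: continuous_subspaceT].
pose K := 1 + tau + tau * dot e e.
have Ij : lebesgue_measure.-integrable `[0%R, tau] (EFin \o (fun t => K * jet c phi (b + t *: e))).
  apply: continuous_compact_integrable; [exact: segment_compact|apply: continuous_subspaceT].
  by apply: contM; [exact: contC|exact: cj].
apply: le_integral => //.
move=> t /set_mem /=; rewrite in_itv /= => /andP[ta tb]; rewrite lee_fin.
have cs : dpsi t ^+ 2 <= dot e e * \sum_i partial i phi (b + t *: e) ^+ 2.
  have := sum_Cauchy_Schwarz (fun i => e ord0 i) (fun i => partial i phi (b + t *: e)).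
  by rewrite /dot; under [\sum_i e ord0 i * e ord0 i]eq_bigr do rewrite -expr2.
set P := \sum_i _ ^+ 2 in cs.
have P0 : 0 <= P by apply: sumr_ge0 => i _; exact: sqr_ge0.
have y1 : `|2 * psi t * dpsi t| <= psi t ^+ 2 + dpsi t ^+ 2.
  rewrite ler_norml; apply/andP; split.
    by have := sqr_ge0 (psi t + dpsi t); nra.
  by have := sqr_ge0 (psi t - dpsi t); nra.
have y2 : (t - tau) * (2 * psi t * dpsi t) <= tau * (psi t ^+ 2 + dpsi t ^+ 2).
  apply: (le_trans (ler_norm _)); rewrite normrM; apply: ler_pM => //.
  by rewrite ler0_norm ?subr_le0//; lra.
have eP : 0 <= P by [].
apply: (@le_trans _ _ (psi t ^+ 2 + tau * (psi t ^+ 2 + dot e e * P))).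
  rewrite /f lerD2l; apply: (le_trans y2); rewrite ler_pM2l//; lra.
rewrite /jet -/(psi t) -/P /dot -/(dot e e) -subr_ge0.
have -> : (1 + tau + tau * dot e e) * (psi t ^+ 2 + P) - (psi t ^+ 2 + tau * (psi t ^+ 2 + dot e e * P)) =
  P + tau * P + (tau * dot e e) * psi t ^+ 2 by ring.
have s0 := sqr_ge0 (psi t).
apply: addr_ge0; [apply: addr_ge0 => //|apply: mulr_ge0 => //]; apply: mulr_ge0 => //; exact: ltW.
Qed.

End trace_bound.

Section trace_constant.
Context (R : realType) (m : nat).
Variable k : Defs.isometry R m m.+1.
Variable e : 'rV[R]_m.+1.
Hypothesis e0 : e != 0.
Hypothesis ek : e *m (frame k)^T = 0.

Lemma dot_mulmx n (x y : 'rV[R]_n) : dot x y = (x *m y^T) ord0 ord0.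
Proof. by rewrite mxE; apply: eq_bigr => i _; rewrite mxE. Qed.

Lemma dot_gt0 n (x : 'rV[R]_n) : x != 0 -> 0 < dot x x.
Proof.
move=> x0; have d0 : 0 <= dot x x by apply: sumr_ge0 => i _; rewrite -expr2 sqr_ge0.
rewrite lt_neqAle d0 andbT eq_sym; apply: contra x0.
rewrite psumr_eq0 => [/allP h|i _]; last by rewrite -expr2 sqr_ge0.
apply/eqP/rowP => i; rewrite mxE; apply/eqP.
by have := h i (mem_index_enum _); rewrite mulf_eq0 orbb.
Qed.

(** Matrix of the coordinates (t, y) that straighten the flat piece, with t along e. In these
    coordinates [leb] on R^(m+1) is an iterated integral over t and y, up to the factor of
    [ge0_integral_linear]. *)
Definition normal_mx : 'M[R]_m.+1 := (col_mx e (frame k) : 'M[R]_(1 + m, m.+1)).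

Lemma normal_mx_unit : normal_mx \in unitmx.
Proof.
pose N : 'M[R]_(1 + m, m.+1) := col_mx e (frame k).
have E : N *m N^T = block_mx (e *m e^T) 0 0 (1%:M : 'M[R]_m).
  rewrite /N tr_col_mx mul_col_row ek frame_orthonormal.
  congr block_mx; apply: trmx_inj; rewrite trmx_mul trmxK ek trmx0.
  by [].
have : \det (normal_mx *m normal_mx^T) != 0.
  have -> : normal_mx *m normal_mx^T = block_mx (e *m e^T) 0 0 (1%:M : 'M[R]_m) by exact: E.
  rewrite (@det_ublock _ 1 m) det1 mulr1 det_mx11 -dot_mulmx.
  by rewrite gt_eqF// dot_gt0.
by rewrite det_mulmx mulf_eq0 negb_or => /andP[h _]; rewrite unitmxE unitfE.
Qed.

Lemma rV_cons_normal t (y : 'rV[R]_m) :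
  base k + rV_cons t y *m normal_mx = emb k y + t *: e.
Proof.
have -> : rV_cons t y = row_mx (t%:M : 'M[R]_1) y :> 'rV[R]_(1 + m).
  apply/rowP => i; rewrite [LHS]mxE; have [j ij|i0] := unliftP ord0 i.
    rewrite /= (_ : i = rshift 1 j); last by rewrite ij; apply/val_inj.
    by rewrite row_mxEr.
  rewrite /= (_ : i = lshift m ord0); last by rewrite i0; apply/val_inj.
  by rewrite row_mxEl mxE eqxx.
by rewrite /normal_mx (@mul_row_col _ 1 1 m) mul_scalar_mx addrA addrAC.
Qed.

Lemma emb_continuous p q (h : Defs.isometry R p q) : continuous (emb h).
Proof.
move=> y; apply: rV_continuousP => i.
rewrite (_ : (fun t => _) = (fun t : 'rV[R]_p => base h ord0 i + \sum_j t ord0 j * frame h j i)); last first.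
  by apply/funext => t; rewrite !mxE.
apply: (@contD R _ (fun=> base h ord0 i) (fun y : 'rV[R]_p => \sum_j y ord0 j * frame h j i)); first exact: contC.
by apply: cont_sum => j; apply: contM; [exact: coord_cont|exact: contC].
Qed.

(** [trace_line_bound] integrated over N, the lines in direction e filling a cylinder inside D. The
    constant depends on the height tau of the cylinder; this is harmless, because the estimate is
    only used to identify traces. *)
Lemma trace_bound (D : set 'rV[R]_m.+1) (N : set 'rV[R]_m) (c tau : R) : measurable D -> measurable N ->
  0 < tau -> (forall y t, N y -> 0 < t < tau -> D (emb k y + t *: e)) ->
  exists2 C : R, 0 <= C & forall phi, smooth phi ->
    (\int[leb R m]_(y in N) ((phi (emb k y) - c) ^+ 2)%:E <=
     C%:E * \int[leb R m.+1]_(x in D) (jet c phi x)%:E)%E.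
Proof.
move=> mD mN t0 ND.
have [C C0 hC] := ge0_integral_linear normal_mx_unit.
set K := 1 + tau + tau * dot e e.
have ee : 0 <= dot e e by apply: sumr_ge0 => i _; rewrite -expr2 sqr_ge0.
have K0 : 0 <= K by apply: addr_ge0; [lra|apply: mulr_ge0 => //; exact: ltW].
exists (tau^-1 * K * C); first by rewrite !mulr_ge0// invr_ge0 ltW.
move=> phi sphi.
pose h (z : 'rV[R]_m.+1) : \bar R := (\1_D z * jet c phi z)%:E.
have mjet : measurable_fun setT (jet c phi) by apply: continuous_measurable_rV; exact: jet_continuous.
have mh : measurable_fun setT h by apply/measurable_EFinP; apply: measurable_funM => //; exact: measurable_indic.
have h0 z : (0 <= h z)%E by rewrite lee_fin mulr_ge0// jet_ge0.
pose g (z : 'rV[R]_m.+1) := h (z *m normal_mx + base k).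
have mg : measurable_fun setT g.
  apply: (measurableT_comp mh); apply: measurable_rVD; last exact: measurable_cst.
  exact: measurable_mulmx.
have g0 z : (0 <= g z)%E by exact: h0.
have IG : (\int[leb R m.+1]_z g z = C%:E * \int[leb R m.+1]_(x in D) (jet c phi x)%:E)%E.
  rewrite (hC (fun x => h (x + base k)))//; last first.
    by apply: (measurableT_comp mh); exact: measurable_shift_rV.
  rewrite ge0_integral_leb_shift//; congr (_ * _)%E.
  rewrite [RHS]integral_mkcond; apply: eq_integral => x _.
  by rewrite /h patchE indicE; case: ifP => _; rewrite ?mul1r ?mul0r.
have gE y t : g (rV_cons t y) = h (emb k y + t *: e) by rewrite /g addrC rV_cons_normal.
pose G (p : 'rV[R]_m * measurableTypeR R) := g (rV_cons p.2 p.1).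
have mG : measurable_fun setT G.
  apply: (measurableT_comp mg).
  exact: (measurableT_comp (@measurable_rV_cons R m) (measurable_fun_pair measurable_snd measurable_fst)).
have G0 p : (0 <= G p)%E by exact: g0.
have IG2 : (\int[leb R m]_y \int[@lebesgue_measure R]_t G (y, t) = \int[leb R m.+1]_z g z)%E.
  by rewrite ge0_integral_leb_cons// (@fubini_tonelli _ _ _ _ R (leb R m) (@lebesgue_measure R) G mG G0).
have mF := @measurable_fun_fubini_tonelli_F _ _ _ _ R (@lebesgue_measure R) G mG G0.
have mphik : measurable_fun setT (fun y => phi (emb k y)).
  apply: continuous_measurable_rV => y; apply: (@continuous_comp _ _ _ (emb k) phi).
    exact: emb_continuous.
  exact: smooth_continuous.
have msq : measurable_fun setT (fun y => (phi (emb k y) - c) ^+ 2).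
  by apply: measurable_funX; apply: measurable_funB => //; exact: measurable_cst.
apply: (@le_trans _ _ (\int[leb R m]_(y in N) ((tau^-1 * K)%:E * fubini_F (@lebesgue_measure R) G y))%E); last first.
  apply: (@le_trans _ _ (\int[leb R m]_y ((tau^-1 * K)%:E * fubini_F (@lebesgue_measure R) G y))%E).
    apply: ge0_subset_integral => //.
    - exact: emeasurable_funM.
    - by move=> y _; apply: mule_ge0; [rewrite lee_fin mulr_ge0// invr_ge0 ltW|exact: integral_ge0].
  rewrite ge0_integralZl//; last 2 first.
  - by move=> y _; exact: integral_ge0.
  - by rewrite lee_fin mulr_ge0// invr_ge0 ltW.
  by rewrite [X in (_ * X)%E]IG2 IG muleA.
apply: ge0_le_integral => //.
- by move=> y _; rewrite lee_fin sqr_ge0.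
- by apply/measurable_EFinP; exact: measurable_funTS.
- by apply: measurable_funTS; exact: emeasurable_funM.
move=> y Ny.
have tl := trace_line_bound c (emb k y) e sphi t0.
have le1 : (\int[lebesgue_measure]_(t in `[0%R, tau]) (jet c phi (emb k y + t *: e)%R)%:E <=
    fubini_F (@lebesgue_measure R) G y)%E.
  have mGy : measurable_fun setT (fun t => G (y, t)) := measurableT_comp mG (measurable_pair1 y).
  have mj : measurable_fun (`]0%R, tau[ : set (measurableTypeR R)) (fun t : R => (jet c phi (emb k y + t *: e)%R)%:E).
    apply/measurable_EFinP; apply: measurable_funTS.
    exact: continuous_measurable_fun (@line_continuous _ _ (jet c phi) (emb k y) e (@jet_continuous _ _ c phi sphi)).
  rewrite integral_itv_bndoo//.
  apply: (@le_trans _ _ (\int[lebesgue_measure]_(t in `]0%R, tau[) G (y, t))%E).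
    apply: ge0_le_integral => //.
    - by move=> t _; rewrite lee_fin jet_ge0.
    - by apply: measurable_funTS.
    move=> t /=; rewrite in_itv /= => tt.
    by rewrite /G gE /h indicE mem_set ?mul1r//; exact: ND.
  by apply: ge0_subset_integral.
have := lee_wpmul2l (_ : 0 <= (tau^-1)%:E)%E tl.
rewrite lee_fin invr_ge0 (ltW t0) => /(_ isT).
rewrite -EFinM mulKf ?gt_eqF// => h1; apply: (le_trans h1).
by rewrite muleA -EFinM; apply: lee_wpmul2l; rewrite // lee_fin mulr_ge0// invr_ge0 ltW.
Qed.

(** On D the smooth functions phi_l approximate the constant c in H^1, since f = c and df = 0 there.
    By [trace_bound] their values on N tend to c in L^2, while by definition of the trace they tend
    to g. *)
Lemma trace_eq_const (D : set 'rV[R]_m.+1) (S N : set 'rV[R]_m) f df g (c tau : R) :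
  measurable D -> measurable N -> N `<=` S -> 0 < tau ->
  (forall y t, N y -> 0 < t < tau -> D (emb k y + t *: e)) -> measurable S -> H1 D f df ->
  has_trace D f df (emb k) S g ->
  {ae leb R m.+1, forall x, D x -> f x = c} ->
  (forall i, {ae leb R m.+1, forall x, D x -> df x ord0 i = 0}) ->
  {ae leb R m, forall y, N y -> g y = c}.
Proof.
move=> mD mN NS t0 ND mS [[mf _] dfm _] [[mg _] [phi [sphi h1 h2]]] fc dfc.
have [C C0 hC] := trace_bound c mD mN t0 ND.
have mgN : measurable_fun N g by exact: measurable_funS mg.
have mphik l : measurable_fun setT (fun y => phi l (emb k y)).
  apply: continuous_measurable_rV => y; apply: (@continuous_comp _ _ _ (emb k) (phi l)).
    exact: emb_continuous.
  exact: smooth_continuous.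
pose a l := (\int[leb R m.+1]_(x in D) (jet c (phi l) x)%:E)%E.
pose b l := (\int[leb R m]_(y in S) ((phi l (emb k y) - g y) ^+ 2)%:E)%E.
pose I := (\int[leb R m]_(y in N) ((g y - c) ^+ 2)%:E)%E.
have I0 : (0 <= I)%E by apply: integral_ge0 => y _; rewrite lee_fin sqr_ge0.
have mgc : measurable_fun N (fun y => (g y - c) ^+ 2).
  by apply: measurable_funX; apply: measurable_funB => //; exact: measurable_cst.
have ale l : (a l <= \int[leb R m.+1]_(x in D) ((phi l x - f x) ^+ 2 +
         \sum_i (partial i (phi l) x - df x ord0 i) ^+ 2)%:E)%E.
  have hall : {ae leb R m.+1, forall x, forall i, D x -> df x ord0 i = 0}.
    exact: (@filter_forall _ _ (fun i x => D x -> df x ord0 i = 0) (almost_everywhere (leb R m.+1)) _).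
  apply: ae_ge0_le_integral => //.
  - by move=> x _; rewrite lee_fin jet_ge0.
  - apply/measurable_EFinP; apply: measurable_funTS; apply: continuous_measurable_rV.
    exact: jet_continuous.
  - by move=> x _; rewrite lee_fin addr_ge0 ?sqr_ge0// sumr_ge0// => i _; exact: sqr_ge0.
  - apply/measurable_EFinP; apply: measurable_funD.
      apply: measurable_funX; apply: measurable_funB => //.
      by apply: measurable_funTS; apply: continuous_measurable_rV; exact: smooth_continuous.
    apply: measurable_sum => i; apply: measurable_funX; apply: measurable_funB.
      by apply: measurable_funTS; apply: continuous_measurable_rV; exact: smooth_partial_continuous.
    by case: (dfm i).
  - move: fc hall; apply: filterS2 => x h1' h2' Dx; rewrite lee_fin /jet h1'// lerD2l.
    by apply: ler_sum => i _; rewrite h2'// subr0.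
have le l : (I <= 2%:E * b l + (2 * C)%:E * a l)%E.
  have mpg : measurable_fun N (fun y => (phi l (emb k y) - g y) ^+ 2).
    by apply: measurable_funX; apply: measurable_funB => //; exact: measurable_funTS.
  have mpc : measurable_fun N (fun y => (phi l (emb k y) - c) ^+ 2).
    apply: measurable_funX; apply: measurable_funB; last exact: measurable_cst.
    exact: measurable_funTS.
  apply: (@le_trans _ _ (\int[leb R m]_(y in N) (2%:E * ((phi l (emb k y) - g y) ^+ 2)%:E + 2%:E * ((phi l (emb k y) - c) ^+ 2)%:E))%E).
    apply: ge0_le_integral => //.
    - by move=> y _; rewrite lee_fin sqr_ge0.
    - exact/measurable_EFinP.
    - apply: emeasurable_funD; apply: emeasurable_funM; try exact: measurable_cst.
        exact/measurable_EFinP.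
      exact/measurable_EFinP.
    - move=> y _; rewrite -!EFinM -EFinD lee_fin.
      set p := phi l _; have := sqr_ge0 ((p - g y) + (p - c)).
      by rewrite !expr2; lra.
  rewrite ge0_integralD//; last 4 first.
  - by move=> y _; rewrite mule_ge0// lee_fin ?sqr_ge0.
  - by apply: emeasurable_funM; [exact: measurable_cst|exact/measurable_EFinP].
  - by move=> y _; rewrite mule_ge0// lee_fin ?sqr_ge0.
  - by apply: emeasurable_funM; [exact: measurable_cst|exact/measurable_EFinP].
  rewrite !ge0_integralZl//; [|exact/measurable_EFinP|by move=> y _; rewrite lee_fin sqr_ge0|exact/measurable_EFinP|by move=> y _; rewrite lee_fin sqr_ge0].
  apply: leeD.
    apply: lee_wpmul2l => //; apply: ge0_subset_integral => //.
    - apply/measurable_EFinP; apply: measurable_funX; apply: measurable_funB => //.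
      exact: measurable_funTS.
    - by move=> y _; rewrite lee_fin sqr_ge0.
  by rewrite EFinM -muleA; apply: lee_wpmul2l => //; exact: hC.
have ca : a l @[l --> \oo] --> 0%E.
  apply: (squeeze_cvge (f := cst 0%E) _ _ h1); last exact: cvg_cst.
  by apply: nearW => l; rewrite ale andbT; apply: integral_ge0 => x _; rewrite lee_fin jet_ge0.
have cv : (2%:E * b l + (2 * C)%:E * a l)%E @[l --> \oo] --> 0%E.
  rewrite (_ : 0%E = 2%:E * 0 + (2 * C)%:E * 0 :> \bar R)%E; last by rewrite !mule0 adde0.
  apply: cvgeD; [by rewrite !mule0|by apply: cvgeZl|by apply: cvgeZl].
have cI : (fun _ : nat => I) @ \oo --> 0%E.
  apply: (squeeze_cvge (f := cst 0%E) _ _ cv); last exact: cvg_cst.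
  by apply: nearW => l; rewrite I0 le.
have Iz : I = 0%E by exact: (cvg_unique (@ereal_hausdorff R) (cvg_cst I) cI).
have g2 : sqint (leb R m) N (fun y => g y - c).
  by split; [apply: measurable_funB => //; exact: measurable_cst|rewrite -/I Iz].
have Rz : \int[leb R m]_(y in N) ((g y - c) ^+ 2) = 0 by rewrite /Rintegral -/I Iz.
have := ae_Rint_eq0 mN (sqint_sq g2) (aeW _ (fun y _ => sqr_ge0 _)) Rz.
by apply: filterS => y h Ny; apply/eqP; rewrite -subr_eq0 -sqrf_eq0; apply/eqP; exact: h.
Qed.

End trace_constant.

(** * Planes, polyhedra and half balls *)

Section affine_functions.
Context (R : realType).

Definition aff n (q : 'rV[R]_n * R) (x : 'rV[R]_n) : R := dot q.1 x + q.2.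

(** Nonzero as a function. Nonzero constants are included; their zero set is empty, which provides a
    harmless default plane. *)
Definition aff_nz n (q : 'rV[R]_n * R) := exists x, aff q x != 0.

Lemma dotDr n (a x y : 'rV[R]_n) : dot a (x + y) = dot a x + dot a y.
Proof. by rewrite /dot -big_split; apply: eq_bigr => i _; rewrite mxE mulrDr. Qed.

Lemma dotZr n (a x : 'rV[R]_n) t : dot a (t *: x) = t * dot a x.
Proof. by rewrite /dot mulr_sumr; apply: eq_bigr => i _; rewrite mxE mulrCA. Qed.

Lemma dotC n (a x : 'rV[R]_n) : dot a x = dot x a.
Proof. by apply: eq_bigr => i _; rewrite mulrC. Qed.

Lemma dot0r n (a : 'rV[R]_n) : dot a 0 = 0.
Proof. by rewrite /dot big1// => i _; rewrite mxE mulr0. Qed.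

Lemma dotNr n (a x : 'rV[R]_n) : dot a (- x) = - dot a x.
Proof. by rewrite -scaleN1r dotZr mulN1r. Qed.

Lemma dot_delta n (a : 'rV[R]_n) i : dot a (delta_mx ord0 i) = a ord0 i.
Proof.
rewrite /dot (bigD1 i)//= big1 ?addr0; first by rewrite mxE !eqxx mulr1.
by move=> j /negPf ji; rewrite mxE ji andbF mulr0.
Qed.

Lemma dot_sumr n (I : finType) (a : 'rV[R]_n) (F : I -> 'rV[R]_n) :
  dot a (\sum_i F i) = \sum_i dot a (F i).
Proof. by apply: (big_morph (dot a) (@dotDr n a) (dot0r a)). Qed.

Lemma dot_continuous n (a : 'rV[R]_n) : continuous (dot a).
Proof. by apply: cont_sum => i; apply: contM; [exact: contC|exact: coord_cont]. Qed.

Lemma aff_continuous n (q : 'rV[R]_n * R) : continuous (aff q).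
Proof. by apply: contD; [exact: dot_continuous|exact: contC]. Qed.

Lemma open_aff_neq0 n (q : 'rV[R]_n * R) : open [set x | aff q x != 0].
Proof.
have -> : [set x | aff q x != 0] = aff q @^-1` [set t | t != 0] by [].
by apply: open_comp; [move=> x _; exact: aff_continuous|exact: open_neq].
Qed.

Lemma aff_line n (q : 'rV[R]_n * R) x y t : aff q (x + t *: y) = aff q x + t * dot q.1 y.
Proof. by rewrite /aff dotDr dotZr; ring. Qed.

Lemma aff_generic1 n (q : 'rV[R]_n * R) (B : set 'rV[R]_n) : aff_nz q -> open B -> B !=set0 ->
  B `&` [set x | aff q x != 0] !=set0.
Proof.
move=> [z qz] oB [y By]; have [yz|yn] := eqVneq (aff q y) 0; last by exists y.
have [w qw] : exists w, dot q.1 w != 0.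
  exists (z - y); have := aff_line q y (z - y) 1; rewrite scale1r addrC subrK yz add0r mul1r => <-.
  exact: qz.
have c : (y + t *: w) @[t --> (0 : R)] --> y + 0 *: w.
  by apply: cvgD; [exact: cvg_cst|apply: cvgZr_tmp; exact: cvg_id].
have : \forall t \near (0 : R)^', B (y + t *: w).
  apply: (@cvg_within _ (nbhs (0 : R))); apply: c.
  by rewrite scale0r addr0; exact: open_nbhs_nbhs.
move=> h; have [t [Bt t0]] : exists t, B (y + t *: w) /\ t != 0.
  near (0 : R)^' => t; exists t; split; first by near: t.
  by near: t; exact: nbhs_dnbhs_neq.
by exists (y + t *: w); split => //=; rewrite aff_line yz add0r mulf_neq0.
Unshelve. all: by end_near.
Qed.

Lemma aff_generic n (s : seq ('rV[R]_n * R)) (B : set 'rV[R]_n) :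
  (forall q, q \in s -> aff_nz q) -> open B -> B !=set0 ->
  exists y, B y /\ forall q, q \in s -> aff q y != 0.
Proof.
elim: s B => [|q s IH] B qn oB B0; first by case: B0 => y By; exists y.
have [|||] := IH (B `&` [set x | aff q x != 0]).
- by move=> q' q's; apply: qn; rewrite in_cons q's orbT.
- by apply: openI => //; exact: open_aff_neq0.
- by apply: aff_generic1 => //; apply: qn; rewrite mem_head.
by move=> y [[By iy] h]; exists y; split => // j; rewrite in_cons => /orP[/eqP ->|/h].
Qed.

Lemma finite_min (I : finType) (P : pred I) (f : I -> R) : (forall i, P i -> 0 < f i) ->
  exists2 e, 0 < e & forall i, P i -> e <= f i.
Proof.
move=> h; exists (\big[Num.min/1]_(i | P i) f i); first exact: lt_bigmin.
by move=> i Pi; exact: bigmin_le_cond.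
Qed.

(* If the vertices carrying positive weight span R^n affinely, then x can be
   moved in every direction by perturbing their weights. *)
Lemma conv_hull_interior n m (p : 'I_m -> 'rV[R]_n) :
  exists2 q : {set 'I_m} -> 'rV[R]_n * R, forall S, aff_nz (q S) &
    forall x, conv_hull p x -> (forall S, aff (q S) x != 0) -> interior (conv_hull p) x.
Proof.
pose van (S : {set 'I_m}) (q : 'rV[R]_n * R) := forall i, i \in S -> aff q (p i) = 0.
(* If the vertices in S lie on a hyperplane, [q S] is such a hyperplane; otherwise it is the
   constant one. *)
have /choice[q hq] : forall S : {set 'I_m}, exists q, aff_nz q /\
    ((exists q', aff_nz q' /\ van S q') -> van S q).
  move=> S; have [[q' [qz qv]]|nq] := pselect (exists q', aff_nz q' /\ van S q').
    by exists q'.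
  exists (0, 1); split => //; exists 0; rewrite /aff /= dot0r add0r; exact: oner_neq0.
exists q => [S|]; first by case: (hq S).
move=> x [w [w0 w1 xE]] hx; pose S := [set i | 0 < w i]%SET.
have affx q' : aff q' x = \sum_i w i * aff q' (p i).
  rewrite /aff; under [RHS]eq_bigr do rewrite mulrDr.
  rewrite big_split /= -mulr_suml w1 mul1r xE dot_sumr; congr (_ + _).
  by apply: eq_bigr => i _; rewrite dotZr.
have nS : ~ exists q', aff_nz q' /\ van S q'.
  move=> h; have [_ /(_ h) v] := hq S; have := hx S; rewrite affx big1 ?eqxx// => i _.
  have [iS|] := boolP (i \in S); first by rewrite v// mulr0.
  by rewrite inE -leNgt => wi; rewrite (_ : w i = 0) ?mul0r//; apply/eqP; rewrite eq_le wi w0.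
(* The rows (1, p_i) with i in S. A column vector annihilated by P is an affine function vanishing
   at these vertices; as none exists, P has full column rank. *)
pose P : 'M[R]_(m, 1 + n) := \matrix_i (if i \in S then row_mx 1%:M (p i) else 0).
have fP : row_full P.
  apply: contrapT => /negP nf; apply: nS.
  have ck0 : cokermx P != 0.
    rewrite -mxrank_eq0 mxrank_coker subn_eq0 -ltnNge ltn_neqAle rank_leq_col andbT.
    by move: nf; rewrite /row_full.
  have [j cj] : exists j, col j (cokermx P) != 0.
    apply: contrapT => /forallNP h; move: ck0 => /eqP; apply; apply/matrixP => a b.
    have /negP/negPn/eqP/colP/(_ a) := h b; by rewrite !mxE.
  set v := col j (cokermx P) in cj.
  have Pv : P *m v = 0 by rewrite /v colE mulmxA mulmx_coker mul0mx.
  pose q' : 'rV[R]_n * R := ((dsubmx (v : 'cV[R]_(1 + n)))^T, (usubmx (v : 'cV[R]_(1 + n))) ord0 ord0).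
  have rowP' i : i \in S -> row_mx 1%:M (p i) *m v = 0.
    move=> iS; have : row i (P *m v) = 0 by rewrite Pv row0.
    by rewrite row_mul rowK iS.
  have affE y : aff q' y = (row_mx 1%:M y *m v) ord0 ord0.
    rewrite -[in RHS](vsubmxK (v : 'cV[R]_(1 + n))) mul_row_col mul1mx mxE addrC /aff /=; congr (_ + _).
    by rewrite mxE; apply: eq_bigr => i _; rewrite mxE mulrC.
  exists q'; split; last by move=> i iS; rewrite affE rowP'// mxE.
  apply: contrapT => /forallNP h.
  have h0 y : aff q' y = 0 by apply/eqP; apply: contrapT => /negP; exact: h.
  have b0 : q'.2 = 0 by have := h0 0; rewrite /aff dot0r add0r.
  have a0 : q'.1 = 0.
    by apply/rowP => i; rewrite [RHS]mxE; have := h0 (delta_mx ord0 i); rewrite /aff b0 addr0 dot_delta.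
  move: cj => /eqP; apply; rewrite -(vsubmxK (v : 'cV[R]_(1 + n))).
  have -> : usubmx (v : 'cV[R]_(1 + n)) = 0.
    by apply/matrixP => i j'; rewrite !ord1 [RHS]mxE; exact: b0.
  have -> : dsubmx (v : 'cV[R]_(1 + n)) = 0 by apply: trmx_inj; rewrite [LHS]a0 trmx0.
  exact: col_mx0.
(* v M is a change of the weights with total zero that moves the point by v. It depends linearly on
   v, so a small v keeps the positive weights positive. *)
pose M : 'M[R]_(n, m) := row_mx 0 1%:M *m pinvmx P.
have MP (v : 'rV[R]_n) : v *m M *m P = row_mx 0 v.
  rewrite /M mulmxA mul_mx_row mulmx0 mulmx1 mulmxKpV//; exact: submx_full.
have [K K0 hK] := mulmx_ball M.
have wS i : i \in S -> 0 < w i by rewrite inE.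
have [e e0 he] := @finite_min _ (mem S) w wS.
apply/nbhs_ballP; exists (e / K) => /=; first exact: divr_gt0.
move=> y xy; pose v := y - x.
have bv : ball (0 : 'rV[R]_n) (e / K) v.
  by move: xy; rewrite -!ball_normE /= /v sub0r normrN distrC.
have := hK _ v (divr_gt0 e0 K0) bv; rewrite mulrC divfK ?gt_eqF// => bc.
pose c := v *m M.
have sumP : \sum_(i in S) c ord0 i *: (row_mx 1%:M (p i) : 'rV[R]_(1 + n)) = row_mx 0 v.
  rewrite -MP -/c mulmx_sum_row [RHS](bigID (mem S)) /= [X in _ = _ + X]big1 ?addr0.
    by apply: eq_bigr => i iS; rewrite rowK iS.
  by move=> i /negPf iS; rewrite rowK iS scaler0.
have s1 : \sum_(i in S) c ord0 i = 0.
  transitivity (lsubmx (\sum_(i in S) c ord0 i *: (row_mx 1%:M (p i) : 'rV[R]_(1 + n))) ord0 ord0); last first.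
    by rewrite sumP row_mxKl mxE.
  rewrite mxE summxE; apply: eq_bigr => i _.
  by rewrite [RHS]mxE row_mxEl [X in _ * X]mxE eqxx mulr1.
have s2 : \sum_(i in S) c ord0 i *: p i = v.
  have := congr1 rsubmx sumP; rewrite row_mxKr => <-; rewrite linear_sum /=.
  by apply: eq_bigr => i _; rewrite linearZ /= row_mxKr.
exists (fun i => w i + (if i \in S then c ord0 i else 0)); split.
- move=> i; case: ifPn => [iS|_]; last by rewrite addr0.
  have := he i iS; move: bc => /(rV_ballP _ _ e0)/(_ i); rewrite mxE sub0r normrN -/c.
  by rewrite ltr_norml => /andP[h1 _] h2; move: (w i) (c ord0 i) h1 h2 => a b h1 h2; lra.
- by rewrite big_split /= w1 -big_mkcond /= s1 addr0.
- under eq_bigr do rewrite scalerDl; rewrite big_split /= -xE.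
  have -> : \sum_i (if i \in S then c ord0 i else 0) *: p i = v; last first.
    exact: (esym (etrans (addrC _ _) (subrK _ _))).
  by rewrite -s2 [RHS]big_mkcond; apply: eq_bigr => i _; case: ifP => // _; rewrite scale0r.
Qed.

End affine_functions.

(** * Lipschitz domains, segments and orthonormal frames *)

Section euclidean_topology.
Context (R : realType).

Lemma dot_ge0 n (x : 'rV[R]_n) : 0 <= dot x x.
Proof. by apply: sumr_ge0 => i _; rewrite -expr2 sqr_ge0. Qed.

Lemma dotBB n (x y : 'rV[R]_n) t :
  dot (x - t *: y) (x - t *: y) = dot x x - 2 * t * dot x y + t ^+ 2 * dot y y.
Proof.
rewrite /dot !mulr_sumr -sumrB -big_split; apply: eq_bigr => i _ /=.
by rewrite !mxE; ring.
Qed.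

Lemma enorm_sqr n (x : 'rV[R]_n) : enorm x ^+ 2 = dot x x.
Proof. by rewrite /enorm sqr_sqrtr// dot_ge0. Qed.

Lemma enorm_ge0 n (x : 'rV[R]_n) : 0 <= enorm x.
Proof. exact: sqrtr_ge0. Qed.

Lemma dot_CS n (x y : 'rV[R]_n) : `|dot x y| <= enorm x * enorm y.
Proof.
rewrite -sqrtr_sqr /enorm -sqrtrM ?dot_ge0//; apply: ler_wsqrtr.
have := sum_Cauchy_Schwarz (fun i => x ord0 i) (fun i => y ord0 i).
by rewrite /dot; under [\sum_i x ord0 i * x ord0 i]eq_bigr do rewrite -expr2;
  under [\sum_i y ord0 i * y ord0 i]eq_bigr do rewrite -expr2.
Qed.

Lemma enorm_bound n (x : 'rV[R]_n) e : 0 <= e -> (forall i, `|x ord0 i| <= e) ->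
  enorm x <= n%:R * e.
Proof.
move=> e0 h; rewrite -(ger0_norm (mulr_ge0 (ler0n R n) e0)) -sqrtr_sqr; apply: ler_wsqrtr.
apply: (@le_trans _ _ (\sum_(i < n) e ^+ 2)).
  apply: ler_sum => i _; rewrite -expr2 -(@real_normK _ (x ord0 i)) ?num_real//.
  by rewrite lerXn2r ?nnegrE.
rewrite sumr_const card_ord exprMn -[leLHS]mulr_natl ler_wpM2r ?sqr_ge0//.
by rewrite -natrX ler_nat; case: n {x h} => // n; rewrite expnS expn1 leq_pmulr.
Qed.

Lemma coord_le_enorm n (x : 'rV[R]_n) i : `|x ord0 i| <= enorm x.
Proof.
rewrite -sqrtr_sqr; apply: ler_wsqrtr; rewrite /dot (bigD1 i)//= -expr2 lerDl.
by apply: sumr_ge0 => j _; rewrite -expr2 sqr_ge0.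
Qed.

Lemma ball_enorm n (x y : 'rV[R]_n) e : 0 < e -> ball x e y -> enorm (y - x) <= n%:R * e.
Proof.
move=> e0 /(rV_ballP _ _ e0) h; apply: enorm_bound; first exact: ltW.
by move=> i; rewrite !mxE distrC ltW.
Qed.

Lemma enorm_ball n (x y : 'rV[R]_n) e : 0 < e -> enorm (y - x) < e -> ball x e y.
Proof.
move=> e0 h; apply/rV_ballP => // i; apply: le_lt_trans h.
by have := coord_le_enorm (y - x) i; rewrite !mxE distrC.
Qed.

(** A boundary point x lies on or below the graph that bounds D. The points x - t e are then
    strictly below it and, the graph being Lipschitz, away from D; so x is not interior to the
    closure. This rules out slits and punctures. *)
Lemma lipschitz_interior n (D : set 'rV[R]_n) : open D -> lipschitz_boundary D ->
  interior (closure D) = D.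
Proof.
move=> oD lD; apply/seteqP; split => x; last first.
  move=> Dx; apply: (@filterS _ (nbhs x) _ D); first exact: subset_closure.
  exact: open_nbhs_nbhs.
move=> ix; apply: contrapT => nDx.
have bx : boundary D x.
  split; first exact: interior_subset ix.
  by move=> /interior_subset.
have [e [g [k [r [e1 r0 gL hD]]]]] := lD x bx.
have ee : dot e e = 1 by rewrite -enorm_sqr e1 expr1n.
pose pr y := y - dot y e *: e.
have prx t : pr (x - t *: e) = pr x.
  rewrite /pr (dotC _ e) dotDr dotNr dotZr ee mulr1 (dotC e x).
  by apply/rowP => i; rewrite !mxE; ring.
have gx : dot x e <= g (pr x).
  rewrite leNgt; apply/negP => h; apply: nDx; apply/(hD x) => //.
  by rewrite subrr /enorm dot0r sqrtr0.
(* At a point differing from x - t e by w, the height exceeds that of x - t e by at most |w| and the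
   graph is lower by at most 2 |k| |w|, so (1 + 2 |k|) |w| < t excludes it from D. The factor n + 1
   converts sup norm balls to Euclidean lengths. *)
pose K := (1 + 2 * `|k|) * (n%:R + 1).
have K0 : 0 < K by rewrite mulr_gt0// ltr_wpDl.
have ck : forall t, 0 < t < r / 2 -> ~ closure D (x - t *: e).
  move=> t /andP[t0 tr] cl.
  pose eta := Num.min (t / K / 2) (r / 2 / (n%:R + 1)).
  have n1 : 0 < n%:R + 1 :> R by rewrite ltr_wpDl.
  have eta0 : 0 < eta by rewrite lt_min !divr_gt0.
  have [y [Dy by_]] := cl _ (nbhsx_ballx (x - t *: e) eta eta0).
  have yb : enorm (y - (x - t *: e)) <= n%:R * eta by exact: ball_enorm.
  set w := y - (x - t *: e) in yb.
  have wle : enorm w * K < t * (n%:R + 1).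
    apply: (@le_lt_trans _ _ (n%:R * eta * K)); first by rewrite ler_wpM2r// ltW.
    have : eta <= t / K / 2 by rewrite ge_min lexx.
    move=> h; have h2 : eta * K <= t / 2 by move: h; rewrite ler_pdivlMr// ler_pdivlMr//; lra.
    rewrite -mulrA; apply: (@le_lt_trans _ _ (n%:R * (t / 2))); first by rewrite ler_wpM2l.
    have n0 : 0 <= n%:R :> R by [].
    by nra.
  have wle2 : enorm w * (1 + 2 * `|k|) < t by move: wle; rewrite /K mulrA ltr_pM2r.
  have wr : enorm w < r / 2.
    apply: (le_lt_trans yb); apply: (@lt_le_trans _ _ ((n%:R + 1) * eta)).
      by rewrite ltr_pM2r// ltrDl.
    have : eta <= r / 2 / (n%:R + 1) by rewrite ge_min lexx orbT.
    by rewrite ler_pdivlMr// mulrC.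
  have yE : y - x = w - t *: e by rewrite /w; apply/rowP => i; rewrite !mxE; ring.
  have tri : enorm (y - x) < r.
    rewrite /enorm -(ger0_norm (ltW r0)) -sqrtr_sqr ltr_sqrt ?exprn_gt0// yE.
    have -> : dot (w - t *: e) (w - t *: e) = dot w w - 2 * t * dot w e + t ^+ 2.
      by rewrite dotBB ee mulr1.
    have h1 := dot_CS w e; rewrite e1 mulr1 in h1.
    have h2 := enorm_sqr w; have h3 := enorm_ge0 w.
    rewrite -h2; have h4 : - dot w e <= enorm w by move: h1; rewrite ler_norml => /andP[h _]; lra.
    by nra.
  have := (hD y tri).1 Dy; rewrite -/(pr y) => hg.
  have l1 : dot y e <= dot x e - t + enorm w.
    have := dot_CS w e; rewrite e1 mulr1 ler_norml => /andP[_].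
    rewrite /w (dotC _ e) dotDr dotNr dotDr dotNr dotZr ee mulr1 (dotC e y) (dotC e x); lra.
  have l2 : `|g (pr y) - g (pr x)| <= `|k| * (2 * enorm w).
    apply: (le_trans (gL _ _)); rewrite -(prx t).
    have -> : pr y - pr (x - t *: e) = w - dot w e *: e.
      have -> : dot w e = dot y e - dot (x - t *: e) e by rewrite /w !(dotC _ e) dotDr dotNr.
      by rewrite /pr /w; apply/rowP => i; rewrite !mxE; ring.
    apply: (@le_trans _ _ (`|k| * enorm (w - dot w e *: e))).
      by rewrite ler_wpM2r ?enorm_ge0// ler_norm.
    rewrite ler_wpM2l//.
    have : dot (w - dot w e *: e) (w - dot w e *: e) <= (2 * enorm w) ^+ 2.
      have -> : dot (w - dot w e *: e) (w - dot w e *: e) = dot w w - dot w e ^+ 2.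
        by rewrite dotBB ee; ring.
      by have := enorm_sqr w; have := enorm_ge0 w; have := sqr_ge0 (dot w e); nra.
    move=> h; rewrite /enorm -/(enorm w) -(ger0_norm (mulr_ge0 (ler0n R 2) (enorm_ge0 w))) -sqrtr_sqr.
    exact: ler_wsqrtr.
  have l3 : g (pr x) - `|k| * (2 * enorm w) <= g (pr y).
    by move: l2; rewrite ler_norml => /andP[h _]; lra.
  by nra.
have [eta eta0 heta] : exists2 eta, 0 < eta & ball x eta `<=` closure D.
  by move: ix => /nbhs_ballP[eta /= eta0 h]; exists eta.
pose t := Num.min (r / 4) (eta / 2).
have t0 : 0 < t by rewrite lt_min !divr_gt0.
apply: (ck t).
  by rewrite t0 /=; apply: (@le_lt_trans _ _ (r / 4)); [rewrite ge_min lexx|lra].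
apply: heta; apply: enorm_ball => //.
rewrite (_ : x - t *: e - x = (- t) *: e); last by apply/rowP => i; rewrite !mxE; ring.
rewrite /enorm dotZr (dotC _ e) dotZr ee mulr1 -expr2 sqrtr_sqr normrN ger0_norm ?ltW//.
by apply: (@le_lt_trans _ _ (eta / 2)); [rewrite ge_min lexx orbT|lra].
Qed.

Definition segment n (x y : 'rV[R]_n) := (fun t : R => x + t *: (y - x)) @` `[0%R, 1%R].

Lemma segment_conn n (x y : 'rV[R]_n) : connected (segment x y).
Proof.
apply: connected_continuous_connected; first exact: segment_connected.
apply: continuous_subspaceT => t.
by apply: cvgD; [exact: cvg_cst|apply: cvgZr_tmp; exact: cvg_id].
Qed.

Lemma segment_l n (x y : 'rV[R]_n) : segment x y x.
Proof. by exists 0; rewrite /= ?in_itv /= ?lexx ?ler01// scale0r addr0. Qed.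

Lemma segment_r n (x y : 'rV[R]_n) : segment x y y.
Proof. by exists 1; rewrite /= ?in_itv /= ?lexx ?ler01// scale1r addrC subrK. Qed.

Lemma segment_convex n (B : set 'rV[R]_n) x y : convex_rV B -> B x -> B y -> segment x y `<=` B.
Proof.
move=> cB Bx By z [t /=]; rewrite in_itv /= => /andP[t0 t1] <-.
exact: (cB y x t By Bx).
Qed.

(** The third hypothesis makes D relatively closed in B as well as open, and the segment from p to
    any point of B is connected. *)
Lemma convex_dichotomy n (B D : set 'rV[R]_n) p : convex_rV B -> open D ->
  (forall y, B y -> closure D y -> D y) -> B p -> D p -> B `<=` D.
Proof.
move=> cB oD h Bp Dp q Bq.
have E : segment p q `&` D = segment p q.
  apply: (segment_conn (x := p) (y := q)).
  - by exists p; split => //; exact: segment_l.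
  - by exists D.
  - exists (closure D); first exact: closed_closure.
    apply/seteqP; split => z [sz Dz]; split => //; first exact: subset_closure.
    by apply: h => //; exact: segment_convex sz.
by have := segment_r p q; rewrite -E => -[].
Qed.

(** If no point of F on the segment were a limit of points of the segment outside F, then F would be
    relatively open and closed in the segment. *)
Lemma exit_point n (F : set 'rV[R]_n) p q : closed F -> F p -> ~ F q ->
  exists2 x, segment p q x /\ F x & closure (segment p q `\` F) x.
Proof.
move=> cF Fp Fq; apply: contrapT => /forall2NP h.
suff E : segment p q `&` F = segment p q by apply: Fq; have := segment_r p q; rewrite -E => -[].
apply: (segment_conn (x := p) (y := q)).
- by exists p; split => //; exact: segment_l.
- exists (~` closure (segment p q `\` F)); first by rewrite openC; exact: closed_closure.
  apply/seteqP; split => z [sz Fz]; split => //.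
    by have [nh|nh] := h z; [case: nh|exact: nh].
  by apply: contrapT => nF; apply: Fz; apply: subset_closure.
- by exists F.
Qed.

(** A Householder reflection maps the first basis vector to the normalised a; its remaining rows
    form the frame. *)
Lemma exists_frame m (a : 'rV[R]_m.+1) : a != 0 ->
  exists k : 'M[R]_(m, m.+1), k *m k^T = 1%:M /\ a *m k^T = 0.
Proof.
move=> a0; have aa := dot_gt0 a0.
pose na := enorm a; have na0 : 0 < na by rewrite sqrtr_gt0.
have na2 : na ^+ 2 = dot a a by exact: enorm_sqr.
pose b := na^-1 *: a; pose d0 : 'rV[R]_m.+1 := delta_mx ord0 ord0.
have bb : dot b b = 1.
  by rewrite /b dotZr dotC dotZr mulrA -na2 expr2; field; rewrite gt_eqF.
have dd : dot d0 d0 = 1 by rewrite dot_delta mxE !eqxx.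
have [Q [Qo Qb]] : exists Q : 'M[R]_m.+1, Q *m Q^T = 1%:M /\ d0 *m Q = b.
  pose u := b - d0.
  have [u0|un] := eqVneq u 0.
    by exists 1%:M; rewrite trmx1 !mulmx1; split => //; apply/eqP; rewrite eq_sym -subr_eq0 -/u u0.
  have uu := dot_gt0 un; set s := dot u u in uu.
  have uT : u *m u^T = s%:M.
    by apply/matrixP => i j; rewrite !ord1 -dot_mulmx mxE eqxx.
  exists (1%:M - (2 / s) *: (u^T *m u)).
  have sym : (1%:M - (2 / s) *: (u^T *m u))^T = 1%:M - (2 / s) *: (u^T *m u).
    by rewrite linearB /= trmx1 linearZ /= trmx_mul trmxK.
  rewrite sym; split.
    have PP : (u^T *m u) *m (u^T *m u) = s *: (u^T *m u).
      by rewrite mulmxA -(mulmxA u^T u) uT mul_mx_scalar scalemxAl.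
    rewrite mulmxBl mul1mx -scalemxAl [_ *m (1%:M - _)]mulmxBr mulmx1 -scalemxAr PP.
    by apply/matrixP => i j; rewrite !mxE; field; rewrite gt_eqF.
  rewrite mulmxBr mulmx1 -scalemxAr mulmxA.
  have -> : d0 *m u^T = (dot d0 u)%:M.
    by apply/matrixP => i j; rewrite !ord1 -dot_mulmx mxE eqxx.
  rewrite mul_scalar_mx scalerA.
  have sE : s = - 2 * dot d0 u.
    by rewrite /s /u -(scale1r d0) dotBB bb dd scale1r dotDr dotNr dd (dotC b); ring.
  have du : 2 / s * dot d0 u = -1.
    have dn : dot d0 u != 0 by apply: contraTneq uu => e; rewrite sE e mulr0 ltxx.
    by rewrite sE; field.
  by rewrite du scaleN1r opprK /u addrC subrK.
pose k : 'M[R]_(m, m.+1) := dsubmx (Q : 'M[R]_(1 + m, m.+1)).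
have E : (Q : 'M[R]_(1 + m, m.+1)) *m (Q : 'M[R]_(1 + m, m.+1))^T = 1%:M by exact: Qo.
exists k; split.
  have := congr1 (@drsubmx _ 1 m 1 m) E.
  rewrite -[Q in Q *m _](@vsubmxK _ 1 m) -[Q in (Q)^T](@vsubmxK _ 1 m) tr_col_mx mul_col_row block_mxKdr.
  by move=> ->; rewrite (@scalar_mx_block _ 1 m) block_mxKdr.
have d0k : d0 *m Q *m k^T = 0.
  have := congr1 (@ursubmx _ 1 m 1 m) E.
  rewrite -[Q in Q *m _](@vsubmxK _ 1 m) -[Q in (Q)^T](@vsubmxK _ 1 m) tr_col_mx mul_col_row block_mxKur.
  rewrite (@scalar_mx_block _ 1 m) block_mxKur => h.
  have -> : d0 *m Q = usubmx (Q : 'M[R]_(1 + m, m.+1)); last exact: h.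
  by rewrite -rowE; apply/rowP => j; rewrite !mxE; congr (Q _ j); apply/val_inj.
have -> : a = na *: (d0 *m Q) by rewrite Qb /b scalerA divff ?gt_eqF// scale1r.
by rewrite -scalemxAl d0k scaler0.
Qed.

End euclidean_topology.

(** * Functions with vanishing weak gradient *)

Section weakly_constant.
Context (R : realType) (n : nat).
Local Notation mu := (leb R n).
Implicit Types (D : set 'rV[R]_n) (f : 'rV[R]_n -> R).

Lemma ball_convex (x : 'rV[R]_n) r : 0 < r -> convex_rV (ball x r).
Proof.
move=> r0 y z t /(rV_ballP _ _ r0) hy /(rV_ballP _ _ r0) hz t0 t1; apply/rV_ballP => // i.
rewrite !mxE; have := hy i; have := hz i; rewrite !ltr_norml => /andP[a b] /andP[c e].
set p := x ord0 i - z ord0 i in a b; set q := x ord0 i - y ord0 i in c e.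
have -> : x ord0 i - (z ord0 i + t * (y ord0 i - z ord0 i)) = p + t * (q - p) by rewrite /p /q; ring.
move: p q a b c e => p q a b c e.
have [pq|pq] := leP p q.
  have h : 0 <= t * (q - p) by rewrite mulr_ge0// subr_ge0.
  have h2 : t * (q - p) <= q - p by rewrite ler_piMl// subr_ge0.
  by apply/andP; split; lra.
have h : 0 <= t * (p - q) by rewrite mulr_ge0// subr_ge0 ltW.
have h2 : t * (p - q) <= p - q by rewrite ler_piMl// subr_ge0 ltW.
by apply/andP; split; lra.
Qed.

Lemma ball_bounded (x : 'rV[R]_n) r : bounded_set (ball x r).
Proof.
exists (`|x| + r); split; first exact: num_real.
move=> M hM y; rewrite -ball_normE /= => h; apply: ltW; apply: le_lt_trans hM.
rewrite -[y](subrK x) addrC; apply: (le_trans (ler_normD _ _)); rewrite lerD2l distrC.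
exact: ltW.
Qed.

Lemma ae_const_unique (U : set 'rV[R]_n) f c c' : open U -> U !=set0 ->
  {ae mu, forall x, U x -> f x = c} -> {ae mu, forall x, U x -> f x = c'} -> c = c'.
Proof.
move=> oU U0 h h'; apply: contrapT => cc.
have : {ae mu, forall x, ~ U x} by move: h h'; apply: filterS2 => x a b Ux; apply: cc; rewrite -(a Ux) b.
move=> [N [mN N0 UN]]; have := leb_open_gt0 oU U0.
have : (mu U <= mu N)%E.
  apply: le_measure; rewrite ?inE//; first exact: open_measurable_rV.
  by move=> x Ux; apply: UN => /=; apply.
by rewrite N0 => h1 h2; have := lt_le_trans h2 h1; rewrite ltxx.
Qed.

(** A union of null sets over all x in D need not be null. Only the rational balls are used,
    numbered by [pickle], and those on which f = c almost everywhere still cover D. *)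
Lemma ae_const_cover D f c : (forall x, D x -> exists2 r, 0 < r & {ae mu, forall y, ball x r y -> f y = c}) ->
  {ae mu, forall x, D x -> f x = c}.
Proof.
move=> h.
pose B (p : 'rV[rat]_n * nat) : set 'rV[R]_n := ball (map_mx ratr p.1 : 'rV[R]_n) p.2.+1%:R^-1.
pose P (p : 'rV[rat]_n * nat) := {ae mu, forall y, B p y -> f y = c}.
have : {ae mu, forall y, forall k : nat, if unpickle k is Some p then P p -> B p y -> f y = c else True}.
  apply: ae_foralln => k; case: (unpickle k) => [p|]; last exact: aeW.
  have [Pp|nP] := pselect (P p); first by move: Pp; apply: filterS => y hy _.
  by apply: aeW => y /nP.
apply: filterS => y hy Dy; have [r r0 hr] := h y Dy.
have [q [k [qk sub]]] := rV_rat_ball y r0.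
have := hy (pickle (q, k)); rewrite pickleK; apply => //.
by rewrite /P; move: hr; apply: filterS => z hz Bz; apply: hz; exact: sub.
Qed.

(** The set of points near which f = c is open, and relatively closed in D because two constants
    that hold on overlapping balls agree. *)
Lemma ae_const_connected D f : open D -> connected D -> D !=set0 ->
  (forall x, D x -> exists r c, 0 < r /\ {ae mu, forall y, ball x r y -> f y = c}) ->
  exists c, {ae mu, forall x, D x -> f x = c}.
Proof.
move=> oD cD [x0 Dx0] h; have [r0 [c [r00 hc]]] := h x0 Dx0.
exists c; apply: ae_const_cover.
pose A := [set x | exists2 r, 0 < r & {ae mu, forall y, ball x r y -> f y = c}].
have oA : open A.
  rewrite openE => x [r r1 hr]; apply/nbhs_ballP; exists (r / 2) => /=; first by rewrite divr_gt0.
  move=> y xy; exists (r / 2); first by rewrite divr_gt0.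
  move: hr; apply: filterS => z hz yz; apply: hz.
  by rewrite (splitr r); exact: ball_triangle yz.
suff E : D `&` A = D by move=> x; rewrite -E => -[].
apply: cD.
- by exists x0; split => //; exists r0.
- by exists A.
- exists (closure A); first exact: closed_closure.
  apply/seteqP; split => x [Dx Ax]; split => //; first exact: subset_closure.
  have [r [c' [r1 hr]]] := h x Dx; exists r => //.
  have [y [[r2 r20 hy] xy]] := Ax _ (nbhsx_ballx x r r1).
  suff <- : c' = c by [].
  apply: (@ae_const_unique (ball x r `&` ball y r2) f).
  - by apply: openI; exact: ball_open.
  - by exists y; split => //; exact: ballxx.
  - by move: hr; apply: filterS => z hz [] /hz.
  - by move: hy; apply: filterS => z hz [] _ /hz.
Qed.

Definition H1_approx D f (df : 'rV[R]_n -> 'rV[R]_n) := exists phi : nat -> 'rV[R]_n -> R, (forall l, smooth (phi l)) /\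
  (\int[mu]_(x in D) ((phi l x - f x) ^+ 2 +
         \sum_i (partial i (phi l) x - df x ord0 i) ^+ 2)%:E)%E @[l --> \oo] --> 0%E.

Lemma H1_approx_L2 D (U : set 'rV[R]_n) f df : H1 D f df -> H1_approx D f df -> measurable D -> measurable U ->
  U `<=` D -> L2_approx U f.
Proof.
move=> [[mf _] mdf _] [phi [sphi h]] mD mU UD; exists phi; split => [l|]; first exact: smooth_continuous.
apply: fine_cvg.
apply: (squeeze_cvge (f := cst 0%E) _ _ h); last exact: cvg_cst.
apply: nearW => l; apply/andP; split; first by apply: integral_ge0 => x _; rewrite lee_fin sqr_ge0.
have m1 : measurable_fun D (fun x => (phi l x - f x) ^+ 2).
  apply: measurable_funX; apply: measurable_funB => //.
  by apply: measurable_funTS; apply: continuous_measurable_rV; exact: smooth_continuous.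
apply: (@le_trans _ _ (\int[mu]_(x in D) ((phi l x - f x) ^+ 2)%:E)%E).
  apply: ge0_subset_integral => //; first exact/measurable_EFinP.
  by move=> x _; rewrite lee_fin sqr_ge0.
apply: ge0_le_integral => //.
- by move=> x _; rewrite lee_fin sqr_ge0.
- exact/measurable_EFinP.
- apply/measurable_EFinP; apply: measurable_funD => //.
  apply: measurable_sum => i; apply: measurable_funX; apply: measurable_funB.
    by apply: measurable_funTS; apply: continuous_measurable_rV; exact: smooth_partial_continuous.
  by case: (mdf i).
- by move=> x _; rewrite lee_fin lerDl sumr_ge0// => i _; exact: sqr_ge0.
Qed.

Lemma H1_grad0_const D f df : open D -> connected D -> D !=set0 -> H1 D f df -> H1_approx D f df ->
  {ae mu, forall x, D x -> df x = 0} -> exists c, {ae mu, forall x, D x -> f x = c}.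
Proof.
move=> oD cD D0 H A df0; apply: ae_const_connected => // x Dx.
have [r /= r0 xD] : exists2 r : R, 0 < r & ball x r `<=` D.
  by have /nbhs_ballP[r /= r0 h] := open_nbhs_nbhs (conj oD Dx); exists r.
have mD : measurable D by exact: open_measurable_rV.
have mB := measurable_rV_ball x r.
have [_ mdf _] := H.
have oB : open (ball x r) by exact: ball_open.
have delta0 : 0 <= n%:R * (r + r) by rewrite mulr_ge0// addr_ge0// ltW.
have diam y z : ball x r y -> ball x r z -> dot (y - z) (y - z) <= (n%:R * (r + r)) ^+ 2.
  move=> xy xz; rewrite -enorm_sqr lerXn2r ?nnegrE ?enorm_ge0//.
  apply: ball_enorm; first by rewrite addr_gt0.
  by apply: ball_triangle xy; exact: ball_sym.
have g0 : grad_norm2 (ball x r) df = 0.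
  rewrite /grad_norm2 (@ae_eq_Rint _ _ _ _ _ mB _ (fun=> 0))//.
  - by rewrite Rintegral_cst// mul0r.
  - apply: measurable_sum => i; rewrite (_ : (fun x => _) = (fun x => df x ord0 i * df x ord0 i))//.
    by apply: measurable_funM; have [m _] := mdf i; apply: measurable_funS m.
  - by move: df0; apply: filterS => y h By; rewrite h ?dot0r//; exact: xD.
have [c hc] := grad0_const oB (@ball_bounded x r) (ball_convex r0) (ex_intro _ x (ballxx x r0)) oD xD delta0 diam H
  (H1_approx_L2 H A mD mB xD) g0.
by exists r, c.
Qed.

End weakly_constant.

(** * Charts, planes containing the boundary, and one-sided traces *)

Section square_isometries.
Context (R : realType).

Lemma coords_emb p n (k : Defs.isometry R p n) y : coords k (emb k y) = y.
Proof. by rewrite /coords /emb addrC addKr -mulmxA frame_orthonormal mulmx1. Qed.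

Lemma coords_continuous p n (k : Defs.isometry R p n) : continuous (coords k).
Proof.
move=> x; apply: rV_continuousP => i.
rewrite (_ : (fun t => _) = (fun t : 'rV[R]_n => \sum_j (t ord0 j - base k ord0 j) * (frame k)^T j i)); last first.
  by apply/funext => t; rewrite mxE; apply: eq_bigr => j _; rewrite !mxE.
apply: cont_sum => j; apply: contM; last exact: contC.
by apply: contB; [exact: coord_cont|exact: contC].
Qed.

Lemma emb_conv_hull p n (k : Defs.isometry R p n) m (q : 'I_m -> 'rV[R]_p) :
  conv_hull (emb k \o q) = emb k @` conv_hull q.
Proof.
have E w : \sum_i w i = 1 -> \sum_i w i *: (emb k \o q) i = emb k (\sum_i w i *: q i).
  move=> w1; rewrite /emb mulmx_suml /=; under eq_bigr do rewrite scalerDr.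
  rewrite big_split /= -scaler_suml w1 scale1r; congr (_ + _).
  by apply: eq_bigr => i _; rewrite scalemxAl.
apply/seteqP; split => x.
  by move=> [w [w0 w1 ->]]; rewrite E//; exists (\sum_i w i *: q i) => //; exists w.
by move=> [_ [w [w0 w1 ->]] <-]; exists w; split => //; rewrite E.
Qed.

Lemma image_closure (S T : topologicalType) (f : S -> T) (A : set S) : continuous f ->
  f @` closure A `<=` closure (f @` A).
Proof.
move=> cf _ [x cx <-] B nB; have [y [Ay By]] := cx _ (cf x B nB).
by exists (f y); split => //; exists y.
Qed.

Lemma coords_closure p n (k : Defs.isometry R p n) A x : closure (emb k @` A) x -> closure A (coords k x).
Proof.
move=> h; have := @image_closure _ _ (coords k) (emb k @` A) (@coords_continuous _ _ k).
move=> /(_ (coords k x)) H; have : closure (coords k @` (emb k @` A)) (coords k x) by apply: H; exists x.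
by apply: closure_subset => _ [_ [y Ay <-] <-]; rewrite coords_emb.
Qed.

(** The equality of dimensions is a hypothesis because the chart of a bulk segment has type
    [isometry R (d - 0) d]. *)
Lemma square_emb_coords p n (E : p = n) (k : Defs.isometry R p n) x : emb k (coords k x) = x.
Proof.
subst p; rewrite /emb /coords -mulmxA (mulmx1C (frame_orthonormal k)) mulmx1.
by rewrite addrC subrK.
Qed.

Lemma emb_interior_closure p n (E : p = n) (k : Defs.isometry R p n) (D : set 'rV[R]_p) : open D ->
  lipschitz_boundary D -> interior (closure (emb k @` D)) `<=` emb k @` D.
Proof.
move=> oD lD x ix; exists (coords k x); last exact: square_emb_coords.
rewrite -(lipschitz_interior oD lD).
have : nbhs (coords k x) (emb k @^-1` closure (emb k @` D)).
  by apply: emb_continuous; rewrite square_emb_coords.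
by apply: filterS => y /coords_closure; rewrite coords_emb.
Qed.

(** The boundary lies in finitely many hyperplanes. Off the planes of [conv_hull_interior], a point
    of the closure is interior to one of the polytopes, hence to the closure, hence in the segment
    by the Lipschitz property. *)
Lemma emb_planes p n (E : p = n) (k : Defs.isometry R p n) (D : set 'rV[R]_p) : open D ->
  lipschitz_boundary D -> polyhedral D ->
  exists s : seq ('rV[R]_n * R), (forall q, q \in s -> aff_nz q) /\
    forall x, closure (emb k @` D) x -> (forall q, q \in s -> aff q x != 0) -> (emb k @` D) x.
Proof.
move=> oD lD [N [m [p' hp]]].
have /choice[q hq] : forall l : 'I_N, exists q : {set 'I_m} -> 'rV[R]_n * R, (forall S, aff_nz (q S)) /\
    forall x, conv_hull (emb k \o p' l) x -> (forall S, aff (q S) x != 0) -> interior (conv_hull (emb k \o p' l)) x.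
  by move=> l; have [q h1 h2] := conv_hull_interior (emb k \o p' l); exists q.
exists [seq q l Z | l <- enum 'I_N, Z <- enum {set 'I_m}]; split.
  by move=> _ /allpairsP[[l Z] [_ _ ->]]; case: (hq l) => + _; apply.
move=> x cx hx; apply: (emb_interior_closure E oD lD).
have := coords_closure cx; rewrite hp => -[l _ hl].
have [_ /(_ x)] := hq l; rewrite emb_conv_hull.
have h1 : (emb k @` conv_hull (p' l)) x by exists (coords k x) => //; exact: square_emb_coords.
move=> /(_ h1) h2.
have : interior (emb k @` conv_hull (p' l)) x.
  by apply: h2 => Z; apply: hx; apply/allpairsP; exists (l, Z); rewrite /= !mem_enum.
apply: filterS => y [z hz <-]; apply: (image_closure (@emb_continuous R p n k)).
by exists z => //; rewrite hp; exists l.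
Qed.

Lemma exists_frame_codim1 p n (E : p.+1 = n) (a : 'rV[R]_n) : a != 0 ->
  exists k : 'M[R]_(p, n), k *m k^T = 1%:M /\ a *m k^T = 0.
Proof. by subst n; exact: exists_frame. Qed.

(** Near y' the flat piece lies in the plane through x with normal a, so translating a neighbourhood
    of y' along a sweeps a cylinder inside the half ball, as [trace_eq_const] requires. *)
Lemma one_side_trace p n (E : p.+1 = n) (D : set 'rV[R]_n) f df c (k : Defs.isometry R p n) S g x a r y' :
  open D -> H1 D f df -> {ae leb R n, forall x, D x -> f x = c} ->
  {ae leb R n, forall x, D x -> df x = 0} -> has_trace D f df (emb k) S g -> open S ->
  a != 0 -> [set y | ball x r y /\ 0 < dot a (y - x)] `<=` D -> S y' -> ball x r (emb k y') ->
  (forall y, S y -> ball x r (emb k y) -> dot a (emb k y - x) = 0) ->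
  exists N, [/\ open N, N y' & {ae leb R p, forall y, N y -> g y = c}].
Proof.
subst n; move=> oD H fc dfc tr oS a0 hD Sy By hyp.
have [e /= e0 he] : exists2 e : R, 0 < e & ball (emb k y') e `<=` ball x r.
  have o : open (ball x r) by exact: ball_open.
  by have /nbhs_ballP[e /= e0 h] := open_nbhs_nbhs (conj o By); exists e.
have e20 : 0 < e / 2 by rewrite divr_gt0.
have [rho /= rho0 hrho] : exists2 rho : R, 0 < rho &
    ball y' rho `<=` S `&` (emb k @^-1` ball (emb k y') (e / 2)).
  have : nbhs y' (S `&` (emb k @^-1` ball (emb k y') (e / 2))).
    apply: filterI; first exact: open_nbhs_nbhs.
    by apply: emb_continuous; exact: nbhsx_ballx.
  by case/nbhs_ballP => rho /= rho0 h; exists rho.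
have hN y : ball y' rho y -> dot a (emb k y - x) = 0.
  by move=> /hrho[Sy' hy]; apply: hyp => //; apply: he; apply: le_ball hy; lra.
(* The piece satisfies the plane equation on an open set of parameters, so its directions are
   orthogonal to a. The scalar t only brings the displacement t v into that open set. *)
have ak v : dot a (v *m frame k) = 0.
  pose t := rho / 2 / (1 + `|v|).
  have v1 : 0 < 1 + `|v| by rewrite ltr_pwDl.
  have t0 : 0 < t by rewrite !divr_gt0.
  have b2 : ball y' rho (y' + t *: v).
    rewrite -ball_normE /= opprD addNKr normrN normrZ gtr0_norm//.
    apply: (@le_lt_trans _ _ (rho / 2)); last lra.
    by rewrite /t mulrAC -mulrA ler_piMr ?divr_ge0 ?(ltW rho0)// ler_pdivrMr// mul1r lerDr.
  have h1 := hN _ (ballxx y' rho0); have := hN _ b2.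
  rewrite (_ : emb k (y' + t *: v) - x = (emb k y' - x) + t *: (v *m frame k)); last first.
    by rewrite /emb mulmxDl -scalemxAl; move: (y' *m _) (v *m _) => A B; apply/rowP => i; rewrite !mxE; ring.
  by rewrite dotDr h1 add0r dotZr => /eqP; rewrite mulf_eq0 gt_eqF//= => /eqP.
have akT : a *m (frame k)^T = 0.
  apply/rowP => j; rewrite [RHS]mxE; have := ak (delta_mx ord0 j); rewrite -rowE => <-.
  by rewrite mxE; apply: eq_bigr => l _; rewrite !mxE.
exists (ball y' rho); split; [exact: ball_open|exact: ballxx|].
pose tau := e / 2 / (1 + `|a|).
have a1 : 0 < 1 + `|a| by rewrite ltr_pwDl.
have tau0 : 0 < tau by rewrite !divr_gt0.
apply: (@trace_eq_const R p k a a0 akT D S _ f df g c tau) => //.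
- exact: open_measurable_rV.
- exact: measurable_rV_ball.
- by move=> y /hrho[].
- move=> y t hy /andP[t0 tt]; apply: hD; split; last first.
    rewrite addrAC dotDr hN// add0r dotZr mulr_gt0//; exact: dot_gt0.
  apply: he; have [_ /= hy2] := hrho _ hy.
  rewrite (splitr e); apply: (ball_triangle hy2).
  rewrite -ball_normE /= opprD addNKr normrN normrZ gtr0_norm//.
  apply: (@le_lt_trans _ _ (t * (1 + `|a|))); first by rewrite ler_pM2l// lerDr.
  by rewrite -ltr_pdivlMr.
- exact: open_measurable_rV.
- by move=> i; move: dfc; apply: filterS => y h Dy; rewrite h// mxE.
Qed.

End square_isometries.

Lemma finite_closure_cover (T : topologicalType) (I : finType) (F : I -> set T) x :
  closure (\bigcup_i F i) x -> exists i, closure (F i) x.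
Proof.
move=> h; apply: contrapT => /forallNP nh.
have : \forall y \near x, forall i, ~ F i y.
  apply: (@filter_forall _ _ (fun i y => ~ F i y) (nbhs x) _) => i.
  have := nh i; rewrite /closure /= => /existsNP[B /not_implyP[nB hB]].
  by apply: filterS nB => y By Fy; apply: hB; exists y.
by move=> /h[y [[i _ Fy] hy]]; exact: hy Fy.
Qed.

(** * Half balls on the two sides of a plane *)

Section half_balls.
Context (R : realType) (d : nat) (I : finType) (D : I -> set 'rV[R]_d).
Hypothesis oD : forall i, open (D i).
Variable s : seq ('rV[R]_d * R).
Hypothesis snz : forall q, q \in s -> aff_nz q.
Hypothesis planes : forall i x, closure (D i) x -> (forall q, q \in s -> aff q x != 0) -> D i x.

Definition half_ball (x a : 'rV[R]_d) (r : R) : set 'rV[R]_d := [set y : 'rV[R]_d | ball x r y /\ 0 < dot a (y - x)].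

(** Within the ball the planes of [s] stay in the plane through x with normal a, so none of them
    enters the two open half balls. *)
Definition one_plane (x a : 'rV[R]_d) (r : R) :=
  forall (y : 'rV[R]_d) q, ball x r y -> q \in s -> aff q y = 0 -> dot a (y - x) = 0.

Lemma one_planeN (x a : 'rV[R]_d) (r : R) : one_plane x a r -> one_plane x (- a) r.
Proof. by move=> h y q yx qs qy; rewrite dotC dotNr dotC (h y q)// oppr0. Qed.

Lemma half_ball_convex (x a : 'rV[R]_d) (r : R) : 0 < r -> convex_rV (half_ball x a r).
Proof.
move=> r0 y z t [hy ay] [hz az] t0 t1; split; first exact: ball_convex.
rewrite (_ : z + t *: (y - z) - x = (1 - t) *: (z - x) + t *: (y - x)); last first.
  by apply/rowP => i; rewrite !mxE; ring.
rewrite dotDr !dotZr; have [->|tn] := eqVneq t 0; first by rewrite subr0 mul1r mul0r addr0.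
by rewrite ltr_wpDl ?mulr_ge0 ?subr_ge0// ?(ltW az)// mulr_gt0// lt_neqAle eq_sym tn.
Qed.

(** No plane of [s] enters the half ball, so there the closure of D i adds nothing to D i, and the
    convex half ball lies in D i as soon as it meets its closure. *)
Lemma half_ball_dichotomy (x a : 'rV[R]_d) (r : R) i (p : 'rV[R]_d) : 0 < r -> one_plane x a r -> half_ball x a r p ->
  closure (D i) p -> half_ball x a r `<=` D i.
Proof.
move=> r0 op hp cp.
have h (y : 'rV[R]_d) : half_ball x a r y -> closure (D i) y -> D i y.
  move=> [hy ay] cy; apply: planes => // q qs; apply: contraTneq ay => qy.
  by rewrite (op y q)// ltxx.
exact: (convex_dichotomy (@half_ball_convex x a r r0) (@oD i) h hp (h _ hp cp)).
Qed.

(** A small ball avoids the finitely many planes that miss x, and those through x are contained in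
    the plane of q0. *)
Lemma exists_one_plane x (q0 : 'rV[R]_d * R) : aff q0 x = 0 ->
  (forall q, q \in s -> aff q x = 0 -> forall w, aff q w = 0 -> aff q0 w = 0) ->
  exists2 r, 0 < r & one_plane x q0.1 r.
Proof.
move=> q0x h.
have nT (P : 'rV[R]_d -> Prop) : (forall y, P y) -> nbhs x P.
  by move=> hP; apply: (@filterS _ (nbhs x) _ setT) => [y _|]; [exact: hP|exact: filterT].
have : \forall y \near x, forall q, q \in s -> aff q x != 0 -> aff q y != 0.
  elim: (s) => [|q l IH]; first by apply: nT => y q; rewrite in_nil.
  have hq : \forall y \near x, aff q x != 0 -> aff q y != 0.
    have [qx|qx] := eqVneq (aff q x) 0.
      by apply: nT => y h0; exfalso; move: h0; apply/negP; rewrite negbK; exact/eqP.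
    have : nbhs x [set y | aff q y != 0] by apply: open_nbhs_nbhs; split => //; exact: open_aff_neq0.
    by apply: filterS => y.
  move: hq IH; apply: filterS2 => y h1 h2 q'; rewrite in_cons => /orP[/eqP ->//|]; exact: h2.
case/nbhs_ballP => r /= r0 hr; exists r => // y q xy qs qy.
have qx : aff q x = 0.
  by apply/eqP; apply: contrapT => /negP qx; have := hr _ xy q qs qx; rewrite qy eqxx.
have := h q qs qx y qy; have -> : aff q0 y = aff q0 x + dot q0.1 (y - x).
  by rewrite -(mul1r (dot _ _)) -aff_line scale1r addrC subrK.
by rewrite q0x add0r.
Qed.

Lemma one_plane_two_sides (x a : 'rV[R]_d) (r : R) i : 0 < r -> a != 0 -> one_plane x a r -> closure (D i) x ->
  half_ball x a r `<=` D i \/ half_ball x (- a) r `<=` D i.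
Proof.
move=> r0 a0 op cx.
pose q : 'rV[R]_d * R := (a, - dot a x).
have qE y : aff q y = dot a (y - x) by rewrite /aff /= dotDr dotNr.
have qn : aff_nz q.
  exists (x + a); rewrite qE addrC addKr gt_eqF//; exact: dot_gt0.
have oB : open (D i `&` ball x r) by apply: openI => //; exact: ball_open.
have B0 : D i `&` ball x r !=set0 by have [y [Dy xy]] := cx _ (nbhsx_ballx x r r0); exists y.
have [w [[Dw xw]]] := aff_generic1 qn oB B0; rewrite /= qE => wn.
have [w0|w0] := ltP 0 (dot a (w - x)).
  by left; apply: (half_ball_dichotomy r0 op (p := w)) => //; exact: subset_closure.
right; apply: (half_ball_dichotomy r0 (one_planeN op) (p := w)); last exact: subset_closure.
by split => //; rewrite dotC dotNr dotC oppr_gt0 lt_neqAle wn w0.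
Qed.

Lemma half_ball_closure (x a : 'rV[R]_d) (r : R) (y : 'rV[R]_d) : a != 0 -> ball x r y -> dot a (y - x) = 0 ->
  closure (half_ball x a r) y.
Proof.
move=> a0 xy ay B nB.
have c : (y + t *: a) @[t --> (0 : R)] --> y + 0 *: a.
  by apply: cvgD; [exact: cvg_cst|apply: cvgZr_tmp; exact: cvg_id].
rewrite scale0r addr0 in c.
have oB : open (ball x r) by exact: ball_open.
have : \forall t \near (0 : R), (B `&` ball x r) (y + t *: a).
  apply: c; apply: (@filterI _ (nbhs y)); [exact: nB|exact: open_nbhs_nbhs (conj oB xy)].
case/nbhs_ballP => e /= e0 he; pose t := e / 2.
have t0 : 0 < t by rewrite divr_gt0.
have e2 : ball (0 : R) e t by rewrite -ball_normE /= sub0r normrN gtr0_norm// /t; lra.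
have [By xy'] := he t e2; exists (y + t *: a); split => //; split => //.
have -> : y + t *: a - x = (y - x) + t *: a by rewrite addrAC.
by rewrite dotDr ay add0r dotZr; apply: mulr_gt0 => //; exact: dot_gt0.
Qed.

(* Following a generic segment from the union of the D i, A i, to a far away
   point until it leaves the closure of this union. *)
Lemma exit_half_balls (A : pred I) : (exists2 i, A i & D i !=set0) ->
  (forall i, bounded_set (D i)) -> (0 < d)%N ->
  exists (x a : 'rV[R]_d) (r : R) i, [/\ 0 < r, a != 0, one_plane x a r, A i &
     half_ball x (- a) r `<=` D i /\
     forall i', A i' -> half_ball x a r `&` closure (D i') = set0].
Proof.
move=> [i0 Ai0 D0] bD d0.
pose U := \bigcup_(i in [set i | A i]) D i.
have oU : open U by exact: bigcup_open.
have U0 : U !=set0 by case: D0 => y Dy; exists y, i0.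
have cU x : closure U x -> exists2 i, A i & closure (D i) x.
  move=> h; have : closure (\bigcup_i (if A i then D i else set0)) x.
    by apply: closure_subset h => y [i Ai Dy]; exists i => //; rewrite [A i](Ai : A i = true).
  by case/finite_closure_cover => i; case: ifP => [Ai|_]; [exists i|rewrite closure0].
have bU : exists z, ~ closure U z.
  have [e he] : exists e, forall i, D i `<=` ball 0 e.
    have /choice[f hf] : forall i, exists e, 0 < e /\ D i `<=` ball 0 e.
      by move=> i; have [e e0 h] := bounded_sub_ball (bD i); exists e.
    exists (\sum_i f i) => i y Dy; have [f0 hi] := hf i; apply: le_ball (hi y Dy).
    by rewrite (bigD1 i)//= lerDl sumr_ge0// => j _; case: (hf j) => /ltW.
  pose z : 'rV[R]_d := const_mx (`|e| + 2); exists z => h.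
  have [y [[i _ /he Dy] zy]] := h _ (nbhsx_ballx z 1 ltr01).
  have e0 : 0 < e.
    by rewrite ltNge; apply/negP => e0; move: Dy; rewrite -ball_normE /= sub0r normrN ltNge (le_trans e0).
  have := (rV_ballP _ _ e0).1 Dy (Ordinal d0); have := (rV_ballP _ _ ltr01).1 zy (Ordinal d0).
  rewrite !mxE sub0r normrN !ltr_norml => /andP[a b] /andP[a' b']; rewrite gtr0_norm in a b *; lra.
have [z [ncz sz]] : exists z, ~ closure U z /\ forall q, q \in s -> aff q z != 0.
  have oC : open (~` closure U) by rewrite openC; exact: closed_closure.
  have [z [hz sz]] := aff_generic snz oC bU; by exists z.
(* The combination of q and q' that vanishes at z. If the segment from y to z meets both planes at
   one point other than z, then [h q q'] vanishes at y too. A generic y excludes this unless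
   [h q q'] is identically zero, in which case the two planes coincide. *)
pose h (q q' : 'rV[R]_d * R) : 'rV[R]_d * R :=
  (aff q' z *: q.1 - aff q z *: q'.1, aff q' z * q.2 - aff q z * q'.2).
have hE q q' w : aff (h q q') w = aff q' z * aff q w - aff q z * aff q' w.
  by rewrite /aff /= dotC dotDr dotNr !dotZr !(dotC w) -![dot _ z + _]/(aff _ z) /aff; ring.
pose s2 := [seq q <- [seq h q q' | q <- s, q' <- s] | `[< aff_nz q >]].
have s2nz q : q \in s2 -> aff_nz q by rewrite mem_filter => /andP[/asboolP].
have [y [Uy sy]] := aff_generic s2nz oU U0.
have [x [sx cx] ncx] := exit_point (@closed_closure _ U) (subset_closure Uy) ncz.
have [t t01 xE] := sx.
have [i Ai cix] := cU x cx.
have nDx i' : A i' -> ~ D i' x.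
  move=> Ai' Dx; have [p [[_ np] Dp]] := ncx (D i') (open_nbhs_nbhs (conj (@oD i') Dx)).
  by apply: np; apply: subset_closure; exists i'.
have [q0 q0s q0x] : exists2 q, q \in s & aff q x = 0.
  apply: contrapT => /forall2NP nq; apply: (nDx i Ai); apply: planes => // q qs.
  by apply/eqP => qx; have [] := nq q.
have lin q : aff q x = (1 - t) * aff q y + t * aff q z.
  by rewrite -xE aff_line dotDr dotNr /aff; ring.
have t1 : 1 - t != 0.
  apply/eqP => t1; have := lin q0; rewrite q0x t1 mul0r add0r (_ : t = 1) ?mul1r; last by lra.
  by move=> /esym/eqP; rewrite (negbTE (sz _ q0s)).
have coin q : q \in s -> aff q x = 0 -> forall w, aff q w = 0 -> aff q0 w = 0.
  move=> qs qx w qw.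
  have hy : aff (h q0 q) y = 0.
    apply: (mulfI t1); rewrite mulr0 hE.
    have := lin q; have := lin q0; rewrite q0x qx => e1 e2.
    have e1' : (1 - t) * aff q0 y = - (t * aff q0 z) by lra.
    have e2' : (1 - t) * aff q y = - (t * aff q z) by lra.
    by rewrite mulrBr mulrCA e1' [X in _ - X]mulrCA e2'; ring.
  have hz0 : ~ aff_nz (h q0 q).
    move=> nz; have : h q0 q \in s2.
      by rewrite mem_filter; apply/andP; split; [exact/asboolP|apply/allpairsP; exists (q0, q)].
    by move/sy; rewrite hy eqxx.
  have : aff (h q0 q) w = 0 by apply/eqP; apply: contrapT => /negP nz; apply: hz0; exists w.
  rewrite hE qw mulr0 subr0 => /eqP; rewrite mulf_eq0 => /orP[/eqP qz|/eqP//].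
  by have := sz q qs; rewrite qz eqxx.
have [r r0 op] := exists_one_plane q0x coin.
(* A point of the segment near x and outside the closure of the union; the side on which it lies
   fixes the sign of the normal. It is off the plane of q0, since q0 vanishes at x, not at z, and
   hence at no other point of the segment. *)
have [p [[sp np] xp]] := ncx _ (nbhsx_ballx x r r0).
have q0p : aff q0 p = dot q0.1 (p - x).
  rewrite -[RHS]add0r -q0x -[dot _ _]mul1r -aff_line scale1r addrC subrK//.
have pn : dot q0.1 (p - x) != 0.
  have [t' _ pE] := sp; rewrite -q0p; apply/eqP => q0p0; apply: np.
  have linp : aff q0 p = (1 - t') * aff q0 y + t' * aff q0 z.
    by rewrite -pE aff_line dotDr dotNr /aff; ring.
  have e1 := lin q0; rewrite q0x in e1; rewrite q0p0 in linp.
  have e2 : (t' - t) * (aff q0 z - aff q0 y) = 0 by lra.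
  move/eqP: e2; rewrite mulf_eq0 => /orP[/eqP e2|/eqP e2].
    by have -> : p = x; [rewrite -pE -xE; congr (_ + _ *: _); lra|exact: cx].
  exfalso; have := sz q0 q0s; apply/negP; rewrite negbK; apply/eqP.
  have ey : aff q0 y = aff q0 z by lra.
  by rewrite ey in e1; lra.
have q0n : q0.1 != 0 by apply/eqP => e; move: pn; rewrite e dotC dot0r eqxx.
have fin a : a != 0 -> one_plane x a r -> half_ball x a r p ->
  exists (x a : 'rV[R]_d) (r : R) i, [/\ 0 < r, a != 0, one_plane x a r, A i &
     half_ball x (- a) r `<=` D i /\
     forall i', A i' -> half_ball x a r `&` closure (D i') = set0].
  move=> an opa hp; exists x, a, r, i.
  have dj i' : A i' -> half_ball x a r `&` closure (D i') = set0.
    move=> Ai'; apply: contrapT => /eqP/set0P[w [hw cw]].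
    have sub := half_ball_dichotomy r0 opa hw cw.
    by apply: np; apply: subset_closure; exists i' => //; exact: sub.
  split => //; split => //.
  have [sub|//] := one_plane_two_sides r0 an opa cix.
  exfalso; have := dj i Ai; rewrite -subset0 => /(_ p); apply; split => //.
  by apply: subset_closure; exact: sub.
have [p0|p0] := ltP 0 (dot q0.1 (p - x)); first exact: (fin _ q0n op (conj xp p0)).
apply: (fin (- q0.1)); [by rewrite oppr_eq0|exact: one_planeN|split => //].
by rewrite dotC dotNr dotC oppr_gt0 lt_neqAle pn p0.
Qed.

End half_balls.

(** Each w is a point of the hyperplane plus a multiple t of the normal of q0. On such points q
    equals t times a constant, which is nonzero as q is not identically zero. *)
Lemma planes_through_frame (R : realType) p n (E : p.+1 = n) (k : Defs.isometry R p n) (q q0 : 'rV[R]_n * R) :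
  (forall y, aff q (emb k y) = 0) -> (forall y, aff q0 (emb k y) = 0) -> aff_nz q0 -> aff_nz q ->
  forall w, aff q w = 0 -> aff q0 w = 0.
Proof.
subst n; move=> hq hq0 [z0 nz0] [z nz] w qw.
have a0 : q0.1 != 0.
  apply: contraNneq nz0 => a0; have := hq0 0; rewrite /aff a0 !(dotC 0) !dot0r.
  by move=> ->.
have lin q' (v : 'rV[R]_p.+1) x : aff q' (x + v) = aff q' x + dot q'.1 v.
  by rewrite -[v]scale1r aff_line mul1r scale1r.
have a0k : q0.1 *m (frame k)^T = 0.
  apply/rowP => j; rewrite [RHS]mxE; have := hq0 (delta_mx ord0 j); rewrite /emb lin.
  have := hq0 0; rewrite /emb mul0mx addr0 => ->; rewrite add0r -rowE => <-.
  by rewrite mxE; apply: eq_bigr => l _; rewrite !mxE.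
have dec u : exists y t, u = emb k y + t *: q0.1.
  pose x := (u - base k) *m invmx (normal_mx k q0.1).
  exists (\row_i x ord0 (lift ord0 i)), (x ord0 ord0).
  rewrite -rV_cons_normal; have -> : rV_cons (x ord0 ord0) (\row_i x ord0 (lift ord0 i)) = x.
    by apply/rowP => i; rewrite mxE; have [j ->|->] := unliftP ord0 i; rewrite /= ?mxE.
  by rewrite /x mulmxKV ?(normal_mx_unit a0 a0k)// addrC subrK.
have [y [t wE]] := dec w; have [y' [t' zE]] := dec z.
move: qw nz; rewrite wE zE !aff_line !hq hq0 !add0r => /eqP.
by rewrite mulf_eq0 => /orP[/eqP ->|/eqP ->]; rewrite ?mul0r// mulr0 eqxx.
Qed.

(** * Definiteness of the bilinear form *)

Section geometry_facts.
Variables (R : realType) (d : nat) (d2 : (1 < d)%N) (G : geometry R d).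
Hypothesis hG : mixed_geometry G.

Let E1 : (d - 1).+1 = d. Proof. by rewrite subn1 prednK// ltnW. Qed.
Let E2 : (d - 2).+1 = (d - 1)%N. Proof. by rewrite -subSn// subSS subn1. Qed.
Let E0 : (d - 0)%N = d. Proof. exact: subn0. Qed.
Let d1 : (0 < d)%N. Proof. exact: ltnW. Qed.

Lemma stratum_Omega c : (c <= d)%N -> stratum G c `<=` Omega G.
Proof. by move=> cd x hx; exists c. Qed.

Lemma seg_Omega c (l : segment_index G c) : (c <= d)%N -> seg l `<=` Omega G.
Proof. by move=> cd x lx; apply: (stratum_Omega cd); exists l. Qed.

Lemma open_seg (i : segment_index G 0) : open (seg i).
Proof.
have [U oU ->] := seg_open hG i (leq0n d).
by apply: openI => //; exact: (Omega_open hG).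
Qed.

Lemma open_dom1 (j : segment_index G 1) : open (dom j).
Proof. exact: (dom_open hG). Qed.

Lemma seg_connected (i : segment_index G 0) : connected (seg i).
Proof.
apply: connected_continuous_connected; first exact: (dom_connected hG).
apply: continuous_subspaceT; exact: emb_continuous.
Qed.

Lemma seg_nonempty c (l : segment_index G c) : (c <= d)%N -> seg l !=set0.
Proof. by move=> cd; have [y ly] := dom_nonempty hG l cd; exists (emb (chart l) y), y. Qed.

Lemma seg_inj (i i' : segment_index G 0) x : seg i x -> seg i' x -> i = i'.
Proof.
move=> ix i'x; have := seg_disjoint hG (leq0n d) (leq0n d) (ex_intro _ x (conj ix i'x)).
by move/eqP; rewrite eq_Tagged => /eqP.
Qed.

Lemma seg01_disjoint (i : segment_index G 0) (j : segment_index G 1) x : seg i x -> ~ seg j x.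
Proof.
move=> ix jx; have := seg_disjoint hG (leq0n d) (d1 : 1 <= d)%N (ex_intro _ x (conj ix jx)).
by move/(congr1 (@tag _ _)).
Qed.

Lemma bounded_subset (T : normedModType R) (A B : set T) : A `<=` B -> bounded_set B -> bounded_set A.
Proof. by move=> AB [M [Mr h]]; exists M; split => // x Mx y /AB; exact: h. Qed.

Lemma seg_bounded (i : segment_index G 0) : bounded_set (seg i).
Proof. exact: bounded_subset (seg_Omega (leq0n d)) (Omega_bounded hG). Qed.

Lemma closure_Omega x : closure (Omega G) x -> exists i : segment_index G 0, closure (seg i) x.
Proof.
move=> h; apply: finite_closure_cover.
have s : Omega G `<=` closure (stratum G 0) by exact: (stratum_dense hG (leq0n d)).
by have := closure_subset s h; rewrite -((closure_id _).1 (@closed_closure _ _)).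
Qed.

Lemma Omega_planes : exists s : seq ('rV[R]_d * R), (forall q, q \in s -> aff_nz q) /\
    forall (i : segment_index G 0) x, closure (seg i) x -> (forall q, q \in s -> aff q x != 0) -> seg i x.
Proof.
have /choice[f hf] : forall i : segment_index G 0, exists s : seq ('rV[R]_d * R), (forall q, q \in s -> aff_nz q) /\
    forall x, closure (seg i) x -> (forall q, q \in s -> aff q x != 0) -> seg i x.
  move=> i; apply: (emb_planes E0).
  - exact: (dom_open hG).
  - exact: (dom_lipschitz hG).
  - exact: (dom_polyhedral hG).
exists (flatten [seq f i | i <- enum (segment_index G 0)]); split.
  by move=> q /flattenP[_ /mapP[i _ ->] qf]; have [h _] := hf i; exact: h.
move=> i x cx h; have [_ hi] := hf i; apply: hi => // q qf; apply: h.
by apply/flattenP; exists (f i) => //; apply/mapP; exists i; rewrite ?mem_enum.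
Qed.

Lemma exists_isometry1 : exists k : Defs.isometry R (d - 1) d, True.
Proof.
have a0 : const_mx 1 != 0 :> 'rV[R]_d.
  by apply/eqP => /rowP/(_ (Ordinal d1)); rewrite !mxE => /eqP; rewrite oner_eq0.
by have [F [hF _]] := exists_frame_codim1 E1 a0; exists (Isometry 0 hF).
Qed.

Lemma exists_isometry2 : exists k : Defs.isometry R (d - 2) d, True.
Proof.
have [[b F hF] _] := exists_isometry1.
have a0 : const_mx 1 != 0 :> 'rV[R]_(d - 1).
  have d1' : (0 < d - 1)%N by rewrite -E2.
  by apply/eqP => /rowP/(_ (Ordinal d1')); rewrite !mxE => /eqP; rewrite oner_eq0.
have [K [hK _]] := exists_frame_codim1 E2 a0.
have h : (K *m F) *m (K *m F)^T = 1%:M by rewrite trmx_mul mulmxA -(mulmxA K) hF mulmx1.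
by exists (Isometry 0 h).
Qed.

Variable v : mdfun G.
Hypothesis hv : V_0 v.

(** [H1] is defined by the weak identity alone. Smooth approximations are extracted from the
    boundary condition of [V_0], taken on an empty flat piece; an isometry is still required to
    state it, whence [exists_isometry1]. *)
Lemma bulk_approx i : H1_approx (seg i) (bulk v i) (dbulk v i).
Proof.
have [k _] := exists_isometry1.
have [|||_ [phi [h1 h2 _]]] := @V_bulk_boundary _ _ _ _ hv i k set0.
- exact: open0.
- by exists 0; split; [exact: real0|move=> M _ x []].
- by rewrite image_set0.
- by exists phi.
Qed.

Lemma intf_approx j : H1_approx (dom j) (intf v j) (dintf v j).
Proof.
have [k _] := exists_isometry2.
have [|||_ [phi [h1 h2 _]]] := @V_intf_boundary _ _ _ _ hv j k set0.
- exact: open0.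
- by exists 0; split; [exact: real0|move=> M _ x []].
- by rewrite image_set0.
- by exists phi.
Qed.

Hypothesis flat_bulk : forall i, {ae leb R d, forall x, seg i x -> dbulk v i x = 0}.
Hypothesis flat_intf : forall j, {ae leb R (d - 1), forall y, dom j y -> dintf v j y = 0}.
Hypothesis no_jump : forall i j, Defs.adjacent i j ->
  {ae leb R (d - 1), forall y, dom j y -> traces v i j y = intf v j y}.

Lemma adjacent_near (i : segment_index G 0) (j : segment_index G 1) x : seg j x -> closure (seg i) x ->
  Defs.adjacent i j.
Proof.
move=> jx ix; have [//|h] := seg_adjacent hG i j d1.
by exfalso; have : (seg j `&` closure (seg i)) x by []; rewrite h.
Qed.

(** A bulk constant is inherited by its trace, and the missing jump hands it to the interface
    function. Adjacency holds because the interface point is in the closure of the half ball. *)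
Lemma intf_near (i : segment_index G 0) (j : segment_index G 1) c (x a : 'rV[R]_d) (r : R) (y : 'rV[R]_(d - 1)) :
  {ae leb R d, forall x, seg i x -> bulk v i x = c} -> 0 < r -> a != 0 ->
  half_ball x a r `<=` seg i -> dom j y -> ball x r (emb (chart j) y) ->
  (forall y, dom j y -> ball x r (emb (chart j) y) -> dot a (emb (chart j) y - x) = 0) ->
  exists N, [/\ open N, N y & {ae leb R (d - 1), forall y, N y -> intf v j y = c}].
Proof.
move=> hc r0 a0 hh jy xy flat.
have ad : Defs.adjacent i j.
  apply: (@adjacent_near i j (emb (chart j) y)); first by exists y.
  by apply: closure_subset hh _ _; apply: half_ball_closure => //; exact: flat.
have [N [oN Ny hN]] := one_side_trace E1 (@open_seg i) (V_bulk hv i) hc (flat_bulk i)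
  (V_traces hv ad) (@open_dom1 j) a0 hh jy xy flat.
exists (N `&` dom j); split; [exact: openI oN (@open_dom1 j)|by split|].
move: hN (no_jump ad); apply: filterS2 => z h1 h2 [Nz jz].
by rewrite -h2// h1.
Qed.

Lemma bulk_flat_eq0 i : {ae leb R d, forall x, seg i x -> bulk v i x = 0}.
Proof.
have /choice[c hc] : forall i, exists c, {ae leb R d, forall x, seg i x -> bulk v i x = c}.
  move=> i'; apply: (H1_grad0_const (@open_seg i') (@seg_connected i') (seg_nonempty i' (leq0n d)) (V_bulk hv i')
    (bulk_approx i') (flat_bulk i')).
have [s [snz planes]] := Omega_planes.
suff c0 : c i = 0 by move: (hc i); rewrite c0.
apply/eqP; apply: contrapT => /negP ci.
have [x [a [r [i1 [r0 a0 op ci1 [hneg hpos]]]]]] := @exit_half_balls R d _ (@seg R d G 0) (@open_seg) s snz planes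
  (fun i => c i != 0) (ex_intro2 _ _ i ci (seg_nonempty i (leq0n d))) seg_bounded d1.
have na0 : - a != 0 by rewrite oppr_eq0.
have neg0 w : dot a w = 0 -> dot (- a) w = 0 by move=> h; rewrite dotC dotNr dotC h oppr0.
have cl y : ball x r y -> dot a (y - x) = 0 -> closure (seg i1) y.
  move=> xy ay; apply: closure_subset hneg _ _; apply: half_ball_closure => //.
  by rewrite dotC dotNr dotC ay oppr0.
have xx : ball x r x by exact: ballxx.
have ax : dot a (x - x) = 0 by rewrite subrr dot0r.
(* Either some bulk segment occupies the half ball beyond the plane, and x is inside Omega, or none
   does, and the plane near x is part of the boundary of Omega. *)
have [[i2 [p [hp cp]]]|none] := pselect (exists i2 : segment_index G 0, half_ball x a r `&` closure (seg i2) !=set0).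
  have sub := half_ball_dichotomy (@open_seg) planes r0 op hp cp.
  have c2 : c i2 = 0.
    apply/eqP; apply: contrapT => /negP c2; have := hpos i2 c2.
    by rewrite -subset0 => /(_ p); apply.
  (* The two half balls and the disc between them lie in the closure of Omega, so x is interior to
     that closure and hence in Omega. *)
  have iO : Omega G x.
    rewrite -(lipschitz_interior (Omega_open hG) (Omega_lipschitz hG)).
    apply/nbhs_ballP; exists r => //= y xy.
    have [ay|ay|ay] := ltgtP (dot a (y - x)) 0.
    - apply: subset_closure; apply: (@seg_Omega 0 i1 (leq0n d)); apply: hneg; split => //.
      by rewrite dotC dotNr dotC oppr_gt0.
    - by apply: subset_closure; apply: (@seg_Omega 0 i2 (leq0n d)); apply: sub.
    - by apply: closure_subset (@seg_Omega 0 i1 (leq0n d)) _ _; exact: cl.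
  (* A bulk segment containing a point of the disc would meet both half balls and so be equal to
     both i1 and i2, whose constants differ. Thus x belongs to X^1, and density of the interface
     provides an interface point in the ball; interface segments can meet the ball only in the
     disc. *)
  have nO k y : ball x r y -> dot a (y - x) = 0 -> ~ seg (k : segment_index G 0) y.
    move=> xy ay ky.
    have [z1 [h1 z1']] := half_ball_closure na0 xy (neg0 _ ay) (open_nbhs_nbhs (conj (@open_seg k) ky)).
    have [z2 [h2 z2']] := half_ball_closure a0 xy ay (open_nbhs_nbhs (conj (@open_seg k) ky)).
    have e1 := seg_inj (hneg _ h1) z1'; have e2 := seg_inj (sub _ h2) z2'.
    by move: ci1; rewrite e1 -e2 c2 eqxx.
  have x1 : Xset G 1 x by split => // -[k _ kx]; exact: (nO k x).
  have [x' [[j _ [y jy yx']] xx']] := stratum_dense hG d1 x1 (nbhsx_ballx x r r0).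
  have flat y' : dom j y' -> ball x r (emb (chart j) y') -> dot a (emb (chart j) y' - x) = 0.
    move=> jy' xy'; have sy' : seg j (emb (chart j) y') by exists y'.
    have [ay|ay|//] := ltgtP (dot a (emb (chart j) y' - x)) 0.
    - exfalso; apply: (@seg01_disjoint i1 j _ _ sy'); apply: hneg; split => //.
      by rewrite dotC dotNr dotC oppr_gt0.
    - by exfalso; apply: (@seg01_disjoint i2 j _ _ sy'); apply: sub.
  have xy : ball x r (emb (chart j) y) by rewrite yx'.
  have [Na [oa Nay ha]] := intf_near (hc i1) r0 na0 hneg jy xy
    (fun y' a b => neg0 _ (flat y' a b)).
  have [Nb [ob Nby hb]] := intf_near (hc i2) r0 a0 sub jy xy flat.
  have : c i1 = c i2.
    apply: (@ae_const_unique _ _ (Na `&` Nb) (intf v j)); [exact: openI|by exists y|..].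
      by move: ha; apply: filterS => z hz [/hz].
    by move: hb; apply: filterS => z hz [_ /hz].
  by move=> e; move: ci1; rewrite e c2 eqxx.
(* The disc about x is parametrised as a flat boundary piece, on which the boundary condition of
   [V_0] makes the trace zero. *)
have [F [hF aF]] := exists_frame_codim1 E1 a0.
pose k := Isometry x hF.
have dk y : dot a (emb k y - x) = 0.
  rewrite /emb /= addrAC subrr add0r dot_mulmx trmx_mul mulmxA aF mul0mx mxE.
  by [].
pose S := [set y | ball x r (emb k y)].
have oS : open S.
  have -> : S = emb k @^-1` ball x r by [].
  by apply: open_comp; [move=> y _; exact: emb_continuous|exact: ball_open].
have bS : bounded_set S.
  have [C C0 hC] := mulmx_ball F^T.
  apply: bounded_subset (@ball_bounded R (d - 1) 0 (C * r)) => y Sy.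
  have b0 : ball (0 : 'rV[R]_d) r (y *m F).
    by move: Sy; rewrite /S /emb /= -!ball_normE /= opprD addNKr sub0r.
  by have := hC _ _ r0 b0; rewrite -mulmxA hF mulmx1.
have kS : emb k @` S `<=` boundary (Omega G) `&` closure (seg i1).
  move=> _ [y Sy <-]; have cy := cl _ Sy (dk y); split => //; split.
    by apply: closure_subset cy; exact: seg_Omega.
  move=> /interior_subset Oy.
  have [z [hz Oz]] := half_ball_closure a0 Sy (dk y) (open_nbhs_nbhs (conj (Omega_open hG) Oy)).
  apply: none; have [i2 ci2] := closure_Omega (subset_closure Oz); exists i2; exists z; split => //.
have S0 : S 0 by rewrite /S /= /emb mul0mx addr0.
have [N [oN N0 hN]] := one_side_trace E1 (@open_seg i1) (V_bulk hv i1) (hc i1) (flat_bulk i1)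
  (V_bulk_boundary hv oS bS kS) oS na0 hneg S0 S0
  (fun y _ _ => neg0 _ (dk y)).
have e : 0 = c i1.
  by apply: (@ae_const_unique _ _ N (cst 0)) hN => //; [exists 0|exact: aeW].
by move: ci1; rewrite -e eqxx.
Qed.

(** At a generic point of the interface segment, every plane of [s] through that point contains the
    whole segment. One side of the segment near the point is then a half ball of a single bulk
    segment, where v vanishes, and the trace carries the value zero over. *)
Lemma intf_flat_eq0 j : {ae leb R (d - 1), forall y, dom j y -> intf v j y = 0}.
Proof.
have [e he] := H1_grad0_const (@open_dom1 j) (dom_connected hG (l := j) d1) (dom_nonempty hG j d1)
  (V_intf hv j) (intf_approx j) (flat_intf j).
suff e0 : e = 0 by move: he; rewrite e0.
have [s [snz planes]] := Omega_planes; pose k := chart j.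
(* The affine functions pulled back to the coordinates of the interface segment. Those that become
   identically zero are the planes containing the segment; genericity is asked of the others. *)
pose qj (q : 'rV[R]_d * R) : 'rV[R]_(d - 1) * R := (q.1 *m (frame k)^T, aff q (base k)).
have qjE q y : aff (qj q) y = aff q (emb k y).
  rewrite /emb -[y *m _]scale1r aff_line mul1r addrC /aff /=; congr (_ + _).
  by rewrite !dot_mulmx trmx_mul mulmxA.
pose s' := [seq q <- map qj s | `[< aff_nz q >]].
have s'nz q : q \in s' -> aff_nz q by rewrite mem_filter => /andP[/asboolP].
have [y [jy sy]] := aff_generic s'nz (@open_dom1 j) (dom_nonempty hG j d1).
set x := emb k y in sy *; have jx : seg j x by exists y.
have [i cx] := closure_Omega (subset_closure (seg_Omega d1 jx)).
have van q : q \in s -> aff q x = 0 -> forall y', aff q (emb k y') = 0.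
  move=> qs qx y'; have nz : ~ aff_nz (qj q).
    move=> nz; have : qj q \in s' by rewrite mem_filter map_f// andbT; exact/asboolP.
    by move/sy; rewrite qjE qx eqxx.
  by apply/eqP; apply: contrapT => /negP n0; apply: nz; exists y'; rewrite qjE.
have [q0 q0s q0x] : exists2 q, q \in s & aff q x = 0.
  apply: contrapT => /forall2NP nq; apply: (@seg01_disjoint i j x) => //; apply: planes => // q qs.
  by apply/eqP => qx; have [] := nq q.
have coin q : q \in s -> aff q x = 0 -> forall w, aff q w = 0 -> aff q0 w = 0.
  move=> qs qx; apply: (planes_through_frame E1 (k := k)); [exact: van|exact: van|exact: snz|exact: snz].
have [r r0 op] := exists_one_plane q0x coin.
have flat y' : dot q0.1 (emb k y' - x) = 0.
  have := van q0 q0s q0x y'; rewrite -[emb k y'](subrK x) addrC -[_ - x]scale1r aff_line q0x add0r mul1r.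
  by rewrite scale1r addrC addrK.
have a0 : q0.1 != 0.
  apply/eqP => a0; have [z] := snz _ q0s; move: q0x; rewrite /aff a0 !(dotC 0) !dot0r !add0r => ->.
  by rewrite eqxx.
have xx : ball x r x by exact: ballxx.
have concl a : a != 0 -> (forall y', dot a (emb k y' - x) = 0) -> half_ball x a r `<=` seg i -> e = 0.
  move=> an fl sub; have [N [oN Ny hN]] := intf_near (bulk_flat_eq0 i) r0 an sub jy xx (fun y' _ _ => fl y').
  apply: (@ae_const_unique _ _ (N `&` dom j) (intf v j)); [exact: openI oN (@open_dom1 j)|by exists y|..].
    by move: he; apply: filterS => z hz [_ /hz].
  by move: hN; apply: filterS => z hz [/hz].
have [sub|sub] := one_plane_two_sides (@open_seg) planes r0 a0 op cx; first exact: concl sub.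
apply: concl sub; first by rewrite oppr_eq0.
by move=> y'; rewrite dotC dotNr dotC flat oppr0.
Qed.

End geometry_facts.

(** * Linear combinations in V_0 *)

Section smooth_combinations.
Context (R : realType) (n : nat) (K : finType) (c : K -> R).

Lemma is_derive_lincomb (r : seq K) (g : K -> 'rV[R]_n -> R) (dg : K -> R) (x v : 'rV[R]_n) :
  (forall k, is_derive x v (g k) (dg k)) ->
  is_derive x v (fun x => \sum_(k <- r) c k * g k x) (\sum_(k <- r) c k * dg k).
Proof.
move=> h; elim: r => [|k r IH].
  rewrite big_nil (_ : (fun x => _) = cst 0); first exact: is_derive_cst.
  by apply/funext => y; rewrite big_nil.
rewrite big_cons (_ : (fun x => _) = (c k *: g k) + (fun x => \sum_(k <- r) c k * g k x)); last first.
  by apply/funext => y; rewrite big_cons.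
apply: is_deriveD; exact: is_deriveZ.
Qed.

Lemma foldr_partial_lincomb (phi : K -> 'rV[R]_n -> R) s : (forall k, smooth (phi k)) ->
  foldr (@partial R n) (fun x => \sum_k c k * phi k x) s =
  (fun x => \sum_k c k * foldr (@partial R n) (phi k) s x).
Proof.
move=> sphi; elim: s => [//|i s IH] /=; rewrite IH; apply/funext => x; rewrite /partial.
have h k : is_derive x (delta_mx ord0 i) (foldr (@partial R n) (phi k) s)
    ('D_(delta_mx ord0 i) (foldr (@partial R n) (phi k) s) x).
  by apply: DeriveDef => //; have [_] := sphi k s; apply.
by have [_] := is_derive_lincomb (index_enum K) h.
Qed.

Lemma smooth_lincomb (phi : K -> 'rV[R]_n -> R) : (forall k, smooth (phi k)) ->
  smooth (fun x => \sum_k c k * phi k x).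
Proof.
move=> sphi s /=; rewrite foldr_partial_lincomb//; split.
  apply: cont_sum => k; apply: contM; first exact: contC.
  by have [] := sphi k s.
move=> x i; have h k : is_derive x (delta_mx ord0 i) (foldr (@partial R n) (phi k) s)
    ('D_(delta_mx ord0 i) (foldr (@partial R n) (phi k) s) x).
  by apply: DeriveDef => //; have [_] := sphi k s; apply.
by have [] := is_derive_lincomb (index_enum K) h.
Qed.

Lemma partial_lincomb (phi : K -> 'rV[R]_n -> R) i x : (forall k, smooth (phi k)) ->
  partial i (fun x => \sum_k c k * phi k x) x = \sum_k c k * partial i (phi k) x.
Proof. by move=> sphi; have := congr1 (@^~ x) (foldr_partial_lincomb [:: i] sphi). Qed.

End smooth_combinations.

Section combinations.
Context (R : realType) (K : finType) (c : K -> R).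

Lemma cvge0_sum (I : nat -> K -> \bar R) : (forall k, I l k @[l --> \oo] --> 0%E) ->
  (\sum_k I l k)%E @[l --> \oo] --> 0%E.
Proof.
move=> h; elim: (index_enum K) => [|k r IH].
  by rewrite (_ : (fun l => _) = cst 0%E); [exact: cvg_cst|apply/funext => l; rewrite big_nil].
rewrite (_ : (fun l => _) = fun l => (I l k + \sum_(k <- r) I l k)%E); last first.
  by apply/funext => l; rewrite big_cons.
by rewrite -[X in _ --> X]adde0; apply: cvgeD.
Qed.

Lemma cvg0_dominated d (T : measurableType d) (mu : {measure set T -> \bar R}) (D : set T)
    (h : nat -> T -> R) (q : nat -> K -> T -> R) (M : R) : measurable D -> 0 <= M ->
  (forall l, measurable_fun D (h l)) -> (forall l x, 0 <= h l x) ->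
  (forall l k, measurable_fun D (q l k)) -> (forall l k x, 0 <= q l k x) ->
  (forall l x, D x -> h l x <= M * \sum_k q l k x) ->
  (forall k, (\int[mu]_(x in D) (q l k x)%:E)%E @[l --> \oo] --> 0%E) ->
  (\int[mu]_(x in D) (h l x)%:E)%E @[l --> \oo] --> 0%E.
Proof.
move=> mD M0 mh h0 mq q0 hq cq.
have c0 : (M%:E * \sum_k \int[mu]_(x in D) (q l k x)%:E)%E @[l --> \oo] --> 0%E.
  by rewrite -[X in _ --> X](mule0 M%:E); apply: cvgeZl => //; exact: cvge0_sum.
apply: (squeeze_cvge (f := cst 0%E) _ _ c0); last exact: cvg_cst.
apply: nearW => l; apply/andP; split; first by apply: integral_ge0 => x _; rewrite lee_fin.
rewrite -ge0_integral_sum//; last 2 first.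
- by move=> k; exact/measurable_EFinP.
- by move=> k x _; rewrite lee_fin.
rewrite -ge0_integralZl//; last 2 first.
- by apply: emeasurable_sum => k; exact/measurable_EFinP.
- by move=> x _; apply: sume_ge0 => k _; rewrite lee_fin.
apply: ge0_le_integral => //.
- by move=> x _; rewrite lee_fin.
- exact/measurable_EFinP.
- apply: emeasurable_funM => //; apply: emeasurable_sum => k; exact/measurable_EFinP.
- by move=> x Dx; rewrite sumEFin -EFinM lee_fin hq.
Qed.

Lemma lincomb_sq_le (a : K -> R) : (\sum_k c k * a k) ^+ 2 <= (\sum_k c k ^+ 2) * \sum_k a k ^+ 2.
Proof. exact: sum_Cauchy_Schwarz. Qed.

Let M := \sum_k c k ^+ 2.
Let M0 : 0 <= M. Proof. by apply: sumr_ge0 => k _; exact: sqr_ge0. Qed.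

Lemma sqint_lincomb d (T : measurableType d) (mu : {measure set T -> \bar R}) (D : set T) (f : K -> T -> R) :
  measurable D -> (forall k, sqint mu D (f k)) -> sqint mu D (fun x => \sum_k c k * f k x).
Proof. by move=> mD h; apply: sqint_sum => // k; exact: sqintZ. Qed.

Variables (n : nat) (D : set 'rV[R]_n) (oD : open D) (bD : bounded_set D).
Variables (f : K -> 'rV[R]_n -> R) (df : K -> 'rV[R]_n -> 'rV[R]_n).
Let mD : measurable D. Proof. exact: open_measurable_rV. Qed.

Lemma H1_lincomb : (forall k, H1 D (f k) (df k)) ->
  H1 D (fun x => \sum_k c k * f k x) (fun x => \sum_k c k *: df k x).
Proof.
move=> h; split.
- by apply: sqint_lincomb => // k; case: (h k).
- move=> i; have := @sqint_lincomb _ _ (leb R n) D (fun k x => df k x ord0 i) mD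
    (fun k => let: And3 _ g _ := h k in g i).
  by congr (sqint _ _); apply/funext => x; rewrite summxE; apply: eq_bigr => k _; rewrite mxE.
move=> phi tphi i; have [sphi _] := tphi.
have s1 : sqint (leb R n) D phi by apply: continuous_sqint => //; exact: smooth_continuous.
have s2 : sqint (leb R n) D (partial i phi).
  by apply: continuous_sqint => //; exact: smooth_partial_continuous.
have r1 k : rint (leb R n) D (fun x => f k x * partial i phi x) by apply: sqintM => //; case: (h k).
have r2 k : rint (leb R n) D (fun x => df k x ord0 i * phi x).
  by have [_ g _] := h k; exact: (sqintM (f := fun x => df k x ord0 i) mD (g i) s1).
transitivity (\sum_k c k * \int[leb R n]_(x in D) (f k x * partial i phi x)).
  under [RHS]eq_bigr => k _ do rewrite -(RintegralZl _ mD (r1 k)).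
  rewrite -(Rint_sum mD _ _ (fun k => rintZ mD (c k) (r1 k))).
  by apply: eq_Rintegral => x _; rewrite mulr_suml; apply: eq_bigr => k _; rewrite mulrA.

transitivity (- \sum_k c k * \int[leb R n]_(x in D) (df k x ord0 i * phi x)).
  by rewrite -sumrN; apply: eq_bigr => k _; have [_ _ ->//] := h k; rewrite mulrN.
congr (- _); under eq_bigr => k _ do rewrite -(RintegralZl _ mD (r2 k)).
rewrite -(Rint_sum mD _ _ (fun k => rintZ mD (c k) (r2 k))).
apply: eq_Rintegral => x _; rewrite summxE mulr_suml; apply: eq_bigr => k _.
by rewrite mxE mulrA.
Qed.

(** The combined smooth sequence works, because by Cauchy-Schwarz each squared error is at most the
    sum of c_k^2 times the sum of the individual squared errors. *)
Lemma has_trace_lincomb m (e : 'rV[R]_m -> 'rV[R]_n) (S : set 'rV[R]_m) (g : K -> 'rV[R]_m -> R) :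
  continuous e -> measurable S -> (forall k, H1 D (f k) (df k)) ->
  (forall k, has_trace D (f k) (df k) e S (g k)) ->
  has_trace D (fun x => \sum_k c k * f k x) (fun x => \sum_k c k *: df k x) e S
    (fun y => \sum_k c k * g k y).
Proof.
move=> ce mS hH ht; split; first by apply: sqint_lincomb => // k; case: (ht k).
have /choice[phi hphi] k : exists phi : nat -> 'rV[R]_n -> R, [/\ forall l, smooth (phi l),
      (\int[leb R n]_(x in D) ((phi l x - f k x) ^+ 2 +
         \sum_i (partial i (phi l) x - df k x ord0 i) ^+ 2)%:E)%E @[l --> \oo] --> 0%E
    & (\int[leb R m]_(y in S) ((phi l (e y) - g k y) ^+ 2)%:E)%E @[l --> \oo] --> 0%E].
  by case: (ht k).
have sphi k l : smooth (phi k l) by case: (hphi k).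
have mphi k l : measurable_fun D (phi k l).
  by apply: measurable_funTS; apply: continuous_measurable_rV; exact: smooth_continuous.
have mdphi k l i : measurable_fun D (partial i (phi k l)).
  by apply: measurable_funTS; apply: continuous_measurable_rV; exact: smooth_partial_continuous.
have mphie k l : measurable_fun S (fun y => phi k l (e y)).
  apply: measurable_funTS; apply: continuous_measurable_rV => y.
  by apply: (@continuous_comp _ _ _ e (phi k l)); [exact: ce|exact: smooth_continuous].
have mf k : measurable_fun D (f k) by case: (hH k) => -[].
have mdf k i : measurable_fun D (fun x => df k x ord0 i) by case: (hH k) => _ /(_ i)[].
have mg k : measurable_fun S (g k) by case: (ht k) => -[].
have E1 l x : \sum_k c k * phi k l x - \sum_k c k * f k x = \sum_k c k * (phi k l x - f k x).
  by rewrite -sumrB; apply: eq_bigr => k _; rewrite mulrBr.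
have E2 l x i : partial i (fun x => \sum_k c k * phi k l x) x - (\sum_k c k *: df k x) ord0 i =
    \sum_k c k * (partial i (phi k l) x - df k x ord0 i).
  rewrite partial_lincomb// summxE -sumrB; apply: eq_bigr => k _.
  by rewrite mxE mulrBr.
have E3 l y : \sum_k c k * phi k l (e y) - \sum_k c k * g k y = \sum_k c k * (phi k l (e y) - g k y).
  by rewrite -sumrB; apply: eq_bigr => k _; rewrite mulrBr.
exists (fun l x => \sum_k c k * phi k l x); split.
- by move=> l; exact: smooth_lincomb.
- apply: (cvg0_dominated (q := fun l k x => (phi k l x - f k x) ^+ 2 +
         \sum_i (partial i (phi k l) x - df k x ord0 i) ^+ 2) mD M0).
  + move=> l; apply: (eq_measurable_fun (fun x => (\sum_k c k * (phi k l x - f k x)) ^+ 2 +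
       \sum_i (\sum_k c k * (partial i (phi k l) x - df k x ord0 i)) ^+ 2)).
      by move=> x _; rewrite E1; congr (_ + _); apply: eq_bigr => i _; rewrite E2.
    apply: measurable_funD; [|apply: measurable_sum => i]; apply: measurable_funX;
      apply: measurable_sum => k; apply: measurable_funM => //; exact: measurable_funB.
  + by move=> l x; rewrite addr_ge0 ?sqr_ge0// sumr_ge0// => i _; exact: sqr_ge0.
  + move=> l k; apply: measurable_funD; first by apply: measurable_funX; exact: measurable_funB.
    by apply: measurable_sum => i; apply: measurable_funX; exact: measurable_funB.
  + by move=> l k x; rewrite addr_ge0 ?sqr_ge0// sumr_ge0// => i _; exact: sqr_ge0.
  + move=> l x Dx; rewrite E1 big_split /= mulrDr; apply: lerD; first exact: lincomb_sq_le.
    rewrite exchange_big /= mulr_sumr; apply: ler_sum => i _; rewrite E2; exact: lincomb_sq_le.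
  + by move=> k; case: (hphi k).
- apply: (cvg0_dominated (q := fun l k y => (phi k l (e y) - g k y) ^+ 2) mS M0).
  + move=> l; apply: (eq_measurable_fun (fun y => (\sum_k c k * (phi k l (e y) - g k y)) ^+ 2)).
      by move=> y _; rewrite E3.
    by apply: measurable_funX; apply: measurable_sum => k; apply: measurable_funM => //; exact: measurable_funB.
  + by move=> l x; exact: sqr_ge0.
  + by move=> l k; apply: measurable_funX; exact: measurable_funB.
  + by move=> l k x; exact: sqr_ge0.
  + by move=> l y Sy; rewrite E3; exact: lincomb_sq_le.
  + by move=> k; case: (hphi k).
Qed.

End combinations.

Section V_0_combinations.
Context (R : realType) (d : nat) (d2 : (1 < d)%N) (G : geometry R d).
Hypothesis hG : mixed_geometry G.

Lemma dom1_bounded (j : segment_index G 1) : bounded_set (dom j).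
Proof.
have [e e0 he] := bounded_sub_ball (Omega_bounded hG).
have [C C0 hC] := mulmx_ball (frame (chart j))^T.
apply: bounded_subset (@ball_bounded R (d - 1) (coords (chart j) 0) (C * e)) => y jy.
have : ball 0 e (emb (chart j) y) by apply: he; apply: (seg_Omega (l := j) (ltnW d2)); exists y.
move/(hC _ _ e0); rewrite -!ball_normE /= sub0r normrN -{2}(coords_emb (chart j) y) /coords.
by rewrite -mulmxBl opprB addrA subrK sub0r mulNmx normrN.
Qed.

Lemma V_0_lincomb (K : finType) (c : K -> R) (v : K -> mdfun G) : (forall k, V_0 (v k)) -> V_0 (lincomb c v).
Proof.
move=> hv; have od0 := open_seg hG; have bd0 := seg_bounded hG; have od1 := open_dom1 d2 hG; have bd1 := dom1_bounded.
have sum0 m (g : 'rV[R]_m -> R) : g = (fun y => \sum_k c k * (cst 0 : 'rV[R]_m -> R) y) -> g = cst 0.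
  by move=> ->; apply/funext => y; rewrite big1// => k _; rewrite mulr0.
split.
- by move=> i; apply: H1_lincomb => // k; exact: (V_bulk (hv k)).
- move=> i j ad; apply: has_trace_lincomb => //.
  + exact: emb_continuous.
  + exact: open_measurable_rV.
  + by move=> k; exact: (V_bulk (hv k)).
  + by move=> k; exact: (V_traces (hv k)).
- move=> i k S oS bS h; rewrite -(sum0 _ _ erefl); apply: has_trace_lincomb => //.
  + exact: emb_continuous.
  + exact: open_measurable_rV.
  + by move=> k'; exact: (V_bulk (hv k')).
  + by move=> k'; exact: (V_bulk_boundary (hv k')).
- by move=> j; apply: H1_lincomb => // k; exact: (V_intf (hv k)).
- move=> k2.
  have /choice[g hg] : forall k, exists g, forall j, Defs.adjacent j k2 ->
    has_trace (dom j) (intf (v k) j) (dintf (v k) j) (coords (chart j) \o emb (chart k2)) (dom k2) g.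
    by move=> k; exact: (V_intf_continuity (hv k) k2).
  exists (fun y => \sum_k c k * g k y) => j ad; apply: has_trace_lincomb => //.
  + by move=> y; apply: continuous_comp; [exact: emb_continuous|exact: coords_continuous].
  + by apply: open_measurable_rV; exact: (dom_open hG).
  + by move=> k; exact: (V_intf (hv k)).
  + by move=> k; exact: hg.
- move=> j k S oS bS h; rewrite -(sum0 _ _ erefl); apply: has_trace_lincomb => //.
  + by move=> y; apply: continuous_comp; [exact: emb_continuous|exact: coords_continuous].
  + exact: open_measurable_rV.
  + by move=> k'; exact: (V_intf (hv k')).
  + by move=> k'; exact: (V_intf_boundary (hv k')).
Qed.

(** Differences are combinations indexed by [bool], so that linearity has to be proved for [lincomb]
    only. *)
Lemma subV_lincomb (v w : mdfun G) :
  subV v w = lincomb (fun b : bool => if b then 1 else -1) (fun b => if b then v else w).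
Proof.
rewrite /subV /lincomb; congr MdFun; apply/funext => i; apply/funext => x;
  try (apply/funext => y); by rewrite big_bool /= ?scale1r ?scaleN1r ?mul1r ?mulN1r.
Qed.

Lemma V_0_sub (v w : mdfun G) : V_0 v -> V_0 w -> V_0 (subV v w).
Proof. by move=> hv hw; rewrite subV_lincomb; apply: V_0_lincomb => -[]. Qed.

End V_0_combinations.

Section conv_hulls.
Context (R : realType) (n : nat).

Lemma conv_hull_compact (I : finType) (p : I -> 'rV[R]_n) : compact (conv_hull p).
Proof.
pose N := #|I|; pose f (w : 'rV[R]_N) := \sum_k w ord0 k *: p (enum_val k).
pose A : set 'rV[R]_N := [set w | (forall k, 0 <= w ord0 k) /\ \sum_k w ord0 k = 1].
have E : conv_hull p = f @` A.
  apply/seteqP; split => x.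
    move=> [w [w0 w1 ->]]; exists (\row_k w (enum_val k)).
      split; first by move=> k; rewrite mxE.
      by rewrite -w1 [RHS](big_enum_val (A := I)); apply: eq_bigr => k _; rewrite mxE.
    by rewrite /f [RHS](big_enum_val (A := I)); apply: eq_bigr => k _; rewrite mxE.
  move=> [w [w0 w1] <-]; exists (fun i => w ord0 (enum_rank i)); split => //.
    by rewrite -w1 (big_enum_val (A := I)); apply: eq_bigr => k _; rewrite enum_valK.
  by rewrite /f [RHS](big_enum_val (A := I)); apply: eq_bigr => k _; rewrite enum_valK.
rewrite E; apply: continuous_compact.
  apply: continuous_subspaceT => w; apply: rV_continuousP => i.
  rewrite (_ : (fun t => _) = fun t : 'rV[R]_N => \sum_k t ord0 k * p (enum_val k) ord0 i).
    by apply: cont_sum => k; apply: contM; [exact: coord_cont|exact: contC].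
  by apply/funext => t; rewrite /f summxE; apply: eq_bigr => k _; rewrite mxE.
apply: (subclosed_compact _ (@cball_compact R N 0 1)).
  have -> : A = (\bigcap_(k in [set: 'I_N]) [set w | 0 <= w ord0 k]) `&` [set w | \sum_k w ord0 k = 1].
    apply/seteqP; split => w [h1 h2]; split => //; first by move=> k _; exact: h1.
    by move=> k; exact: (h1 k Logic.I).
  apply: closedI.
    apply: closed_bigI => k _; apply: (@closed_comp _ _ (fun w : 'rV[R]_N => w ord0 k) [set t | 0 <= t]).
      by move=> w _; exact: coord_cont.
    exact: closed_ge.
  apply: (@closed_comp _ _ (fun w : 'rV[R]_N => \sum_k w ord0 k) [set t | t = 1]).
    by move=> w _; apply: cont_sum => k; exact: coord_cont.
  exact: closed_eq.
move=> w [w0 w1]; apply/cballP => // k; rewrite mxE sub0r normrN ger0_norm//.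
by rewrite -w1 (bigD1 k)//= lerDl sumr_ge0.
Qed.

Lemma conv_hull_closed (I : finType) (p : I -> 'rV[R]_n) : closed (conv_hull p).
Proof. by apply: compact_closed; [exact: norm_hausdorff|exact: conv_hull_compact]. Qed.

Lemma conv_hull_convex (I : finType) (p : I -> 'rV[R]_n) : convex_rV (conv_hull p).
Proof.
move=> x y t [w [w0 w1 ->]] [w' [w0' w1' ->]] t0 t1.
exists (fun i => (1 - t) * w' i + t * w i); split.
- by move=> i; apply: addr_ge0; apply: mulr_ge0 => //; rewrite subr_ge0.
- by rewrite big_split /= -!mulr_sumr w1 w1'; ring.
under [RHS]eq_bigr do rewrite scalerDl -!scalerA.
by rewrite big_split /= -!scaler_sumr; apply/rowP => i; rewrite !mxE; ring.
Qed.

End conv_hulls.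

Lemma Rint_lincomb d (T : measurableType d) (R : realType) (mu : {measure set T -> \bar R}) (D : set T)
    (K : finType) (c : K -> R) (F : K -> T -> R) (h : T -> R) : measurable D ->
  (forall k, rint mu D (F k)) -> (forall x, D x -> h x = \sum_k c k * F k x) ->
  \int[mu]_(x in D) h x = \sum_k c k * \int[mu]_(x in D) F k x.
Proof.
move=> mD rF hE; under [RHS]eq_bigr => k _ do rewrite -(RintegralZl _ mD (rF k)).
rewrite -(Rint_sum mD _ _ (fun k => rintZ mD (c k) (rF k))).
by apply: eq_Rintegral => x /set_mem; exact: hE.
Qed.

Lemma coef_dot_rint (R : realType) n m (D : set 'rV[R]_n) (a : 'rV[R]_n -> R) (lo hi : R) (f g : 'rV[R]_n -> 'rV[R]_m) :
  measurable D -> measurable_fun D a -> {ae leb R n, forall x, D x -> lo <= a x <= hi} ->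
  (forall i, sqint (leb R n) D (fun x => f x ord0 i)) -> (forall i, sqint (leb R n) D (fun x => g x ord0 i)) ->
  rint (leb R n) D (fun x => a x * dot (f x) (g x)).
Proof.
move=> mD ma ha hf hg; rewrite (_ : (fun x => _) = (fun x => \sum_i (a x * f x ord0 i) * g x ord0 i)); last first.
  by apply/funext => x; rewrite mulr_sumr; apply: eq_bigr => i _; rewrite mulrA.
apply: rint_sum => // i; apply: sqintM => //.
apply: (sqint_mul_bounded mD (M := `|lo| + `|hi|)) => //.
move: ha; apply: filterS => x h Dx; have /andP[h1 h2] := h Dx.
by rewrite ler_norml; apply/andP; split; have := ler_norm (- lo); have := ler_norm hi; rewrite normrN;
  have := normr_ge0 lo; have := normr_ge0 hi; lra.
Qed.

(** * The bilinear form, its lower bound, and the load *)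

Section forms.
Context (R : realType) (d : nat) (d2 : (1 < d)%N) (G : geometry R d).
Hypothesis hG : mixed_geometry G.
Variables (alpha_lo alpha_hi beta_lo beta_hi : R).
Hypotheses (alpha0 : 0 < alpha_lo) (beta0 : 0 < beta_lo).
Variables (A0 : bulk_fun G R) (A1 B1 : intf_fun G R).
Hypothesis hA0 : bulk_coef alpha_lo alpha_hi A0.
Hypothesis hA1 : intf_coef alpha_lo alpha_hi A1.
Hypothesis hB1 : intf_coef beta_lo beta_hi B1.
Local Notation a := (Defs.form A0 A1 B1).
Implicit Types v w : mdfun G.

Lemma mseg (i : segment_index G 0) : measurable (seg i).
Proof. by apply: open_measurable_rV; exact: (open_seg hG). Qed.

Lemma mdom (j : segment_index G 1) : measurable (dom j).
Proof. by apply: open_measurable_rV; exact: (open_dom1 d2 hG). Qed.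

Lemma bulk_form_rint v w i : V_0 v -> V_0 w ->
  rint (leb R d) (seg i) (fun x => A0 i x * dot (dbulk v i x) (dbulk w i x)).
Proof.
move=> hv hw; have [m h] := hA0 i; apply: (coef_dot_rint (@mseg i) m h).
- by case: (V_bulk hv i).
- by case: (V_bulk hw i).
Qed.

Lemma intf_form_rint v w j : V_0 v -> V_0 w ->
  rint (leb R (d - 1)) (dom j) (fun y => A1 j y * dot (dintf v j y) (dintf w j y)).
Proof.
move=> hv hw; have [m h] := hA1 j; apply: (coef_dot_rint (@mdom j) m h).
- by case: (V_intf hv j).
- by case: (V_intf hw j).
Qed.

Lemma jump_sqint v i j : V_0 v -> Defs.adjacent i j ->
  sqint (leb R (d - 1)) (dom j) (fun y => traces v i j y - intf v j y).
Proof.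
move=> hv ad; apply: (sqintB (@mdom j)); first by case: (V_traces hv ad).
by case: (V_intf hv j).
Qed.

Lemma jump_form_rint v w i j : V_0 v -> V_0 w -> Defs.adjacent i j ->
  rint (leb R (d - 1)) (dom j) (fun y => B1 j y * (traces v i j y - intf v j y) * (traces w i j y - intf w j y)).
Proof.
move=> hv hw ad; apply: (sqintM (@mdom j)); last exact: jump_sqint.
have [m h] := hB1 j; apply: (sqint_mul_bounded (@mdom j) (M := `|beta_lo| + `|beta_hi|)) => //.
  move: h; apply: filterS => x h Dx; have /andP[h1 h2] := h Dx.
  by rewrite ler_norml; apply/andP; split; have := ler_norm (- beta_lo); have := ler_norm beta_hi; rewrite normrN;
    have := normr_ge0 beta_lo; have := normr_ge0 beta_hi; lra.
exact: jump_sqint.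
Qed.

Lemma form_sym v w : a v w = a w v.
Proof.
rewrite /Defs.form; congr (_ + _ + _).
- by apply: eq_bigr => i _; apply: eq_Rintegral => x _; rewrite dotC.
- by apply: eq_bigr => i _; apply: eq_Rintegral => x _; rewrite dotC.
- by apply: eq_bigr => i _; apply: eq_bigr => j _; apply: eq_Rintegral => x _; rewrite mulrAC.
Qed.

Lemma form_lincombr v (K : finType) (c : K -> R) (w : K -> mdfun G) : V_0 v -> (forall k, V_0 (w k)) ->
  a v (lincomb c w) = \sum_k c k * a v (w k).
Proof.
move=> hv hw; rewrite /Defs.form; under [RHS]eq_bigr do rewrite !mulrDr.
rewrite !big_split /=; congr (_ + _ + _).
- under [RHS]eq_bigr do rewrite mulr_sumr; rewrite [RHS]exchange_big; apply: eq_bigr => i _.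
  apply: Rint_lincomb (@mseg i) (fun k => bulk_form_rint i hv (hw k)) _ => x _ /=.
  rewrite dot_sumr mulr_sumr; apply: eq_bigr => k _; rewrite dotZr; ring.
- under [RHS]eq_bigr do rewrite mulr_sumr; rewrite [RHS]exchange_big; apply: eq_bigr => i _.
  apply: Rint_lincomb (@mdom i) (fun k => intf_form_rint i hv (hw k)) _ => x _ /=.
  rewrite dot_sumr mulr_sumr; apply: eq_bigr => k _; rewrite dotZr; ring.
under [RHS]eq_bigr do rewrite mulr_sumr; rewrite [RHS]exchange_big; apply: eq_bigr => i _.
under [RHS]eq_bigr do rewrite mulr_sumr; rewrite [RHS]exchange_big; apply: eq_bigr => j /asboolP ad.
apply: Rint_lincomb (@mdom j) (fun k => jump_form_rint hv (hw k) ad) _ => x _ /=.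
rewrite -sumrB mulr_sumr; apply: eq_bigr => k _; ring.
Qed.

Lemma form_lincombl v (K : finType) (c : K -> R) (w : K -> mdfun G) : V_0 v -> (forall k, V_0 (w k)) ->
  a (lincomb c w) v = \sum_k c k * a (w k) v.
Proof.
by move=> hv hw; rewrite form_sym form_lincombr//; apply: eq_bigr => k _; rewrite form_sym.
Qed.

Lemma form_subr v w w' : V_0 v -> V_0 w -> V_0 w' -> a v (subV w w') = a v w - a v w'.
Proof.
move=> hv hw hw'; rewrite subV_lincomb form_lincombr//; last by case.
by rewrite big_bool /= mul1r mulN1r.
Qed.

Lemma form_subl v w w' : V_0 v -> V_0 w -> V_0 w' -> a (subV w w') v = a w v - a w' v.
Proof. by move=> hv hw hw'; rewrite form_sym form_subr// !(form_sym v). Qed.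

Lemma coef_dot_lower n m (D : set 'rV[R]_n) (b : 'rV[R]_n -> R) (lo hi : R) (f : 'rV[R]_n -> 'rV[R]_m) :
  measurable D -> measurable_fun D b -> {ae leb R n, forall x, D x -> lo <= b x <= hi} ->
  (forall i, sqint (leb R n) D (fun x => f x ord0 i)) ->
  lo * \int[leb R n]_(x in D) dot (f x) (f x) <= \int[leb R n]_(x in D) (b x * dot (f x) (f x)).
Proof.
move=> mD mb hb hf; have r1 : rint (leb R n) D (fun x => dot (f x) (f x)).
  by apply: rint_sum => // i; exact: sqintM.
rewrite -(RintegralZl _ mD r1); apply: ae_le_Rint => //; [exact: rintZ|exact: (coef_dot_rint mD mb hb hf hf)|].
by move: hb; apply: filterS => x h Dx; apply: ler_wpM2r; [exact: dot_ge0|case/andP: (h Dx)].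
Qed.

Definition grad2 v : R := \sum_i grad_norm2 (seg i) (dbulk v i) +
  \sum_(j : segment_index G 1) grad_norm2 (dom j) (dintf v j).

Definition jump2 v i j : R := \int[leb R (d - 1)]_(y in dom j) ((traces v i j y - intf v j y) ^+ 2).

Lemma grad_norm2_ge0 n (D : set 'rV[R]_n) df : 0 <= grad_norm2 D df.
Proof. by apply: Rintegral_ge0 => x _; exact: dot_ge0. Qed.

Lemma form_lower v : V_0 v ->
  alpha_lo * grad2 v + \sum_i \sum_(j | `[< Defs.adjacent i j >]) beta_lo * jump2 v i j <= a v v.
Proof.
move=> hv; rewrite /grad2 mulrDr !mulr_sumr /Defs.form; apply: lerD; first apply: lerD.
- apply: ler_sum => i _; have [m h] := hA0 i; apply: (coef_dot_lower (@mseg i) m h).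
  by case: (V_bulk hv i).
- apply: ler_sum => i _; have [m h] := hA1 i; apply: (coef_dot_lower (@mdom i) m h).
  by case: (V_intf hv i).
apply: ler_sum => i _; apply: ler_sum => j /asboolP ad.
have s := jump_sqint hv ad; have r := sqint_sq s.
rewrite /jump2 -(RintegralZl _ (@mdom j) r); apply: ae_le_Rint => //.
- exact: mdom.
- by apply: rintZ => //; exact: mdom.
- exact: jump_form_rint.
have [_ h] := hB1 j; move: h; apply: filterS => x h Dx; rewrite -mulrA -expr2.
by apply: ler_wpM2r; [exact: sqr_ge0|case/andP: (h Dx)].
Qed.

Lemma grad_norm2_eq0 n (D : set 'rV[R]_n) f df : measurable D -> H1 D f df -> grad_norm2 D df = 0 ->
  {ae leb R n, forall x, D x -> df x = 0}.
Proof.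
move=> mD [_ hdf _] g0.
have r1 : rint (leb R n) D (fun x => dot (df x) (df x)) by apply: rint_sum => // i; apply: sqintM => //; exact: hdf.
have := ae_Rint_eq0 mD r1 (aeW _ (fun x _ => dot_ge0 _)) g0.
apply: filterS => x h Dx; apply/eqP; apply: contrapT => /negP n0.
by have := dot_gt0 n0; rewrite h// ltxx.
Qed.

Definition zeroV v := (forall i, {ae leb R d, forall x, seg i x -> bulk v i x = 0}) /\
  (forall j : segment_index G 1, {ae leb R (d - 1), forall y, dom j y -> intf v j y = 0}).

Lemma form_definite v : V_0 v -> a v v = 0 -> zeroV v.
Proof.
move=> hv av; have := form_lower hv; rewrite av.
have j0 i j : 0 <= jump2 v i j by apply: Rintegral_ge0 => x _; exact: sqr_ge0.
have g1 : 0 <= \sum_i grad_norm2 (seg i) (dbulk v i) by apply: sumr_ge0 => i _; exact: grad_norm2_ge0.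
have g2 : 0 <= \sum_(j : segment_index G 1) grad_norm2 (dom j) (dintf v j).
  by apply: sumr_ge0 => i _; exact: grad_norm2_ge0.
have s0 : 0 <= \sum_i \sum_(j | `[< Defs.adjacent i j >]) beta_lo * jump2 v i j.
  by apply: sumr_ge0 => i _; apply: sumr_ge0 => j _; apply: mulr_ge0 => //; exact: ltW.
move=> le0; have G0 : grad2 v = 0.
  apply/eqP; rewrite eq_le addr_ge0// andbT -(pmulr_rle0 _ alpha0); lra.
have S0 : \sum_i \sum_(j | `[< Defs.adjacent i j >]) beta_lo * jump2 v i j = 0.
  by apply/eqP; rewrite eq_le s0 andbT; move: le0; rewrite G0 mulr0 add0r.
have [b0 i0] : (forall i, grad_norm2 (seg i) (dbulk v i) = 0) /\
    (forall j : segment_index G 1, grad_norm2 (dom j) (dintf v j) = 0).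
  move/eqP: G0; rewrite /grad2 paddr_eq0// => /andP[]; rewrite !psumr_eq0 => [|i _|i _]; try exact: grad_norm2_ge0.
  by move=> /allP h1 /allP h2; split => i; apply/eqP; [apply: h1|apply: h2]; rewrite mem_index_enum.
have fb i := grad_norm2_eq0 (@mseg i) (V_bulk hv i) (b0 i).
have fi j := grad_norm2_eq0 (@mdom j) (V_intf hv j) (i0 j).
have nj i j : Defs.adjacent i j -> {ae leb R (d - 1), forall y, dom j y -> traces v i j y = intf v j y}.
  move=> ad; have z : jump2 v i j = 0.
    suff : beta_lo * jump2 v i j == 0 by rewrite mulf_eq0 gt_eqF//= => /eqP.
    move/eqP: S0; rewrite psumr_eq0; last first.
      by move=> i' _; apply: sumr_ge0 => j' _; apply: mulr_ge0 => //; exact: ltW.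
    move/allP/(_ i (mem_index_enum _)) => /=; rewrite psumr_eq0; last first.
      by move=> j' _; apply: mulr_ge0 => //; exact: ltW.
    by move/allP/(_ j (mem_index_enum _)) => /implyP; apply; exact/asboolP.
  have := ae_Rint_eq0 (@mdom j) (sqint_sq (jump_sqint hv ad)) (aeW _ (fun x _ => sqr_ge0 _)) z.
  by apply: filterS => y h jy; apply/eqP; rewrite -subr_eq0 -sqrf_eq0; apply/eqP; exact: h.
split => [i|j]; first exact: (bulk_flat_eq0 d2 hG hv fb nj).
exact: (intf_flat_eq0 d2 hG hv fb fi nj).
Qed.

Variables (f0 : bulk_fun G R) (f1 : intf_fun G R).
Hypotheses (hf0 : forall i, L2 (seg i) (f0 i)) (hf1 : forall j, L2 (dom j) (f1 j)).

Lemma bulk_sqint v i : V_0 v -> sqint (leb R d) (seg i) (bulk v i).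
Proof. by move=> hv; case: (V_bulk hv i). Qed.

Lemma intf_sqint v j : V_0 v -> sqint (leb R (d - 1)) (dom j) (intf v j).
Proof. by move=> hv; case: (V_intf hv j). Qed.

Lemma load_lincomb (K : finType) (c : K -> R) (w : K -> mdfun G) : (forall k, V_0 (w k)) ->
  load f0 f1 (lincomb c w) = \sum_k c k * load f0 f1 (w k).
Proof.
move=> hw; rewrite /load; under [RHS]eq_bigr do rewrite mulrDr; rewrite big_split /=; congr (_ + _).
  under [RHS]eq_bigr do rewrite mulr_sumr; rewrite [RHS]exchange_big; apply: eq_bigr => i _.
  apply: Rint_lincomb (@mseg i) (fun k => sqintM (@mseg i) (hf0 i) (bulk_sqint i (hw k))) _ => x _ /=.
  by rewrite mulr_sumr; apply: eq_bigr => k _; ring.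
under [RHS]eq_bigr do rewrite mulr_sumr; rewrite [RHS]exchange_big; apply: eq_bigr => i _.
apply: Rint_lincomb (@mdom i) (fun k => sqintM (@mdom i) (hf1 i) (intf_sqint i (hw k))) _ => x _ /=.
by rewrite mulr_sumr; apply: eq_bigr => k _; ring.
Qed.

Lemma load_sub w w' : V_0 w -> V_0 w' -> load f0 f1 (subV w w') = load f0 f1 w - load f0 f1 w'.
Proof.
by move=> hw hw'; rewrite subV_lincomb load_lincomb; [rewrite big_bool /= mul1r mulN1r|case].
Qed.

Lemma load_zero v : V_0 v -> zeroV v -> load f0 f1 v = 0.
Proof.
move=> hv [z0 z1]; rewrite /load !big1 ?addr0// => i _.
  rewrite (@ae_eq_Rint _ _ _ _ _ (@mdom i) _ (fun=> 0)) ?Rintegral_cst ?mul0r//; first exact: mdom.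
    by apply: measurable_funM; [case: (hf1 i)|case: (intf_sqint i hv)].
  by move: (z1 i); apply: filterS => y h iy; rewrite h// mulr0.
rewrite (@ae_eq_Rint _ _ _ _ _ (@mseg i) _ (fun=> 0)) ?Rintegral_cst ?mul0r//; first exact: mseg.
  by apply: measurable_funM; [case: (hf0 i)|case: (bulk_sqint i hv)].
by move: (z0 i); apply: filterS => y h iy; rewrite h// mulr0.
Qed.

End forms.

(** * The prototypical method *)

Section prototypical.
Context (R : realType) (d : nat) (d2 : (1 < d)%N) (G : geometry R d).
Hypothesis hG : mixed_geometry G.
Variables (alpha_lo alpha_hi beta_lo beta_hi : R).
Hypotheses (alpha0 : 0 < alpha_lo) (beta0 : 0 < beta_lo).
Variables (A0 : bulk_fun G R) (A1 B1 : intf_fun G R).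
Hypothesis hA0 : bulk_coef alpha_lo alpha_hi A0.
Hypothesis hA1 : intf_coef alpha_lo alpha_hi A1.
Hypothesis hB1 : intf_coef beta_lo beta_hi B1.
Local Notation a := (Defs.form A0 A1 B1).
Implicit Types v w : mdfun G.

Variables (sigma tau H : R) (M : meshes G).
Hypothesis hM : coarse_meshes sigma tau H M.

Lemma element_hull n (T : set 'rV[R]_n) : simplex T \/ hexahedron T ->
  [/\ closed T, compact T & convex_rV T].
Proof.
by move=> [[p -> _]|[p -> _]]; split; [exact: conv_hull_closed|exact: conv_hull_compact|exact: conv_hull_convex|
  exact: conv_hull_closed|exact: conv_hull_compact|exact: conv_hull_convex].
Qed.

Lemma bulk_elt_hull (k : bulk_index M) : [/\ closed (bulk_elt k), compact (bulk_elt k) & convex_rV (bulk_elt k)].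
Proof. by apply: element_hull; have [_ h _] := bulk_partition hM; exact: h. Qed.

Lemma intf_elt_hull (k : intf_index M) : [/\ closed (intf_elt k), compact (intf_elt k) & convex_rV (intf_elt k)].
Proof. by apply: element_hull; have [_ h _] := intf_partition hM (intf_seg k); apply: h; rewrite /= eqxx. Qed.

Lemma bulk_elt_seg_meas k (i : segment_index G 0) : measurable (bulk_elt (m := M) k `&` seg i).
Proof. by apply: measurableI; [apply: closed_measurable_rV; case: (bulk_elt_hull k)|exact: mseg]. Qed.

Lemma intf_elt_dom_meas k : measurable (intf_elt (m := M) k `&` dom (intf_seg k)).
Proof. by apply: measurableI; [apply: closed_measurable_rV; case: (intf_elt_hull k)|exact: mdom]. Qed.

Lemma sqint_bounded_rint n (D : set 'rV[R]_n) (f : 'rV[R]_n -> R) : measurable D -> bounded_set D ->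
  sqint (leb R n) D f -> rint (leb R n) D f.
Proof.
move=> mD bD hf; have c1 : continuous (fun _ : 'rV[R]_n => 1 : R) by move=> x; apply: (@cst_continuous _ _ (1 : R)).
have := sqintM mD hf (continuous_sqint bD mD c1).
by congr (rint _ _); apply/funext => x; rewrite mulr1.
Qed.

Lemma rint_subset n (D E : set 'rV[R]_n) (f : 'rV[R]_n -> R) : measurable D -> measurable E -> E `<=` D ->
  rint (leb R n) D f -> rint (leb R n) E f.
Proof. by move=> mD mE ED; apply: integrableS. Qed.

Lemma bulk_elt_rint v k i : V_0 v -> rint (leb R d) (bulk_elt (m := M) k `&` seg i) (bulk v i).
Proof.
move=> hv; apply: (@rint_subset _ (seg i)); [exact: mseg|exact: bulk_elt_seg_meas|exact: subIsetr|].
apply: sqint_bounded_rint; [exact: mseg|exact: seg_bounded|exact: bulk_sqint].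
Qed.

Lemma intf_elt_rint v k : V_0 v ->
  rint (leb R (d - 1)) (intf_elt (m := M) k `&` dom (intf_seg k)) (intf v (intf_seg k)).
Proof.
move=> hv; apply: (@rint_subset _ (dom (intf_seg k))); [exact: mdom|exact: intf_elt_dom_meas|exact: subIsetr|].
apply: sqint_bounded_rint; [exact: mdom|exact: dom1_bounded|exact: intf_sqint].
Qed.

Lemma qoi_lincomb (K : finType) (c : K -> R) (w : K -> mdfun G) (T : element M) : (forall k, V_0 (w k)) ->
  qoi T (lincomb c w) = \sum_k c k * qoi T (w k).
Proof.
move=> hw; case: T => t /=; under [RHS]eq_bigr do rewrite mulrCA; rewrite -[RHS]mulr_sumr; congr (_ * _).
  under [RHS]eq_bigr do rewrite mulr_sumr; rewrite [RHS]exchange_big; apply: eq_bigr => i _.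
  by apply: Rint_lincomb => //; [exact: bulk_elt_seg_meas|move=> k; exact: bulk_elt_rint].
by apply: Rint_lincomb => //; [exact: intf_elt_dom_meas|move=> k; exact: intf_elt_rint].
Qed.

Lemma qoi_sub v w (T : element M) : V_0 v -> V_0 w -> qoi T (subV v w) = qoi T v - qoi T w.
Proof. by move=> hv hw; rewrite subV_lincomb qoi_lincomb; [rewrite big_bool /= mul1r mulN1r|case]. Qed.

Lemma qoi_zero v (T : element M) : V_0 v -> zeroV v -> qoi T v = 0.
Proof.
move=> hv [z0 z1]; case: T => t /=; last first.
  rewrite (@ae_eq_Rint _ _ _ _ _ (intf_elt_dom_meas t) _ (fun=> 0)) ?Rintegral_cst ?mul0r ?mulr0//.
  - exact: intf_elt_dom_meas.
  - by apply: measurable_funS (intf_sqint (intf_seg t) hv).1; [exact: mdom|exact: subIsetr].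
  - by move: (z1 (intf_seg t)); apply: filterS => y h [_ /h].
rewrite big1 ?mulr0// => i _.
rewrite (@ae_eq_Rint _ _ _ _ _ (bulk_elt_seg_meas t i) _ (fun=> 0)) ?Rintegral_cst ?mul0r//.
- exact: bulk_elt_seg_meas.
- by apply: measurable_funS (bulk_sqint i hv).1; [exact: mseg|exact: subIsetr].
- by move: (z0 i); apply: filterS => y h [_ /h].
Qed.

Variable phi : element M -> mdfun G.
Hypothesis hphi : prototypical_basis A0 A1 B1 phi.

Local Notation Vt := (V_tilde M A0 A1 B1).

Lemma V_tilde_lincomb (K : finType) (c : K -> R) (w : K -> mdfun G) : (forall k, Vt (w k)) -> Vt (lincomb c w).
Proof.
move=> hw; split; first by apply: (V_0_lincomb d2 hG) => k; case: (hw k).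
move=> v hv; rewrite (form_lincombl d2 hG hA0 hA1 hB1)//; last 2 first.
- by case: hv.
- by move=> k; case: (hw k).
by rewrite big1// => k _; have [_ ->//] := hw k; rewrite mulr0.
Qed.

Lemma V_tilde_sub v w : Vt v -> Vt w -> Vt (subV v w).
Proof. by move=> hv hw; rewrite subV_lincomb; apply: V_tilde_lincomb => -[]. Qed.

Let phiV T : V_0 (phi T). Proof. by case: (hphi T) => -[]. Qed.
Let phiVt T : Vt (phi T). Proof. by case: (hphi T). Qed.

Lemma qoi_span c T : qoi T (lincomb c phi) = c T.
Proof.
rewrite qoi_lincomb// (bigD1 T)//= big1 ?addr0; first by have [_ ->] := hphi T; rewrite eqxx mulr1.
by move=> S ST; have [_ ->] := hphi S; rewrite eq_sym (negbTE ST) mulr0.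
Qed.

Lemma interpolant_V_tilde v : Vt (interpolant phi v).
Proof. exact: V_tilde_lincomb. Qed.

Lemma interpolant_kernel v : V_0 v -> kernel_W M (subV v (interpolant phi v)).
Proof.
move=> hv; have [hI _] := interpolant_V_tilde v.
split; first exact: V_0_sub.
by move=> T; rewrite qoi_sub// qoi_span subrr.
Qed.

(** v - R v lies both in V_tilde and in W, so it is orthogonal to itself. This is the sense in which
    the [phi T] span V_tilde: up to equality almost everywhere. *)
Lemma interpolant_zero v : Vt v -> zeroV (subV v (interpolant phi v)).
Proof.
move=> hv; have [v0 _] := hv; have hw := interpolant_kernel v0.
apply: (form_definite d2 hG alpha0 beta0 hA0 hA1 hB1); first by case: hw.
by have [_ ->] := V_tilde_sub hv (interpolant_V_tilde v).
Qed.

(** The Gram matrix of the basis is invertible: a vector in its kernel gives a combination w with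
    a(w, w) = 0, hence w = 0 almost everywhere, and its coefficients are the values [qoi T w]. *)
Lemma exists_coefficients (b : element M -> R) :
  exists c, forall T, a (lincomb c phi) (phi T) = b T.
Proof.
pose N := #|{: element M}|; pose ev (s : 'I_N) : element M := enum_val s.
pose Gm : 'M[R]_N := \matrix_(s, t) a (phi (ev s)) (phi (ev t)).
pose cf (x : 'rV[R]_N) (T : element M) := x ord0 (enum_rank T).
have aE x T : a (lincomb (cf x) phi) (phi T) = (x *m Gm) ord0 (enum_rank T).
  rewrite (form_lincombl d2 hG hA0 hA1 hB1)// mxE (big_enum_val (A := {: element M})).
  by apply: eq_bigr => s _; rewrite mxE /cf /ev enum_valK enum_rankK.
have Gu : Gm \in unitmx.
  rewrite -row_free_unit -kermx_eq0; apply/negPn/negP => /rowV0Pn[x /sub_kermxP xG x0].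
  have aw T : a (lincomb (cf x) phi) (phi T) = 0 by rewrite aE xG mxE.
  have hw : V_0 (lincomb (cf x) phi) by exact: V_0_lincomb.
  have ww : a (lincomb (cf x) phi) (lincomb (cf x) phi) = 0.
    by rewrite (form_lincombr d2 hG hA0 hA1 hB1)// big1// => T _; rewrite aw mulr0.
  have zw := form_definite d2 hG alpha0 beta0 hA0 hA1 hB1 hw ww.
  move/eqP: x0; apply; apply/rowP => s; rewrite mxE.
  by have := qoi_span (cf x) (ev s); rewrite qoi_zero// /cf /ev enum_valK => <-.
exists (cf ((\row_s b (ev s)) *m invmx Gm)) => T.
by rewrite aE mulmxKV// mxE /ev enum_rankK.
Qed.

Variables (f0 : bulk_fun G R) (f1 : intf_fun G R).
Hypotheses (hf0 : forall i, L2 (seg i) (f0 i)) (hf1 : forall j, L2 (dom j) (f1 j)).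
Local Notation solution := (prototypical_solution M A0 A1 B1 f0 f1).

(** The equations are solved for v = [phi T] and then extended to V_tilde. A function of V_tilde and
    its interpolant are distinct records in general, so the form is compared through orthogonality
    to W and the load through almost everywhere equality. *)
Lemma prototypical_exists : exists uH, solution uH.
Proof.
have [c hc] := exists_coefficients (fun T => load f0 f1 (phi T)).
have hu : Vt (lincomb c phi) by exact: V_tilde_lincomb.
exists (lincomb c phi); split => // v hv; have [v0 _] := hv.
have hI := interpolant_V_tilde v; have [I0 _] := hI.
have hw := interpolant_kernel v0; have [w0 _] := hw.
have l0 : load f0 f1 (subV v (interpolant phi v)) = 0.
  by apply: (load_zero d2 hG hf0 hf1) => //; exact: interpolant_zero.
have [u0 uW] := hu.
have := uW _ hw; rewrite (form_subr d2 hG hA0 hA1 hB1)// => /eqP; rewrite subr_eq0 => /eqP ->.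
move: l0; rewrite (load_sub d2 hG hf0 hf1)// => /eqP; rewrite subr_eq0 => /eqP ->.
rewrite /interpolant (form_lincombr d2 hG hA0 hA1 hB1)// (load_lincomb d2 hG hf0 hf1)//.
by apply: eq_bigr => T _; rewrite hc.
Qed.

Lemma zeroV_sub v w : zeroV (subV v w) -> eqV v w.
Proof.
move=> [z0 z1]; split => i.
  by move: (z0 i); apply: filterS => x h ix; apply/eqP; rewrite -subr_eq0; apply/eqP; exact: h.
by move: (z1 i); apply: filterS => x h ix; apply/eqP; rewrite -subr_eq0; apply/eqP; exact: h.
Qed.

Lemma prototypical_unique v w : solution v -> solution w -> eqV v w.
Proof.
move=> [hv av] [hw aw]; apply: zeroV_sub.
have hvw := V_tilde_sub hv hw; have [vw0 _] := hvw; have [v0 _] := hv; have [w0 _] := hw.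
apply: (form_definite d2 hG alpha0 beta0 hA0 hA1 hB1) => //.
by rewrite (form_subl d2 hG hA0 hA1 hB1)// av// aw// subrr.
Qed.

(** u - R u is in W, hence orthogonal to every test function of V_tilde, so that R u satisfies the
    same equations as u there. *)
Lemma interpolant_solution u : model_solution A0 A1 B1 f0 f1 u -> solution (interpolant phi u).
Proof.
move=> [u0 au]; have hI := interpolant_V_tilde u; split => // v hv; have [v0 vW] := hv; have [I0 _] := hI.
have := vW _ (interpolant_kernel u0).
rewrite (form_subr d2 hG hA0 hA1 hB1)// => /eqP; rewrite subr_eq0 => /eqP e.
by rewrite form_sym -e form_sym au.
Qed.

Lemma prototypical_interpolant u uH : model_solution A0 A1 B1 f0 f1 u -> solution uH -> eqV uH (interpolant phi u).
Proof. by move=> hu hH; apply: prototypical_unique => //; exact: interpolant_solution. Qed.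

(* uH = R u puts the error e in W, so that a(uH, e) = 0. *)
Lemma galerkin_error u uH : model_solution A0 A1 B1 f0 f1 u -> solution uH ->
  [/\ V_0 (subV u uH), forall T : element M, qoi T (subV u uH) = 0 &
      a (subV u uH) (subV u uH) = load f0 f1 (subV u uH)].
Proof.
move=> hu hH; have [u0 au] := hu; have [hHt aH] := hH; have [H0 HW] := hHt.
have e0 : V_0 (subV u uH) by exact: V_0_sub.
have qe (T : element M) : qoi T (subV u uH) = 0.
  have z : zeroV (subV (interpolant phi u) uH).
    have hI := interpolant_solution hu; have [hIt aI] := hI; have [I0 _] := hIt.
    have hd := V_tilde_sub hIt hHt; have [hd0 _] := hd.
    apply: (form_definite d2 hG alpha0 beta0 hA0 hA1 hB1) => //.
    by rewrite (form_subl d2 hG hA0 hA1 hB1)// aI// aH// subrr.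
  have [I0 _] := interpolant_V_tilde u.
  have := qoi_zero T (V_0_sub d2 hG I0 H0) z; rewrite qoi_sub// /interpolant qoi_span => /eqP; rewrite subr_eq0 => /eqP h.
  by rewrite qoi_sub// h subrr.
split => //; have eW : kernel_W M (subV u uH) by split.
rewrite (form_subl d2 hG hA0 hA1 hB1)// au// HW// subr0.
by [].
Qed.

End prototypical.

(** * Error estimate *)

Section convex_bodies.
Context (R : realType) (n : nat).
Local Notation mu := (leb R n).
Implicit Types T U : set 'rV[R]_n.

Lemma interior_contraction T x0 p (t : R) : convex_rV T -> interior T x0 -> T p -> 0 <= t < 1 ->
  interior T (x0 + t *: (p - x0)).
Proof.
move=> cT ix Tp /andP[t0 t1]; have [e /= e0 he] : exists2 e : R, 0 < e & ball x0 e `<=` T.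
  by case/nbhs_ballP: ix => e /= e0 h; exists e.
apply/nbhs_ballP; exists ((1 - t) * e) => /=; first by rewrite mulr_gt0// subr_gt0.
have t1n : 1 - t != 0 by rewrite gt_eqF// subr_gt0.
move=> y hy; pose q := x0 + (1 - t)^-1 *: (y - (x0 + t *: (p - x0))).
have Tq : T q.
  apply: he; rewrite -ball_normE /= /q opprD addNKr normrN normrZ gtr0_norm ?invr_gt0 ?subr_gt0//.
  rewrite mulrC ltr_pdivrMr ?subr_gt0// mulrC.
  by move: hy; rewrite -ball_normE /= distrC.
have -> : y = q + t *: (p - q) by apply/rowP => i; rewrite /q !mxE; field.
by apply: cT => //; exact: ltW.
Qed.

Lemma interior_convex T : convex_rV T -> convex_rV (interior T).
Proof.
move=> cT x y t ix iy t0 t1; have [->|tn] := eqVneq t 1.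
  by rewrite scale1r addrC subrK.
by apply: interior_contraction => //; [exact: interior_subset ix|rewrite t0 lt_neqAle tn t1].
Qed.

(** Contracting T by t < 1 towards an interior point maps it into its interior, so t^n |T| is at
    most the measure of the interior; then t tends to one. *)
Lemma boundary_null T : closed T -> compact T -> convex_rV T -> interior T !=set0 ->
  mu (T `\` interior T) = 0%E.
Proof.
move=> clT coT cT [x0 ix]; have oU : open (interior T) by exact: open_interior.
have mU : measurable (interior T) by exact: open_measurable_rV.
have mT : measurable T by exact: closed_measurable_rV.
have fT : (mu T < +oo)%E by apply: leb_bounded => //; exact: compact_bounded.
have UT : interior T `<=` T by exact: interior_subset.
have fU : (mu (interior T) < +oo)%E by apply: le_lt_trans fT; apply: le_measure; rewrite ?inE.
have key (t : R) : 0 < t < 1 -> (mu T <= (t ^- n)%:E * mu (interior T))%E.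
  move=> /andP[t0 t1]; have := @leb_homothety R n t ((1 - t) *: x0) (interior T) (lt0r_neq0 t0) mU.
  rewrite gtr0_norm// => <-.
  have tn : t != 0 by rewrite gt_eqF.
  have mS : measurable [set x : 'rV[R]_n | interior T (t *: x + (1 - t) *: x0)].
    apply: (measurable_rV_comp (f := fun x : 'rV[R]_n => t *: x + (1 - t) *: x0)) => //.
    apply: measurable_rVD; last exact: measurable_cst.
    by apply: measurable_rVZ; [exact: measurable_cst|exact: measurable_id].
  apply: le_measure; rewrite ?inE// => p Tp /=.
  rewrite (_ : _ + _ = x0 + t *: (p - x0)); last by apply/rowP => i; rewrite !mxE; ring.
  by apply: interior_contraction => //; rewrite (ltW t0).
have eqm : mu (interior T) = mu T.
  have fineU : mu (interior T) = (fine (mu (interior T)))%:E by rewrite fineK// ge0_fin_numE.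
  have fineT : mu T = (fine (mu T))%:E by rewrite fineK// ge0_fin_numE.
  apply/eqP; rewrite eq_le; apply/andP; split; first by apply: le_measure; rewrite ?inE.
  rewrite fineU fineT lee_fin.
  set u := fine (mu (interior T)) in fineU *; set s := fine (mu T) in fineT *.
  have k2 (t : R) : 0 < t < 1 -> t ^+ n * s <= u.
    move=> h; have := key t h; rewrite fineU fineT -EFinM lee_fin; case/andP: h => t0 t1.
    by rewrite mulrC ler_pdivlMr ?exprn_gt0// mulrC.
  (* The ratios are t = 1 - 1/(k+1), admissible once k > 0. *)
  have c : (1 - harmonic k) ^+ n * s @[k --> \oo] --> (1 - 0) ^+ n * s.
    apply: cvgMr_tmp; have hk : (1 - harmonic k) @[k --> \oo] --> (1 - 0 : R).
      by apply: (@cvgB _ R^o); [exact: cvg_cst|exact: cvg_harmonic].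
    exact: cvg_trans (cvg_app _ hk) (@exprn_continuous R n _).
  rewrite subr0 expr1n mul1r in c.
  apply: (closed_cvg (fun y : R => y <= u) (@closed_le R u) _ _ c).
  near=> k; apply: k2; rewrite /harmonic; apply/andP; split.
    by rewrite /= subr_gt0 invf_lt1 ?ltr0n// ltr1n ltnS; near: k; exact: nbhs_infty_gt.
  by rewrite ltrBlDr ltrDl invr_gt0 ltr0n.
have fnT : mu (interior T) \is a fin_num by rewrite ge0_fin_numE.
have mTU : mu (T `&` interior T) = mu (interior T) by congr (mu _); exact: setIidr.
have -> : mu (T `\` interior T) = (mu T - mu (T `&` interior T))%E by exact: measureD.
by rewrite mTU -eqm subee.
Unshelve. all: by end_near.
Qed.

Lemma Rint_interior T D (g : 'rV[R]_n -> R) : closed T -> compact T -> convex_rV T -> interior T !=set0 ->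
  measurable D -> interior T `<=` D -> rint mu D g ->
  \int[mu]_(x in T `&` D) g x = \int[mu]_(x in interior T) g x.
Proof.
move=> clT coT cT i0 mD UD hg.
have mT : measurable T by exact: closed_measurable_rV.
have mU : measurable (interior T) by apply: open_measurable_rV; exact: open_interior.
have UT : interior T `<=` T by exact: interior_subset.
have E : T `&` D = interior T `|` ((T `\` interior T) `&` D).
  apply/seteqP; split => x.
    by move=> [Tx Dx]; have [ix|ix] := pselect (interior T x); [left|right].
  by move=> [ix|[[Tx _] Dx]]; split => //; [exact: UT|exact: UD].
have mN : measurable ((T `\` interior T) `&` D) by apply: measurableI => //; exact: measurableD.
have N0 : mu ((T `\` interior T) `&` D) = 0%E.
  apply/eqP; rewrite eq_le measure_ge0 andbT -(boundary_null clT coT cT i0).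
  apply: le_measure; rewrite ?inE//; first exact: measurableD.
have iE : mu.-integrable (T `&` D) (EFin \o g).
  by apply: (integrableS mD _ _ hg); [exact: measurableI|exact: subIsetr].
have dE : [disjoint interior T & (T `\` interior T) `&` D] by apply/disj_setPS => x [ix [[_ nx] _]].
rewrite E in iE *; rewrite (Rintegral_setU mU mN iE dE).
have -> : \int[mu]_(x in (T `\` interior T) `&` D) g x = 0; last by rewrite addr0.
rewrite /Rintegral null_set_integral//.
by case/integrableP: hg => mg _; apply: measurable_funS mg => //; exact: subIsetr.
Qed.

End convex_bodies.

(** * Summation over the elements of one segment *)

Section mesh_partition.
Context (R : realType) (n : nat) (D : set 'rV[R]_n) (K : finType) (P : pred K) (T : K -> set 'rV[R]_n).
Local Notation mu := (leb R n).
Hypotheses (oD : open D) (iD : interior (closure D) `<=` D).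
Hypothesis cover : closure D = \bigcup_(k in [set k | P k]) T k.
Hypothesis closed_T : forall k, P k -> closed (T k).
Hypothesis compact_T : forall k, P k -> compact (T k).
Hypothesis convex_T : forall k, P k -> convex_rV (T k).
Hypothesis interior_T : forall k, P k -> interior (T k) !=set0.
Hypothesis disjoint_T : forall k k', P k -> P k' -> k != k' -> interior (T k) `&` interior (T k') = set0.
Let U k := interior (T k).

Lemma element_sub k : P k -> U k `<=` D.
Proof.
move=> Pk x ix; apply: iD; apply: filterS ix => y Ty; rewrite cover; by exists k.
Qed.

Let mD : measurable D. Proof. exact: open_measurable_rV. Qed.
Let mU k : measurable (U k). Proof. by apply: open_measurable_rV; exact: open_interior. Qed.

(** The closed elements cover D, their boundaries are null and their interiors are disjoint, so
    almost every point of D is in exactly one of these interiors. *)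
Lemma Rint_elements (g : 'rV[R]_n -> R) : rint mu D g ->
  \int[mu]_(x in D) g x = \sum_(k | P k) \int[mu]_(x in U k) g x.
Proof.
move=> hg.
have rk k : rint mu D (fun x => \1_(U k) x * g x).
  apply: (@rint_le _ _ _ _ _ _ _ (fun x => `|g x|)) => //.
  - by apply: measurable_funM; [exact: measurable_indic|exact: rint_meas hg].
  - move=> x _; rewrite normrM indicE; case: (_ \in _); rewrite ?normr1 ?mul1r// normr0 mul0r//.
  - exact: integrable_norm hg.
have Ek k : P k -> \int[mu]_(x in U k) g x = \int[mu]_(x in D) (\1_(U k) x * g x).
  move=> Pk; rewrite Rintegral_mkcond [RHS]Rintegral_mkcond; apply: eq_Rintegral => x _.
  rewrite !patchE indicE; case: ifPn => [xU|xU]; last by case: ifP => // _; rewrite mul0r.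
  by rewrite mem_set ?mul1r//; apply: (element_sub Pk); exact: set_mem.
rewrite (eq_bigr _ Ek) -(Rint_sum mD _ _ rk); apply: ae_eq_Rint => //.
- exact: rint_meas hg.
- by apply: rint_meas; exact: rint_sum.
have null k : P k -> {ae mu, forall x, T k x -> U k x}.
  move=> Pk; exists (T k `\` U k); split.
  - by apply: measurableD => //; apply: closed_measurable_rV; exact: closed_T.
  - exact: (boundary_null (closed_T Pk) (compact_T Pk) (convex_T Pk) (interior_T Pk)).
  - by move=> x /= h; apply: contrapT => h2; apply: h => Tx; apply: contrapT => Ux; apply: h2.
have all : {ae mu, forall x, forall k, P k -> T k x -> U k x}.
  apply: (@filter_forall _ _ (fun k x => P k -> T k x -> U k x) (almost_everywhere mu) _) => k.
  have [Pk|nPk] := boolP (P k); last by apply: aeW => x.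
  by apply: filterS (null k Pk) => x h _.
apply: filterS all => x h Dx.
have [k Pk Tk] : exists2 k, P k & T k x.
  have : closure D x by exact: subset_closure.
  by rewrite cover => -[k Pk Tk]; exists k.
have Uk := h k Pk Tk.
rewrite (bigD1 k)//= indicE mem_set// mul1r big1 ?addr0// => k' /andP[Pk' kk'].
rewrite indicE memNset ?mul0r// => Uk'.
by have := disjoint_T Pk Pk' (_ : k != k'); rewrite eq_sym kk' => /(_ isT); rewrite -subset0 => /(_ x); apply.
Qed.

Variables (h : R).
Hypothesis h0 : 0 <= h.
Hypothesis diam_T : forall k x y, P k -> T k x -> T k y -> dot (x - y) (x - y) <= h ^+ 2.
Variables (e : 'rV[R]_n -> R) (de : 'rV[R]_n -> 'rV[R]_n).
Hypotheses (He : H1 D e de) (Ae : H1_approx D e de).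
Hypothesis mean0 : forall k, P k -> \int[mu]_(x in U k) e x = 0.

Let UT k : U k `<=` T k. Proof. exact: interior_subset. Qed.
Let oU k : open (U k). Proof. exact: open_interior. Qed.
Let bU k : P k -> bounded_set (U k).
Proof. by move=> Pk; apply: (@bounded_subset R 'rV[R]_n _ _ (@UT k)); apply: compact_bounded; exact: compact_T. Qed.
Let cU k : P k -> convex_rV (U k).
Proof. by move=> Pk; apply: interior_convex; exact: convex_T. Qed.
Let dU k : P k -> forall x y, U k x -> U k y -> dot (x - y) (x - y) <= h ^+ 2.
Proof. by move=> Pk x y /UT Tx /UT Ty; exact: diam_T Pk Tx Ty. Qed.
Let e2 : sqint mu D e. Proof. by case: He. Qed.
Let e2U k : P k -> sqint mu (U k) e.
Proof. by move=> Pk; apply: (sqint_subset mD (mU k) _ e2); exact: element_sub. Qed.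
Let Ape k : P k -> L2_approx (U k) e.
Proof. by move=> Pk; exact: H1_approx_L2 He Ae mD (mU k) (element_sub Pk). Qed.

Lemma dot_rint (df : 'rV[R]_n -> 'rV[R]_n) : (forall i, L2 D (fun x => df x ord0 i)) -> rint mu D (fun x => dot (df x) (df x)).
Proof. by move=> hdf; apply: rint_sum => // i; apply: sqintM => //; exact: hdf. Qed.

Let C := 2 ^+ n * h.
Let C0 : 0 <= C. Proof. by rewrite mulr_ge0// exprn_ge0. Qed.

Let poincare_U k : P k -> \int[mu]_(x in U k) e x ^+ 2 <= C ^+ 2 * grad_norm2 (U k) de.
Proof.
move=> Pk; apply: (@poincare R n D (U k)) => //.
- exact: bU.
- exact: cU.
- exact: interior_T.
- exact: element_sub.
- exact: dU.
- exact: Ape.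
- exact: mean0.
Qed.

Lemma mesh_poincare : L2_norm2 D e <= C ^+ 2 * grad_norm2 D de.
Proof.
rewrite /L2_norm2 /grad_norm2 (Rint_elements (sqint_sq e2)).
have hde : forall i, L2 D (fun x => de x ord0 i) by case: He.
rewrite (Rint_elements (dot_rint hde)) mulr_sumr; apply: ler_sum => k Pk.
exact: poincare_U.
Qed.

(** For s = 0, Cauchy-Schwarz on D and [mesh_poincare]. For s = 1, [poincare_mean0] followed by the
    Poincaré inequality on each element gives C twice, and the discrete Cauchy-Schwarz inequality
    sums the products of local gradient norms. *)
Lemma mesh_load (s : nat) f df : (s <= 1)%N -> Hs s D f df ->
  `|\int[mu]_(x in D) (f x * e x)| <= C ^+ s.+1 * (Num.sqrt (Hs_seminorm2 s D f df) * Num.sqrt (grad_norm2 D de)).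
Proof.
have sqle (x y z w : R) : 0 <= y -> 0 <= z -> 0 <= w -> x ^+ 2 <= y ^+ 2 * (z * w) -> `|x| <= y * (Num.sqrt z * Num.sqrt w).
  move=> y0 z0 w0 hx; have -> : y * (Num.sqrt z * Num.sqrt w) = Num.sqrt (y ^+ 2 * (z * w)).
    by rewrite sqrtrM ?sqr_ge0// sqrtr_sqr ger0_norm// sqrtrM.
  by rewrite -sqrtr_sqr; exact: ler_wsqrtr.
have g0 (Z : set 'rV[R]_n) b : 0 <= grad_norm2 Z b by apply: Rintegral_ge0 => x _; exact: dot_ge0.
have l0 (Z : set 'rV[R]_n) b : 0 <= L2_norm2 Z b by apply: Rintegral_ge0 => x _; exact: sqr_ge0.
case: s => [_ hf|[_ hf|//]].
  apply: sqle => //=; apply: (le_trans (sqint_Cauchy_Schwarz mD hf e2)).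
  rewrite expr1 [leRHS]mulrCA; apply: ler_wpM2l; first exact: l0.
  exact: mesh_poincare.
have [f2 df2 _] := hf; have de2 : forall i, L2 D (fun x => de x ord0 i) by case: He.
rewrite (Rint_elements (sqintM mD f2 e2)).
have step k : P k -> `|\int[mu]_(x in U k) (f x * e x)| <= C ^+ 2 * (Num.sqrt (grad_norm2 (U k) df) * Num.sqrt (grad_norm2 (U k) de)).
  move=> Pk; apply: sqle => //; first by rewrite exprn_ge0.
  have pm : (\int[mu]_(x in U k) (f x * e x)) ^+ 2 <= C ^+ 2 * (grad_norm2 (U k) df * \int[mu]_(x in U k) e x ^+ 2).
    apply: (@poincare_mean0 R n D (U k)) => //; [exact: bU|exact: cU|exact: interior_T|exact: element_sub|exact: dU|exact: e2U|exact: Ape|exact: mean0].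
  apply: (le_trans pm).
  rewrite -[(C ^+ 2) ^+ 2]/(C ^+ 2 * C ^+ 2) -mulrA; apply: ler_wpM2l; first exact: sqr_ge0.
  rewrite mulrCA; apply: ler_wpM2l => //.
  exact: poincare_U.
apply: (le_trans (ler_norm_sum _ _ _)); apply: (le_trans (ler_sum _ step)).
rewrite -mulr_sumr; apply: ler_wpM2l; first by rewrite exprn_ge0.
rewrite /= -sqrtrM// -[leLHS]ger0_norm; last by apply: sumr_ge0 => k _; rewrite mulr_ge0 ?sqrtr_ge0.
rewrite -sqrtr_sqr; apply: ler_wsqrtr; rewrite big_mkcond /=.
have -> : \sum_k (if P k then Num.sqrt (grad_norm2 (U k) df) * Num.sqrt (grad_norm2 (U k) de) else 0) =
    \sum_k (if P k then Num.sqrt (grad_norm2 (U k) df) else 0) * (if P k then Num.sqrt (grad_norm2 (U k) de) else 0).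
  by apply: eq_bigr => k _; case: ifP; rewrite ?mul0r.
apply: (le_trans (sum_Cauchy_Schwarz _ _)).
have sq (b : 'rV[R]_n -> 'rV[R]_n) : (forall i, L2 D (fun x => b x ord0 i)) ->
    \sum_k (if P k then Num.sqrt (grad_norm2 (U k) b) else 0) ^+ 2 = grad_norm2 D b.
  move=> b2; rewrite [RHS](Rint_elements (dot_rint b2)) [RHS]big_mkcond; apply: eq_bigr => k _.
  by case: ifP => _; [rewrite sqr_sqrtr|rewrite expr0n].
by rewrite !sq.
Qed.

End mesh_partition.

Section element_size.
Context (R : realType) (n : nat).
Implicit Types T : set 'rV[R]_n.

Lemma ball_enorm_sub (r : R) (x y : 'rV[R]_n) : 0 < r -> ball 0 r x -> ball 0 r y -> enorm (x - y) <= n%:R * (r + r).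
Proof.
move=> r0 bx b_y; apply: ball_enorm; first by rewrite addr_gt0.
by apply: ball_triangle bx; apply: ball_sym.
Qed.

Lemma diam_le T (r : R) : 0 < r -> T !=set0 -> T `<=` ball 0 r -> diam T <= n%:R * (r + r).
Proof.
move=> r0 [x Tx] Tr; apply: ge_sup; first by exists (enorm (x - x)), x, x.
by move=> _ [y [z [Ty Tz ->]]]; apply: ball_enorm_sub => //; exact: Tr.
Qed.

Lemma enorm_le_diam T (x y : 'rV[R]_n) : bounded_set T -> T x -> T y -> enorm (x - y) <= diam T.
Proof.
move=> /bounded_sub_ball[r r0 Tr] Tx Ty; apply: ub_le_sup; last by exists x, y.
by exists (n%:R * (r + r)) => _ [z [w [Tz Tw ->]]]; apply: ball_enorm_sub => //; exact: Tr.
Qed.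

Lemma regular_element_interior (sigma tau H : R) T : 0 < sigma -> 0 < tau -> 0 < H ->
  regular_element sigma tau H T -> interior T !=set0.
Proof.
move=> s0 t0 H0 [/andP[dT _] [x hx]]; exists x.
have r0 : 0 < diam T / sigma by rewrite divr_gt0//; apply: lt_le_trans dT; exact: mulr_gt0.
have e0 : 0 < diam T / sigma / n.+1%:R by rewrite divr_gt0.
apply/nbhs_ballP; exists (diam T / sigma / n.+1%:R) => //= y bxy; apply: hx => /=.
apply: le_trans (ball_enorm e0 bxy) _; rewrite mulrCA -[leRHS]mulr1; apply: ler_wpM2l; first exact: ltW.
by rewrite ler_pdivrMr// mul1r ler_nat.
Qed.

Lemma regular_element_diam (sigma tau H : R) T (x y : 'rV[R]_n) : bounded_set T -> regular_element sigma tau H T ->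
  T x -> T y -> dot (x - y) (x - y) <= H ^+ 2.
Proof.
move=> bT [/andP[_ dT] _] Tx Ty; rewrite -enorm_sqr.
have h := le_trans (enorm_le_diam bT Tx Ty) dT.
by rewrite ler_sqr ?nnegrE ?enorm_ge0// (le_trans (enorm_ge0 _) h).
Qed.

End element_size.

(** * Bounds for the error and for the load at the error *)

Section convergence.
Context (R : realType) (d : nat) (d2 : (1 < d)%N) (G : geometry R d).
Hypothesis hG : mixed_geometry G.
Variables (sigma tau : R).
Hypotheses (sigma0 : 0 < sigma) (tau0 : 0 < tau).

(** The L^2 part of [normV] is at most a multiple of H times the gradient part, so a constant
    independent of H requires H to be bounded. It is the diameter of an element, and elements lie in
    the closure of Omega. *)
Lemma mesh_size_bound : exists2 Hmax : R, 0 < Hmax &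
  forall (H : R) (M : meshes G), 0 < H -> coarse_meshes sigma tau H M -> H <= Hmax.
Proof.
have [r r0 hr] := bounded_sub_ball (Omega_bounded hG).
(* The closure of Omega lies in a ball of radius r + 1, and d converts sup norm to Euclidean
   distances; the last 1 ensures positivity. *)
exists (d%:R * (r + 1 + (r + 1)) + 1) => [|H M H0 hM].
  by rewrite ltr_wpDl// mulr_ge0// addr_ge0// addr_ge0// ltW.
have [k <-] := bulk_mesh_size hM; apply: (@le_trans _ _ (d%:R * (r + 1 + (r + 1)))); last by rewrite lerDl.
have [x ix] := regular_element_interior sigma0 tau0 H0 (bulk_regular hM k).
apply: diam_le; [by rewrite addr_gt0|by exists x; exact: interior_subset ix|].
move=> y Ty; have cy : closure (Omega G) y by case: (bulk_partition hM) => -> _ _; exists k.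
have [z [Oz yz]] := cy _ (@nbhsx_ballx _ _ y 1 ltr01).
by apply: (ball_triangle (hr z Oz)); exact: ball_sym.
Qed.

Variables (H : R) (M : meshes G).
Hypotheses (H0 : 0 < H) (hM : coarse_meshes sigma tau H M).
Variable e : mdfun G.
Hypotheses (he : V_0 e) (qe : forall T : element M, qoi T e = 0).

Let C := 2 ^+ d * H.

Lemma element_volume_neq0 n (T : set 'rV[R]_n) : closed T -> compact T -> interior T !=set0 ->
  (fine (leb R n T))^-1 != 0.
Proof.
move=> clT coT iT; rewrite invr_eq0 gt_eqF// fine_gt0//; apply/andP; split.
  apply: lt_le_trans (leb_open_gt0 (@open_interior _ _) iT) _; apply: le_measure; rewrite ?inE.
  - by apply: open_measurable_rV; exact: open_interior.
  - exact: closed_measurable_rV.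
  - exact: interior_subset.
by apply: leb_bounded; [exact: compact_bounded|exact: closed_measurable_rV].
Qed.

Let bulk_int k : interior (bulk_elt (m := M) k) !=set0.
Proof. exact: regular_element_interior sigma0 tau0 H0 (bulk_regular hM k). Qed.

Let intf_int k : interior (intf_elt (m := M) k) !=set0.
Proof. exact: regular_element_interior sigma0 tau0 H0 (intf_regular hM k). Qed.

(** [qoi] sums over all bulk segments. Those other than i meet the element only in its null
    boundary, because its interior lies in segment i and segments are disjoint. *)
Lemma bulk_mean0 k i : interior (bulk_elt (m := M) k) `<=` seg i ->
  \int[leb R d]_(x in interior (bulk_elt k)) bulk e i x = 0.
Proof.
move=> ki; have [cl co cv] := bulk_elt_hull hM k.
have := qe (inl k) => /= /eqP; rewrite mulf_eq0 (negbTE (element_volume_neq0 cl co (bulk_int k))) /=.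
have rD : rint (leb R d) (seg i) (bulk e i).
  by apply: sqint_bounded_rint; [exact: mseg|exact: seg_bounded|exact: bulk_sqint].
have mD : measurable (seg i) by exact: mseg.
rewrite (bigD1 i)//= (Rint_interior cl co cv (bulk_int k) mD ki rD) big1 ?addr0 => [/eqP//|i' ii'].
have mTi := bulk_elt_seg_meas hG hM k i'.
have sub : bulk_elt k `&` seg i' `<=` bulk_elt k `\` interior (bulk_elt k).
  by move=> x [Tx ix']; split => // /ki ix; move/eqP: ii'; apply; exact: seg_inj ix' ix.
rewrite /Rintegral null_set_integral//.
  by case/integrableP: (bulk_elt_rint hG hM k i' he).
apply/eqP; rewrite eq_le measure_ge0 andbT -(boundary_null cl co cv (bulk_int k)).
apply: le_measure; rewrite ?inE//; apply: measurableD; first exact: closed_measurable_rV.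
by apply: open_measurable_rV; exact: open_interior.
Qed.

Lemma intf_mean0 k : interior (intf_elt (m := M) k) `<=` dom (intf_seg k) ->
  \int[leb R (d - 1)]_(x in interior (intf_elt k)) intf e (intf_seg k) x = 0.
Proof.
move=> ki; have [cl co cv] := intf_elt_hull hM k.
have := qe (inr k) => /= /eqP; rewrite mulf_eq0 (negbTE (element_volume_neq0 cl co (intf_int k))) /=.
have rD : rint (leb R (d - 1)) (dom (intf_seg k)) (intf e (intf_seg k)).
  by apply: sqint_bounded_rint; [exact: mdom|exact: dom1_bounded|exact: intf_sqint].
have mD : measurable (dom (intf_seg k)) by exact: mdom.
by rewrite (Rint_interior cl co cv (intf_int k) mD ki rD) => /eqP.
Qed.

Lemma seg_interior_closure (i : segment_index G 0) : interior (closure (seg i)) `<=` seg i.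
Proof.
by apply: emb_interior_closure; [exact: subn0|exact: (dom_open hG)|exact: (dom_lipschitz hG)].
Qed.

Lemma bulk_estimates i :
  L2_norm2 (seg i) (bulk e i) <= C ^+ 2 * grad_norm2 (seg i) (dbulk e i) /\
  forall s f df, (s <= 1)%N -> Hs s (seg i) f df ->
    `|\int[leb R d]_(x in seg i) (f x * bulk e i x)| <=
    C ^+ s.+1 * (Num.sqrt (Hs_seminorm2 s (seg i) f df) * Num.sqrt (grad_norm2 (seg i) (dbulk e i))).
Proof.
have [P cover] := bulk_resolves hM i; pose PP := [pred k | k \in P].
have clT k : PP k -> closed (bulk_elt k) by case: (bulk_elt_hull hM k).
have coT k : PP k -> compact (bulk_elt k) by case: (bulk_elt_hull hM k).
have cvT k : PP k -> convex_rV (bulk_elt k) by case: (bulk_elt_hull hM k).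
have iT k : PP k -> interior (bulk_elt k) !=set0 by [].
have dT k k' : PP k -> PP k' -> k != k' -> interior (bulk_elt k) `&` interior (bulk_elt k') = set0.
  by move=> _ _ kk'; have [_ _ h] := bulk_partition hM; have [] := h k k' isT isT kk'.
have dm k (x y : 'rV[R]_d) : PP k -> bulk_elt k x -> bulk_elt k y -> dot (x - y) (x - y) <= H ^+ 2.
  by move=> Pk; apply: regular_element_diam (bulk_regular hM k); apply: compact_bounded; exact: coT.
have iD := @seg_interior_closure i.
have m0 k : PP k -> \int[leb R d]_(x in interior (bulk_elt k)) bulk e i x = 0.
  by move=> Pk; apply: bulk_mean0; exact: (element_sub iD (P := PP) (T := @bulk_elt _ _ _ M) cover).
have He := V_bulk he i; have Ae := bulk_approx d2 he i.
have oD : open (seg i) by exact: open_seg.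
split=> [|s f df].
  exact: (mesh_poincare (P := PP) oD iD cover clT coT cvT iT dT (ltW H0) dm He Ae m0).
exact: (mesh_load (P := PP) oD iD cover clT coT cvT iT dT (ltW H0) dm He Ae m0).
Qed.

Let C' := 2 ^+ (d - 1) * H.

Lemma intf_estimates_aux j :
  L2_norm2 (dom j) (intf e j) <= C' ^+ 2 * grad_norm2 (dom j) (dintf e j) /\
  forall s f df, (s <= 1)%N -> Hs s (dom j) f df ->
    `|\int[leb R (d - 1)]_(x in dom j) (f x * intf e j x)| <=
    C' ^+ s.+1 * (Num.sqrt (Hs_seminorm2 s (dom j) f df) * Num.sqrt (grad_norm2 (dom j) (dintf e j))).
Proof.
pose P := [pred k | intf_seg (m := M) k == j].
have [cover _ disj] := intf_partition hM j.
have clT k : P k -> closed (intf_elt k) by case: (intf_elt_hull hM k).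
have coT k : P k -> compact (intf_elt k) by case: (intf_elt_hull hM k).
have cvT k : P k -> convex_rV (intf_elt k) by case: (intf_elt_hull hM k).
have iT k : P k -> interior (intf_elt k) !=set0 by [].
have dT k k' : P k -> P k' -> k != k' -> interior (intf_elt k) `&` interior (intf_elt k') = set0.
  by move=> Pk Pk' kk'; have [] := disj k k' Pk Pk' kk'.
have dm k (x y : 'rV[R]_(d - 1)) : P k -> intf_elt k x -> intf_elt k y -> dot (x - y) (x - y) <= H ^+ 2.
  by move=> Pk; apply: regular_element_diam (intf_regular hM k); apply: compact_bounded; exact: coT.
have oD : open (dom j) by exact: open_dom1.
have iD : interior (closure (dom j)) `<=` dom j.
  by rewrite (lipschitz_interior oD)//; apply: (dom_lipschitz hG); exact: ltnW.
have m0 k : P k -> \int[leb R (d - 1)]_(x in interior (intf_elt k)) intf e j x = 0.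
  move=> Pk; have sub := element_sub iD (P := P) (T := @intf_elt _ _ _ M) cover Pk.
  by move: sub; rewrite -(eqP Pk); exact: intf_mean0.
have He := V_intf he j; have Ae := intf_approx d2 he j; split=> [|s f df].
  exact: (mesh_poincare (P := P) oD iD cover clT coT cvT iT dT (ltW H0) dm He Ae m0).
exact: (mesh_load (P := P) oD iD cover clT coT cvT iT dT (ltW H0) dm He Ae m0).
Qed.

Let C'0 : 0 <= C'. Proof. by rewrite mulr_ge0 ?exprn_ge0// ltW. Qed.
Let C'C : C' <= C.
Proof. by rewrite ler_wpM2r ?(ltW H0)// ler_weXn2l ?ler1n// leq_subr. Qed.
Let C0 : 0 <= C. Proof. exact: le_trans C'C. Qed.

Lemma intf_estimates j :
  L2_norm2 (dom j) (intf e j) <= C ^+ 2 * grad_norm2 (dom j) (dintf e j) /\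
  forall s f df, (s <= 1)%N -> Hs s (dom j) f df ->
    `|\int[leb R (d - 1)]_(x in dom j) (f x * intf e j x)| <=
    C ^+ s.+1 * (Num.sqrt (Hs_seminorm2 s (dom j) f df) * Num.sqrt (grad_norm2 (dom j) (dintf e j))).
Proof.
have pw m : C' ^+ m <= C ^+ m by apply: lerXn2r; rewrite ?nnegrE.
have [h1 h2] := intf_estimates_aux j; split=> [|s f df s1 hf].
  by apply: le_trans h1 _; apply: ler_wpM2r; [exact: grad_norm2_ge0|exact: pw].
apply: le_trans (h2 s f df s1 hf) _; apply: ler_wpM2r; last exact: pw.
by rewrite mulr_ge0// sqrtr_ge0.
Qed.

Lemma normV_le_grad (Hmax : R) : H <= Hmax ->
  normV e <= Num.sqrt ((2 ^+ d * Hmax) ^+ 2 + 1) * Num.sqrt (grad2 e).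
Proof.
move=> HH; have g0 : 0 <= grad2 e by rewrite addr_ge0// sumr_ge0// => ? _; exact: grad_norm2_ge0.
rewrite -sqrtrM ?addr_ge0 ?sqr_ge0//; apply: ler_wsqrtr.
apply: (@le_trans _ _ ((C ^+ 2 + 1) * grad2 e)); last first.
  apply: ler_wpM2r => //; rewrite lerD2r lerXn2r ?nnegrE//; last by rewrite ler_wpM2l// exprn_ge0.
  by rewrite mulr_ge0 ?exprn_ge0// (le_trans (ltW H0)).
rewrite /grad2 mulrDr !mulr_sumr; apply: lerD; apply: ler_sum => i _; rewrite mulrDl mul1r lerD2r.
  by case: (bulk_estimates i).
by case: (intf_estimates i).
Qed.

(** Bulk and interface segments are indexed together by a sum type, so that one discrete
    Cauchy-Schwarz inequality combines all local bounds. *)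
Lemma load_bound (s : nat) f0 df0 f1 df1 : (s <= 1)%N -> Hs_data s f0 df0 f1 df1 ->
  load f0 f1 e <= C ^+ s.+1 * (data_seminorm s f0 df0 f1 df1 * Num.sqrt (grad2 e)).
Proof.
move=> s1 [h0 h1].
have Hs0 n (D : set 'rV[R]_n) f df : 0 <= Hs_seminorm2 s D f df.
  by case: s {s1 h0 h1} => [|s]; apply: Rintegral_ge0 => x _; [exact: sqr_ge0|exact: dot_ge0].
pose I := (segment_index G 0 + segment_index G 1)%type.
pose x (k : I) := Num.sqrt (match k with inl i => Hs_seminorm2 s (seg i) (f0 i) (df0 i)
  | inr j => Hs_seminorm2 s (dom j) (f1 j) (df1 j) end).
pose y (k : I) := Num.sqrt (match k with inl i => grad_norm2 (seg i) (dbulk e i)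
  | inr j => grad_norm2 (dom j) (dintf e j) end).
have E1 : \sum_k x k ^+ 2 = data_seminorm s f0 df0 f1 df1 ^+ 2.
  rewrite /data_seminorm sqr_sqrtr ?addr_ge0 ?sumr_ge0//.
  by rewrite big_sumType /=; congr (_ + _); apply: eq_bigr => i _; rewrite sqr_sqrtr.
have E2 : \sum_k y k ^+ 2 = grad2 e.
  by rewrite big_sumType /=; congr (_ + _); apply: eq_bigr => i _; rewrite sqr_sqrtr ?grad_norm2_ge0.
have g0 : 0 <= grad2 e by rewrite -E2 sumr_ge0// => k _; exact: sqr_ge0.
have le1 : load f0 f1 e <= C ^+ s.+1 * \sum_k x k * y k.
  rewrite mulr_sumr big_sumType /=; apply: lerD; apply: ler_sum => i _.
    by apply: le_trans (ler_norm _) _; have [_] := bulk_estimates i; apply.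
  by apply: le_trans (ler_norm _) _; have [_] := intf_estimates i; apply.
apply: (le_trans le1); apply: ler_wpM2l; first by rewrite exprn_ge0.
have xy0 : 0 <= \sum_k x k * y k by apply: sumr_ge0 => k _; rewrite mulr_ge0// sqrtr_ge0.
rewrite -(ger0_norm xy0) -sqrtr_sqr -[data_seminorm _ _ _ _ _]ger0_norm ?sqrtr_ge0// -sqrtr_sqr -sqrtrM ?sqr_ge0//.
by apply: ler_wsqrtr; rewrite -E1 -E2; exact: sum_Cauchy_Schwarz.
Qed.

End convergence.

Theorem theorem3p2 (R : realType) (d : nat) (hd : d = 2%N \/ d = 3%N)
    (G : geometry R d) (hG : mixed_geometry G)
    (alpha_lo alpha_hi beta_lo beta_hi : R)
    (halpha : 0 < alpha_lo <= alpha_hi) (hbeta : 0 < beta_lo <= beta_hi)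
    (sigma tau : R) (hsigma : 0 < sigma) (htau : 0 < tau) :
  exists2 C : R, 0 < C &
  forall (A0 : bulk_fun G R) (A1 B1 : intf_fun G R)
    (H : R) (M : meshes G) (phi : element M -> mdfun G),
  bulk_coef alpha_lo alpha_hi A0 -> intf_coef alpha_lo alpha_hi A1 ->
  intf_coef beta_lo beta_hi B1 ->
  0 < H -> coarse_meshes sigma tau H M -> prototypical_basis A0 A1 B1 phi ->
  [/\ forall (f0 : bulk_fun G R) (f1 : intf_fun G R),
        (forall i, L2 (seg i) (f0 i)) -> (forall j, L2 (dom j) (f1 j)) ->
        exists2 uH, prototypical_solution M A0 A1 B1 f0 f1 uH &
          forall uH', prototypical_solution M A0 A1 B1 f0 f1 uH' -> eqV uH' uH,
      forall (f0 : bulk_fun G R) (f1 : intf_fun G R) (u uH : mdfun G),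
        (forall i, L2 (seg i) (f0 i)) -> (forall j, L2 (dom j) (f1 j)) ->
        model_solution A0 A1 B1 f0 f1 u ->
        prototypical_solution M A0 A1 B1 f0 f1 uH ->
        eqV uH (interpolant phi u)
    & forall (s : nat) (f0 : bulk_fun G R) (df0 : bulk_fun G 'rV[R]_d)
        (f1 : intf_fun G R) (df1 : intf_fun G 'rV[R]_(d - 1))
        (u uH : mdfun G),
        (s <= 1)%N -> Hs_data s f0 df0 f1 df1 ->
        model_solution A0 A1 B1 f0 f1 u ->
        prototypical_solution M A0 A1 B1 f0 f1 uH ->
        normV (subV u uH) <= C * H ^+ s.+1 * data_seminorm s f0 df0 f1 df1].
Proof.
have d2 : (1 < d)%N by case: hd => ->.
have [alpha0 _] := andP halpha; have [beta0 _] := andP hbeta.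
have [Hmax Hmax0 hmax] := mesh_size_bound hG hsigma htau.
set K := Num.sqrt ((2 ^+ d * Hmax) ^+ 2 + 1).
have K0 : 0 < K by rewrite sqrtr_gt0 ltr_wpDl// sqr_ge0.
(* K passes from the gradient part to [normV], 1/alpha_lo comes from the lower bound of the form,
   and (2^d)^2 dominates (2^d)^(s+1) for both values of s. *)
exists (K * (2 ^+ d) ^+ 2 / alpha_lo); first by rewrite divr_gt0// mulr_gt0// !exprn_gt0.
move=> A0 A1 B1 H M phi hA0 hA1 hB1 H0 hM hphi; split.
- move=> f0 f1 hf0 hf1.
  have [uH hu] := prototypical_exists d2 hG alpha0 beta0 hA0 hA1 hB1 hM hphi hf0 hf1.
  by exists uH => // uH' hu'; exact: (prototypical_unique d2 hG alpha0 beta0 hA0 hA1 hB1 hu' hu).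
- move=> f0 f1 u uH _ _ hu hH.
  exact: (prototypical_interpolant d2 hG alpha0 beta0 hA0 hA1 hB1 hM hphi hu hH).
- move=> s f0 df0 f1 df1 u uH s1 hf hu hH.
  have [he qe ae] := galerkin_error d2 hG alpha0 beta0 hA0 hA1 hB1 hM hphi hu hH.
  set e := subV u uH in he qe ae *; set F := data_seminorm s f0 df0 f1 df1; set g := Num.sqrt (grad2 e).
  have g0 : 0 <= grad2 e by rewrite addr_ge0// sumr_ge0// => ? _; exact: grad_norm2_ge0.
  have nV := normV_le_grad d2 hG hsigma htau H0 hM he qe (hmax H M H0 hM).
  have lb := load_bound d2 hG hsigma htau H0 hM he qe s1 hf.
  have lo := form_lower d2 hG hA0 hA1 hB1 he.
  have jump0 : 0 <= \sum_i \sum_(j | `[< Defs.adjacent i j >]) beta_lo * jump2 e i j.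
    apply: sumr_ge0 => i _; apply: sumr_ge0 => j _; rewrite mulr_ge0 ?(ltW beta0)//.
    by apply: Rintegral_ge0 => y _; exact: sqr_ge0.
  have key : alpha_lo * g ^+ 2 <= (2 ^+ d * H) ^+ s.+1 * (F * g).
    rewrite sqr_sqrtr//; apply: le_trans lb; rewrite -ae; apply: le_trans lo; by rewrite lerDl.
  have F0 : 0 <= F by exact: sqrtr_ge0.
  have gb : alpha_lo * g <= (2 ^+ d * H) ^+ s.+1 * F.
    (* The inequality [key] is quadratic in g on the left and linear on the right; a factor g can be
       cancelled only if it is nonzero. *)
    have [gz|gn] := eqVneq g 0.
      by rewrite gz mulr0 mulr_ge0// exprn_ge0// mulr_ge0 ?exprn_ge0// ltW.
    have gp : 0 < g by rewrite lt_neqAle eq_sym gn sqrtr_ge0.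
    by rewrite -(ler_pM2r gp) -!mulrA -expr2.
  have pw : (2 ^+ d * H) ^+ s.+1 <= (2 ^+ d) ^+ 2 * H ^+ s.+1.
    rewrite exprMn; apply: ler_wpM2r; first by rewrite exprn_ge0// ltW.
    by apply: ler_weXn2l; rewrite // exprn_ege1// ler1n.
  apply: (le_trans nV); rewrite -/K -/g.
  have -> : K * (2 ^+ d) ^+ 2 / alpha_lo * H ^+ s.+1 * F = K * (((2 ^+ d) ^+ 2 * H ^+ s.+1) * F / alpha_lo) by ring.
  apply: ler_wpM2l; first exact: ltW.
  rewrite ler_pdivlMr// mulrC; apply: (le_trans gb); exact: ler_wpM2r.
Qed.
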